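(* Let $K>0$ and $A>0$ be fixed cut-off levels, and let the data satisfy the assumptions of the context, with constants $\alpha,\beta,\eta$ as there. Let $r\ge2$ and $b,c\in[1,+\infty]$ be given such that $$rc\gamma\ge2\quad\text{and}\quad 2b\le rc<\eta-1$$ with a fixed real number $\gamma\in(0,\min(1,\beta/(2\alpha)))$. Let $m,n\in[1,+\infty]$ be real numbers such that $$\frac1m+\frac1c=\frac1n+\frac1b=1,$$ and let $k_{reg}\ge2$ and $j_{reg}>0$ be constants, assumed to exist, with $$C_{reg}:=\mathbb E\big(\|\nabla u_{K,A}\|_{L^{2+j_{reg}}(\mathcal D)}^{k_{reg}}\big)<+\infty .$$ If $$n<1+\frac{j_{reg}}2\quad\text{and}\quad rm<k_{reg},$$ then the approximated solution $u_{K,A}^{(\varepsilon_W,\varepsilon_l)}$ converges to the solution $u_{K,A}$ of the truncated problem for $\varepsilon_W,\varepsilon_l\to0$ and it holds $$\|u_{K,A}-u_{K,A}^{(\varepsilon_W,\varepsilon_l)}\|_{L^r(\Omega;V)}\le C(\overline a_-,\mathcal D,r)\,\|a_{K,A}^{(\varepsilon_W,\varepsilon_l)}-a_{K,A}\|_{L^{rc}(\Omega;L^{2b}(\mathcal D))}\,\|\nabla u_{K,A}\|_{L^{rm}(\Omega;L^{2n}(\mathcal D))}$$ $$\le C_{reg}\,C(\overline a_-,\mathcal D,r)\,\big(\varepsilon_W^\gamma+\varepsilon_l^{\frac1{rc}}\big),$$ where $C(\overline a_-,\mathcal D,r)$ denotes a constant depending on the indicated parameters $\overline a_-$, $\mathcal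 D$ and $r$.
   Context: $(\Omega,\mathcal F,\mathbb P)$ is a complete probability space, $0<D<+\infty$, $\mathcal D=(0,D)^2$, $H=L^2(\mathcal D)$. $\partial\mathcal D=\Gamma_1\cup\Gamma_2$ is a disjoint decomposition into two $1$-dimensional manifolds such that the exterior normal derivative on $\Gamma_2$ is well-defined for every $u\in C^1(\overline{\mathcal D})$. $T$ is the trace operator on $H^1(\mathcal D)$, $V=\{v\in H^1(\mathcal D):Tv|_{\Gamma_1}=0\}$, $\|v\|_V=\|v\|_{H^1(\mathcal D)}=\big(\int_{\mathcal D}|v|^2+\|\nabla v\|_2^2\,d\underline x\big)^{1/2}$. $L^p(\Omega;B)$ has norm $\mathbb E(\|\cdot\|_B^p)^{1/p}$ for $p<+\infty$ and the essential supremum norm for $p=+\infty$. With $\chi_B(z)=\min(z,B)$ for $z\ge0$, $B>0$, the coefficients are, for $(x,y)\in\mathcal D$, $$a_{K,A}(x,y)=\chi_A\Big(\overline a(x,y)+\Phi_1(W_1(x,y))+\Phi_2\big(W_2(\chi_K(l_1(x)),\chi_K(l_2(y)))\big)\Big),$$ $$a_{K,A}^{(\varepsilon_W,\varepsilon_l)}(x,y)=\chi_A\Big(\overline a(x,y)+\Phi_1(W_1^{(\varepsilon_W)}(x,y))+\Phi_2\big(W_2^{(\varepsilon_W)}(\chi_K(l_1^{(\varepsilon_l)}(x)),\chi_K(l_2^{(\varepsilon_l)}(y)))\big)\Big).$$ $u_{K,A}$ (the solution of the truncated problem) and $u_{K,A}^{(\varepsilon_W,\varepsilon_l)}$ are the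 pathwise weak solutions for these two coefficients: for a coefficient $h$, the pathwise weak solution is the unique $u(\omega,\cdot)\in V$ with $\int_{\mathcal D}h\,\nabla u\cdot\nabla v\,d\underline x=\int_{\mathcal D}fv\,d\underline x+\int_{\Gamma_2}g\,[Tv]\,d\underline x$ for all $v\in V$. Assumptions: (i) $W_1$, $W_2$ are stochastically independent zero-mean Gaussian random fields on $[0,D]^2$ and $[0,K]^2$ with $\mathbb P$-a.s. continuous paths. With covariance functions $q_1,q_2$, covariance operators $Q_j\phi=\int_{[0,z_j]^2}q_j(\cdot,(x',y'))\phi(x',y')\,d(x',y')$ ($z=(D,K)$) and eigenpairs $(\lambda_i^{(j)},e_i^{(j)},\ i\in\mathbb N)$, where $(e_i^{(j)})_i$ is an orthonormal basis of $L^2([0,z_j]^2)$, the eigenfunctions are continuously differentiable and there are $\alpha,\beta,C_e,C_\lambda>0$ with $\|e_i^{(j)}\|_{L^\infty([0,z_j]^2)}\le C_e$, $\|\nabla e_i^{(j)}\|_{L^\infty([0,z_j]^2)}\le C_e i^\alpha$ for all $i\in\mathbb N$, $j=1,2$, and $\sum_{i=1}^\infty(\lambda_i^{(1)}+\lambda_i^{(2)})i^\beta\le C_\lambda<\infty$. (ii) $\Phi_1,\Phi_2:\mathbb R\to[0,+\infty)$ are continuous, $\Phi_1\in C^1(\mathbb R)$, $|\Phi_1'(x)|\le\phi\exp(\psi|x|)$ and $|\Phi_2(x)-\Phi_2(y)|\le C_{lip}|x-y|$ for $x,y\in\mathbb R$, with constants $\phi,\psi,C_{lip}>0$. (iii)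 $f\in L^q(\Omega;H)$ and $g\in L^q(\Omega;L^2(\Gamma_2))$ for some $q\in(1,+\infty)$. (iv) $\overline a:\mathcal D\to(0,+\infty)$ is deterministic, continuous, and $\overline a_-\le\overline a(x,y)\le\overline a_+$ for $(x,y)\in\mathcal D$ with constants $\overline a_+,\overline a_->0$. (v) $l_1,l_2$ are Lévy subordinators on $[0,D]$ ($\mathbb P$-a.s. non-decreasing real-valued Lévy processes) with Lévy triplets $(\gamma_1,0,\nu_1)$ and $(\gamma_2,0,\nu_2)$, independent of $W_1$ and $W_2$. There are approximations $l_1^{(\varepsilon_l)},l_2^{(\varepsilon_l)}$ of these processes and constants $\eta,C_l>0$ such that for every $s\in[1,\eta-1)$, $\mathbb E(|l_j(x)-l_j^{(\varepsilon_l)}(x)|^s)\le C_l\varepsilon_l$ for $\varepsilon_l>0$, $x\in[0,D]$, $j=1,2$. (vi) $W_1^{(\varepsilon_W)}$ (resp. $W_2^{(\varepsilon_W)}$) is constructed by point evaluation of $W_1$ (resp. $W_2$) on the tensor product grid built from an equidistant grid on $[0,D]$ (resp. $[0,K]$) with maximum step size $\varepsilon_W$, and (bi-)linear interpolation between the grid points.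
   Formalization: In the second inequality the constant may depend on all numerical constants of the assumptions, C_reg included (as printed it fails under scaling of f,g); the approximations of l_1,l_2 are also assumed nonnegative, measurable and, jointly with l_1,l_2, independent of (W_1,W_2). *)

(* Defs.v *)
From HB Require Import structures.
From mathcomp Require Import all_boot all_order all_algebra.
From mathcomp Require Import all_classical all_reals all_analysis.
Set Implicit Arguments.
Unset Strict Implicit.
Unset Printing Implicit Defensive.
Import Order.TTheory GRing.Theory Num.Theory.
Import numFieldNormedType.Exports.
Local Open Scope classical_set_scope.
Local Open Scope ring_scope.

Section domain.
Context {R : realType}.
Implicit Types (D L : R) (G : set (R * R)) (p : \bar R) (v : R * R -> R).

Definition sq L : set (R * R) := `]0, L[ `*` `]0, L[.
Definition csq L : set (R * R) := `[0, L] `*` `[0, L].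
Definition bdry L : set (R * R) := closure (sq L) `\` sq L.

Definition leb2 := (@lebesgue_measure R \x @lebesgue_measure R)%E.

Definition LpD L p v : \bar R := 'N[leb2]_p[(EFin \o v) \_ (sq L)].

Definition L2 L v : Prop :=
  measurable_fun (sq L) v /\ (LpD L 2%:E v < +oo)%E.

(** One-dimensional topological manifold, possibly with boundary points. *)
Definition one_manifold G : Prop :=
  forall z, G z -> exists U : set (R * R), [/\ open U, U z &
    exists (I : set R) (h : R -> R * R) (k : R * R -> R),
    [/\ (I = `]0, 1[%classic) \/ (I = `[0, 1[%classic),
        {within I, continuous h},
        {within U `&` G, continuous k},
        h @` I = U `&` G &
        forall t, I t -> k (h t) = t]].

(** The square being convex, its exterior unit normals at [z] are the unit
    vectors of its supporting half-planes; there is exactly one of them iff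
    [z] is a boundary point other than a corner. *)
Definition exterior_normal L (z nu : R * R) : Prop :=
  nu.1 ^+ 2 + nu.2 ^+ 2 = 1 /\
  forall y, closure (sq L) y -> (y.1 - z.1) * nu.1 + (y.2 - z.2) * nu.2 <= 0.

Definition boundary_decomposition D (G1 G2 : set (R * R)) : Prop :=
  [/\ bdry D = G1 `|` G2, G1 `&` G2 = set0,
      one_manifold G1, one_manifold G2 &
      forall z, G2 z -> exists! nu, exterior_normal D z nu].

Definition dx v (z : R * R) : R := derive1 (fun s : R => v (s, z.2)) z.1.
Definition dy v (z : R * R) : R := derive1 (fun s : R => v (z.1, s)) z.2.
Definition partially_derivable v (z : R * R) : Prop :=
  derivable (fun s : R => v (s, z.2)) z.1 1 /\
  derivable (fun s : R => v (z.1, s)) z.2 1.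

Fixpoint Ck (k : nat) v : Prop :=
  continuous v /\
  if k is k'.+1 then
    [/\ forall z, partially_derivable v z, Ck k' (dx v) & Ck k' (dy v)]
  else True.
Definition smooth v : Prop := forall k, Ck k v.

Definition C1_closed L v : Prop :=
  {within csq L, continuous v} /\
  exists d1 d2 : R * R -> R,
    [/\ {within csq L, continuous d1}, {within csq L, continuous d2} &
        forall z, sq L z ->
          [/\ partially_derivable v z, dx v z = d1 z & dy v z = d2 z]].

Definition test_function L v : Prop :=
  smooth v /\ exists K : set (R * R),
    [/\ compact K, K `<=` sq L & forall z, ~ K z -> v z = 0].

Definition eucl (z : R * R) : R := Num.sqrt (z.1 ^+ 2 + z.2 ^+ 2).

Definition is_weak_grad L v (w : R * R -> R * R) : Prop :=
  [/\ L2 L (fun x => (w x).1), L2 L (fun x => (w x).2) &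
      forall t, test_function L t ->
      (\int[leb2]_(x in sq L) (v x * dx t x) =
         - \int[leb2]_(x in sq L) ((w x).1 * t x))%R /\
      (\int[leb2]_(x in sq L) (v x * dy t x) =
         - \int[leb2]_(x in sq L) ((w x).2 * t x))%R].

(** A representative of the weak gradient; unique up to null sets. *)
Definition wgrad L v : R * R -> R * R :=
  xget (fun=> (0, 0)) [set w | is_weak_grad L v w].

Definition H1 L v : Prop := L2 L v /\ exists w, is_weak_grad L v w.

Definition H1norm L v : \bar R :=
  ((\int[leb2]_(x in sq L) (v x ^+ 2 + eucl (wgrad L v x) ^+ 2)%:E)
     `^ (2^-1))%E.

Definition grad_Lp L p v : \bar R := LpD L p (fun x => eucl (wgrad L v x)).

(** The four sides of the square, by arc length. *)
Definition side L (i : 'I_4) (s : R) : R * R :=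
  match val i with
  | 0%N => (s, 0) | 1%N => (s, L) | 2%N => (0, s) | _ => (L, s)
  end.

Definition on_side L G (i : 'I_4) : set R := `[0, L] `&` side L i @^-1` G.

Definition bd_integral L G v : R :=
  \sum_(i < 4) (\int[lebesgue_measure]_(s in on_side L G i) v (side L i s))%R.

Definition bd_L2 L G v : \bar R :=
  ((\sum_(i < 4) \int[lebesgue_measure]_(s in on_side L G i)
      ((v (side L i s)) ^+ 2)%:E) `^ (2^-1))%E.

(** [is_trace L v t]: [t] represents [T v], where [T] is the continuous
    extension to [H^1] of the restriction of smooth functions to the boundary. *)
Definition is_trace L v (t : R * R -> R) : Prop :=
  measurable_fun setT t /\
  exists phi : nat -> R * R -> R,
    [/\ forall k, smooth (phi k),
        H1norm L (phi k \- v) @[k --> \oo] --> 0%E &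
        bd_L2 L (bdry L) (phi k \- t) @[k --> \oo] --> 0%E].

Definition V L G1 v : Prop :=
  H1 L v /\ exists2 t, is_trace L v t &
    forall i, {ae @lebesgue_measure R, forall s, on_side L G1 i s ->
                 t (side L i s) = 0}.

Definition dot (z z' : R * R) : R := z.1 * z'.1 + z.2 * z'.2.

Definition weak_solution D G1 G2 (h f g u : R * R -> R) : Prop :=
  V D G1 u /\ forall v Tv, V D G1 v -> is_trace D v Tv ->
    (\int[leb2]_(x in sq D) (h x * dot (wgrad D u x) (wgrad D v x)) =
     \int[leb2]_(x in sq D) (f x * v x)
       + bd_integral D G2 (fun x => g x * Tv x))%R.

Definition orthonormal_basis L (e : nat -> R * R -> R) : Prop :=
  [/\ forall i, L2 L (e i),
      forall i j,
        (\int[leb2]_(x in sq L) (e i x * e j x))%R = (i == j)%:R &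
      forall v, L2 L v ->
        LpD L 2%:E (fun x => v x - \sum_(i < k)
          (\int[leb2]_(y in sq L) (v y * e i y))%R * e i x)
        @[k --> \oo] --> 0%E].

Definition chi (B z : R) : R := Num.min z B.

Definition coefficient (A K : R) (abar : R * R -> R) (Phi1 Phi2 : R -> R)
    (W1 W2 : R * R -> R) (l1 l2 : R -> R) (x : R * R) : R :=
  chi A (abar x + Phi1 (W1 x) + Phi2 (W2 (chi K (l1 x.1), chi K (l2 x.2)))).

(** Bilinear interpolation on [[0,L]^2] from the nodes [(i L / N, j L / N)],
    in the nodal basis of hat functions. *)
Definition hat (t : R) : R := Num.max 0 (1 - `|t|).
Definition interp L (N : nat) (w : R * R -> R) (x : R * R) : R :=
  let h := L / N%:R in
  \sum_(i < N.+1) \sum_(j < N.+1)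
    w (i%:R * h, j%:R * h) * hat (x.1 / h - i%:R) * hat (x.2 / h - j%:R).

End domain.

Section probability.
Context {R : realType} {d : measure_display} {Omega : measurableType d}.
Variable P : probability Omega R.

(** Generators of the sigma-algebra of the family [(X t)_(t in S)]. *)
Definition gens {T : Type} (S : set T) (X : Omega -> T -> R) :
    set (set Omega) :=
  [set E | exists2 t, S t &
     exists2 B : set R, measurable B & E = (X^~ t) @^-1` B].

Definition indep (F G : set (set Omega)) : Prop :=
  forall E E', <<s F >> E -> <<s G >> E' -> P (E `&` E') = (P E * P E')%E.

(** Normal law, possibly degenerate. *)
Definition normal_law (X : Omega -> R) : Prop :=
  exists m s : R,
    (s != 0 /\ forall B : set R, measurable B ->
       P (X @^-1` B) = normal_prob m s B) \/
    (forall B : set R, measurable B -> P (X @^-1` B) = \d_m B).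

Definition gaussian_field (S : set (R * R)) (W : Omega -> R * R -> R) : Prop :=
  (forall z, S z -> measurable_fun setT (W^~ z)) /\
  forall k (z : 'I_k -> R * R) (c : 'I_k -> R), (forall i, S (z i)) ->
    normal_law (fun w => \sum_(i < k) c i * W w (z i)).

Definition cov_fun (W : Omega -> R * R -> R) (z z' : R * R) : R :=
  fine (covariance P (W^~ z) (W^~ z')).

(** The index [i : nat] stands for the [i.+1]-th eigenpair. *)
Definition field_assumption (L alpha Ce : R) (W : Omega -> R * R -> R)
    (lam : nat -> R) (e : nat -> R * R -> R) : Prop :=
  [/\ gaussian_field (csq L) W,
      forall z, csq L z -> ('E_P[W^~ z] = 0)%E,
      {ae P, forall w, {within csq L, continuous (W w)}},
      orthonormal_basis L e /\
      (forall i, {ae leb2, forall z : R * R, sq L z ->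
         (\int[leb2]_(y in sq L) (cov_fun W z y * e i y))%R = lam i * e i z}) &
      forall i, [/\ C1_closed L (e i), (LpD L +oo (e i) <= Ce%:E)%E &
        (LpD L +oo (fun z => eucl (dx (e i) z, dy (e i) z))
           <= (Ce * i.+1%:R `^ alpha)%:E)%E]].

Definition levy_process (D : R) (l : Omega -> R -> R) : Prop :=
  [/\ forall t, t \in `[0, D] -> measurable_fun setT (l^~ t),
      {ae P, forall w, l w 0 = 0},
      forall k (t : nat -> R), (forall i, (i <= k)%N -> t i \in `[0, D]) ->
        (forall i, (i < k)%N -> t i <= t i.+1) ->
        forall B : nat -> set R, (forall i, measurable (B i)) ->
        P (\bigcap_(i in `I_k) [set w | B i (l w (t i.+1) - l w (t i))]) =
        (\prod_(i < k) P [set w | B i (l w (t i.+1) - l w (t i))%R])%E,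
      forall s t, 0 <= s -> 0 <= t -> s + t <= D ->
        forall B : set R, measurable B ->
        P [set w | B (l w (s + t) - l w s)] = P [set w | B (l w t)] &
      (forall t eps, t \in `[0, D] -> 0 < eps ->
        P [set w | eps < `|l w s - l w t|] @[s --> within `[0, D] (nbhs t)]
          --> 0%E) /\
      {ae P, forall w,
        (forall t, 0 <= t < D -> l w s @[s --> t^'+] --> l w t) /\
        (forall t, 0 < t <= D -> cvg (l w s @[s --> t^'-]))}].

(** Lévy-Khintchine formula with truncation function [x 1_(|x| <= 1)]; real
    and imaginary parts of the characteristic function. *)
Definition levy_triplet (D : R) (l : Omega -> R -> R) (gam b : R)
    (nu : {measure set R -> \bar R}) : Prop :=
  [/\ nu [set 0] = 0%E,
      (\int[nu]_x (Num.min 1 (x ^+ 2))%:E < +oo)%E &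
      forall t xi, t \in `[0, D] ->
      let re := - (b * xi ^+ 2 / 2) + (\int[nu]_x (cos (xi * x) - 1))%R in
      let im := gam * xi + (\int[nu]_x
                  (sin (xi * x) - xi * x * \1_`[-1, 1] x))%R in
      ('E_P[fun w => cos (xi * l w t)] = (expR (t * re) * cos (t * im))%:E)%E /\
      ('E_P[fun w => sin (xi * l w t)] = (expR (t * re) * sin (t * im))%:E)%E].

Definition subordinator (D : R) (l : Omega -> R -> R) : Prop :=
  levy_process D l /\
  {ae P, forall w s t, 0 <= s -> s <= t -> t <= D -> l w s <= l w t}.

(** Nonnegativity of the approximation is what makes [chi K] applicable. *)
Definition subordinator_approximation (D eta Cl : R) (l : Omega -> R -> R)
    (la : R -> Omega -> R -> R) : Prop :=
  forall el, 0 < el ->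
  [/\ measurable_fun ([set: Omega] `*` `[0, D]) (fun z => la el z.1 z.2),
      {ae P, forall w x, x \in `[0, D] -> 0 <= la el w x} &
      forall s x, 1 <= s < eta - 1 -> x \in `[0, D] ->
        ('E_P[fun w => (`|l w x - la el w x| `^ s)%R] <= (Cl * el)%:E)%E].

End probability.

(* Main.v *)
Require Import Defs.
From HB Require Import structures.
From mathcomp Require Import all_boot all_order all_algebra.
From mathcomp Require Import all_classical all_reals all_analysis.
From mathcomp Require Import measurable_realfun ess_sup_inf.
From mathcomp Require Import ring lra.
Set Implicit Arguments.
Unset Strict Implicit.
Unset Printing Implicit Defensive.
Import Order.TTheory GRing.Theory Num.Theory.
Import numFieldNormedType.Exports.
Local Open Scope classical_set_scope.
Local Open Scope ring_scope.
Import HBNNSimple.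

(** Two mechanisms are combined: a deterministic perturbation estimate for the
    elliptic problem, and a moment estimate for the coefficient.

    Perturbation. If [u] and [u'] solve the problem for the coefficients [h]
    and [h'] with the same data, both equations are tested with [e = u - u'];
    subtracting them gives [int h' |grad e|^2 = int (h' - h) grad u . grad e].
    As [h'] is bounded below, Hoelder's inequality bounds the [L^2] norm of
    [grad e] by the [L^2b] norm of [h' - h] times the [L^2n] norm of [grad u],
    and Poincare's inequality on [V] ([poincare_V]) then bounds the [H^1] norm
    of [e]; this is [pathwise_stability].  The inequality on [V] rests on the
    geometry of [G1]: a corner has two exterior normals, so it lies in [G1],
    and a one-dimensional manifold contains with it an arc, which projects onto
    an interval of positive length of some side ([boundary_interval]).  If the
    cut-off [A] is smaller than [abar_m], both coefficients equal [A] and the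
    solutions coincide.  Hoelder's inequality on the sample space gives the first
    estimate ([error_le_coefficient_error]).  The norms of the solutions may be
    nonmeasurable functions of the sample; their integrals are suprema over
    measurable minorants, and Hoelder's inequality holds for such integrals as
    soon as one factor, here the coefficient error, is measurable
    ([Lnorm_le_mul]).

    Moments. By Jensen's inequality and Tonelli's theorem the mixed norm of the
    coefficient error is bounded by its moments of order [p = r c] at the
    points of the square ([mixed_norm_bound]), for which [coefficient_error]
    gives a multiple of [eW^(gamma p) + el].

    The field enters through the second moments of its increments.  The average
    of [W] against a bounded weight [psi] has second moment
    [sum_i lam_i <psi, e_i>^2] ([pairing_variance]).  For [psi] the difference
    of two normalized indicators of boxes shrinking to [x] and [y], the
    coefficient [<psi, e_i>] is at most about
    [2 Ce min (1, i^alpha |x - y|) <= 2 Ce i^(alpha gamma) |x - y|^gamma], and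
    [2 alpha gamma <= beta] makes the sum finite; Fatou's lemma gives
    [E |W x - W y|^2 <= C |x - y|^(2 gamma)] ([field_increment]).  The
    increments being normal, all their moments are controlled by the second
    one, and so are the exponential moments of [W x] ([normal_power_moment],
    [normal_exp_moment]).  Bilinear interpolation is an average with
    nonnegative weights, so Jensen's inequality transfers both bounds to the
    interpolation error and to the interpolant ([interp_error], [interp_exp]);
    the mean value theorem and the Cauchy-Schwarz inequality carry the first of
    them through [Phi1] ([interp_phi_error]).

    The second field is evaluated at random points.  They are independent of
    it, so by Tonelli's theorem on two copies of the sample space
    ([indep_tonelli]) they may be frozen while the expectation over the field
    is taken: the interpolation error is bounded as before, and replacing the
    subordinators by their approximations costs [E |l - l_a|^(gamma p)], which
    is of order [el] because [1 <= gamma p < eta - 1]. *)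

(** * Integrals and norms of nonmeasurable nonnegative functions *)

Section lower_integral.
Context d (T : measurableType d) (R : realType).
Variable mu : {measure set T -> \bar R}.
Local Open Scope ereal_scope.

(** The integral of a nonnegative function is the supremum of the integrals of
    the simple functions below it, so it is monotone without any
    measurability. *)
Lemma le_integral_any (f g : T -> \bar R) :
  (forall x, 0 <= f x) -> (forall x, f x <= g x) ->
  \int[mu]_x f x <= \int[mu]_x g x.
Proof.
move=> f0 fg; have g0 x : 0 <= g x by exact: le_trans (f0 x) (fg x).
rewrite !ge0_integralTE//; apply: ereal_sup_le => _ [h /= hf <-].
exists h => // x; exact: le_trans (hf x) (fg x).
Qed.

Lemma integral_le_minorant (f : T -> \bar R) (c : \bar R) :
  (forall x, 0 <= f x) ->
  (forall h : T -> R, measurable_fun setT h -> (forall x, (0 <= h x)%R) ->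
     (forall x, (h x)%:E <= f x) -> \int[mu]_x (h x)%:E <= c) ->
  \int[mu]_x f x <= c.
Proof.
move=> f0 H; rewrite ge0_integralTE//; apply: ge_ereal_sup => _ [h /= hf <-].
rewrite -integralT_nnsfun; apply: H => //.
Qed.

(** A measurable minorant of [f], set to zero on the exceptional null set, keeps
    its integral and becomes a minorant of [g]. *)
Lemma ae_le_integral_any (f g : T -> \bar R) :
  (forall x, 0 <= f x) -> (forall x, 0 <= g x) ->
  {ae mu, forall x, f x <= g x} ->
  \int[mu]_x f x <= \int[mu]_x g x.
Proof.
move=> f0 g0 [N [mN N0 fgN]]; apply: integral_le_minorant => // h mh h0 hf.
have mk : measurable_fun setT (fun x => h x * \1_(~` N) x)%R.
  by apply: measurable_funM => //; apply: measurable_indic; exact: measurableC.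
rewrite (@ge0_ae_eq_integral _ _ _ mu _ _ (fun x => (h x * \1_(~` N) x)%:E)) //.
- apply: le_integral_any => x; first by rewrite lee_fin mulr_ge0.
  rewrite indicE; case: (boolP (x \in ~` N)) => [|_]; last by rewrite mulr0.
  rewrite inE /= mulr1 => Nx; apply: le_trans (hf x) _.
  by apply: contrapT => fg; apply: Nx; exact: fgN.
- exact/measurable_EFinP.
- exact/measurable_EFinP.
- by move=> x _; rewrite lee_fin.
- by move=> x _; rewrite lee_fin mulr_ge0.
exists N; split => // x /= Hx; apply: contrapT => Nx; apply: Hx => _.
by rewrite indicE mem_set ?mulr1.
Qed.

End lower_integral.

Section Lnorm_lower.
Context d (T : measurableType d) (R : realType).
Variable mu : {measure set T -> \bar R}.
Local Open Scope ereal_scope.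

Lemma LnormE (f : T -> \bar R) (p : R) :
  'N[mu]_(p%:E)[f] = (\int[mu]_x `|f x| `^ p) `^ p^-1.
Proof. by rewrite unlock. Qed.

Lemma Lnorm_ge0E (f : T -> R) (p : R) : (forall x, (0 <= f x)%R) ->
  'N[mu]_(p%:E)[EFin \o f] = (\int[mu]_x (f x `^ p)%:E) `^ p^-1.
Proof.
move=> f0; rewrite LnormE.
rewrite (@eq_integral _ _ _ mu _ (fun x => (f x `^ p)%:E)) // => x _.
by rewrite gee0_abs ?lee_fin//= poweR_EFin.
Qed.

Lemma Lnorm_gee0E (f : T -> \bar R) (p : R) : (forall x, 0 <= f x) ->
  'N[mu]_(p%:E)[f] = (\int[mu]_x (f x `^ p)) `^ p^-1.
Proof.
move=> f0; rewrite LnormE; congr (_ `^ _); apply: eq_integral => x _ /=.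
by rewrite gee0_abs.
Qed.

Lemma le_poweR2r (p : R) (x y : \bar R) : (0 <= p)%R -> 0 <= x -> x <= y ->
  x `^ p <= y `^ p.
Proof.
move=> p0 x0 xy; apply: gt0_ler_poweR => //.
- by rewrite in_itv /= x0 leey.
- by rewrite in_itv /= (le_trans x0 xy) leey.
Qed.

Lemma measurable_fun_powR d' (U : measurableType d') (D : set U) (f : U -> R)
    (p : R) : measurable_fun D f -> measurable_fun D (fun x => f x `^ p)%R.
Proof. exact: (measurableT_comp (measurable_powR p)). Qed.

Lemma hoelder_ge0 (f g : T -> R) (p q : R) :
  measurable_fun setT f -> measurable_fun setT g ->
  (forall x, (0 <= f x)%R) -> (forall x, (0 <= g x)%R) ->
  (0 < p)%R -> (0 < q)%R -> (p^-1 + q^-1 = 1)%R ->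
  \int[mu]_x (f x * g x)%:E <=
  (\int[mu]_x (f x `^ p)%:E) `^ p^-1 * (\int[mu]_x (g x `^ q)%:E) `^ q^-1.
Proof.
move=> mf mg f0 g0 p0 q0 pq; have := hoelder mu mf mg p0 q0 pq.
rewrite Lnorm1 !Lnorm_ge0E//.
by under eq_integral do rewrite /= ger0_norm ?mulr_ge0//.
Qed.

(** Below a measurable minorant [h] of [X^r] lies a measurable minorant of [G],
    the quotient of [h^(1/r)] by [C a] where [a] is positive; Hoelder's
    inequality applies to [a] and this quotient. *)
Lemma Lnorm_le_mul (X G : T -> \bar R) (a : T -> R) (C r c m : R) :
  measurable_fun setT a -> (forall x, (0 <= a x)%R) ->
  (forall x, 0 <= X x) -> (forall x, 0 <= G x) ->
  (0 < C)%R -> (0 < r)%R -> (0 < c)%R -> (0 < m)%R -> (c^-1 + m^-1 = 1)%R ->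
  {ae mu, forall x, X x <= C%:E * (a x)%:E * G x} ->
  'N[mu]_(r%:E)[X] <=
  C%:E * 'N[mu]_((r * c)%:E)[EFin \o a] * 'N[mu]_((r * m)%:E)[G].
Proof.
move=> ma a0 X0 G0 C0 r0 c0 m0 cm [N [mN N0 XN]].
have rn0 : (r != 0)%R by rewrite gt_eqF.
rewrite [leLHS]Lnorm_gee0E//.
have -> : C%:E * 'N[mu]_((r * c)%:E)[EFin \o a] * 'N[mu]_((r * m)%:E)[G] =
  ((C `^ r)%:E * ((\int[mu]_x (a x `^ (r * c))%:E) `^ c^-1 *
   (\int[mu]_x (G x `^ (r * m))) `^ m^-1)) `^ r^-1.
  rewrite Lnorm_ge0E// Lnorm_gee0E// poweRM ?mule_ge0 ?poweR_ge0//.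
  rewrite poweR_EFin -powRrM mulfV// powRr1 ?ltW//.
  rewrite poweRM ?poweR_ge0// -!poweRrM !invfM.
  - by rewrite -!(mulrC r^-1)%R muleA.
  - by rewrite lee_fin powR_ge0.
apply: le_poweR2r; first by rewrite invr_ge0 ltW.
  by rewrite integral_ge0// => x _; exact: poweR_ge0.
apply: integral_le_minorant => [x|h mh h0 hX]; first exact: poweR_ge0.
(* Where [a] vanishes, so does [X], hence [h]. *)
pose S := ~` N `&` [set x | (0 < a x)%R].
have mS : measurable S.
  apply: measurableI; first exact: measurableC.
  rewrite -[X in measurable X]setTI.
  have := @measurable_fun_ltr _ _ R setT (cst 0%R) a (measurable_cst _) ma.
  by move=> /(_ measurableT [set true] I); rewrite setTI.
pose k x := (h x `^ r^-1 * (C * a x) `^ (- 1) * \1_S x)%R.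
have k0 x : (0 <= k x)%R.
  by rewrite /k !mulr_ge0 ?powR_ge0.
have mk : measurable_fun setT k.
  apply: measurable_funM; last exact: measurable_indic.
  apply: measurable_funM; apply: measurable_fun_powR => //.
  exact: measurable_funM.
have kG x : (k x)%:E <= G x.
  rewrite /k indicE; case: (boolP (x \in S)) => [|_]; last by rewrite mulr0.
  rewrite inE mulr1 => -[/= Nx ax].
  have {}XN : X x <= C%:E * (a x)%:E * G x.
    by apply: contrapT => ?; apply: Nx; exact: XN.
  rewrite -EFinM muleC in XN.
  have hX' : (h x `^ r^-1)%:E <= X x.
    have := hX x.
    case: (X x) (X0 x) => [y|_|]; rewrite ?leey// !lee_fin => y0.
    move=> hy.
    have -> : y = ((y `^ r) `^ r^-1)%R by rewrite -powRrM mulfV// powRr1.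
    by apply: ge0_ler_powR => //; rewrite ?invr_ge0 ?(ltW r0)// nnegrE ?powR_ge0.
  have Ca : (0 < C * a x)%R by rewrite mulr_gt0.
  rewrite (powR_inv1 (ltW Ca)) EFinM lee_pdivrMr//; exact: le_trans hX' XN.
have hk : {ae mu, forall x, setT x -> (h x)%:E <= ((C `^ r) * (a x `^ r * k x `^ r))%:E}.
  exists N; split => // x /= Hx; apply: contrapT => Nx; apply: Hx => _.
  rewrite lee_fin.
  have {}XN : X x <= C%:E * (a x)%:E * G x.
    by apply: contrapT => ?; apply: Nx; exact: XN.
  have [ax|ax] := eqVneq (a x) 0%R.
    move: XN; rewrite ax mule0 mul0e => XN.
    have XE : X x = 0 by apply/eqP; rewrite eq_le XN X0.
    have := hX x; rewrite XE poweR0r// lee_fin => h0'.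
    by apply: le_trans h0' _; rewrite !mulr_ge0 ?powR_ge0.
  have ap : (0 < a x)%R by rewrite lt_neqAle eq_sym ax a0.
  have xS : S x by split.
  rewrite -(powRM _ (a0 x) (k0 x)) -(powRM _ (ltW C0) (mulr_ge0 (a0 x) (k0 x))).
  rewrite /k indicE mem_set//= mulr1.
  rewrite (powR_inv1 (mulr_ge0 (ltW C0) (a0 x))).
  have -> : (C * (a x * (h x `^ r^-1 * (C * a x)^-1)) = h x `^ r^-1)%R.
    by field; rewrite ax gt_eqF.
  by rewrite -powRrM mulVf// powRr1.
have mh' := mh.
apply: le_trans (ae_ge0_le_integral _ _ _ _ _ hk) _ => //.
- by move=> x _; rewrite lee_fin.
- exact/measurable_EFinP.
- by move=> x _; rewrite lee_fin !mulr_ge0 ?powR_ge0.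
- have mm : measurable_fun setT (fun x => a x `^ r * k x `^ r)%R.
    by apply: measurable_funM; exact: measurable_fun_powR.
  by apply/measurable_EFinP; exact: measurable_funM.
under eq_integral do rewrite EFinM.
rewrite ge0_integralZl_EFin ?powR_ge0//; last 2 first.
- by move=> x _; rewrite lee_fin mulr_ge0 ?powR_ge0.
- apply/measurable_EFinP.
  by apply: measurable_funM; exact: measurable_fun_powR.
apply: lee_wpmul2l; first by rewrite lee_fin powR_ge0.
apply: le_trans (hoelder_ge0 _ _ _ _ c0 m0 cm) _ => //.
- exact: measurable_fun_powR.
- exact: measurable_fun_powR.
- by move=> x; exact: powR_ge0.
- by move=> x; exact: powR_ge0.
apply: lee_pmul; [exact: poweR_ge0|exact: poweR_ge0| |].
  apply: le_poweR2r; first by rewrite invr_ge0 ltW.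
    by apply: integral_ge0 => x _; rewrite lee_fin powR_ge0.
  by apply: le_integral_any => x; rewrite ?lee_fin ?powR_ge0// powRrM.
apply: le_poweR2r; first by rewrite invr_ge0 ltW.
  by apply: integral_ge0 => x _; rewrite lee_fin powR_ge0.
apply: le_integral_any => x; first by rewrite lee_fin powR_ge0.
rewrite -powRrM -poweR_EFin; apply: le_poweR2r => //.
  by rewrite mulr_ge0 // ltW.
by rewrite lee_fin.
Qed.

(** [Lnorm_le_mul] with the indicator of [A] as measurable factor. *)
Lemma Lnorm_le_exponent (X : T -> \bar R) (A : set T) (s t : R) :
  measurable A -> (forall x, 0 <= X x) -> (forall x, ~ A x -> X x = 0) ->
  (0 < s)%R -> (s <= t)%R ->
  'N[mu]_(s%:E)[X] <= (mu A) `^ (s^-1 - t^-1) * 'N[mu]_(t%:E)[X].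
Proof.
move=> mA X0 XA s0; rewrite le_eqVlt => /predU1P[<-|st].
  by rewrite subrr poweRe0 mul1e.
have t0 : (0 < t)%R by exact: lt_trans s0 st.
have ts0 : (0 < t - s)%R by rewrite subr_gt0.
have c0 : (0 < t / (t - s))%R by rewrite divr_gt0.
have m0 : (0 < t / s)%R by rewrite divr_gt0.
have cm : ((t / (t - s))^-1 + (t / s)^-1 = 1)%R.
  by field; rewrite !gt_eqF.
have := @Lnorm_le_mul X X \1_A 1 s _ _ (measurable_indic mA) (fun x => ler0n _ _) X0 X0 ltr01 s0 c0 m0 cm.
have -> : (s * (t / s) = t)%R by field; rewrite gt_eqF.
rewrite mul1e Lnorm_ge0E//.
under eq_integral => x _.
  have -> : (\1_A x `^ (s * (t / (t - s))) = \1_A x :> R)%R.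
    rewrite indicE; case: (x \in A) => /=; first by rewrite powR1.
    by rewrite powR0// mulf_neq0// gt_eqF.
  over.
rewrite integral_indic// setIT.
have -> : ((s * (t / (t - s)))^-1 = s^-1 - t^-1)%R.
  by field; rewrite !gt_eqF.
apply => //; apply: aeW => x; rewrite mul1e indicE.
have [xA|/negP xA] := boolP (x \in A); first by rewrite mul1e.
by rewrite mul0e XA// => /mem_set.
Qed.

End Lnorm_lower.

(** * Bilinear interpolation and joint measurability *)

Section interpolation.
Context {R : realType}.
Implicit Types (L : R) (N : nat) (w : R * R -> R) (x : R * R).

Lemma hat_ge0 (t : R) : 0 <= hat t.
Proof. by rewrite /hat le_max lexx. Qed.

Lemma hat_eq0 (t : R) : 1 <= `|t| -> hat t = 0.
Proof. by move=> t1; rewrite /hat; apply/max_idPl; rewrite subr_le0. Qed.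

Lemma hat_in (t : R) : `|t| <= 1 -> hat t = 1 - `|t|.
Proof. by move=> t1; rewrite /hat; apply/max_idPr; rewrite subr_ge0. Qed.

(** The hat functions at the nodes form a partition of unity: at most two of
    them are nonzero at a given point, and there they are affine with opposite
    slopes. *)
Lemma hat_sum N (y : R) : 0 <= y <= N%:R -> \sum_(i < N.+1) hat (y - i%:R) = 1.
Proof.
elim: N y => [|N IH] y /andP[y0 yN].
  have -> : y = 0 by apply/eqP; rewrite eq_le y0 yN.
  by rewrite big_ord_recl big_ord0 /= hat_in subr0 normr0 ?ler01// subr0 addr0.
rewrite big_ord_recr /=; have [yN'|yN'] := leP y N%:R.
  rewrite IH ?y0// hat_eq0 ?addr0// distrC ger0_norm.
    by rewrite -natr1; lra.
  by rewrite subr_ge0.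
rewrite big_ord_recr /= big1 ?add0r => [|i _].
  have y1 : `|y - N%:R| = y - N%:R by rewrite ger0_norm//; lra.
  have y2 : `|y - N.+1%:R| = N%:R + 1 - y.
    by rewrite distrC natr1 ger0_norm// subr_ge0.
  move: yN; rewrite -natr1 => yN.
  by rewrite !hat_in ?natr1 ?y1 ?y2; lra.
rewrite hat_eq0//; have iN : i%:R + 1 <= N%:R :> R by rewrite natr1 ler_nat.
by rewrite ger0_norm; lra.
Qed.

Lemma interpD L N w w' x :
  interp L N (fun z => w z + w' z) x = interp L N w x + interp L N w' x.
Proof.
rewrite /interp -big_split; apply: eq_bigr => i _ /=.
by rewrite -big_split; apply: eq_bigr => j _ /=; rewrite !mulrDl.
Qed.

Lemma interpZ L N w x c : interp L N (fun z => c * w z) x = c * interp L N w x.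
Proof.
rewrite /interp mulr_sumr; apply: eq_bigr => i _.
by rewrite mulr_sumr; apply: eq_bigr => j _; rewrite !mulrA.
Qed.

Lemma grid_in L N i : 0 < L -> (i < N.+1)%N -> 0 <= i%:R * (L / N%:R) <= L.
Proof.
move=> L0 iN; rewrite mulr_ge0 ?divr_ge0 ?(ltW L0)//=.
case: N iN => [|N] iN; first by rewrite invr0 !mulr0 ltW.
rewrite mulrCA ger_pMr// ler_pdivrMr ?ltr0n// mul1r ler_nat.
exact: iN.
Qed.

Lemma grid_csq L N (i j : 'I_N.+1) : 0 < L ->
  csq L (i%:R * (L / N%:R), j%:R * (L / N%:R)).
Proof.
by move=> L0; split; rewrite /= in_itv /=; apply: grid_in.
Qed.

Lemma scaled_in L N (s : R) : 0 < L -> (0 < N)%N -> 0 <= s <= L ->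
  0 <= s / (L / N%:R) <= N%:R.
Proof.
move=> L0 N0 /andP[s0 sL]; have N0' : 0 < N%:R :> R by rewrite ltr0n.
by rewrite divr_ge0 ?divr_ge0 ?(ltW L0)//= invf_div mulrA ler_pdivrMr// mulrC ler_wpM2l.
Qed.

Lemma interp_cst L N x c : 0 < L -> (0 < N)%N -> csq L x ->
  interp L N (fun=> c) x = c.
Proof.
move=> L0 N0 [/=]; rewrite !in_itv /= => x1 x2.
rewrite /interp (eq_bigr (fun i : 'I_N.+1 => c * hat (x.1 / (L / N%:R) - i%:R))).
  by rewrite -mulr_sumr hat_sum ?mulr1//; exact: scaled_in.
by move=> i _; rewrite -mulr_sumr hat_sum ?mulr1//; exact: scaled_in.
Qed.

Lemma hat_near L N (s : R) (i : nat) : 0 < L -> (0 < N)%N ->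
  hat (s / (L / N%:R) - i%:R) != 0 -> `|s - i%:R * (L / N%:R)| <= L / N%:R.
Proof.
move=> L0 N0; have h0 : 0 < L / N%:R by rewrite divr_gt0// ltr0n.
apply: contraNT; rewrite -ltNge => hs; apply/eqP/hat_eq0.
have -> : s / (L / N%:R) - i%:R = (s - i%:R * (L / N%:R)) / (L / N%:R).
  by rewrite mulrBl mulfK// gt_eqF.
by rewrite normrM normfV (gtr0_norm h0) ler_pdivlMr// mul1r ltW.
Qed.

(** The weights are nonnegative, and only the nodes of the cell around [x] carry
    a nonzero weight. *)
Lemma ler_interp L N w w' x : 0 < L -> (0 < N)%N ->
  (forall z, csq L z -> `|x.1 - z.1| <= L / N%:R -> `|x.2 - z.2| <= L / N%:R ->
    w z <= w' z) ->
  interp L N w x <= interp L N w' x.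
Proof.
move=> L0 N0 ww; rewrite /interp; apply: ler_sum => i _; apply: ler_sum => j _.
have [->|h1] := eqVneq (hat (x.1 / (L / N%:R) - i%:R)) 0; first by rewrite !mulr0 !mul0r.
have [->|h2] := eqVneq (hat (x.2 / (L / N%:R) - j%:R)) 0; first by rewrite !mulr0.
do 2 (apply: ler_wpM2r; first exact: hat_ge0).
by apply: ww; [exact: grid_csq|exact: hat_near|exact: hat_near].
Qed.

Lemma interp_le L N w x c : 0 < L -> (0 < N)%N -> csq L x ->
  (forall z, csq L z -> `|x.1 - z.1| <= L / N%:R -> `|x.2 - z.2| <= L / N%:R ->
    w z <= c) ->
  interp L N w x <= c.
Proof.
move=> L0 N0 xL wc; rewrite -[leRHS](interp_cst c L0 N0 xL).
exact: ler_interp.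
Qed.

(** Jensen's inequality for the weights of the interpolation, convexity being
    expressed by supporting lines of slope [s]. *)
Lemma jensen_interp L N w x (F s : R -> R) : 0 < L -> (0 < N)%N -> csq L x ->
  (forall a b, F a + s a * (b - a) <= F b) ->
  F (interp L N w x) <= interp L N (F \o w) x.
Proof.
move=> L0 N0 xL Fs; set a := interp L N w x.
apply: (@le_trans _ _ (interp L N (fun z => (F a - s a * a) + s a * w z) x)).
  rewrite interpD interpZ interp_cst// -/a; lra.
apply: ler_interp => // z _ _ _ /=; have := Fs a (w z); lra.
Qed.

Lemma cvg_interp L w x : 0 < L -> csq L x ->
  {within csq L, continuous w} -> interp L n.+1 w x @[n --> \oo] --> w x.
Proof.
move=> L0 xL cw; apply/cvgrPdist_le => e e0.
have /(_ e e0) : forall e, 0 < e -> \forall z \near within (csq L) (nbhs x), `|w x - w z| <= e.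
  move=> e' e'0; have := cw x; rewrite /prop_for /continuous_at nbhs_subspace_in//.
  by move=> /cvgrPdist_le /(_ _ e'0).
case=> -[A B] /= [/nbhs_ballP[d1 /= d10 Ad] /nbhs_ballP[d2 /= d20 Bd]] AB.
pose dl := Num.min d1 d2; have dl0 : 0 < dl by rewrite lt_min d10.
near=> n.
have hn : L / n.+1%:R < dl.
  rewrite ltr_pdivrMr ?ltr0n// -ltr_pdivrMl//.
  have : (Num.trunc (dl^-1 * L)).+1%:R <= n.+1%:R :> R.
    by rewrite ler_nat ltnS; near: n; exact: nbhs_infty_ge.
  by apply: lt_le_trans; exact: truncnS_gt.
have dist z : csq L z -> `|x.1 - z.1| <= L / n.+1%:R -> `|x.2 - z.2| <= L / n.+1%:R ->
    `|w x - w z| <= e.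
  move=> zL z1 z2; apply: (AB z) => //; split.
    by apply: Ad; rewrite /ball /= (le_lt_trans z1)// (lt_le_trans hn)// ge_min lexx.
  by apply: Bd; rewrite /ball /= (le_lt_trans z2)// (lt_le_trans hn)// ge_min lexx orbT.
rewrite ler_norml; apply/andP; split.
  rewrite lerBrDr -lerBrDl opprK addrC; apply: interp_le => // z zL z1 z2.
  by have := dist z zL z1 z2; rewrite ler_norml; lra.
rewrite lerBlDr -lerBlDl.
rewrite -(interp_cst (w x - e) L0 (ltn0Sn n) xL) //; apply: ler_interp => // z zL z1 z2.
by have := dist z zL z1 z2; rewrite ler_norml; lra.
Unshelve. all: by end_near. Qed.

End interpolation.

Section caratheodory.
Context d (T : measurableType d) (R : realType).
Implicit Types (L : R) (F : T -> R * R -> R).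

Lemma measurable_csq L : measurable (csq L).
Proof. by apply: measurableX; exact: measurable_itv. Qed.

Lemma measurable_sq L : measurable (sq L).
Proof. by apply: measurableX; exact: measurable_itv. Qed.

Lemma sq_csq L : sq L `<=` csq L.
Proof.
move=> z [/=]; rewrite !in_itv /= => /andP[a b] /andP[c e].
by split; rewrite /= in_itv /= !ltW.
Qed.

Lemma measurable_hat : measurable_fun setT (@hat R).
Proof.
apply: measurable_maxr; first exact: measurable_cst.
by apply: measurable_funB; [exact: measurable_cst|exact: normr_measurable].
Qed.

Lemma measurable_interp L N F : 0 < L ->
  (forall z, csq L z -> measurable_fun setT (F^~ z)) ->
  measurable_fun setT (fun p : T * (R * R) => interp L N (F p.1) p.2).
Proof.
move=> L0 mF; rewrite /interp; apply: measurable_sum => i.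
apply: measurable_sum => j.
apply: measurable_funM; first apply: measurable_funM.
- apply: (measurableT_comp (f := F^~ _)); last exact: measurable_fst.
  exact/mF/grid_csq.
- apply: measurableT_comp; first exact: measurable_hat.
  apply: measurable_funB; last exact: measurable_cst.
  apply: measurable_funM; last exact: measurable_cst.
  by apply: measurableT_comp => //; exact: measurable_fst.
- apply: measurableT_comp; first exact: measurable_hat.
  apply: measurable_funB; last exact: measurable_cst.
  apply: measurable_funM; last exact: measurable_cst.
  by apply: measurableT_comp => //; exact: measurable_snd.
Qed.

(** A function measurable in the first and continuous in the second variable
    is the limit of its interpolations in the second variable. *)
Lemma caratheodory_measurable L F : 0 < L ->
  (forall z, csq L z -> measurable_fun setT (F^~ z)) ->
  (forall t, {within csq L, continuous (F t)}) ->
  measurable_fun ([set: T] `*` csq L) (fun p => F p.1 p.2).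
Proof.
move=> L0 mF cF.
apply: (@measurable_fun_cvg _ _ R _
  (fun n (p : T * (R * R)) => interp L n.+1 (F p.1) p.2)).
- move=> n; apply: measurable_funTS; exact: measurable_interp.
- by move=> [t z] [_ /= zL]; exact: cvg_interp.
Qed.

End caratheodory.

Lemma continuous_measurable2 (R : realType) (L : R) (w : R * R -> R) : 0 < L ->
  {within csq L, continuous w} -> measurable_fun (csq L) w.
Proof.
move=> L0 cw.
have m := @caratheodory_measurable _ unit R L (fun=> w) L0
  (fun _ _ => measurable_cst _) (fun=> cw).
have mp : measurable_fun (csq L) (fun z => (tt, z)).
  by apply: measurable_funTS; exact: pair1_measurable.
apply: (measurable_comp _ _ m mp) => //.
- by apply: measurableX => //; exact: measurable_csq.
- by move=> _ [z zL <-].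
Qed.

(** * Smooth bump functions *)

Section smooth1.
Context {R : realType}.
Implicit Types (f g : R -> R) (k : nat) (P : {poly R}).

(** A class of functions of one variable that is stable under sums, products,
    exponentials and affine substitutions; products of two of them in separate
    variables are smooth on the plane. *)
Fixpoint diffn k f : Prop :=
  if k is k'.+1 then
    exists2 f' : R -> R, (forall x : R, is_derive x (1 : R) f (f' x)) &
      diffn k' f'
  else True.

Lemma diffnS k f : diffn k.+1 f -> diffn k f.
Proof.
by elim: k f => // k IH f [f' ff' /IH df']; exists f'.
Qed.

Lemma diffn_cst k (c : R) : diffn k (fun=> c).
Proof.
elim: k c => // k IH c /=; exists (fun=> 0) => // x; exact: is_derive_cst.
Qed.

Lemma diffnD k f g : diffn k f -> diffn k g -> diffn k (fun x => f x + g x).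
Proof.
elim: k f g => // k IH f g [f' ff' df] [g' gg' dg].
exists (fun x => f' x + g' x); last exact: IH.
by move=> x; exact: (is_deriveD (f := f) (g := g)).
Qed.

Lemma diffnM k f g : diffn k f -> diffn k g -> diffn k (fun x => f x * g x).
Proof.
elim: k f g => // k IH f g df dg; have df0 := diffnS df; have dg0 := diffnS dg.
move: df dg => [f' ff' df] [g' gg' dg].
exists (fun x => f x * g' x + g x * f' x).
  by move=> x; exact: (is_deriveM (f := f) (g := g)).
by apply: diffnD; exact: IH.
Qed.

Lemma diffn_expR k f : diffn k f -> diffn k (fun x => expR (f x)).
Proof.
elim: k f => // k IH f df; have df0 := diffnS df.
move: df => [f' ff' df]; exists (fun x => expR (f x) * f' x).
  by move=> x; apply: (is_derive1_comp (f := expR) (g := f)).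
by apply: diffnM => //; exact: IH.
Qed.

Lemma diffn_affine k f (a b : R) : diffn k f -> diffn k (fun x => f (a * x + b)).
Proof.
elim: k f => // k IH f [f' ff' df]; exists (fun x => f' (a * x + b) * a).
  move=> x; apply: (is_derive1_comp (f := f) (g := fun x => a * x + b)).
  have dA : is_derive x (1 : R) (fun x : R => a * x) (a * 1).
    exact: (is_deriveZ (f := id) a).
  have dB : is_derive x (1 : R) (fun x : R => b) (0 : R) by exact: is_derive_cst.
  rewrite -[X in is_derive _ _ _ X]mulr1 -[X in is_derive _ _ _ X]addr0.
  exact: (is_deriveD dA dB).
by apply: diffnM; [exact: IH|exact: diffn_cst].
Qed.

(** The functions [p (1/x) exp (-1/x)], extended by [0] to [x <= 0], form a
    class that is stable under differentiation. *)
Definition flat P (x : R) : R :=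
  if 0 < x then P.[x^-1] * expR (- x^-1) else 0.

(** Each monomial is dominated by the corresponding term of the exponential
    series; this makes [flat] differentiable at the origin. *)
Lemma poly_le_expR P : exists2 C : R, 0 <= C &
  forall y, 0 <= y -> `|P.[y]| <= C * expR y.
Proof.
exists (\sum_(i < size P) `|P`_i| * i`!%:R) => [|y y0].
  by apply: sumr_ge0 => i _; rewrite mulr_ge0.
rewrite horner_coef mulr_suml (le_trans (ler_norm_sum _ _ _))// ler_sum// => i _.
rewrite normrM -mulrA ler_wpM2l// ger0_norm ?exprn_ge0//.
case: (nat_of_ord i) => [|n].
  by rewrite expr0 fact0 mul1r; have := expR_ge1Dx y; lra.
rewrite mulrC -ler_pdivrMr ?ltr0n ?fact_gt0//.
by apply: le_trans (expR_ge1Dxn n y0); rewrite lerDr.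
Qed.

Lemma is_derive_quadratic f (a C : R) : 0 <= C ->
  (forall h, `|f (h + a) - f a| <= C * h ^+ 2) -> is_derive a 1 f 0.
Proof.
move=> C0 fC.
have H : (fun h : R => h^-1 *: (f (h *: (1 : R) + a) - f a)) @ 0^' --> (0 : R).
  apply/cvgrPdist_le => e e0; near=> h.
  have h0 : h != 0 by near: h; exact: nbhs_dnbhs_neq.
  rewrite sub0r normrN normrM normfV ler_pdivrMl ?normr_gt0//.
  rewrite [h *: _]mulr1; apply: le_trans (fC h) _.
  rewrite -(real_normK (num_real h)) expr2 mulrCA ler_wpM2l//.
  have : `|h| <= e / (C + 1).
    by near: h; apply: dnbhs0_le; rewrite divr_gt0//; lra.
  rewrite ler_pdivlMr; last lra.
  by apply: le_trans; rewrite mulrC ler_wpM2l//; lra.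
split; first by apply/cvg_ex; exists 0.
by apply/cvg_lim.
Unshelve. all: by end_near. Qed.

Lemma is_derive_flat P (x : R) : is_derive x 1 (flat P) (flat ('X^2 * (P - P^`())) x).
Proof.
have [x0|x0|x0] := ltgtP x 0.
- rewrite {2}/flat ltNge (ltW x0) /=.
  have dB : is_derive x (1 : R) (fun=> 0 : R) (0 : R) by exact: is_derive_cst.
  apply: near_eq_is_derive dB; near=> y.
  rewrite /flat ltNge ifF//; apply/negbF; apply: ltW.
  near: y; exact: lt_nbhsl.
- rewrite {2}/flat x0.
  suff H : is_derive x 1 (fun x => P.[x^-1] * expR (- x^-1))
      (('X^2 * (P - P^`())).[x^-1] * expR (- x^-1)).
    apply: near_eq_is_derive H; near=> y; rewrite /flat ifT//; near: y; exact: lt_nbhsr.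
  have xn0 : x != 0 by rewrite gt_eqF.
  have dV : is_derive x 1 (fun y : R => y^-1) (- x ^- 2).
    apply: is_derive_eq; first exact: (is_deriveV (f := id)).
    by rewrite scaler1.
  have dP : is_derive x 1 (horner P \o (fun y : R => y^-1)) (P^`().[x^-1] * - x ^- 2).
    exact: is_derive1_comp.
  have dE : is_derive x 1 (expR \o (fun y : R => - y^-1)) (expR (- x^-1) * x ^- 2).
    apply: is_derive1_comp; apply: is_derive_eq.
    by rewrite opprK.
  apply: (is_derive_eq (is_deriveM dP dE)).
  rewrite /= !hornerE /GRing.scale /= -exprVn.
  by ring.
rewrite x0 {2}/flat ltxx.
have [C C0 PC] := poly_le_expR (P * 'X^2).
apply: (@is_derive_quadratic _ _ C) => // h.
rewrite addr0 /flat ltxx subr0; case: ifPn => [h0|_]; last first.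
  by rewrite normr0 mulr_ge0 ?sqr_ge0.
have := PC h^-1; rewrite invr_ge0 (ltW h0) => /(_ isT).
rewrite hornerM hornerXn normrM [X in _ * X]ger0_norm ?sqr_ge0// => H.
rewrite normrM (ger0_norm (expR_ge0 _)) expRN.
rewrite ler_pdivrMr ?expR_gt0//.
have hh : h ^+ 2 * h^-1 ^+ 2 = 1 by rewrite -exprMn mulfV ?gt_eqF// expr1n.
have -> : `|P.[h^-1]| = h ^+ 2 * (`|P.[h^-1]| * h^-1 ^+ 2) by rewrite mulrCA hh mulr1.
by rewrite [leRHS]mulrAC [leRHS]mulrC ler_wpM2l ?sqr_ge0.
Unshelve. all: by end_near. Qed.

Lemma diffn_flat k P : diffn k (flat P).
Proof.
elim: k P => // k IH P /=; exists (flat ('X^2 * (P - P^`()))) => // x.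
exact: is_derive_flat.
Qed.

Lemma diffn_continuous f : diffn 1 f -> continuous f.
Proof.
move=> [f' ff' _] x; apply/differentiable_continuous/derivable1_diffP.
by have := ff' x => -[].
Qed.

Lemma continuous_fst2 f : continuous f -> continuous (fun z : R * R => f z.1).
Proof. by move=> cf z; apply: continuous_comp; [exact: cvg_fst|exact: cf]. Qed.

Lemma continuous_snd2 f : continuous f -> continuous (fun z : R * R => f z.2).
Proof. by move=> cf z; apply: continuous_comp; [exact: cvg_snd|exact: cf]. Qed.

Lemma Ck_continuous k (v : R * R -> R) : Ck k v -> continuous v.
Proof. by case: k => [|k] []. Qed.

Lemma smooth_tensor f g : (forall k, diffn k f) -> (forall k, diffn k g) ->
  smooth (fun z : R * R => f z.1 * g z.2).
Proof.
move=> df dg k; move: (df k.+1) (dg k.+1) => {df dg}.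
elim: k f g => [|k IH] f g df dg.
  split=> // z; apply: (continuousM (s := fun z : R * R => f z.1) (t := fun z : R * R => g z.2)).
    exact/continuous_fst2/diffn_continuous.
  exact/continuous_snd2/diffn_continuous.
have [f' ff' df'] := df; have [g' gg' dg'] := dg.
have dfx (z : R * R) : is_derive z.1 1 (fun s => f s * g z.2) (f' z.1 * g z.2).
  have dc : is_derive z.1 (1 : R) (fun=> g z.2) (0 : R) by exact: is_derive_cst.
  apply: (is_derive_eq (is_deriveM (ff' z.1) dc)).
  by rewrite scaler0 add0r [LHS]mulrC.
have dfy (z : R * R) : is_derive z.2 1 (fun s => f z.1 * g s) (f z.1 * g' z.2).
  have dc : is_derive z.2 (1 : R) (fun=> f z.1) (0 : R) by exact: is_derive_cst.
  apply: (is_derive_eq (is_deriveM dc (gg' z.2))).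
  by rewrite scaler0 addr0.
split.
  by apply: (@Ck_continuous k); apply: IH; exact: diffnS.
split.
- by move=> z; split; [have [] := dfx z|have [] := dfy z].
- have -> : dx (fun z => f z.1 * g z.2) = (fun z => f' z.1 * g z.2).
    by apply/funext => z; rewrite /dx derive1E; have [] := dfx z.
  by apply: IH => //; exact: diffnS.
- have -> : dy (fun z => f z.1 * g z.2) = (fun z => f z.1 * g' z.2).
    by apply/funext => z; rewrite /dy derive1E; have [] := dfy z.
  by apply: IH => //; exact: diffnS.
Qed.

(** Smooth approximations, from below, of the indicator of [`]a, b[]. *)
Definition bump (a b : R) (n : nat) (x : R) : R :=
  1 - expR (- (n%:R * (flat 1 (x - a) * flat 1 (b - x)))).

Lemma flat1_ge0 (x : R) : 0 <= flat 1 x.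
Proof. by rewrite /flat; case: ifP => // _; rewrite hornerC mul1r expR_ge0. Qed.

Lemma diffn_bump k a b n : diffn k (bump a b n).
Proof.
have dflat (p q : R) : diffn k (fun x => flat 1 (p * x + q)).
  exact/diffn_affine/diffn_flat.
have -> : bump a b n = fun x => 1 + (- 1) * expR ((- n%:R) *
    (flat 1 (1 * x + - a) * flat 1 ((- 1) * x + b))).
  by apply/funext => x; rewrite /bump !mul1r !mulN1r mulNr [- x + b]addrC.
apply: diffnD; first exact: diffn_cst.
apply: diffnM; first exact: diffn_cst.
apply: diffn_expR; apply: diffnM; first exact: diffn_cst.
exact: diffnM.
Qed.

Lemma bump_ge0 a b n x : 0 <= bump a b n x.
Proof.
rewrite /bump subr_ge0 -expR0 ler_expR oppr_le0.
by rewrite !mulr_ge0 ?flat1_ge0.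
Qed.

Lemma bump_le1 a b n x : bump a b n x <= 1.
Proof. by rewrite /bump gerBl expR_ge0. Qed.

Lemma bump_out a b n x : ~~ (a < x < b) -> bump a b n x = 0.
Proof.
rewrite negb_and -!leNgt /bump /flat => /orP[xa|bx].
  by rewrite subr_gt0 ltNge xa mul0r mulr0 oppr0 expR0 subrr.
by rewrite [0 < b - x]subr_gt0 [x < b]ltNge bx !mulr0 oppr0 expR0 subrr.
Qed.

Lemma cvg_bump a b x : bump a b n x @[n --> \oo] --> (\1_`]a, b[ x : R).
Proof.
rewrite indicE mem_setE in_itv /=; have [/andP[ax xb]|xab] := boolP (a < x < b); last first.
  by under eq_fun do rewrite bump_out//; exact: cvg_cst.
have bp : 0 < flat 1 (x - a) * flat 1 (b - x).
  by rewrite /flat !subr_gt0 ax xb !hornerC !mul1r mulr_gt0 ?expR_gt0.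
set t := flat _ _ * _ in bp.
rewrite -[X in _ --> X](subr0 1); apply: cvgB; first exact: cvg_cst.
have -> : (fun n : nat => expR (- (n%:R * t))) = (fun n : nat => expR (- t) ^+ n).
  by apply/funext => n; rewrite -expRM_natl mulrN.
apply: cvg_expr; rewrite ger0_norm ?expR_ge0//.
by rewrite -expR0 ltr_expR oppr_lt0.
Qed.

Lemma test_bump L a b c d n : 0 < a -> b < L -> 0 < c -> d < L ->
  test_function L (fun z => bump a b n z.1 * bump c d n z.2).
Proof.
move=> a0 bL c0 dL; split.
  by apply: smooth_tensor => k; exact: diffn_bump.
exists (`[a, b] `*` `[c, d]); split.
- by apply: compact_setX; exact: segment_compact.
- move=> z [/=]; rewrite !in_itv /= => /andP[az zb] /andP[cz zd].
  split; rewrite /= in_itv /=; first by rewrite (lt_le_trans a0 az) (le_lt_trans zb bL).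
  by rewrite (lt_le_trans c0 cz) (le_lt_trans zd dL).
- move=> z zK; have [zab|zab] := boolP (a < z.1 < b); last by rewrite bump_out// mul0r.
  rewrite [X in _ * X]bump_out ?mulr0//; apply/negP => zcd; apply: zK.
  split; rewrite /= in_itv /=.
    by move/andP: zab => [/ltW -> /ltW ->].
  by move/andP: zcd => [/ltW -> /ltW ->].
Qed.

End smooth1.

(** * Square-integrable functions on the square *)

Section L2_square.
Context {R : realType}.
Implicit Types (L : R) (v w g : R * R -> R).
Local Notation RR := (measurableTypeR R * measurableTypeR R)%type.

(** The plane carries two judgmentally equal, but syntactically distinct,
    measurable structures; [msq], [mfunRR] and [mEFinRR] pass to the one used by
    [leb2]. *)
Lemma msq L : @measurable _ RR (sq L).
Proof. exact: measurable_sq. Qed.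

Lemma mfunRR (A : set (R * R)) v : measurable_fun A v -> @measurable_fun _ _ RR R A v.
Proof. by []. Qed.

Lemma mEFinRR (A : set (R * R)) v : measurable_fun A v ->
  @measurable_fun _ _ RR (\bar R) A (fun x => (v x)%:E).
Proof. by move=> mv; apply/measurable_EFinP; exact: mfunRR. Qed.

Lemma leb2_sq L : 0 < L -> leb2 (sq L) = (L ^+ 2)%:E.
Proof.
move=> L0; rewrite /leb2 /sq product_measure1E; try exact: measurable_itv.
have E : lebesgue_measure (`]0%R, L[%classic : set R) = L%:E.
  by rewrite lebesgue_measure_itv/= lte_fin L0 -EFinD subr0.
rewrite expr2 EFinM; congr (_ * _)%E; exact: E.
Qed.

Lemma LpDE L p v : p != 0 ->
  LpD L p%:E v = ((\int[leb2]_(x in sq L) (`|v x| `^ p)%:E) `^ p^-1)%E.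
Proof.
move=> p0; rewrite /LpD LnormE; congr (poweR _ _).
rewrite [RHS]integral_mkcond; apply: eq_integral => x _.
by rewrite /patch; case: ifP => // xL; rewrite abse0 poweR0r.
Qed.

Lemma L2P L v : L2 L v <->
  measurable_fun (sq L) v /\ (\int[leb2]_(x in sq L) (v x ^+ 2)%:E < +oo)%E.
Proof.
rewrite /L2 LpDE ?pnatr_eq0//.
have -> : (\int[leb2]_(x in sq L) (`|v x| `^ 2)%:E =
    \int[leb2]_(x in sq L) (v x ^+ 2)%:E)%E.
  apply: eq_integral => x _.
  by rewrite powR_mulrn// real_normK// num_real.
split=> -[mv vf]; split=> //; last exact: poweR_lty.
move: vf; case: (\int[_]_(_ in _) _)%E => [r|//|//]; first by rewrite !ltry.
by rewrite poweRyr ?invr_neq0.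
Qed.

Lemma L2_sqr_integrable L v : L2 L v ->
  leb2.-integrable (sq L) (fun x => (v x ^+ 2)%:E).
Proof.
move=> /L2P[mv vf]; apply/integrableP; split.
  by apply: mEFinRR; exact: measurable_funX.
by under eq_integral do rewrite /= ger0_norm ?sqr_ge0//.
Qed.

Lemma L2_integrableM L v w : L2 L v -> L2 L w ->
  leb2.-integrable (sq L) (fun x => (v x * w x)%:E).
Proof.
move=> vL wL; have mS := msq L.
apply: (le_integrable mS _ _ (integrableD mS (L2_sqr_integrable vL) (L2_sqr_integrable wL))).
  by apply: mEFinRR; apply: measurable_funM; [case: vL|case: wL].
move=> x _ /=; rewrite lee_fin [leRHS]ger0_norm ?addr_ge0 ?sqr_ge0//.
rewrite ler_norml; have := sqr_ge0 (v x + w x); have := sqr_ge0 (v x - w x).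
by have := sqr_ge0 (v x); have := sqr_ge0 (w x); nra.
Qed.

Lemma bounded_L2 L v (M : R) : 0 < L -> measurable_fun (sq L) v ->
  (forall x, sq L x -> `|v x| <= M) -> L2 L v.
Proof.
move=> L0 mv vM; apply/L2P; split=> //.
have mS := msq L.
apply: (@le_lt_trans _ _ (\int[leb2]_(x in sq L) (M ^+ 2)%:E)%E).
  apply: ge0_le_integral => //.
  - by move=> x _; rewrite lee_fin sqr_ge0.
  - by apply: mEFinRR; exact: measurable_funX.
  - move=> x xL; rewrite lee_fin -(real_normK (num_real (v x))).
    by rewrite ler_sqr ?nnegrE ?vM// (le_trans _ (vM x xL)).
by rewrite integral_cst// [X in (_ * X)%E]leb2_sq// -EFinM ltry.
Qed.

Lemma L2_cst L (c : R) : 0 < L -> L2 L (fun=> c).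
Proof. by move=> L0; apply: (@bounded_L2 _ _ `|c|). Qed.

Lemma L2_integrable L v : 0 < L -> L2 L v ->
  leb2.-integrable (sq L) (EFin \o v).
Proof.
move=> L0 vL; have := L2_integrableM vL (L2_cst 1 L0).
by apply: eq_integrable; [exact: msq|move=> x _; rewrite mulr1].
Qed.

Lemma L2D L v w : L2 L v -> L2 L w -> L2 L (fun x => v x + w x).
Proof.
move=> vL wL; have mS := msq L.
have mv := vL.1; have mw := wL.1.
apply/L2P; split; first exact: measurable_funD.
have i := integrableD mS (integrableZl mS (2 : R) (L2_sqr_integrable vL))
  (integrableZl mS (2 : R) (L2_sqr_integrable wL)).
apply: le_lt_trans (integrable_lty mS i).
apply: ge0_le_integral => //.
- by move=> x _; rewrite lee_fin sqr_ge0.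
- by apply: mEFinRR; apply: measurable_funX; exact: measurable_funD.
- by case/integrableP: i.
- move=> x _; rewrite -!EFinM -EFinD lee_fin.
  by have := sqr_ge0 (v x - w x); nra.
Qed.

Lemma L2Z L v c : L2 L v -> L2 L (fun x => c * v x).
Proof.
move=> vL; have mS := msq L; have mv := vL.1.
apply/L2P; split; first exact: measurable_funM.
have := integrable_lty mS (integrableZl mS (c ^+ 2) (L2_sqr_integrable vL)).
by congr (_ < _)%E; apply: eq_integral => x _; rewrite -EFinM exprMn.
Qed.

Lemma L2B L v w : L2 L v -> L2 L w -> L2 L (fun x => v x - w x).
Proof.
move=> vL wL; have := L2D vL (L2Z (-1) wL).
by congr L2; apply/funext => x; rewrite mulN1r.
Qed.

End L2_square.

(** * The fundamental lemma of the calculus of variations *)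

Section dynkin_integral.
Context d d' (T : measurableType d) (T' : measurableType d') (R : realType).
Variables (mu : {measure set T -> \bar R}) (D : set T) (phi : T -> T').
Hypotheses (mD : measurable D) (mphi : measurable_fun setT phi).
Local Open Scope ereal_scope.

(** The sets whose preimage carries no integral of [g] form a Dynkin system, for
    [g] has integral zero on [D]. *)
Lemma integral_preimage0 (G : set (set T')) (g : T -> \bar R) :
  @measurable _ T' = <<s G >> -> setI_closed G ->
  mu.-integrable D g -> \int[mu]_(x in D) g x = 0 ->
  (forall A, G A -> \int[mu]_(x in D `&` phi @^-1` A) g x = 0) ->
  forall A, measurable A -> \int[mu]_(x in D `&` phi @^-1` A) g x = 0.
Proof.
move=> GE GI ig g0 gG A.
have mp B : measurable B -> measurable (phi @^-1` B).
  by move=> mB; rewrite -[X in measurable X]setTI; exact: mphi.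
rewrite {1}GE; apply: (@dynkin_induction _ _ G
    (fun A => \int[mu]_(x in D `&` phi @^-1` A) g x = 0)) => //.
- by rewrite preimage_setT setIT.
- move=> S mS IS; have mpS := mp _ mS.
  have := @integral_setU _ _ _ mu (D `&` phi @^-1` S) (D `&` phi @^-1` (~` S)) g.
  rewrite -setIUr -preimage_setU setUv preimage_setT setIT g0 IS add0e => <- //.
  + exact: measurableI.
  + by apply: measurableI => //; apply: mp; exact: measurableC.
  + exact: measurable_int ig.
  + by rewrite disj_set2E setIACA setIid -preimage_setI setICr preimage_set0 setI0.
- move=> F mF tF IF.
  rewrite preimage_bigcup setI_bigcupr integral_bigcup.
  + by apply: eseries0 => i _ _; exact: IF.
  + apply/trivIsetP => i j _ _ ij.
    move/trivIsetP: tF => /(_ i j I I ij) Fij.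
    by rewrite setIACA setIid -preimage_setI Fij preimage_set0 setI0.
  + by move=> i; apply: measurableI => //; exact: mp.
  + apply: integrableS ig => //.
      by apply: bigcup_measurable => i _; apply: measurableI => //; exact: mp.
    by apply: bigcup_sub => i _; exact: subIsetl.
Qed.

End dynkin_integral.

Section fundamental_lemma.
Context {R : realType}.
Implicit Types (L : R) (v w g t : R * R -> R).
Local Notation RR := (measurableTypeR R * measurableTypeR R)%type.

Lemma Rintegral_EFin L v : leb2.-integrable (sq L) (EFin \o v) ->
  (\int[leb2]_(x in sq L) (v x)%:E = (\int[leb2]_(x in sq L) (v x))%R%:E)%E.
Proof.
move=> iv; rewrite /Rintegral fineK//; apply: integrable_fin_num iv; exact: msq.
Qed.

Definition halfplane (a c : R) (x : R * R) : R := \1_`]a, +oo[ x.1 * \1_`]c, +oo[ x.2.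

Lemma measurable_indic2 (A B : set R) : measurable A -> measurable B ->
  measurable_fun setT (fun x : R * R => \1_A x.1 * \1_B x.2 : R).
Proof.
move=> mA mB; apply: measurable_funM.
  have mi : measurable_fun setT (\1_A : R -> R) by exact: measurable_indic.
  exact: (measurableT_comp mi (@measurable_fst _ _ R R)).
have mi : measurable_fun setT (\1_B : R -> R) by exact: measurable_indic.
exact: (measurableT_comp mi (@measurable_snd _ _ R R)).
Qed.

Lemma indic_norm1 (T : Type) (A : set T) x : `|\1_A x : R| <= 1.
Proof. by rewrite indicE; case: (_ \in _); rewrite ?normr1 ?normr0 ?ler01. Qed.

Lemma cvg_integral_test L g (s : nat -> R * R -> R) (l : R * R -> R) : 0 < L ->
  L2 L g -> (forall n, measurable_fun (sq L) (s n)) -> measurable_fun (sq L) l ->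
  (forall n x, `|s n x| <= 1) ->
  (forall x, sq L x -> s n x @[n --> \oo] --> l x) ->
  (forall n, \int[leb2]_(x in sq L) (g x * s n x)%:E = 0)%E ->
  (\int[leb2]_(x in sq L) (g x * l x)%:E = 0)%E.
Proof.
move=> L0 gL ms ml s1 sl s0; have mS := msq L; have mg := gL.1.
have ig := integrable_abse (L2_integrable L0 gL).
have [] := @dominated_convergence _ _ _ leb2 _ mS (fun n x => (g x * s n x)%:E)
  (fun x => (g x * l x)%:E) _ _ _ _ ig _.
- by move=> n; apply: mEFinRR; exact: measurable_funM.
- by apply: mEFinRR; exact: measurable_funM.
- apply: aeW => x xL; apply: cvg_EFin; first by apply: nearW.
  by apply: cvgMr; exact: sl.
- apply: aeW => x n xL /=; rewrite lee_fin normrM ler_piMr//.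
move=> _ _.
have -> : (fun n => \int[leb2]_(x in sq L) (g x * s n x)%:E)%E = cst 0%E.
  by apply/funext => n; exact: s0.
move=> h; apply/esym.
have := cvg_unique (@ereal_hausdorff R) (cvg_cst (0%E : \bar R)) h; exact.
Qed.

(** The test functions [bump] increase to indicators of boxes, and boxes inside
    the open square exhaust its intersection with a quadrant. *)
Lemma fundamental_halfplane L g : 0 < L -> L2 L g ->
  (forall t, test_function L t -> (\int[leb2]_(x in sq L) (g x * t x))%R = 0) ->
  forall a c, (\int[leb2]_(x in sq L) (g x * halfplane a c x)%:E = 0)%E.
Proof.
move=> L0 gL gt.
have box a b c d : 0 < a -> b < L -> 0 < c -> d < L ->
    (\int[leb2]_(x in sq L) (g x * (\1_`]a, b[ x.1 * \1_`]c, d[ x.2))%:E = 0)%E.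
  move=> a0 bL c0 dL.
  have mb n : measurable_fun (sq L) (fun x => bump a b n x.1 * bump c d n x.2).
    apply: measurable_funM; apply: measurable_funTS.
      apply: (measurableT_comp (f := bump a b n)); last exact: measurable_fst.
      by apply: continuous_measurable_fun; apply/diffn_continuous/diffn_bump.
    apply: (measurableT_comp (f := bump c d n)); last exact: measurable_snd.
    by apply: continuous_measurable_fun; apply/diffn_continuous/diffn_bump.
  have b1 n x : `|bump a b n x.1 * bump c d n x.2| <= 1.
    rewrite ger0_norm ?mulr_ge0 ?bump_ge0//.
    by rewrite mulr_ile1 ?bump_ge0 ?bump_le1.
  apply: (@cvg_integral_test L g _ _ L0 gL mb _ b1).
  - by apply: measurable_funTS; apply: measurable_indic2; exact: measurable_itv.
  - by move=> x _; apply: cvgM; exact: cvg_bump.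
  - move=> n; rewrite Rintegral_EFin; first by rewrite gt//; exact: test_bump.
    apply: L2_integrableM => //; apply: (@bounded_L2 _ _ _ 1) => // x _; exact: b1.
move=> a c.
pose e n : R := n.+1%:R^-1.
have e0 n : 0 < e n by rewrite invr_gt0 ltr0n.
pose s n (x : R * R) : R := \1_`]Num.max a (e n), L - e n[ x.1 *
  \1_`]Num.max c (e n), L - e n[ x.2.
have cvs (z p : R) : 0 < z < L ->
    \1_`]Num.max p (e n), L - e n[ z @[n --> \oo] --> (\1_`]p, +oo[ z : R).
  move=> /andP[z0 zL]; have Lz : 0 < L - z by rewrite subr_gt0.
  apply: cvg_near_cst; near=> n.
  rewrite !indicE !mem_setE !in_itv /= andbT gt_max.
  have -> : e n < z.
    by near: n; exact: (near_infty_natSinv_lt (PosNum z0)).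
  have -> : z < L - e n; last by rewrite !andbT.
  have : e n < L - z by near: n; exact: (near_infty_natSinv_lt (PosNum Lz)).
  by rewrite ltrBrDr addrC -ltrBrDr.
apply: (@cvg_integral_test L g s _ L0 gL).
- by move=> n; apply: measurable_funTS; apply: measurable_indic2; exact: measurable_itv.
- by apply: measurable_funTS; apply: measurable_indic2; exact: measurable_itv.
- by move=> n x; rewrite normrM mulr_ile1 ?indic_norm1.
- move=> x [/=]; rewrite !in_itv /= => x1 x2; apply: cvgM; exact: cvs.
- move=> n; apply: box; rewrite ?lt_max ?e0 ?orbT//.
  + by rewrite ltrBlDr ltrDl.
  + by rewrite ltrBlDr ltrDl.
Unshelve. all: by end_near. Qed.

Lemma measurableR_rays : @measurable _ (measurableTypeR R) = <<s @RGenOInfty.G R >>.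
Proof. exact: RGenOInfty.measurableE. Qed.

Lemma setI_closed_rays : setI_closed (@RGenOInfty.G R).
Proof.
move=> _ _ [x ->] [y ->]; exists (Num.max x y); apply/predeqP => z /=.
rewrite !in_itv /= !andbT gt_max; split=> [[-> ->]//|/andP[]//].
Qed.

(** The fundamental lemma of the calculus of variations on the square: the
    bumps give the integrals over quadrants, Dynkin's theorem those over all
    Borel sets. *)
Lemma fundamental_lemma L g : 0 < L -> L2 L g ->
  (forall t, test_function L t -> (\int[leb2]_(x in sq L) (g x * t x))%R = 0) ->
  {ae leb2, forall x, sq L x -> g x = 0}.
Proof.
move=> L0 gL gt; have mS := msq L; have H := fundamental_halfplane L0 gL gt.
have ig := L2_integrable L0 gL.
pose X (A : set R) : set RR := [set x | A x.1].
pose Y (A : set R) : set RR := [set x | A x.2].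
have mX (A : set (measurableTypeR R)) : measurable A -> measurable (X A).
  by move=> mA; rewrite -[X _]setTI; exact: measurable_fst.
have mY (A : set (measurableTypeR R)) : measurable A -> measurable (Y A).
  by move=> mA; rewrite -[Y _]setTI; exact: measurable_snd.
have q a c : (\int[leb2]_(x in sq L `&` X `]a, +oo[%classic `&` Y `]c, +oo[%classic) (g x)%:E = 0)%E.
  rewrite -setIA integral_mkcondr -[RHS](H a c); apply: eq_integral => x _.
  rewrite /halfplane /patch in_setI !indicE /X /Y.
  rewrite (_ : (x \in [set x | _]) = (x.1 \in `]a, +oo[%classic)); last first.
    by apply/idP/idP; rewrite !inE.
  rewrite (_ : (x \in [set x | _]) = (x.2 \in `]c, +oo[%classic)); last first.
    by apply/idP/idP; rewrite !inE.
  by case: (_ \in _) => /=; case: (_ \in _); rewrite ?mul1r ?mulr1 ?mulr0 ?mul0r ?mulr0.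
have full (A : set RR) : sq L `<=` A -> sq L `&` A = sq L by move=> h; apply/setIidPl.
have rY a (B : set (measurableTypeR R)) : measurable B ->
    (\int[leb2]_(x in sq L `&` X `]a, +oo[%classic `&` Y B) (g x)%:E = 0)%E.
  have mD : measurable (sq L `&` X `]a, +oo[%classic : set RR).
    by apply: measurableI => //; apply: mX; exact: measurable_itv.
  apply: (integral_preimage0 mD (@measurable_snd _ _ _ _) measurableR_rays
    setI_closed_rays).
  - by apply: integrableS ig => //; exact: subIsetl.
  - have := q a (-1); congr (_ = _); congr (integral _ _ _).
    apply/setIidPl => x [[/= _]]; rewrite in_itv /= => /andP[x2 _] _.
    by rewrite /Y /= in_itv /= andbT (lt_trans _ x2)// ltrN10.
  - by move=> _ [c ->]; exact: q.
have rect (A B : set (measurableTypeR R)) : measurable A -> measurable B ->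
    (\int[leb2]_(x in sq L `&` (A `*` B)) (g x)%:E = 0)%E.
  move=> mA mB.
  have mD : measurable (sq L `&` Y B : set RR) by apply: measurableI => //; exact: mY.
  have -> : sq L `&` (A `*` B) = sq L `&` Y B `&` fst @^-1` A.
    by apply/predeqP => x; split => [[? []]//|[[]]].
  apply: (integral_preimage0 mD (@measurable_fst _ _ _ _) measurableR_rays
    setI_closed_rays) mA.
  - by apply: integrableS ig => //; exact: subIsetl.
  - have := rY (-1) B mB; congr (_ = _); congr (integral _ _ _).
    rewrite setIAC; apply/setIidPl => x [[/=]].
    rewrite in_itv /= => /andP[x1 _] _ _.
    by rewrite /X /= in_itv /= andbT (lt_trans _ x1)// ltrN10.
  - by move=> _ [c ->]; rewrite setIAC; exact: rY.
have mid : measurable_fun (setT : set RR) (@id RR) by exact: measurable_id.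
have all (A : set RR) : measurable A ->
    (\int[leb2]_(x in sq L `&` A) (g x)%:E = 0)%E.
  apply: (integral_preimage0 mS mid (@measurable_prod_measurableType _ _ _ _) _ ig).
  - move=> _ _ [A1 mA1 [B1 mB1 <-]] [A2 mA2 [B2 mB2 <-]].
    exists (A1 `&` A2); first exact: measurableI.
    exists (B1 `&` B2); first exact: measurableI.
    by rewrite -setXI.
  - rewrite -[RHS](rect setT setT measurableT measurableT).
    by rewrite setXTT setIT.
  - by move=> _ [A1 mA1 [B1 mB1 <-]]; exact: rect.
suff : ae_eq leb2 (sq L) (EFin \o g) (cst 0%E).
  by apply: filterS => x h /h /= [].
apply: integral_ae_eq => // E ES mE.
by rewrite integral0 -[RHS](all E mE) setIidr.
Qed.

End fundamental_lemma.

(** * Weak gradients *)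

Section fubini_square.
Context {R : realType}.
Implicit Types (L : R) (v w t : R * R -> R).
Local Notation RR := (measurableTypeR R * measurableTypeR R)%type.
Local Notation mu := (@lebesgue_measure R).

Let sqE L (f : R * R -> \bar R) x y :
  (f \_ (sq L)) (x, y) = ((fun x => ((fun y => f (x, y)) \_ `]0, L[) y) \_ `]0, L[) x.
Proof.
rewrite /patch; case: ifPn.
  by rewrite inE => -[/= xL yL]; rewrite !mem_set.
move=> xyL; case: ifPn => // xL; case: ifPn => // yL.
by exfalso; move/negP: xyL; apply; rewrite inE; split; exact: set_mem.
Qed.

Let restrict_cst0 L (f : R -> R -> \bar R) x :
  (\int[mu]_y (((fun x => (f x \_ `]0%R, L[%classic) y) \_ `]0%R, L[%classic) x) =
  ((fun x => \int[mu]_(y in `]0%R, L[) f x y) \_ `]0%R, L[%classic) x)%E.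
Proof.
have [xL|xL] := boolP (x \in `]0%R, L[%classic).
  rewrite [RHS]/patch xL [RHS]integral_mkcond; apply: eq_integral => y _.
  by rewrite [LHS]/patch xL.
rewrite [RHS]/patch (negbTE xL) integral0_eq// => y _.
by rewrite /patch (negbTE xL).
Qed.

Lemma tonelli_square L (f : R * R -> \bar R) :
  @measurable_fun _ _ RR (\bar R) (sq L) f -> (forall x, 0 <= f x)%E ->
  (\int[leb2]_(z in sq L) f z =
   \int[mu]_(x in `]0%R, L[) \int[mu]_(y in `]0%R, L[) f (x, y))%E.
Proof.
move=> mf f0; rewrite integral_mkcond fubini_tonelli1.
- rewrite [RHS]integral_mkcond; apply: eq_integral => x _.
  rewrite -restrict_cst0; apply: eq_integral => y _; exact: sqE.
- exact/(measurable_restrictT _ (msq L)).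
- by move=> x; rewrite /patch; case: ifP.
Qed.

Lemma tonelli_square_sym L (f : R * R -> \bar R) :
  @measurable_fun _ _ RR (\bar R) (sq L) f -> (forall x, 0 <= f x)%E ->
  (\int[leb2]_(z in sq L) f z =
   \int[mu]_(y in `]0%R, L[) \int[mu]_(x in `]0%R, L[) f (x, y))%E.
Proof.
move=> mf f0; rewrite integral_mkcond fubini_tonelli2.
- rewrite [RHS]integral_mkcond; apply: eq_integral => y _.
  rewrite -(restrict_cst0 _ (fun y x => f (x, y))); apply: eq_integral => x _.
  by rewrite sqE /patch; case: ifP => //; case: ifP.
- exact/(measurable_restrictT _ (msq L)).
- by move=> x; rewrite /patch; case: ifP.
Qed.

Lemma fubini_square L (f : R * R -> \bar R) :
  leb2.-integrable (sq L) f ->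
  (\int[leb2]_(z in sq L) f z =
   \int[mu]_(x in `]0%R, L[) \int[mu]_(y in `]0%R, L[) f (x, y))%E.
Proof.
move=> fi; rewrite integral_mkcond -integral12_prod_meas1.
- rewrite [RHS]integral_mkcond; apply: eq_integral => x _.
  rewrite -restrict_cst0; apply: eq_integral => y _; exact: sqE.
- by apply/(integrable_mkcond _ _).1 => //; exact: msq.
Qed.

Lemma fubini_square_sym L (f : R * R -> \bar R) :
  leb2.-integrable (sq L) f ->
  (\int[leb2]_(z in sq L) f z =
   \int[mu]_(y in `]0%R, L[) \int[mu]_(x in `]0%R, L[) f (x, y))%E.
Proof.
move=> fi; rewrite integral_mkcond -integral21_prod_meas1.
- rewrite [RHS]integral_mkcond; apply: eq_integral => y _.
  rewrite -(restrict_cst0 _ (fun y x => f (x, y))); apply: eq_integral => x _.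
  by rewrite sqE /patch; case: ifP => //; case: ifP.
- by apply/(integrable_mkcond _ _).1 => //; exact: msq.
Qed.

Lemma continuous_L2 L v : 0 < L -> continuous v -> L2 L v.
Proof.
move=> L0 cv.
have kL : compact (csq L) by apply: compact_setX; exact: segment_compact.
have : bounded_set (v @` csq L).
  apply: compact_bounded; apply: continuous_compact => //.
  exact: continuous_subspaceT.
move=> [M [_ /(_ (M + 1))]]; rewrite ltrDl ltr01 => /(_ isT) vM.
apply: (@bounded_L2 _ _ _ (M + 1)) => // [|x xL].
  apply: (measurable_funS (measurable_csq _)); first exact: sq_csq.
  by apply: continuous_measurable2 => //; exact: continuous_subspaceT.
by apply: vM; exists x => //; exact: sq_csq.
Qed.

Lemma FTC_line (F f : R -> R) (a b : R) : a < b ->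
  (forall x : R, is_derive x (1 : R) F (f x)) -> continuous f ->
  (\int[mu]_(x in `]a, b[) (f x)%:E = (F b - F a)%:E)%E.
Proof.
move=> ab Ff cf.
have cF : continuous F.
  move=> x; apply/differentiable_continuous/derivable1_diffP.
  by have := Ff x => -[].
rewrite -(@integral_itv_bndoo _ a b _ true false); last first.
  apply: measurable_funTS; apply/measurable_EFinP.
  exact: continuous_measurable_fun.
rewrite (@continuous_FTC2 _ f F) ?EFinB//.
- exact: continuous_subspaceT.
- split; first by move=> x _; have := Ff x => -[].
    exact/cvg_at_right_filter/cF.
  exact/cvg_at_left_filter/cF.
- by move=> x _; rewrite derive1E; have := Ff x => -[].
Qed.

Lemma continuous_pairl (y : R) v : continuous v -> continuous (fun x : R => v (x, y)).
Proof.
move=> cv x; apply: (@continuous_comp _ _ _ (fun x : R => (x, y)) v); last exact: cv.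
move=> A [[P Q] /= [xP yQ] PQA]; apply: filterS xP => z Pz; apply: PQA.
by split => //; exact: nbhs_singleton.
Qed.

Lemma continuous_pairr (x : R) v : continuous v -> continuous (fun y : R => v (x, y)).
Proof.
move=> cv y; apply: (@continuous_comp _ _ _ (fun y : R => (x, y)) v); last exact: cv.
move=> A [[P Q] /= [xP yQ] PQA]; apply: filterS yQ => z Qz; apply: PQA.
by split => //; exact: nbhs_singleton.
Qed.

Lemma Ck1_derive_x v : Ck 1 v ->
  forall x y : R, is_derive x (1 : R) (fun s => v (s, y)) (dx v (x, y)).
Proof.
move=> [_ [pv _ _]] x y; have [/= d _] := pv (x, y).
by rewrite /dx derive1E /=; exact: derivableP.
Qed.

Lemma Ck1_derive_y v : Ck 1 v ->
  forall x y : R, is_derive y (1 : R) (fun s => v (x, s)) (dy v (x, y)).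
Proof.
move=> [_ [pv _ _]] x y; have [/= _ d] := pv (x, y).
by rewrite /dy derive1E /=; exact: derivableP.
Qed.

Lemma Ck1_continuous_dx v : Ck 1 v -> continuous (dx v).
Proof. by case=> _ [_ []]. Qed.

Lemma Ck1_continuous_dy v : Ck 1 v -> continuous (dy v).
Proof. by case=> _ [_ _ []]. Qed.

Lemma test_vanish L t : test_function L t -> forall x, ~ sq L x -> t x = 0.
Proof. by move=> [_ [K [_ KL Kt]]] x xL; apply: Kt => /KL. Qed.

(** On each horizontal segment the product [v t] has integral of its derivative
    equal to zero, since [t] vanishes at both ends. *)
Lemma parts_x L v t : 0 < L -> Ck 1 v -> test_function L t ->
  (\int[leb2]_(x in sq L) (v x * dx t x) = - \int[leb2]_(x in sq L) (dx v x * t x))%R.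
Proof.
move=> L0 cv tt; have ct := tt.1 1%N.
have Cv := continuous_L2 L0 (Ck_continuous cv).
have Ct := continuous_L2 L0 (Ck_continuous ct).
have Cdv := continuous_L2 L0 (Ck1_continuous_dx cv).
have Cdt := continuous_L2 L0 (Ck1_continuous_dx ct).
have i1 := L2_integrableM Cv Cdt; have i2 := L2_integrableM Cdv Ct.
apply/eqP; rewrite -addr_eq0 -RintegralD//; last exact: msq.
have H x y : is_derive x (1 : R) (fun s => v (s, y) * t (s, y))
    (v (x, y) * dx t (x, y) + dx v (x, y) * t (x, y)).
  apply: is_derive_eq.
    exact: (is_deriveM (Ck1_derive_x cv x y) (Ck1_derive_x ct x y)).
  by rewrite [X in _ = _ + X]mulrC.
rewrite /Rintegral fubini_square_sym; last first.
  by have := integrableD (msq L) i1 i2; apply: eq_integrable => //; exact: msq.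
rewrite integral0_eq// => y _ /=.
rewrite (FTC_line L0 (fun x => H x y)).
- rewrite !(test_vanish tt) ?mulr0 ?subrr//.
    by move=> [/=]; rewrite in_itv/= ltxx.
  by move=> [/=]; rewrite in_itv/= ltxx andbF.
- move=> x; apply: cvgD; apply: cvgM; apply: continuous_pairl.
  + exact: Ck_continuous cv.
  + exact: Ck1_continuous_dx.
  + exact: Ck1_continuous_dx.
  + exact: Ck_continuous ct.
Qed.

Lemma parts_y L v t : 0 < L -> Ck 1 v -> test_function L t ->
  (\int[leb2]_(x in sq L) (v x * dy t x) = - \int[leb2]_(x in sq L) (dy v x * t x))%R.
Proof.
move=> L0 cv tt; have ct := tt.1 1%N.
have Cv := continuous_L2 L0 (Ck_continuous cv).
have Ct := continuous_L2 L0 (Ck_continuous ct).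
have Cdv := continuous_L2 L0 (Ck1_continuous_dy cv).
have Cdt := continuous_L2 L0 (Ck1_continuous_dy ct).
have i1 := L2_integrableM Cv Cdt; have i2 := L2_integrableM Cdv Ct.
apply/eqP; rewrite -addr_eq0 -RintegralD//; last exact: msq.
have H x y : is_derive y (1 : R) (fun s => v (x, s) * t (x, s))
    (v (x, y) * dy t (x, y) + dy v (x, y) * t (x, y)).
  apply: is_derive_eq.
    exact: (is_deriveM (Ck1_derive_y cv x y) (Ck1_derive_y ct x y)).
  by rewrite [X in _ = _ + X]mulrC.
rewrite /Rintegral fubini_square; last first.
  by have := integrableD (msq L) i1 i2; apply: eq_integrable => //; exact: msq.
rewrite integral0_eq// => x _ /=.
rewrite (FTC_line L0 (H x)).
- rewrite !(test_vanish tt) ?mulr0 ?subrr//.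
    by move=> [/= _]; rewrite in_itv/= ltxx.
  by move=> [/= _]; rewrite in_itv/= ltxx andbF.
- move=> y; apply: cvgD; apply: cvgM; apply: continuous_pairr.
  + exact: Ck_continuous cv.
  + exact: Ck1_continuous_dy.
  + exact: Ck1_continuous_dy.
  + exact: Ck_continuous ct.
Qed.

End fubini_square.

Section weak_gradient.
Context {R : realType}.
Implicit Types (L : R) (v : R * R -> R) (w : R * R -> R * R).

Lemma smooth_weak_grad L v : 0 < L -> Ck 1 v ->
  is_weak_grad L v (fun z => (dx v z, dy v z)).
Proof.
move=> L0 cv; split => /=.
- exact/continuous_L2/Ck1_continuous_dx.
- exact/continuous_L2/Ck1_continuous_dy.
- by move=> t tt; split; [exact: parts_x|exact: parts_y].
Qed.

Lemma test_L2 L t : 0 < L -> test_function L t ->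
  [/\ L2 L t, L2 L (dx t) & L2 L (dy t)].
Proof.
move=> L0 [/(_ 1%N) ct _]; split; apply: continuous_L2 => //.
- exact: Ck_continuous ct.
- exact: Ck1_continuous_dx.
- exact: Ck1_continuous_dy.
Qed.

#[global] Instance ae_leb2_filter : Filter (nbhs (almost_everywhere (@leb2 R))).
Proof.
exact: (@ae_filter_ringOfSetsType _ _ _ (lebesgue_measure \x lebesgue_measure)%E).
Qed.

(** The difference of two weak gradients is orthogonal to all test functions. *)
Lemma weak_grad_unique L v w w' : 0 < L ->
  is_weak_grad L v w -> is_weak_grad L v w' ->
  {ae leb2, forall x, sq L x -> w x = w' x}.
Proof.
move=> L0 [w1 w2 vw] [w1' w2' vw'].
have H1 : {ae leb2, forall x, sq L x -> (w x).1 - (w' x).1 = 0}.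
  apply: fundamental_lemma => //; first exact: L2B.
  move=> t tt; have [ct _ _] := test_L2 L0 tt.
  under eq_Rintegral do rewrite mulrBl.
  rewrite RintegralB; [|exact: msq|exact: L2_integrableM|exact: L2_integrableM].
  have [/= e1 _] := vw t tt; have [/= e2 _] := vw' t tt.
  by apply/eqP; rewrite subr_eq0; apply/eqP/oppr_inj; rewrite -e1 -e2.
have H2 : {ae leb2, forall x, sq L x -> (w x).2 - (w' x).2 = 0}.
  apply: fundamental_lemma => //; first exact: L2B.
  move=> t tt; have [ct _ _] := test_L2 L0 tt.
  under eq_Rintegral do rewrite mulrBl.
  rewrite RintegralB; [|exact: msq|exact: L2_integrableM|exact: L2_integrableM].
  have [/= _ e1] := vw t tt; have [/= _ e2] := vw' t tt.
  by apply/eqP; rewrite subr_eq0; apply/eqP/oppr_inj; rewrite -e1 -e2.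
apply: filterS2 H1 H2 => x h1 h2 xL.
rewrite [LHS]surjective_pairing [RHS]surjective_pairing.
by congr (_, _); apply/eqP; rewrite -subr_eq0; [rewrite h1|rewrite h2].
Qed.

Lemma weak_gradB L v v' w w' : 0 < L -> L2 L v -> L2 L v' ->
  is_weak_grad L v w -> is_weak_grad L v' w' ->
  is_weak_grad L (v \- v') (fun z => ((w z).1 - (w' z).1, (w z).2 - (w' z).2)).
Proof.
move=> L0 vL vL' [w1 w2 vw] [w1' w2' vw']; split; [exact: L2B|exact: L2B|].
move=> t tt; have [ct dxt dyt] := test_L2 L0 tt.
have [e1 f1] := vw t tt; have [e2 f2] := vw' t tt; split => /=.
  under eq_Rintegral do rewrite mulrBl.
  rewrite RintegralB; [|exact: msq|exact: L2_integrableM|exact: L2_integrableM].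
  under [in RHS]eq_Rintegral do rewrite mulrBl.
  rewrite RintegralB; [|exact: msq|exact: L2_integrableM|exact: L2_integrableM].
  by rewrite e1 e2 opprB opprK addrC.
under eq_Rintegral do rewrite mulrBl.
rewrite RintegralB; [|exact: msq|exact: L2_integrableM|exact: L2_integrableM].
under [in RHS]eq_Rintegral do rewrite mulrBl.
rewrite RintegralB; [|exact: msq|exact: L2_integrableM|exact: L2_integrableM].
by rewrite f1 f2 opprB opprK addrC.
Qed.

Lemma wgradP L v : H1 L v -> is_weak_grad L v (wgrad L v).
Proof. by move=> [_ ?]; rewrite /wgrad; exact: xgetPex. Qed.

Lemma H1B L v v' : 0 < L -> H1 L v -> H1 L v' -> H1 L (v \- v').
Proof.
move=> L0 [vL [w vw]] [vL' [w' vw']]; split; first exact: L2B.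
by eexists; exact: weak_gradB vw vw'.
Qed.

Lemma wgradB L v v' : 0 < L -> H1 L v -> H1 L v' ->
  {ae leb2, forall x, sq L x -> wgrad L (v \- v') x =
    ((wgrad L v x).1 - (wgrad L v' x).1, (wgrad L v x).2 - (wgrad L v' x).2)}.
Proof.
move=> L0 hv hv'; apply: (weak_grad_unique L0 (wgradP (H1B L0 hv hv'))).
by apply: weak_gradB; [|case: hv|case: hv'|exact: wgradP|exact: wgradP].
Qed.

Lemma smooth_H1 L v : 0 < L -> Ck 1 v -> H1 L v.
Proof.
move=> L0 cv; split; first exact/continuous_L2/(Ck_continuous cv).
by eexists; exact: smooth_weak_grad.
Qed.

Lemma smooth_wgrad L v : 0 < L -> Ck 1 v ->
  {ae leb2, forall x, sq L x -> wgrad L v x = (dx v x, dy v x)}.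
Proof.
move=> L0 cv; apply: (weak_grad_unique L0 (wgradP (smooth_H1 L0 cv))).
exact: smooth_weak_grad.
Qed.

End weak_gradient.

(** * The norm of the Sobolev space *)

Section ereal_sqrt.
Context {R : realType}.
Local Open Scope ereal_scope.
Implicit Types x y : \bar R.

Lemma sqrte_sqr x : 0 <= x -> x `^ 2^-1 * x `^ 2^-1 = x.
Proof.
move=> x0; rewrite -poweRD; last first.
  by rewrite /poweRD_def; apply/implyP => /eqP; lra.
by rewrite (_ : 2^-1 + 2^-1 = 1)%R ?poweRe1//; lra.
Qed.

Lemma sqr_sqrte x : 0 <= x -> (x * x) `^ 2^-1 = x.
Proof.
by move=> x0; rewrite poweRM// sqrte_sqr.
Qed.

Lemma sqrte_le x y : 0 <= x -> 0 <= y -> x <= y * y -> x `^ 2^-1 <= y.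
Proof.
move=> x0 y0 xy; rewrite -[leRHS]sqr_sqrte//.
by apply: le_poweR2r => //; rewrite invr_ge0.
Qed.

(** Turns the quadratic estimates below into triangle inequalities up to the
    factor 2. *)
Lemma sqrte_double x y z : 0 <= x -> 0 <= y -> 0 <= z ->
  x <= 2%:E * y + 2%:E * z -> x `^ 2^-1 <= 2%:E * (y `^ 2^-1 + z `^ 2^-1).
Proof.
move=> x0 y0 z0 xyz; apply: sqrte_le => //.
  by rewrite mule_ge0// adde_ge0// poweR_ge0.
have yy := sqrte_sqr y0; have zz := sqrte_sqr z0.
move: (poweR_ge0 y 2^-1) (poweR_ge0 z 2^-1) yy zz.
move: (y `^ 2^-1) (z `^ 2^-1) => a b a0 b0 ya zb.
apply: le_trans xyz _; rewrite -ya -zb.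
have oo2 : 2%:E * +oo * (2%:E * +oo) = +oo :> \bar R.
  by rewrite !gt0_muley ?lte_fin.
have bN : b != -oo by rewrite -ltNye (lt_le_trans _ b0)// ltNy0.
case: a a0 {ya} => [a| |] // a0; last by rewrite (addye bN) oo2 leey.
case: b b0 {zb bN} => [b| |] // b0; last by rewrite addey// oo2 leey.
rewrite -?EFinM -?EFinD -?EFinM lee_fin; rewrite !lee_fin in a0 b0.
by nra.
Qed.

Lemma lee_double2 a b c d x y : 0 <= a -> 0 <= b -> 0 <= c -> 0 <= d ->
  x <= 2%:E * a + 2%:E * c -> y <= 2%:E * b + 2%:E * d ->
  x + y <= 2%:E * (a + b) + 2%:E * (c + d).
Proof.
by move=> a0 b0 c0 d0 xa yb; rewrite !ge0_muleDr// addeACA leeD.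
Qed.

Lemma cvg_sqrte (u : nat -> \bar R) : (forall n, 0 <= u n) ->
  u n `^ 2^-1 @[n --> \oo] --> 0 -> u n @[n --> \oo] --> 0.
Proof.
move=> u0 cu.
have -> : u = (fun n => u n `^ 2^-1 * u n `^ 2^-1).
  by apply/funext => n; rewrite sqrte_sqr.
rewrite -[X in _ --> X](mule0 0); exact: cvgeM.
Qed.

End ereal_sqrt.

Section H1_norm.
Context {R : realType}.
Implicit Types (L : R) (v : R * R -> R) (w : R * R -> R * R).
Local Notation RR := (measurableTypeR R * measurableTypeR R)%type.

Definition sqint L v : \bar R := (\int[leb2]_(x in sq L) (v x ^+ 2)%:E)%E.

(** The squared norm of the gradient, for any representative [w] of it. *)
Definition gradint L w : \bar R :=
  (\int[leb2]_(x in sq L) ((w x).1 ^+ 2 + (w x).2 ^+ 2)%:E)%E.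

Lemma sqint_ge0 L v : (0 <= sqint L v)%E.
Proof. by apply: integral_ge0 => x _; rewrite lee_fin sqr_ge0. Qed.

Lemma gradint_ge0 L w : (0 <= gradint L w)%E.
Proof. by apply: integral_ge0 => x _; rewrite lee_fin addr_ge0// sqr_ge0. Qed.

Lemma eucl_sqr (z : R * R) : eucl z ^+ 2 = z.1 ^+ 2 + z.2 ^+ 2.
Proof. by rewrite sqr_sqrtr// addr_ge0// sqr_ge0. Qed.

Lemma gradintE L w : L2 L (fun x => (w x).1) -> L2 L (fun x => (w x).2) ->
  gradint L w = (sqint L (fun x => (w x).1) + sqint L (fun x => (w x).2))%E.
Proof.
move=> [m1 _] [m2 _]; rewrite /gradint /sqint -ge0_integralD//.
- exact: msq.
- by move=> x _; rewrite lee_fin sqr_ge0.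
- by apply: mEFinRR; exact: measurable_funX.
- by move=> x _; rewrite lee_fin sqr_ge0.
- by apply: mEFinRR; exact: measurable_funX.
Qed.

Lemma sqint_fin L v : L2 L v -> (sqint L v < +oo)%E.
Proof. by case/L2P. Qed.

Lemma H1normE L v : H1 L v ->
  H1norm L v = ((sqint L v + gradint L (wgrad L v)) `^ 2^-1)%E.
Proof.
move=> hv; have [[mv _] _] := hv; have [[m1 _] [m2 _] _] := wgradP hv.
rewrite /H1norm /sqint /gradint -ge0_integralD//.
- by congr (poweR _ _); apply: eq_integral => x _; rewrite eucl_sqr.
- exact: msq.
- by move=> x _; rewrite lee_fin sqr_ge0.
- by apply: mEFinRR; exact: measurable_funX.
- by move=> x _; rewrite lee_fin addr_ge0// sqr_ge0.
- by apply: mEFinRR; apply: measurable_funD; exact: measurable_funX.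
Qed.

Lemma eq_gradint L w w' : L2 L (fun x => (w x).1) -> L2 L (fun x => (w x).2) ->
  L2 L (fun x => (w' x).1) -> L2 L (fun x => (w' x).2) ->
  {ae leb2, forall x, sq L x -> w x = w' x} -> gradint L w = gradint L w'.
Proof.
move=> [m1 _] [m2 _] [m1' _] [m2' _] ww; apply: ge0_ae_eq_integral.
- exact: msq.
- by apply: mEFinRR; apply: measurable_funD; exact: measurable_funX.
- by apply: mEFinRR; apply: measurable_funD; exact: measurable_funX.
- by move=> x _; rewrite lee_fin addr_ge0// sqr_ge0.
- by move=> x _; rewrite lee_fin addr_ge0// sqr_ge0.
- by apply: filterS ww => x ww xL; rewrite ww.
Qed.

Lemma sqintB L v v' : L2 L v -> L2 L v' ->
  (sqint L (v \- v')%R <= 2%:E * sqint L v + 2%:E * sqint L v')%E.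
Proof.
move=> [mv _] [mv' _]; rewrite /sqint -!ge0_integralZl//.
- rewrite -ge0_integralD//.
  + apply: ge0_le_integral => //.
    * exact: msq.
    * by move=> x _; rewrite lee_fin sqr_ge0.
    * by apply: mEFinRR; apply: measurable_funX; exact: measurable_funB.
    * under eq_fun do rewrite -!EFinM -EFinD.
      by apply: mEFinRR; apply: measurable_funD; apply: measurable_funM => //; exact: measurable_funX.
    * move=> x _; rewrite -!EFinM -EFinD lee_fin /=.
      by have := sqr_ge0 (v x + v' x); nra.
  + exact: msq.
  + by move=> x _; rewrite -EFinM lee_fin mulr_ge0// sqr_ge0.
  + under eq_fun do rewrite -!EFinM.
    by apply: mEFinRR; apply: measurable_funM => //; exact: measurable_funX.
  + by move=> x _; rewrite -EFinM lee_fin mulr_ge0// sqr_ge0.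
  + under eq_fun do rewrite -!EFinM.
    by apply: mEFinRR; apply: measurable_funM => //; exact: measurable_funX.
- exact: msq.
- by apply: mEFinRR; exact: measurable_funX.
- by move=> x _; rewrite lee_fin sqr_ge0.
- exact: msq.
- by apply: mEFinRR; exact: measurable_funX.
- by move=> x _; rewrite lee_fin sqr_ge0.
Qed.

Lemma gradintB L v v' : 0 < L -> H1 L v -> H1 L v' ->
  (gradint L (wgrad L (v \- v')%R) <=
   2%:E * gradint L (wgrad L v) + 2%:E * gradint L (wgrad L v'))%E.
Proof.
move=> L0 hv hv'; have [w1 w2 _] := wgradP hv; have [w1' w2' _] := wgradP hv'.
have [d1 d2 _] := wgradP (H1B L0 hv hv').
rewrite (eq_gradint d1 d2 _ _ (wgradB L0 hv hv')) /=; [|exact: L2B|exact: L2B].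
rewrite !gradintE//=; [|exact: L2B|exact: L2B].
by apply: lee_double2; rewrite ?sqint_ge0//; exact: sqintB.
Qed.

(** A triangle inequality up to the factor 2, which suffices for limits. *)
Lemma H1normB L v v' : 0 < L -> H1 L v -> H1 L v' ->
  (H1norm L (v \- v')%R <= 2%:E * (H1norm L v + H1norm L v'))%E.
Proof.
move=> L0 hv hv'; rewrite !H1normE//; last exact: H1B.
have s1 := sqint_ge0 L (v \- v'); have s2 := sqint_ge0 L v; have s3 := sqint_ge0 L v'.
have g1 := gradint_ge0 L (wgrad L (v \- v')); have g2 := gradint_ge0 L (wgrad L v).
have g3 := gradint_ge0 L (wgrad L v').
apply: (sqrte_double (adde_ge0 s1 g1) (adde_ge0 s2 g2) (adde_ge0 s3 g3)).
apply: (lee_double2 s2 g2 s3 g3); last exact: gradintB.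
by apply: sqintB; [case: hv|case: hv'].
Qed.

Lemma H1norm_cvg L (u : nat -> R * R -> R) : (forall n, H1 L (u n)) ->
  (H1norm L (u n) @[n --> \oo] --> 0)%E ->
  (sqint L (u n) @[n --> \oo] --> 0)%E /\
  (gradint L (wgrad L (u n)) @[n --> \oo] --> 0)%E.
Proof.
move=> hu; under eq_cvg do rewrite H1normE//.
move=> /cvg_sqrte h.
have {}h : (sqint L (u n) + gradint L (wgrad L (u n)) @[n --> \oo] --> 0)%E.
  by apply: h => n; apply: adde_ge0; [exact: sqint_ge0|exact: gradint_ge0].
split; apply: (squeeze_cvge _ (cvg_cst _) h); apply: nearW => n.
  by rewrite sqint_ge0; apply: leeDl; exact: gradint_ge0.
by rewrite gradint_ge0; apply: leeDr; exact: sqint_ge0.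
Qed.

Lemma CkB k v v' : Ck k v -> Ck k v' -> Ck k (v \- v').
Proof.
elim: k v v' => [|k IH] v v' hv hv'.
  by split=> // z; apply: cvgB; [exact: hv.1|exact: hv'.1].
have [cv [pv xv yv]] := hv; have [cv' [pv' xv' yv']] := hv'.
split; first by move=> z; apply: cvgB; [exact: cv|exact: cv'].
have dxB z : is_derive z.1 (1 : R) (fun s => (v \- v') (s, z.2)) (dx v z - dx v' z).
  have [/derivableP d _] := pv z; have [/derivableP d' _] := pv' z.
  by rewrite /dx !derive1E; exact: (is_deriveB d d').
have dyB z : is_derive z.2 (1 : R) (fun s => (v \- v') (z.1, s)) (dy v z - dy v' z).
  have [_ /derivableP d] := pv z; have [_ /derivableP d'] := pv' z.
  by rewrite /dy !derive1E; exact: (is_deriveB d d').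
split.
- by move=> z; split; [case: (dxB z)|case: (dyB z)].
- have -> : dx (v \- v') = dx v \- dx v'.
    by apply/funext => z; rewrite {1}/dx derive1E; case: (dxB z).
  exact: IH.
- have -> : dy (v \- v') = dy v \- dy v'.
    by apply/funext => z; rewrite {1}/dy derive1E; case: (dyB z).
  exact: IH.
Qed.

Lemma smoothB v v' : smooth v -> smooth v' -> smooth (v \- v').
Proof. by move=> hv hv' k; exact: CkB. Qed.

End H1_norm.

(** * Poincare's inequality *)

Section poincare_smooth.
Context {R : realType}.
Implicit Types (L : R).
Local Notation RT := (measurableTypeR R).
Local Notation RR := (measurableTypeR R * measurableTypeR R)%type.
Local Notation mu := (@lebesgue_measure R).
Local Notation I L := (`]0%R, L%R[%classic : set RT).

Lemma integral_le_ge0 d (T : measurableType d) (m : {measure set T -> \bar R})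
    (D : set T) (f g : T -> \bar R) : measurable D ->
  measurable_fun D f -> measurable_fun D g ->
  (forall x, D x -> f x <= g x)%E -> (forall x, D x -> 0 <= g x)%E ->
  (\int[m]_(x in D) f x <= \int[m]_(x in D) g x)%E.
Proof.
move=> mD mf mg fg g0.
apply: (@le_trans _ _ (\int[m]_(x in D) (f^\+ x))%E).
  rewrite integralE -[leRHS]sube0; apply: leeB => //.
  by apply: integral_ge0 => x _; exact: funeneg_ge0.
apply: ge0_le_integral => //; first exact: measurable_funepos.
by move=> x Dx; rewrite funeposE ge_max fg// g0.
Qed.

(** Cauchy-Schwarz for the increments of [F], obtained by integrating
    [0 <= (f - c)^2] with [c] the mean slope. *)
Lemma increment_le L (F f : R -> R) (x y : R) : 0 < L ->
  (forall x : R, is_derive x (1 : R) F (f x)) -> continuous f ->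
  0 <= x <= L -> 0 <= y <= L ->
  (((F x - F y) ^+ 2)%:E <= L%:E * \int[mu]_(t in I L) (f t ^+ 2)%:E)%E.
Proof.
move=> L0 Ff cf; wlog : x y / y < x.
  move=> H xL yL; have [xy|yx|->] := ltgtP x y; [|exact: H|].
    by rewrite -sqrrN opprB; exact: H.
  rewrite subrr expr0n mule_ge0 ?lee_fin ?(ltW L0)//.
  by apply: integral_ge0 => t _; rewrite lee_fin sqr_ge0.
move=> yx /andP[x0 xL] /andP[y0 yL].
have h0 : 0 < x - y by rewrite subr_gt0.
set c := (F x - F y) / (x - y).
have mf : measurable_fun setT f by exact: continuous_measurable_fun.
have J : (((F x - F y) ^+ 2 / (x - y))%:E <= \int[mu]_(t in I L) (f t ^+ 2)%:E)%E.
  have dG (t : R) : is_derive t (1 : R) (fun t => 2 * c * F t - c ^+ 2 * t)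
      (2 * c * f t - c ^+ 2).
    have d1 : is_derive t (1 : R) (fun t => 2 * c * F t) (2 * c * f t).
      exact: (is_deriveZ (2 * c) (Ff t)).
    have d2 : is_derive t (1 : R) (fun t : R => c ^+ 2 * t) (c ^+ 2).
      by rewrite -[X in is_derive _ _ _ X]mulr1; exact: (is_deriveZ (f := id) (c ^+ 2)).
    exact: (is_deriveB d1 d2).
  have -> : (F x - F y) ^+ 2 / (x - y) =
      (2 * c * F x - c ^+ 2 * x) - (2 * c * F y - c ^+ 2 * y).
    by rewrite /c; field; rewrite gt_eqF.
  have cg : continuous (fun t => 2 * c * f t - c ^+ 2).
    move=> t; apply: cvgB; last exact: cvg_cst.
    by apply: cvgM; [exact: cvg_cst|exact: cf].
  rewrite -(FTC_line yx dG cg).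
  apply: (@le_trans _ _ (\int[mu]_(t in `]y, x[) (f t ^+ 2)%:E)%E).
    apply: integral_le_ge0 => //.
    - apply: measurable_funTS; apply/measurable_EFinP.
      exact: continuous_measurable_fun.
    - apply: measurable_funTS; apply/measurable_EFinP.
      exact: measurable_funX.
    - by move=> t _; rewrite lee_fin; have := sqr_ge0 (f t - c); nra.
    - by move=> t _; rewrite lee_fin sqr_ge0.
  apply: ge0_subset_integral => //.
  - by apply: measurable_funTS; apply/measurable_EFinP; exact: measurable_funX.
  - by move=> t _; rewrite lee_fin sqr_ge0.
  - move=> t; rewrite /= !in_itv /= => /andP[yt tx].
    by rewrite (le_lt_trans y0 yt) (lt_le_trans tx xL).
have -> : ((F x - F y) ^+ 2)%:E = ((x - y)%:E * ((F x - F y) ^+ 2 / (x - y))%:E)%E.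
  by rewrite -EFinM; congr EFin; field; rewrite gt_eqF.
apply: lee_pmul => //; rewrite lee_fin.
- exact: ltW.
- by rewrite divr_ge0 ?sqr_ge0 ?ltW.
- lra.
Qed.

Lemma measurable_inner L (f : R * R -> \bar R) :
  @measurable_fun _ _ RR (\bar R) (sq L) f -> (forall x, 0 <= f x)%E ->
  @measurable_fun _ _ RT (\bar R) (I L) (fun x => \int[mu]_(y in I L) f (x, y))%E.
Proof.
move=> mf f0.
have := @measurable_fun_fubini_tonelli_F _ _ _ _ _ mu (f \_ (sq L)).
have mf' : measurable_fun (setT : set RR) (f \_ (sq L)).
  exact/(measurable_restrictT _ (msq L)).
move=> /(_ mf')/(_ _)/wrap[]; first by move=> z; rewrite /patch; case: ifP.
move=> h; have {h} := measurable_funTS (D := I L) h.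
apply: eq_measurable_fun => x; rewrite inE => xL.
rewrite [RHS]integral_mkcond; apply: eq_integral => y _.
rewrite /patch; have -> : ((x, y) \in sq L) = (y \in I L).
  by apply/idP/idP; rewrite !inE; [case|split].
by [].
Qed.

Lemma measurable_inner_sym L (f : R * R -> \bar R) :
  @measurable_fun _ _ RR (\bar R) (sq L) f -> (forall x, 0 <= f x)%E ->
  @measurable_fun _ _ RT (\bar R) (I L) (fun y => \int[mu]_(x in I L) f (x, y))%E.
Proof.
move=> mf f0.
have := @measurable_fun_fubini_tonelli_G _ _ _ _ _ mu (f \_ (sq L)).
have mf' : measurable_fun (setT : set RR) (f \_ (sq L)).
  exact/(measurable_restrictT _ (msq L)).
move=> /(_ mf')/(_ _)/wrap[]; first by move=> z; rewrite /patch; case: ifP.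
move=> h; have {h} := measurable_funTS (D := I L) h.
apply: eq_measurable_fun => y; rewrite inE => yL.
rewrite [RHS]integral_mkcond; apply: eq_integral => x _.
rewrite /patch; have -> : ((x, y) \in sq L) = (x \in I L).
  by apply/idP/idP; rewrite !inE; [case|split].
by [].
Qed.

Lemma lebesgue_I L : 0 < L -> mu (I L) = L%:E.
Proof. by move=> L0; rewrite lebesgue_measure_itv/= lte_fin L0 -EFinD subr0. Qed.

(** A point [(x, y)] is joined to [(s, y)] by a horizontal segment and then to
    one end of the segment of abscissa [s] by a vertical one; [increment_le]
    bounds the change of [v] along both, and the result is averaged over [s] in
    [`]a, b[] and over [(x, y)]. *)
Lemma poincare_core L (a b : R) (v p q : R * R -> R) :
  0 < L -> 0 <= a -> a < b -> b <= L ->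
  continuous v -> continuous p -> continuous q ->
  (forall x y, is_derive x (1 : R) (fun s => v (s, y)) (p (x, y))) ->
  (forall x y, is_derive y (1 : R) (fun s => v (x, s)) (q (x, y))) ->
  ((b - a)%:E * sqint L v <=
   (4 * L ^+ 2)%:E * (\int[mu]_(s in `]a, b[)
      (Num.min (v (s, 0%R) ^+ 2) (v (s, L) ^+ 2))%:E) +
   (4 * L ^+ 3)%:E * sqint L q + (2 * L ^+ 2 * (b - a))%:E * sqint L p)%E.
Proof.
move=> L0 a0 ab bL cv cp cq vp vq.
have ba0 : 0 < b - a by rewrite subr_gt0.
pose m s := Num.min (v (s, 0) ^+ 2) (v (s, L) ^+ 2).
pose Q s := (\int[mu]_(t in I L) (q (s, t) ^+ 2)%:E)%E.
pose P y := (\int[mu]_(t in I L) (p (t, y) ^+ 2)%:E)%E.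
have Q0 s : (0 <= Q s)%E by apply: integral_ge0 => t _; rewrite lee_fin sqr_ge0.
have P0 y : (0 <= P y)%E by apply: integral_ge0 => t _; rewrite lee_fin sqr_ge0.
have m0 s : 0 <= m s by rewrite le_min !sqr_ge0.
have pt x s y : 0 < x < L -> 0 < s < L -> 0 < y < L ->
    ((v (x, y) ^+ 2)%:E <= 4%:E * (m s)%:E + (4 * L)%:E * Q s + (2 * L)%:E * P y)%E.
  move=> xL sL yL.
  have W (z : R) : 0 < z < L -> 0 <= z <= L by move=> /andP[/ltW -> /ltW ->].
  have i1 := @increment_le L (fun s => v (s, y)) (fun s => p (s, y)) x s L0
    (fun s => vp s y) (continuous_pairl (y := y) cp) (W _ xL) (W _ sL).
  have i2 (e : R) (eL : 0 <= e <= L) := @increment_le L (fun t => v (s, t))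
    (fun t => q (s, t)) y e L0 (vq s) (continuous_pairr (x := s) cq) (W _ yL) eL.
  have [e eL me] : exists2 e : R, 0 <= e <= L & m s = v (s, e) ^+ 2.
    rewrite /m; case: (leP (v (s, 0) ^+ 2)) => _.
      by exists 0 => //; rewrite lexx ltW.
    by exists L => //; rewrite lexx ltW.
  have {}i2 := i2 e eL.
  apply: (@le_trans _ _ (4%:E * (m s)%:E + 4%:E * ((v (s, y) - v (s, e)) ^+ 2)%:E +
      2%:E * ((v (x, y) - v (s, y)) ^+ 2)%:E)%E).
    rewrite me -!EFinM -!EFinD lee_fin.
    have := sqr_ge0 (v (x, y) - 2 * v (s, y)); have := sqr_ge0 (v (s, y) - 2 * v (s, e)).
    nra.
  apply: leeD.
    apply: leeD2l; rewrite (EFinM 4 L) -muleA; apply: lee_wpmul2l; last exact: i2.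
    by rewrite lee_fin.
  rewrite (EFinM 2 L) -muleA; apply: lee_wpmul2l; last exact: i1.
  by rewrite lee_fin.
have mq2 : @measurable_fun _ _ RR (\bar R) (sq L) (fun z => (q z ^+ 2)%:E).
  by apply: mEFinRR; apply: measurable_funX; case: (continuous_L2 L0 cq).
have mp2 : @measurable_fun _ _ RR (\bar R) (sq L) (fun z => (p z ^+ 2)%:E).
  by apply: mEFinRR; apply: measurable_funX; case: (continuous_L2 L0 cp).
have mv2 : @measurable_fun _ _ RR (\bar R) (sq L) (fun z => (v z ^+ 2)%:E).
  by apply: mEFinRR; apply: measurable_funX; case: (continuous_L2 L0 cv).
have q20 z : (0 <= (q z ^+ 2)%:E)%E by rewrite lee_fin sqr_ge0.
have p20 z : (0 <= (p z ^+ 2)%:E)%E by rewrite lee_fin sqr_ge0.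
have mQ : @measurable_fun _ _ RT (\bar R) (I L) Q := measurable_inner mq2 q20.
have mP : @measurable_fun _ _ RT (\bar R) (I L) P := measurable_inner_sym mp2 p20.
have mm : measurable_fun setT m.
  apply: measurable_minr; apply: measurable_funX; apply: continuous_measurable_fun;
  exact: continuous_pairl.
have sJ : (`]a, b[%classic : set RT) `<=` I L.
  move=> s; rewrite /= !in_itv /= => /andP[sa sb].
  by rewrite (le_lt_trans a0 sa) (lt_le_trans sb bL).
have mJ : measurable (`]a, b[%classic : set RT) by exact: measurable_itv.
have mI : measurable (I L) by exact: measurable_itv.
have muJ : mu (`]a, b[%classic : set RT) = (b - a)%:E.
  by rewrite lebesgue_measure_itv/= lte_fin ab -EFinD.
set M := (X in (_ <= _ * X + _ + _)%E).
have M0 : (0 <= M)%E by apply: integral_ge0 => s _; rewrite lee_fin; exact: m0.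
have qE : sqint L q = (\int[mu]_(s in I L) Q s)%E.
  by rewrite /sqint tonelli_square.
have pE : sqint L p = (\int[mu]_(s in I L) P s)%E.
  by rewrite /sqint tonelli_square_sym.
have pt2 x y : 0 < x < L -> 0 < y < L ->
    ((b - a)%:E * (v (x, y) ^+ 2)%:E <= 4%:E * M + (4 * L)%:E * sqint L q +
      (2 * L * (b - a))%:E * P y)%E.
  move=> xL yL.
  have -> : ((b - a)%:E * (v (x, y) ^+ 2)%:E =
      \int[mu]_(s in (`]a, b[%classic : set RT)) (v (x, y) ^+ 2)%:E)%E.
    by rewrite integral_cst// muleC; congr (_ * _)%E; exact/esym/muJ.
  apply: (@le_trans _ _ (\int[mu]_(s in (`]a, b[%classic : set RT))
      (4%:E * (m s)%:E + (4 * L)%:E * Q s + (2 * L)%:E * P y))%E).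
    apply: ge0_le_integral => //.
    - by move=> s _; rewrite lee_fin sqr_ge0.
    - apply: emeasurable_funD; last exact: measurable_cst.
      apply: emeasurable_funD; apply: emeasurable_funM => //.
        by apply: measurable_funTS; apply/measurable_EFinP.
      exact: measurable_funS mQ.
    - move=> s sab; apply: pt => //.
      by have := sJ _ sab; rewrite /= in_itv.
  rewrite ge0_integralD//; first last.
  - by move=> s _; rewrite mule_ge0// lee_fin; lra.
  - apply: emeasurable_funD; apply: emeasurable_funM => //.
      by apply: measurable_funTS; apply/measurable_EFinP.
    exact: measurable_funS mQ.
  - by move=> s _; rewrite adde_ge0// mule_ge0// lee_fin//; lra.
  rewrite ge0_integralD//; first last.
  - by apply: emeasurable_funM => //; exact: measurable_funS mQ.
  - by move=> s _; rewrite mule_ge0// lee_fin//; lra.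
  - apply: emeasurable_funM => //.
    by apply: measurable_funTS; apply/measurable_EFinP.
  - by move=> s _; rewrite mule_ge0// lee_fin.
  apply: leeD; first apply: leeD.
  - rewrite ge0_integralZl//.
    + by apply: measurable_funTS; apply/measurable_EFinP.
    + by move=> s _; rewrite lee_fin.
  - rewrite ge0_integralZl//; last 2 first.
    + exact: measurable_funS mQ.
    + by rewrite lee_fin; lra.
    apply: lee_wpmul2l; first by rewrite lee_fin; lra.
    by rewrite qE; apply: ge0_subset_integral.
  - rewrite integral_cst// (EFinM (2 * L)) muleAC le_eqVlt; apply/orP; left.
    by apply/eqP; congr (_ * _ * _)%E; exact: muJ.
have mP2 : @measurable_fun _ _ RR (\bar R) (sq L) (fun z => P z.2).
  apply: (@measurable_comp _ _ _ _ _ _ (I L) _ (sq L) snd) => //.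
  - by move=> _ [[x y] [_ yL] <-].
  - apply: measurable_funTS; exact: measurable_snd.
rewrite /sqint -ge0_integralZl//; last 3 first.
- exact: msq.
- by move=> z _; rewrite lee_fin sqr_ge0.
- by rewrite lee_fin ltW.
apply: (@le_trans _ _ (\int[leb2]_(z in sq L) (4%:E * M + (4 * L)%:E * sqint L q +
      (2 * L * (b - a))%:E * P z.2))%E).
  apply: ge0_le_integral.
  - exact: msq.
  - by move=> z _; rewrite mule_ge0// lee_fin ?sqr_ge0// ltW.
  - by apply: emeasurable_funM.
  - by apply: emeasurable_funD => //; exact: emeasurable_funM.
  - by move=> [x y] [/= xL yL]; apply: pt2; rewrite in_itv in xL yL.
have Sq0 := sqint_ge0 L q.
rewrite ge0_integralD//; first last.
- exact: emeasurable_funM.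
- by move=> z _; rewrite mule_ge0// lee_fin mulr_ge0 ?ltW// mulr_gt0.
- by move=> z _; rewrite adde_ge0// mule_ge0// lee_fin// mulr_ge0// ltW.
- exact: msq.
rewrite integral_cst; last exact: msq.
rewrite [X in (X + _ <= _)%E](_ : _ = ((4%:E * M + (4 * L)%:E * sqint L q) *
    (L ^+ 2)%:E)%E); last by congr (_ * _)%E; exact: leb2_sq.
rewrite ge0_integralZl//; last 2 first.
- exact: msq.
- by rewrite lee_fin mulr_ge0 ?ltW// mulr_gt0.
have -> : (\int[leb2]_(z in sq L) P z.2 = L%:E * sqint L p)%E.
  rewrite tonelli_square_sym// pE -ge0_integralZl//; last by rewrite lee_fin ltW.
  apply: eq_integral => y _ /=; rewrite integral_cst// muleC; congr (_ * _)%E.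
  exact: lebesgue_I.
rewrite -/(sqint L q) -/(sqint L p) muleC ge0_muleDr; last 2 first.
- by rewrite mule_ge0.
- by rewrite mule_ge0// lee_fin mulr_ge0// ltW.
rewrite !muleA -!EFinM.
by apply: leeD; [apply: leeD|]; rewrite le_eqVlt; apply/orP; left; apply/eqP; congr (_%:E * _)%E; ring.
Qed.

End poincare_smooth.

Section boundary.
Context {R : realType}.
Implicit Types (L : R) (G : set (R * R)).

Lemma cvg_pair2 (T : Type) (F : set_system T) (FF : Filter F) (f g : T -> R) (x y : R) :
  f t @[t --> F] --> x -> g t @[t --> F] --> y ->
  (f t, g t) @[t --> F] --> (x, y).
Proof.
move=> fx gy A [[P Q] /= [xP yQ] PQA].
have h : F ((fun t => P (f t)) `&` (fun t => Q (g t))).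
  by apply: filterI; [exact: fx|exact: gy].
by apply: (@filterS _ F _ _ _ _ h) => t [Pt Qt]; exact: PQA.
Qed.

Lemma closure_sq L : 0 < L -> closure (sq L) = csq L.
Proof.
move=> L0; apply/seteqP; split.
  rewrite [X in _ `<=` X](_ : _ = closure (csq L)).
    by apply: closure_subset; exact: sq_csq.
  apply/closure_id; apply: compact_closed; first exact: norm_hausdorff.
  by apply: compact_setX; exact: segment_compact.
move=> z [/=]; rewrite !in_itv /= => /andP[x0 xL] /andP[y0 yL] B Bz.
pose c (e : R) := (z.1 + e * (L / 2 - z.1), z.2 + e * (L / 2 - z.2)).
have cz : c e @[e --> 0^'+] --> z.
  rewrite [X in _ --> X](_ : _ = c 0); last by rewrite /c !mul0r !addr0; case: (z).
  apply: cvg_at_right_filter; apply: cvg_pair2.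
    apply: cvgD; first exact: cvg_cst.
    by apply: cvgM; [exact: cvg_id|exact: cvg_cst].
  apply: cvgD; first exact: cvg_cst.
  by apply: cvgM; [exact: cvg_id|exact: cvg_cst].
have [e [Be ez]] : exists e, B (c e) /\ 0 < e < 1.
  apply: (@filter_ex _ (0^'+)); near=> e; split.
    by near: e; exact: cz.
  apply/andP; split; first by near: e; exact: nbhs_right_gt.
  by near: e; exact: nbhs_right_lt.
exists (c e); split=> //; case/andP: ez => e0 e1.
by split; rewrite /= in_itv /=; apply/andP; split; nra.
Unshelve. all: by end_near. Qed.

Lemma bdryE L z : 0 < L -> bdry L z <-> csq L z /\ ~ sq L z.
Proof. by move=> L0; rewrite /bdry closure_sq. Qed.

Lemma on_side_bdry L (i : 'I_4) : 0 < L -> on_side L (bdry L) i = `[0, L]%classic.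
Proof.
move=> L0; apply/setIidPl => s; rewrite /= in_itv /= => sL; apply/bdryE => //.
have l0 : 0 <= (0 : R) <= L by rewrite lexx ltW.
have lL : 0 <= L <= L by rewrite lexx ltW.
case: i => -[|[|[|[|//]]]] iP; rewrite /side /=; split.
- by split; rewrite /= in_itv.
- by move=> [/= _]; rewrite in_itv/= ltxx.
- by split; rewrite /= in_itv.
- by move=> [/= _]; rewrite in_itv/= ltxx andbF.
- by split; rewrite /= in_itv.
- by move=> [/=]; rewrite in_itv/= ltxx.
- by split; rewrite /= in_itv.
- by move=> [/=]; rewrite in_itv/= ltxx andbF.
Qed.

Lemma between (a b v : R) : Num.min a b < v < Num.max a b ->
  Num.min a b <= v <= Num.max a b.
Proof. by move=> /andP[/ltW -> /ltW ->]. Qed.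

(** The corner [(0, 0)] has two exterior normals and so lies in [G1]; being a
    one-dimensional manifold, [G1] contains with it an injective path, whose
    image is not a point and so sweeps an interval in one of the coordinates; a
    point of the path whose coordinate lies inside the interval is on one of two
    opposite sides. *)
Lemma boundary_interval D G1 G2 : 0 < D -> boundary_decomposition D G1 G2 ->
  exists a b : R, [/\ 0 <= a, a < b, b <= D &
    (forall s, a < s < b -> G1 (s, 0) \/ G1 (s, D)) \/
    (forall s, a < s < b -> G1 (0, s) \/ G1 (D, s))].
Proof.
move=> D0 [Gb _ mG1 _ nG2].
have D00 : bdry D (0, 0).
  apply/bdryE => //; split; last by move=> [/=]; rewrite in_itv/= ltxx.
  by split; rewrite /= in_itv /= lexx ltW.
have G10 : G1 (0, 0).
  move: D00; rewrite Gb => -[//|/nG2[nu [_ nuU]]]; exfalso.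
  have n1 : exterior_normal D (0, 0) (-1, 0).
    split=> /=; first by rewrite sqrrN expr1n expr0n addr0.
    rewrite closure_sq// => y [/=]; rewrite !in_itv /= => /andP[y0 _] _.
    by rewrite subr0 mulrN1 mulr0 addr0 oppr_le0.
  have n2 : exterior_normal D (0, 0) (0, -1).
    split=> /=; first by rewrite sqrrN expr1n expr0n add0r.
    rewrite closure_sq// => y [/= _]; rewrite !in_itv /= => /andP[y0 _].
    by rewrite !subr0 mulrN1 mulr0 add0r oppr_le0.
  have := nuU _ n1; rewrite (nuU _ n2) => -[] /eqP.
  by rewrite eq_sym oppr_eq0 oner_eq0.
have [U [oU U0 [I [h [k [II ch ck hI kh]]]]]] := mG1 _ G10.
(* Two interior parameters avoid the possible end point of the manifold. *)
pose t1 : R := 3^-1; pose t2 : R := 2 / 3.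
have t12 : t1 < t2 by rewrite /t1 /t2; lra.
have sub : `[t1, t2]%classic `<=` I.
  move=> t; rewrite /= in_itv /= /t1 /t2 => /andP[a b].
  by case: II => ->; rewrite /= in_itv /=; lra.
have hG t : `[t1, t2]%classic t -> G1 (h t).
  by move=> /sub It; have [] : (U `&` G1) (h t) by rewrite -hI; exists t.
have ch' : {within `[t1, t2], continuous h} by exact: continuous_subspaceW ch.
have ch1 : {within `[t1, t2], continuous (fst \o h)}.
  by apply: within_continuous_comp ch' => x _; exact: cvg_fst.
have ch2 : {within `[t1, t2], continuous (snd \o h)}.
  by apply: within_continuous_comp ch' => x _; exact: cvg_snd.
have I1 : `[t1, t2]%classic t1 by rewrite /= in_itv /= lexx ltW.
have I2 : `[t1, t2]%classic t2 by rewrite /= in_itv /= lexx ltW.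
have hb t : `[t1, t2]%classic t -> csq D (h t) /\ ~ sq D (h t).
  by move=> /hG ht; apply/bdryE => //; rewrite Gb; left.
have edge (y : R) : 0 <= y <= D -> ~ (0 < y < D) -> y = 0 \/ y = D.
  move=> /andP[y0 yD] yN; have [->|yn0] := eqVneq y 0; [by left|right].
  apply/eqP; rewrite eq_le yD leNgt; apply/negP => yD'; apply: yN.
  by rewrite yD' andbT lt_neqAle eq_sym yn0.
have [[c11 c12] _] := hb _ I1; have [[c21 c22] _] := hb _ I2.
rewrite /= !in_itv /= in c11 c12 c21 c22.
have [h1|h1] := eqVneq (h t1).1 (h t2).1; last first.
  exists (Num.min (h t1).1 (h t2).1), (Num.max (h t1).1 (h t2).1); split.
  - by rewrite le_min; case/andP: c11 => ->; case/andP: c21 => ->.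
  - by rewrite gt_min !lt_max !ltxx /= orbF; case: ltgtP h1.
  - by rewrite ge_max; case/andP: c11 => _ ->; case/andP: c21 => _ ->.
  left=> s sab; have [t tI ts] := IVT (ltW t12) ch1 (between sab).
  have tI' : `[t1, t2]%classic t by [].
  have [[t1b t2b] tN] := hb _ tI'; have Gt := hG _ tI'.
  rewrite /= in ts; rewrite /= !in_itv /= in t1b t2b.
  have s0D : 0 < s < D.
    case/andP: sab => s1 s2; apply/andP; split.
      by apply: le_lt_trans s1; rewrite le_min; case/andP: c11 => ->; case/andP: c21 => ->.
    by apply: lt_le_trans s2 _; rewrite ge_max; case/andP: c11 => _ ->; case/andP: c21 => _ ->.
  have hN : ~ 0 < (h t).2 < D.
    by move=> hh; apply: tN; split; rewrite /= in_itv //= ts.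
  have [e|e] := edge (h t).2 t2b hN.
  - by left; rewrite -ts -e; case: (h t) Gt.
  - by right; rewrite -ts -e; case: (h t) Gt.
have h2 : (h t1).2 != (h t2).2.
  apply/eqP => h2; have : h t1 = h t2.
    by rewrite [LHS]surjective_pairing [RHS]surjective_pairing h1 h2.
  move=> /(congr1 k); rewrite !kh; [|exact: sub|exact: sub] => t12'.
  by rewrite t12' ltxx in t12.
exists (Num.min (h t1).2 (h t2).2), (Num.max (h t1).2 (h t2).2); split.
- by rewrite le_min; case/andP: c12 => ->; case/andP: c22 => ->.
- by rewrite gt_min !lt_max !ltxx /= orbF; case: ltgtP h2.
- by rewrite ge_max; case/andP: c12 => _ ->; case/andP: c22 => _ ->.
right=> s sab; have [t tI ts] := IVT (ltW t12) ch2 (between sab).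
have tI' : `[t1, t2]%classic t by [].
have [[t1b t2b] tN] := hb _ tI'; have Gt := hG _ tI'.
rewrite /= in ts; rewrite /= !in_itv /= in t1b t2b.
have s0D : 0 < s < D.
  case/andP: sab => s1 s2; apply/andP; split.
    by apply: le_lt_trans s1; rewrite le_min; case/andP: c12 => ->; case/andP: c22 => ->.
  by apply: lt_le_trans s2 _; rewrite ge_max; case/andP: c12 => _ ->; case/andP: c22 => _ ->.
have hN : ~ 0 < (h t).1 < D.
  by move=> hh; apply: tN; split; rewrite /= in_itv //= ts.
have [e|e] := edge (h t).1 t1b hN.
- by left; rewrite -ts -e; case: (h t) Gt.
- by right; rewrite -ts -[X in (X, _)]e; case: (h t) Gt.
Qed.

End boundary.

Section traces.
Context {R : realType}.
Implicit Types (L : R) (v t phi : R * R -> R).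
Local Notation RT := (measurableTypeR R).
Local Notation mu := (@lebesgue_measure R).

Definition bdint L v : \bar R :=
  (\sum_(i < 4) \int[mu]_(s in (`[0%R, L]%classic : set RT)) (v (side L i s) ^+ 2)%:E)%E.

Lemma bdint_ge0 L v : (0 <= bdint L v)%E.
Proof. by apply: sume_ge0 => i _; apply: integral_ge0 => s _; rewrite lee_fin sqr_ge0. Qed.

Lemma bd_L2E L v : 0 < L -> bd_L2 L (bdry L) v = (bdint L v `^ 2^-1)%E.
Proof.
move=> L0; rewrite /bd_L2; congr (poweR _ _); apply: eq_bigr => i _.
by rewrite on_side_bdry.
Qed.

#[global] Instance ae_lebesgue_filter : Filter (nbhs (almost_everywhere mu)).
Proof. exact: (@ae_filter_ringOfSetsType _ _ _ mu). Qed.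

Definition mside L v := forall i : 'I_4, measurable_fun setT (fun s => v (side L i s)).

Lemma mside_continuous L v : continuous v -> mside L v.
Proof.
move=> cv i; apply: continuous_measurable_fun.
case: i => -[|[|[|[|//]]]] iP; rewrite /side /=.
- exact: continuous_pairl.
- exact: continuous_pairl.
- exact: continuous_pairr.
- exact: continuous_pairr.
Qed.

Lemma mside_measurable L v : measurable_fun setT v -> mside L v.
Proof.
move=> mv i; case: i => -[|[|[|[|//]]]] iP; rewrite /side /=.
- exact: (measurableT_comp mv (@pair2_measurable _ _ R R 0)).
- exact: (measurableT_comp mv (@pair2_measurable _ _ R R L)).
- exact: (measurableT_comp mv (@pair1_measurable _ _ R R 0)).
- exact: (measurableT_comp mv (@pair1_measurable _ _ R R L)).
Qed.

Lemma msideB L v t : mside L v -> mside L t -> mside L (v \- t).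
Proof. by move=> mv mt i; exact: measurable_funB. Qed.

Lemma mside_sqr L (i : 'I_4) (A : set RT) v : mside L v ->
  measurable_fun A (fun s => (v (side L i s) ^+ 2)%:E).
Proof.
move=> mv; apply: measurable_funTS; apply/measurable_EFinP; apply: measurable_funX.
exact: mv.
Qed.

Lemma side_le_bdint L (i : 'I_4) v :
  (\int[mu]_(s in (`[0%R, L]%classic : set RT)) (v (side L i s) ^+ 2)%:E <= bdint L v)%E.
Proof.
rewrite /bdint (bigD1 i)//=; apply: leeDl; apply: sume_ge0 => j _.
by apply: integral_ge0 => s _; rewrite lee_fin sqr_ge0.
Qed.

Lemma bdintB L v t : mside L v -> mside L t ->
  (bdint L (v \- t)%R <= 2%:E * bdint L v + 2%:E * bdint L t)%E.
Proof.
move=> mv mt; rewrite /bdint !ge0_sume_distrr.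
- rewrite -big_split /=; apply: lee_sum => i _.
  have m1 := @mside_sqr L i `[0%R, L]%classic v mv.
  have m2 := @mside_sqr L i `[0%R, L]%classic t mt.
  rewrite -!ge0_integralZl//; try by move=> s _; rewrite lee_fin sqr_ge0.
  rewrite -ge0_integralD//.
  + apply: ge0_le_integral => //.
    * by move=> s _; rewrite lee_fin sqr_ge0.
    * exact: (@mside_sqr L i _ (v \- t) (msideB mv mt)).
    * by apply: emeasurable_funD; exact: emeasurable_funM.
    * move=> s _; rewrite -!EFinM -EFinD lee_fin /=.
      by have := sqr_ge0 (v (side L i s) + t (side L i s)); nra.
  + by move=> s _; rewrite -EFinM lee_fin mulr_ge0// sqr_ge0.
  + exact: emeasurable_funM.
  + by move=> s _; rewrite -EFinM lee_fin mulr_ge0// sqr_ge0.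
  + exact: emeasurable_funM.
- by move=> i _; apply: integral_ge0 => s _; rewrite lee_fin sqr_ge0.
- by move=> i _; apply: integral_ge0 => s _; rewrite lee_fin sqr_ge0.
Qed.

(** For almost every [s] one of the two ends lies in [G], where [t] vanishes, so
    that there [phi] is equal to [phi - t]. *)
Lemma trace_min L (a b : R) (G : set (R * R)) (i j : 'I_4) phi t :
  0 <= a -> b <= L -> mside L phi -> mside L t ->
  (forall s, a < s < b -> G (side L i s) \/ G (side L j s)) ->
  (forall i, {ae mu, forall s, on_side L G i s -> t (side L i s) = 0}) ->
  (\int[mu]_(s in `]a, b[)
     (Num.min (phi (side L i s) ^+ 2) (phi (side L j s) ^+ 2))%:E <=
   2%:E * bdint L (phi \- t)%R)%E.
Proof.
move=> a0 bL mphi mt Gs tG; have mB := msideB mphi mt.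
set D := (phi \- t)%R in mB *.
have mJ : measurable (`]a, b[%classic : set RT) by exact: measurable_itv.
have JI : (`]a, b[%classic : set RT) `<=` `[0, L]%classic.
  move=> s; rewrite /= !in_itv /= => /andP[sa sb].
  by rewrite (le_trans a0 (ltW sa)) (le_trans (ltW sb) bL).
apply: (@le_trans _ _ (\int[mu]_(s in (`]a, b[%classic : set RT))
    ((D (side L i s) ^+ 2)%:E + (D (side L j s) ^+ 2)%:E))%E).
  apply: ae_ge0_le_integral => //.
  - by move=> s _; rewrite lee_fin le_min !sqr_ge0.
  - apply: measurable_funTS; apply/measurable_EFinP.
    by apply: measurable_minr; apply: measurable_funX; exact: mphi.
  - by move=> s _; rewrite -EFinD lee_fin addr_ge0// sqr_ge0.
  - by apply: emeasurable_funD; exact: mside_sqr.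
  - apply: filterS2 (tG i) (tG j) => s ti tj sJ.
    have s0L : `[0, L]%classic s by exact: JI.
    rewrite -EFinD lee_fin ge_min; apply/orP.
    have sab : a < s < b by move: sJ; rewrite /= in_itv.
    have [Gi|Gj] := Gs s sab; [left|right].
      by rewrite /D /= ti ?subr0 ?lerDl ?sqr_ge0//; split.
    by rewrite /D /= tj ?subr0 ?lerDr ?sqr_ge0//; split.
rewrite ge0_integralD//; first last.
- exact: mside_sqr.
- by move=> s _; rewrite lee_fin sqr_ge0.
- exact: mside_sqr.
- by move=> s _; rewrite lee_fin sqr_ge0.
have half k : (\int[mu]_(s in (`]a, b[%classic : set RT)) (D (side L k s) ^+ 2)%:E
    <= bdint L D)%E.
  apply: le_trans (side_le_bdint L k D).
  apply: ge0_subset_integral => //; first exact: mside_sqr.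
  by move=> s _; rewrite lee_fin sqr_ge0.
by rewrite mule_natl mule2n; apply: leeD; exact: half.
Qed.

(** Exchanging the coordinates reduces the case of vertical sides to that of
    horizontal ones. *)
Lemma sqint_swap L v : continuous v -> 0 < L ->
  sqint L (fun z => v (z.2, z.1)) = sqint L v.
Proof.
move=> cv L0.
have cs : continuous (fun z : R * R => v (z.2, z.1)).
  move=> z; apply: (@continuous_comp _ _ _ (fun z : R * R => (z.2, z.1)) v).
    by apply: cvg_pair2; [exact: cvg_snd|exact: cvg_fst].
  exact: cv.
rewrite /sqint tonelli_square; last 2 first.
- by apply: mEFinRR; apply: measurable_funX; case: (continuous_L2 L0 cs).
- by move=> z; rewrite lee_fin sqr_ge0.
rewrite tonelli_square_sym//.
- by apply: mEFinRR; apply: measurable_funX; case: (continuous_L2 L0 cv).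
- by move=> z; rewrite lee_fin sqr_ge0.
Qed.

(** The interval of [boundary_interval] feeds [poincare_core]; the boundary term
    is controlled by the distance of [phi] to a function [t] vanishing on [G1],
    which tends to zero along an approximating sequence. *)
Lemma poincare_smooth D G1 G2 : 0 < D -> boundary_decomposition D G1 G2 ->
  exists2 C : R, 0 < C & forall phi t, smooth phi -> mside D t ->
  (forall i, {ae mu, forall s, on_side D G1 i s -> t (side D i s) = 0}) ->
  (sqint D phi <= C%:E * (bdint D (phi \- t)%R +
     gradint D (fun z => (dx phi z, dy phi z))))%E.
Proof.
move=> D0 hG; have [a [b [a0 ab bD J]]] := boundary_interval D0 hG.
have ba0 : 0 < b - a by rewrite subr_gt0.
(* The sum of the three constants of [poincare_core], the boundary term being at
   most [2 bdint]. *)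
pose K := 8 * D ^+ 2 + 4 * D ^+ 3 + 2 * D ^+ 2 * (b - a).
have D2 : 0 < D ^+ 2 by rewrite exprn_gt0.
have D3 : 0 < D ^+ 3 by rewrite exprn_gt0.
have Db : 0 < D ^+ 2 * (b - a) by rewrite mulr_gt0.
have K0 : 0 < K by rewrite /K -mulrA; lra.
exists (K / (b - a)); first by rewrite divr_gt0.
move=> phi t sphi mt tG.
have c1 := sphi 1%N; have cphi := Ck_continuous c1.
have cdx := Ck1_continuous_dx c1; have cdy := Ck1_continuous_dy c1.
have mphi := mside_continuous D cphi.
rewrite gradintE /=; [|exact: continuous_L2|exact: continuous_L2].
have X0 := sqint_ge0 D (dx phi); have Y0 := sqint_ge0 D (dy phi).
have B0 := bdint_ge0 D (phi \- t).
have fin (M X Y : \bar R) : (0 <= M -> 0 <= X -> 0 <= Y ->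
    (b - a)%:E * sqint D phi <= (4 * D ^+ 2)%:E * M + (4 * D ^+ 3)%:E * Y +
      (2 * D ^+ 2 * (b - a))%:E * X ->
    M <= 2%:E * bdint D (phi \- t)%R ->
    sqint D phi <= (K / (b - a))%:E * (bdint D (phi \- t)%R + (X + Y)))%E.
  move=> M0 X0' Y0' h MB.
  rewrite mulrC EFinM -muleA lee_pdivlMl//.
  apply: le_trans h _; rewrite !ge0_muleDr// ?adde_ge0//.
  rewrite (addeC (K%:E * X)%E) addeA; apply: leeD; first apply: leeD.
  - apply: (@le_trans _ _ ((4 * D ^+ 2)%:E * (2%:E * bdint D (phi \- t)%R))%E).
      by apply: lee_wpmul2l MB; rewrite lee_fin; lra.
    rewrite muleA -EFinM; apply: lee_wpmul2r => //; rewrite lee_fin /K -mulrA; lra.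
  - by apply: lee_wpmul2r => //; rewrite lee_fin /K -mulrA; lra.
  - by apply: lee_wpmul2r => //; rewrite lee_fin /K -!mulrA; lra.
case: J => J.
- pose i : 'I_4 := @Ordinal 4 0 isT; pose j : 'I_4 := @Ordinal 4 1 isT.
  have MB := @trace_min D a b G1 i j phi t a0 bD mphi mt J tG.
  set M := (X in (X <= _)%E) in MB.
  have M0 : (0 <= M)%E by apply: integral_ge0 => s _; rewrite lee_fin le_min !sqr_ge0.
  have h : ((b - a)%:E * sqint D phi <= (4 * D ^+ 2)%:E * M +
      (4 * D ^+ 3)%:E * sqint D (dy phi) + (2 * D ^+ 2 * (b - a))%:E * sqint D (dx phi))%E.
    exact: (@poincare_core R D a b phi (dx phi) (dy phi) D0 a0 ab bD cphi cdx cdy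
      (Ck1_derive_x c1) (Ck1_derive_y c1)).
  exact: (fin _ _ _ M0 X0 Y0 h MB).
- pose i : 'I_4 := @Ordinal 4 2 isT; pose j : 'I_4 := @Ordinal 4 3 isT.
  have MB := @trace_min D a b G1 i j phi t a0 bD mphi mt J tG.
  pose sw (w : R * R -> R) (z : R * R) := w (z.2, z.1).
  have csw w : continuous w -> continuous (sw w).
    move=> cw z; apply: (@continuous_comp _ _ _ (fun z : R * R => (z.2, z.1)) w).
      by apply: cvg_pair2; [exact: cvg_snd|exact: cvg_fst].
    exact: cw.
  set M := (X in (X <= _)%E) in MB.
  have M0 : (0 <= M)%E by apply: integral_ge0 => s _; rewrite lee_fin le_min !sqr_ge0.
  have h : ((b - a)%:E * sqint D phi <= (4 * D ^+ 2)%:E * M +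
      (4 * D ^+ 3)%:E * sqint D (dx phi) + (2 * D ^+ 2 * (b - a))%:E * sqint D (dy phi))%E.
    rewrite -(sqint_swap cphi D0) -(sqint_swap cdx D0) -(sqint_swap cdy D0).
    exact: (@poincare_core R D a b (sw phi) (sw (dy phi)) (sw (dx phi)) D0 a0 ab bD
      (csw _ cphi) (csw _ cdy) (csw _ cdx) (fun x y => Ck1_derive_y c1 y x)
      (fun x y => Ck1_derive_x c1 y x)).
  by rewrite (addeC (sqint D (dx phi))); exact: (fin _ _ _ M0 Y0 X0 h MB).
Qed.

End traces.

Section space_V.
Context {R : realType}.
Implicit Types (v t phi : R * R -> R).
Variables (D : R) (G1 G2 : set (R * R)).
Hypothesis D0 : 0 < D.
Local Notation mu := (@lebesgue_measure R).

Lemma bd_L2B v t : mside D v -> mside D t ->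
  (bd_L2 D (bdry D) (v \- t)%R <=
   2%:E * (bd_L2 D (bdry D) v + bd_L2 D (bdry D) t))%E.
Proof.
move=> mv mt; rewrite !bd_L2E//.
exact: (sqrte_double (bdint_ge0 _ _) (bdint_ge0 _ _) (bdint_ge0 _ _) (bdintB mv mt)).
Qed.

Lemma cvg_double (u w z : nat -> \bar R) : (forall n, 0 <= z n)%E ->
  (forall n, z n <= 2%:E * (u n + w n))%E ->
  (u @ \oo --> 0 -> w @ \oo --> 0 -> z @ \oo --> 0)%E.
Proof.
move=> z0 zuw u0 w0.
have h : (2%:E * (u n + w n) @[n --> \oo] --> 0)%E.
  rewrite -[X in _ --> X](mule0 2%:E) -[X in (_ * X)%E](adde0 0%E).
  by apply: cvgeZl => //; apply: cvgeD.
apply: (squeeze_cvge _ (cvg_cst _) h); apply: nearW => n.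
by rewrite z0 zuw.
Qed.

(** The differences of the approximating sequences approximate the
    difference. *)
Lemma is_traceB v v' t t' : H1 D v -> H1 D v' -> is_trace D v t -> is_trace D v' t' ->
  is_trace D (v \- v') (t \- t').
Proof.
move=> hv hv' [mt [phi [sphi pv pt]]] [mt' [phi' [sphi' pv' pt']]].
split; first exact: measurable_funB.
have hphi k := smooth_H1 D0 (sphi k 1%N); have hphi' k := smooth_H1 D0 (sphi' k 1%N).
have mphi k := mside_continuous D (Ck_continuous (sphi k 1%N)).
have mphi' k := mside_continuous D (Ck_continuous (sphi' k 1%N)).
exists (fun k => phi k \- phi' k); split.
- by move=> k; exact: smoothB.
- apply: cvg_double pv pv' => k.
    by rewrite /H1norm poweR_ge0.
  have -> : (phi k \- phi' k) \- (v \- v') = (phi k \- v) \- (phi' k \- v').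
    by apply/funext => z /=; ring.
  by apply: H1normB => //; exact: H1B.
- apply: cvg_double pt pt' => k.
    by rewrite /bd_L2 poweR_ge0.
  have -> : (phi k \- phi' k) \- (t \- t') = (phi k \- t) \- (phi' k \- t').
    by apply/funext => z /=; ring.
  by apply: bd_L2B; apply: msideB => //; exact: mside_measurable.
Qed.

Lemma VB v v' : V D G1 v -> V D G1 v' ->
  V D G1 (v \- v') /\ exists t, is_trace D (v \- v') t.
Proof.
move=> [hv [t tv t0]] [hv' [t' tv' t0']].
have tB := is_traceB hv hv' tv tv'; split; last by exists (t \- t').
split; first exact: H1B.
exists (t \- t') => // i; apply: filterS2 (t0 i) (t0' i) => s h h' sG /=.
by rewrite h// h'// subrr.
Qed.

(** The gradient of [phi] is the sum of those of [v] and [phi - v] almost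
    everywhere. *)
Lemma gradint_smooth_le v phi : H1 D v -> smooth phi ->
  (gradint D (fun z => (dx phi z, dy phi z)) <=
   2%:E * gradint D (wgrad D v) + 2%:E * gradint D (wgrad D (phi \- v)%R))%E.
Proof.
move=> hv sphi; have c1 := sphi 1%N; have hphi := smooth_H1 D0 c1.
have [w1 w2 _] := wgradP hv; have [e1 e2 _] := wgradP (H1B D0 hphi hv).
have [p1 p2 _] := smooth_weak_grad D0 c1.
have [q1 q2 _] := wgradP hphi.
have E : gradint D (fun z => (dx phi z, dy phi z)) = gradint D
  (fun z => ((wgrad D (phi \- v) z).1 + (wgrad D v z).1, (wgrad D (phi \- v) z).2 + (wgrad D v z).2)).
  apply: eq_gradint => //=; [exact: L2D|exact: L2D|].
  apply: filterS2 (wgradB D0 hphi hv) (smooth_wgrad D0 c1) => z h h' zD.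
  rewrite h//= h'//=; by congr (_, _); ring.
have L2N (f : R * R -> R) : L2 D f -> L2 D (fun x => - f x).
  by move=> fL; have := L2Z (-1) fL; congr L2; apply/funext => x; rewrite mulN1r.
have sqN (f : R * R -> R) : sqint D (fun x => - f x) = sqint D f.
  by apply: eq_integral => x _; rewrite sqrrN.
have sD (f g : R * R -> R) : L2 D f -> L2 D g ->
    (sqint D (fun x => f x + g x)%R <= 2%:E * sqint D g + 2%:E * sqint D f)%E.
  move=> fL gL; rewrite -(sqN f); apply: le_trans (sqintB gL (L2N _ fL)).
  rewrite le_eqVlt; apply/orP; left; apply/eqP; congr sqint.
  by apply/funext => x /=; rewrite opprK addrC.
rewrite E !gradintE//=; [|exact: L2D|exact: L2D].
apply: (lee_double2 (sqint_ge0 _ _) (sqint_ge0 _ _) (sqint_ge0 _ _) (sqint_ge0 _ _)).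
  exact: sD.
exact: sD.
Qed.

Lemma sqint_le_approx v phi : L2 D v -> L2 D phi ->
  (sqint D v <= 2%:E * sqint D phi + 2%:E * sqint D (phi \- v)%R)%E.
Proof.
move=> vL pL; have -> : sqint D v = sqint D (phi \- (phi \- v)).
  by congr sqint; apply/funext => z /=; ring.
by apply: sqintB => //; exact: L2B.
Qed.

(** The inequality for smooth functions passes to the limit along a sequence
    realizing the trace. *)
Lemma poincare_V : boundary_decomposition D G1 G2 ->
  exists2 C : R, 0 < C & forall v, V D G1 v ->
    (sqint D v <= C%:E * gradint D (wgrad D v))%E.
Proof.
move=> hG; have [C C0 HC] := poincare_smooth D0 hG.
exists (4 * C); first by rewrite mulr_gt0.
move=> v [hv [t [mt [phi [sphi pv pt]]] tG]].
have hphi k := smooth_H1 D0 (sphi k 1%N).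
have [cs cg] := H1norm_cvg (fun k => H1B D0 (hphi k) hv) pv.
have cb : (bdint D (phi k \- t)%R @[k --> \oo] --> 0)%E.
  apply: cvg_sqrte; first by move=> n; exact: bdint_ge0.
  by move: pt; rewrite (_ : (fun k => bd_L2 _ _ _) =
    fun k => (bdint D (phi k \- t)%R `^ 2^-1)%E)//; apply/funext => k; rewrite bd_L2E.
pose S k := sqint D (phi k \- v); pose G k := gradint D (wgrad D (phi k \- v)).
pose B k := bdint D (phi k \- t).
have key k : (sqint D v <= (4 * C)%:E * gradint D (wgrad D v) +
    ((2 * C)%:E * B k + (4 * C)%:E * G k + 2%:E * S k))%E.
  have h1 := sqint_le_approx hv.1 (hphi k).1.
  have h2 := HC (phi k) t (sphi k) (mside_measurable D mt) tG.
  have h3 := gradint_smooth_le hv (sphi k).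
  have B0 : (0 <= B k)%E := bdint_ge0 _ _.
  have G0 : (0 <= G k)%E := gradint_ge0 _ _.
  have g0 : (0 <= gradint D (wgrad D v))%E := gradint_ge0 _ _.
  have P0 : (0 <= gradint D (fun z => (dx (phi k) z, dy (phi k) z)))%E := gradint_ge0 _ _.
  have s0 : (0 <= sqint D (phi k))%E := sqint_ge0 _ _.
  have S0 : (0 <= S k)%E := sqint_ge0 _ _.
  move: h1 h2 h3; rewrite -/(B k) -/(G k) -/(S k).
  move: (gradint D (fun z => _)) (gradint D (wgrad D v)) (sqint D (phi k)) (sqint D v)
    (B k) (G k) (S k) B0 G0 g0 P0 s0 S0 => P g s V b G' S' b0 G0' g0 P0 s0 S0 h1 h2 h3.
  apply: le_trans h1 _; rewrite addeA; apply: leeD => //.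
  apply: (@le_trans _ _ (2%:E * (C%:E * (b + (2%:E * g + 2%:E * G'))))%E).
    apply: lee_wpmul2l; first by rewrite lee_fin.
    apply: le_trans h2 _; apply: lee_wpmul2l; first by rewrite lee_fin ltW.
    by apply: leeD.
  have n2g : (0 <= 2%:E * g)%E by rewrite mule_ge0.
  have n2G : (0 <= 2%:E * G')%E by rewrite mule_ge0.
  rewrite (ge0_muleDr _ b0 (adde_ge0 n2g n2G)) (ge0_muleDr _ n2g n2G).
  rewrite !ge0_muleDr ?mule_ge0 ?adde_ge0 ?mule_ge0 ?lee_fin ?(ltW C0)//.
  rewrite !muleA -!EFinM addeCA.
  apply: leeD; last apply: leeD; rewrite le_eqVlt; apply/orP; left; apply/eqP;
    congr (_%:E * _)%E; ring.
have cE : ((2 * C)%:E * B k + (4 * C)%:E * G k + 2%:E * S k @[k --> \oo] --> 0)%E.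
  rewrite -[X in _ --> X](adde0 0%E) -[X in (X + _)%E](adde0 0%E).
  rewrite -[X in (X + _ + _)%E](mule0 (2 * C)%:E) -[X in (_ + X + _)%E](mule0 (4 * C)%:E).
  rewrite -[X in (_ + _ + X)%E](mule0 2%:E).
  apply: cvgeD; [by rewrite !mule0 adde0 | |exact: cvgeZl].
  by apply: cvgeD; [by rewrite !mule0|exact: cvgeZl|exact: cvgeZl].
have gfin : gradint D (wgrad D v) \is a fin_num.
  have [w1 w2 _] := wgradP hv.
  rewrite ge0_fin_numE ?gradint_ge0// gradintE//.
  by apply: lte_add_pinfty; exact: sqint_fin.
have cT : ((4 * C)%:E * gradint D (wgrad D v) +
   ((2 * C)%:E * B k + (4 * C)%:E * G k + 2%:E * S k) @[k --> \oo] -->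
   (4 * C)%:E * gradint D (wgrad D v))%E.
  rewrite -[X in _ --> X]adde0; apply: cvgeD; [|exact: cvg_cst|exact: cE].
  by rewrite fin_num_adde_defr// fin_numM.
rewrite -(cvg_lim _ cT)//; apply: lime_ge; first by apply/cvg_ex; eexists; exact: cT.
exact: nearW.
Qed.

End space_V.

(** * Stability of weak solutions under perturbation of the coefficient *)

Section energy.
Variable R : realType.
Implicit Types (D L A k : R).

Lemma L2_bdM L (h v : R * R -> R) A : measurable_fun (sq L) h ->
  (forall x, sq L x -> `|h x| <= A) -> L2 L v -> L2 L (fun x => h x * v x).
Proof.
move=> mh hA vL; have := vL; move/L2P => [mv iv]; apply/L2P; split.
  by apply: measurable_funM.
have A2 : leb2.-integrable (sq L) (fun x => ((A ^+ 2) * (v x ^+ 2))%:E).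
  have := integrableZl (msq L) (A ^+ 2) (L2_sqr_integrable vL).
  by apply: eq_integrable => //; exact: msq.
apply: (@le_lt_trans _ _ (\int[leb2]_(x in sq L) ((A ^+ 2) * (v x ^+ 2))%:E)%E).
  rewrite integral_mkcond [leRHS]integral_mkcond.
  apply: le_integral_any => x; rewrite /patch; case: ifPn => // /set_mem sx.
    by rewrite lee_fin sqr_ge0.
  rewrite lee_fin exprMn ler_wpM2r ?sqr_ge0// -(ger0_norm (sqr_ge0 (h x))) normrX.
  by rewrite lerXn2r ?nnegrE ?hA// (le_trans _ (hA _ sx)).
rewrite ltey_eq; apply/orP; left.
exact: (integrable_fin_num (msq L) A2).
Qed.

(** The hypothesis says that [t := h w.e - h' (w - e).e] has integral zero.
    Pointwise, [k^2 |e|^2 <= 2 k t + (h' - h)^2 |w|^2], by expanding the square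
    of [(h' - h) w - k e] and using [k <= h']. *)
Lemma energy_gap L (h h' w1 w2 e1 e2 : R * R -> R) A k :
  measurable_fun (sq L) h -> measurable_fun (sq L) h' ->
  (forall x, sq L x -> `|h x| <= A) -> (forall x, sq L x -> `|h' x| <= A) ->
  0 < k -> (forall x, sq L x -> k <= h' x) ->
  L2 L w1 -> L2 L w2 -> L2 L e1 -> L2 L e2 ->
  (\int[leb2]_(x in sq L) (h x * dot (w1 x, w2 x) (e1 x, e2 x)) =
   \int[leb2]_(x in sq L)
     (h' x * dot (w1 x - e1 x, w2 x - e2 x) (e1 x, e2 x)))%R ->
  ((k ^+ 2)%:E * \int[leb2]_(x in sq L) (e1 x ^+ 2 + e2 x ^+ 2)%:E <=
   \int[leb2]_(x in sq L)
     ((h' x - h x) ^+ 2 * (w1 x ^+ 2 + w2 x ^+ 2))%:E)%E.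
Proof.
move=> mh mh' hA hA' k0 kh' Lw1 Lw2 Le1 Le2 eqI.
pose t0 := (fun x => h x * dot (w1 x, w2 x) (e1 x, e2 x)).
pose t1 := (fun x => h' x * dot (w1 x - e1 x, w2 x - e2 x) (e1 x, e2 x)).
have iM a b : L2 L a -> L2 L b -> leb2.-integrable (sq L) (fun x => (a x * b x)%:E).
  exact: L2_integrableM.
have it0 : leb2.-integrable (sq L) (EFin \o t0).
  have := integrableD (msq L) (iM _ _ (L2_bdM mh hA Lw1) Le1)
                      (iM _ _ (L2_bdM mh hA Lw2) Le2).
  apply: eq_integrable; first exact: msq.
  by move=> x _; rewrite /= -EFinD /t0 /dot/=; congr (_%:E); ring.
have it1 : leb2.-integrable (sq L) (EFin \o t1).
  have := integrableD (msq L) (iM _ _ (L2_bdM mh' hA' (L2B Lw1 Le1)) Le1)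
                      (iM _ _ (L2_bdM mh' hA' (L2B Lw2 Le2)) Le2).
  apply: eq_integrable; first exact: msq.
  by move=> x _; rewrite /= -EFinD /t1 /dot/=; congr (_%:E); ring.
have iE : leb2.-integrable (sq L) (fun x => (e1 x ^+ 2 + e2 x ^+ 2)%:E).
  have := integrableD (msq L) (L2_sqr_integrable Le1) (L2_sqr_integrable Le2).
  by apply: eq_integrable; first exact: msq.
have hB x : sq L x -> `|h' x - h x| <= A + A.
  by move=> sx; rewrite (le_trans (ler_normB _ _))// lerD ?hA ?hA'.
have mB : measurable_fun (sq L) (fun x => h' x - h x) by exact: measurable_funB.
have iW : leb2.-integrable (sq L)
    (fun x => ((h' x - h x) ^+ 2 * (w1 x ^+ 2 + w2 x ^+ 2))%:E).
  have := integrableD (msq L) (L2_sqr_integrable (L2_bdM mB hB Lw1))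
                       (L2_sqr_integrable (L2_bdM mB hB Lw2)).
  apply: eq_integrable; first exact: msq.
  by move=> x _; rewrite /= -EFinD; congr (_%:E); ring.
have it : leb2.-integrable (sq L) (fun x => ((2 * k) * (t0 x - t1 x))%:E).
  have := integrableZl (msq L) (2 * k) (integrableB (msq L) it0 it1).
  by apply: eq_integrable; first exact: msq.
have t00 : (\int[leb2]_(x in sq L) ((2 * k) * (t0 x - t1 x))%:E = 0)%E.
  transitivity ((2 * k)%:E * \int[leb2]_(x in sq L) ((EFin \o t0) x - (EFin \o t1) x))%E.
    rewrite -integralZl//; first exact: msq.
    exact: (integrableB (msq L) it0 it1).
  rewrite integralB//; last exact: msq.
  have := eqI; rewrite /Rintegral -/t0 -/t1 => eqf.
  rewrite -[X in (X - _)%E]fineK; last exact: (integrable_fin_num (msq L) it0).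
  rewrite -[X in (_ - X)%E]fineK; last exact: (integrable_fin_num (msq L) it1).
  by rewrite /comp eqf -EFinB subrr mule0.
rewrite -(integralZl (msq L) iE (k ^+ 2)).
rewrite -[leRHS]add0e -t00 -(integralD (msq L) it iW).
apply: le_integral => //.
- exact: msq.
- exact: (integrableZl (msq L) (k ^+ 2) iE).
- exact: (integrableD (msq L) it iW).
move=> x /set_mem sx /=; rewrite -EFinM -EFinD lee_fin /t0 /t1 /dot/=.
have kx := kh' _ sx.
set a := h' x - h x.
have : 0 <= (a * w1 x - k * e1 x) ^+ 2 + (a * w2 x - k * e2 x) ^+ 2.
  by rewrite addr_ge0 ?sqr_ge0.
have : 0 <= (2 * k) * (h' x - k) * (e1 x ^+ 2 + e2 x ^+ 2).
  by rewrite !mulr_ge0 ?subr_ge0// ?addr_ge0 ?sqr_ge0// ltW.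
rewrite /a; nra.
Qed.

Lemma poweR2 (x : \bar R) : (0 <= x)%E -> (x `^ 2 = x * x)%E.
Proof.
by case: x => [x|//|//] x0; rewrite ?poweRyr ?pnatr_eq0//= powR_mulrn// expr2.
Qed.

(** [S] and [G] stand for the squared norms of a function and of its gradient,
    [a] and [c] for the two Hoelder factors. *)
Lemma sqrt_stability (S G a c : \bar R) (C k : R) : 0 < C -> 0 < k ->
  (0 <= a)%E -> (0 <= c)%E -> (0 <= S)%E -> (0 <= G)%E ->
  (S <= C%:E * G)%E -> ((k ^+ 2)%:E * G <= a `^ 2 * c `^ 2)%E ->
  ((S + G) `^ 2^-1 <= (Num.sqrt (C + 1) / k)%:E * a * c)%E.
Proof.
move=> C0 k0 a0 c0 S0 G0 SG kG.
have k2 : 0 < k ^+ 2 by rewrite exprn_gt0.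
have q0 : (0 <= (Num.sqrt (C + 1) / k)%:E)%E by rewrite lee_fin divr_ge0 ?sqrtr_ge0// ltW.
have gk : (G <= (k^-2)%:E * ((a * c) * (a * c)))%E.
  rewrite -(@lee_pmul2l _ (k ^+ 2)%:E)//.
  by rewrite muleA -EFinM divff ?gt_eqF// mul1e (le_trans kG)// !poweR2// muleACA.
apply: sqrte_le; [exact: adde_ge0|by rewrite !mule_ge0|].
apply: (@le_trans _ _ ((C + 1)%:E * G)%E).
  rewrite (EFinD C 1) ge0_muleDl ?lee_fin ?(ltW C0) ?ler01//.
  by rewrite mul1e; apply: leeD.
apply: (@le_trans _ _ ((C + 1)%:E * ((k^-2)%:E * ((a * c) * (a * c))))%E).
  by rewrite lee_pmul2l// lte_fin addr_gt0.
have qq : (C + 1) * k^-2 = Num.sqrt (C + 1) / k * (Num.sqrt (C + 1) / k).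
  by rewrite mulrACA -!expr2 sqr_sqrtr ?addr_ge0 ?ltW// exprVn.
by rewrite muleA -EFinM qq EFinM muleACA !muleA.
Qed.

Lemma hoelder_sq L (f g : R * R -> R) (p q : R) :
  measurable_fun (sq L) f -> measurable_fun (sq L) g ->
  0 < p -> 0 < q -> p^-1 + q^-1 = 1 ->
  (\int[leb2]_(x in sq L) (f x ^+ 2 * g x ^+ 2)%:E <=
   LpD L (2 * p)%:E f `^ 2 * LpD L (2 * q)%:E g `^ 2)%E.
Proof.
move=> mf mg p0 q0 pq.
pose F := (fun x => f x ^+ 2) \_ (sq L); pose G := (fun x => g x ^+ 2) \_ (sq L).
have mF (h : R * R -> R) : measurable_fun (sq L) h ->
    measurable_fun setT ((fun x => h x ^+ 2) \_ (sq L)).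
  move=> mh; apply/(measurable_restrictT _ (msq L)).
  exact: measurable_funX.
have F0 (h : R * R -> R) x : 0 <= ((fun x => h x ^+ 2) \_ (sq L)) x.
  by rewrite /patch; case: ifP; rewrite ?sqr_ge0.
have E (h : R * R -> R) (s : R) : 0 < s ->
    ((\int[leb2]_x (((fun x => h x ^+ 2) \_ (sq L)) x `^ s)%:E) `^ s^-1
     = LpD L (2 * s)%:E h `^ 2)%E.
  move=> s0; rewrite LpDE ?mulf_neq0 ?gt_eqF// -poweRrM; congr (poweR _ _); last first.
    by rewrite invfM mulrAC mulVf ?mul1r.
  rewrite [RHS]integral_mkcond; apply: eq_integral => x _; rewrite /patch.
  case: ifP => _; last by rewrite powR0 ?gt_eqF.
  by rewrite -(ger0_norm (sqr_ge0 (h x))) normrX -powR_mulrn ?normr_ge0// -powRrM.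
rewrite -(E f p p0) -(E g q q0).
apply: (le_trans _ (hoelder_ge0 leb2 (mfunRR (mF f mf)) (mfunRR (mF g mg)) (F0 f) (F0 g) p0 q0 pq)).
rewrite [leLHS]integral_mkcond le_eqVlt; apply/orP; left; apply/eqP.
by apply: eq_integral => x _; rewrite /patch; case: ifP => _//; rewrite mul0r.
Qed.

Lemma measurable_eucl L (w : R * R -> R * R) :
  measurable_fun (sq L) (fun x => (w x).1) ->
  measurable_fun (sq L) (fun x => (w x).2) ->
  measurable_fun (sq L) (fun x => eucl (w x)).
Proof.
move=> m1 m2; apply: (@measurableT_comp _ _ _ _ _ _ (@Num.sqrt R)).
  apply: continuous_measurable_fun; exact: (@sqrt_continuous R).
by apply: measurable_funD; apply: measurable_funX.
Qed.

Lemma measurable_mul_dot L (h a1 a2 c1 c2 : R * R -> R) :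
  measurable_fun (sq L) h ->
  measurable_fun (sq L) a1 -> measurable_fun (sq L) a2 ->
  measurable_fun (sq L) c1 -> measurable_fun (sq L) c2 ->
  measurable_fun (sq L) (fun x => h x * dot (a1 x, a2 x) (c1 x, c2 x)).
Proof.
move=> mh ma1 ma2 mc1 mc2.
apply: (measurable_funM mh); apply: (measurable_funD (measurable_funM ma1 mc1)).
exact: measurable_funM.
Qed.

(** Both equations are tested with [u - u'], which gives the hypothesis of
    [energy_gap]; Hoelder's inequality and Poincare's inequality conclude. *)
Lemma pathwise_stability D G1 G2 : 0 < D -> boundary_decomposition D G1 G2 ->
  exists2 C, 0 < C & forall (k A : R) (h h' f g u u' : R * R -> R) (b n : R),
    0 < k -> 0 < b -> 0 < n -> b^-1 + n^-1 = 1 ->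
    measurable_fun (sq D) h -> measurable_fun (sq D) h' ->
    (forall x, sq D x -> `|h x| <= A) -> (forall x, sq D x -> `|h' x| <= A) ->
    (forall x, sq D x -> k <= h' x) ->
    weak_solution D G1 G2 h f g u -> weak_solution D G1 G2 h' f g u' ->
    (H1norm D (u \- u')%R <= (C / k)%:E * LpD D (2 * b)%:E (h' \- h)%R *
       grad_Lp D (2 * n)%:E u)%E.
Proof.
move=> D0 bd; have [C C0 poinc] := poincare_V D0 bd.
exists (Num.sqrt (C + 1)); first by rewrite sqrtr_gt0 addr_gt0.
move=> k A h h' f g u u' b n k0 b0 n0 bn mh mh' hA hA' kh' [Vu su] [Vu' su'].
have [Ve [t tt]] := VB D0 Vu Vu'.
have := su _ _ Ve tt; rewrite -(su' _ _ Ve tt) => eqI.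
have [Hu _] := Vu; have [Hu' _] := Vu'; have [He _] := Ve.
have [Lw1 Lw2 _] := wgradP Hu; have [Le1 Le2 _] := wgradP He.
have [Lv1 Lv2 _] := wgradP Hu'.
have aeB := wgradB D0 Hu Hu'.
have [mw1 _] := Lw1; have [mw2 _] := Lw2; have [me1 _] := Le1.
have [me2 _] := Le2; have [mw'1 _] := Lv1; have [mw'2 _] := Lv2.
have key := @energy_gap D h h' (fun x => (wgrad D u x).1)
  (fun x => (wgrad D u x).2) _ _ A k mh mh' hA hA' k0 kh' Lw1 Lw2 Le1 Le2.
have {key} key : ((k ^+ 2)%:E * gradint D (wgrad D (u \- u')%R) <=
    LpD D (2 * b)%:E (h' \- h)%R `^ 2 * grad_Lp D (2 * n)%:E u `^ 2)%E.
  apply: le_trans (hoelder_sq _ _ b0 n0 bn); last 2 first.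
  - exact: measurable_funB.
  - by apply: measurable_eucl; [case: Lw1|case: Lw2].
  have -> : (\int[leb2]_(x in sq D) ((h' \- h)%R x ^+ 2 * eucl (wgrad D u x) ^+ 2)%:E
    = \int[leb2]_(x in sq D) ((h' x - h x) ^+ 2 *
        ((wgrad D u x).1 ^+ 2 + (wgrad D u x).2 ^+ 2))%:E)%E.
    by apply: eq_integral => x _; rewrite eucl_sqr.
  apply: key.
  transitivity (\int[leb2]_(x in sq D) (h x * dot (wgrad D u x)
       (wgrad D (u \- u')%R x)))%R.
    by congr fine; apply: eq_integral => x _; rewrite /dot.
  rewrite eqI; congr fine; apply: ae_eq_integral.
  - exact: msq.
  - apply: mEFinRR; exact: (measurable_mul_dot mh' mw'1 mw'2 me1 me2).
  - apply: mEFinRR.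
    exact: (measurable_mul_dot mh' (measurable_funB mw1 me1) (measurable_funB mw2 me2) me1 me2).
  move: aeB; apply: filterS => x xE sx; have := xE sx => -> /=.
  by rewrite /dot /=; congr (_%:E); ring.
rewrite (H1normE He).
apply: (sqrt_stability C0 k0 _ _ _ _ (poinc _ Ve) key).
- exact: Lnorm_ge0.
- exact: Lnorm_ge0.
- exact: sqint_ge0.
- exact: gradint_ge0.
Qed.
End energy.

(** * Moments of normal laws *)

Section normal_moments.
Context {R : realType}.
Local Notation mu := (@lebesgue_measure R).
Implicit Types (m s t x : R) (F : R -> \bar R).

(** Change of variables for the density, which is the Radon-Nikodym derivative
    of the law. *)
Lemma integral_normal_prob m s F : measurable_fun setT F ->
  (forall x, (0 <= F x)%E) ->
  (\int[normal_prob m s]_x F x = \int[mu]_x (F x * (normal_pdf m s x)%:E))%E.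
Proof.
move=> mF F0; pose nu := normal_prob m s.
have dom : normal_prob m s `<< mu := @normal_prob_dominates R m s.
rewrite -(Radon_Nikodym_SigmaFinite.change_of_variables dom F0 measurableT mF).
apply: ae_eq_integral => //.
- apply: emeasurable_funM => //; apply: (measurable_int mu).
  exact: Radon_Nikodym_SigmaFinite.f_integrable.
- apply: emeasurable_funM => //; apply/measurable_EFinP.
  exact: measurable_normal_pdf.
apply: ae_eqe_mul2l; apply: integral_ae_eq => //.
- exact: Radon_Nikodym_SigmaFinite.f_integrable.
- by apply/measurable_EFinP; exact: measurable_normal_pdf.
by move=> E _ mE; rewrite -Radon_Nikodym_SigmaFinite.f_integral.
Qed.

Context {d : measure_display} {T : measurableType d} (P : probability T R).
Implicit Types X : T -> R.

Lemma expectation_law X (nu : {measure set (measurableTypeR R) -> \bar R}) F :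
  measurable_fun setT X ->
  (forall B : set R, measurable B -> P (X @^-1` B) = nu B) ->
  measurable_fun setT F -> (forall x, (0 <= F x)%E) ->
  (\int[P]_w F (X w) = \int[nu]_x F x)%E.
Proof.
move=> mX XE mF F0.
rewrite -(@ge0_integral_pushforward _ _ T (measurableTypeR R) R X mX P setT F measurableT mF)//.
by apply: eq_measure_integral => A mA _; exact: XE.
Qed.

Local Notation peak := normal_peak.

Lemma normal_peak_double s : peak (2 * s) = peak s / 2.
Proof.
rewrite /normal_peak exprMn -mulrA -mulrnAr sqrtrM ?sqr_ge0//.
by rewrite sqrtr_sqr ger0_norm// invfM mulrC.
Qed.

(** A factor of at most [exp (y^2 / (4 s^2))], with [y = x - m], is paid for by
    doubling the standard deviation: the exponents satisfy [1/4 - 1/2 <= -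
    1/8]. *)
Lemma normal_pdf_dominate m s (a : R) x : s != 0 ->
  a <= expR ((x - m) ^+ 2 / (4 * s ^+ 2)) ->
  a * normal_pdf m s x <= 2 * normal_pdf m (2 * s) x.
Proof.
move=> s0 aE.
have s20 : 2 * s != 0 by rewrite mulf_neq0.
rewrite !normal_pdfE//= normal_peak_double [leRHS]mulrA mulrCA [2 * _]mulrC divfK//.
rewrite ler_wpM2l ?normal_peak_ge0// /normal_fun.
rewrite (le_trans (ler_wpM2r (expR_ge0 _) aE))// -expRD ler_expR.
set y := (x - m) ^+ 2; have y0 : 0 <= y by exact: sqr_ge0.
have ss : 0 < s ^+ 2 by rewrite exprn_even_gt0.
have -> : y / (4 * s ^+ 2) = (y / s ^+ 2) / 4 by field.
have -> : - y / (s ^+ 2 *+ 2) = - (y / s ^+ 2) / 2 by rewrite -mulr_natr; field.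
have -> : - y / ((2 * s) ^+ 2 *+ 2) = - (y / s ^+ 2) / 8.
  by rewrite exprMn -mulr_natr; field.
by have : 0 <= y / s ^+ 2 by [exact: divr_ge0 (ltW ss)]; lra.
Qed.

(** By [t |y| <= y^2 / (4 s^2) + t^2 s^2]. *)
Lemma normal_exp_dominate m s t x : s != 0 -> 0 <= t ->
  expR (t * `|x|) * normal_pdf m s x <=
    expR (t * `|m| + t ^+ 2 * s ^+ 2) * (2 * normal_pdf m (2 * s) x).
Proof.
move=> s0 t0; have ss : 0 < s ^+ 2 by rewrite exprn_even_gt0.
set e := t * `|m| + _.
rewrite -ler_pdivrMl ?expR_gt0// -expRN mulrA -expRD.
apply: normal_pdf_dominate => //; rewrite ler_expR /e.
set y := x - m; have -> : x = y + m by rewrite /y subrK.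
have := ler_wpM2l t0 (ler_normD y m).
have : 0 <= (`|y| / (2 * s) - t * s) ^+ 2 by rewrite sqr_ge0.
rewrite sqrrB exprMn exprVn exprMn real_normK ?num_real//.
have -> : `|y| / (2 * s) * (t * s) *+ 2 = t * `|y|.
  by rewrite -mulr_natr; field.
by rewrite exprMn (_ : 2 ^+ 2 = 4)//; lra.
Qed.

Lemma normal_sqr_dominate m s x : s != 0 ->
  (x - m) ^+ 2 * normal_pdf m s x <= 8 * s ^+ 2 * normal_pdf m (2 * s) x.
Proof.
move=> s0; have ss : 0 < s ^+ 2 by rewrite exprn_even_gt0.
have -> : 8 * s ^+ 2 * normal_pdf m (2 * s) x =
  (4 * s ^+ 2) * (2 * normal_pdf m (2 * s) x) by ring.
have s4 : 0 < 4 * s ^+ 2 by exact: mulr_gt0.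
rewrite -(ler_pdivrMl _ _ s4).
rewrite [leLHS]mulrA; apply: normal_pdf_dominate => //.
rewrite mulrC; set a := _ / _; apply: (le_trans _ (expR_ge1Dx a)).
by rewrite lerDr.
Qed.

Lemma integral_scaled_pdf (k : R) m s : 0 <= k ->
  (\int[mu]_x (k * normal_pdf m s x)%:E = k%:E)%E.
Proof.
move=> k0; under eq_integral do rewrite EFinM.
rewrite ge0_integralZl_EFin//; first by rewrite integral_normal_pdf mule1.
- by move=> x _; rewrite lee_fin normal_pdf_ge0.
- by apply/measurable_EFinP; exact: measurable_normal_pdf.
Qed.

Local Notation I2 := (`[(-2)%R, 2%R]%classic : set R).

(** A density bounded by its peak puts mass at most [4 peak] on an interval of
    length 4; mass [3/4] there forces the peak to be large and the variance to
    be small. *)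
Lemma normal_variance_le8 m s : s != 0 ->
  ((3 / 4)%:E <= \int[mu]_x (\1_I2 x * normal_pdf m s x)%:E)%E -> s ^+ 2 <= 8.
Proof.
move=> s0 ge; have ss : 0 < s ^+ 2 by rewrite exprn_even_gt0.
have mpdf := measurable_normal_pdf m s.
have : ((3 / 4)%:E <= (4 * peak s)%:E)%E.
  apply: (le_trans ge).
  have -> : ((4 * peak s)%:E = \int[mu]_x (peak s * \1_I2 x)%:E)%E.
    under eq_integral do rewrite EFinM.
    rewrite ge0_integralZl_EFin//; last by rewrite normal_peak_ge0.
      rewrite integral_indic// setIT.
      have E : lebesgue_measure I2 = 4%:E.
        rewrite lebesgue_measure_itv/= lte_fin (_ : (-2 : R) < 2); last by lra.
        by rewrite -EFinD; congr (_%:E); ring.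
      transitivity ((peak s)%:E * 4%:E)%E; last by congr (_ * _)%E; exact: esym E.
      by rewrite -EFinM; congr (_%:E); ring.
    by apply/measurable_EFinP; exact: measurable_indic.
  apply: le_integral_any => x; rewrite lee_fin; first by rewrite mulr_ge0 ?normal_pdf_ge0.
  by rewrite mulrC ler_wpM2r// normal_pdf_ub.
rewrite lee_fin => h; have {h} : 3 / 16 <= peak s by lra.
rewrite /normal_peak -ler_pV2 ?inE ?unitfE; last 2 first.
- by rewrite gt_eqF ?normal_peak_gt0// -/(peak s) normal_peak_gt0.
- by apply/andP; split; [apply: lt0r_neq0|]; rewrite divr_gt0.
rewrite invrK => h.
have pi2 := pi_ge2 R.
have : s ^+ 2 * pi *+ 2 <= (3 / 16)^-1 ^+ 2.
  rewrite -[leLHS]sqr_sqrtr ?lerXn2r ?nnegrE ?sqrtr_ge0//.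
  by rewrite mulrn_wge0// mulr_ge0 ?pi_ge0// ltW.
rewrite -mulr_natr invf_div; nra.
Qed.

(** The mean is within distance 2 of points carrying mass [3/4], up to the
    spread of the law: [m^2 <= 2 (x - m)^2 + 8] on the interval, integrated
    against the density. *)
Lemma normal_mean_le14 m s : s != 0 -> s ^+ 2 <= 8 ->
  ((3 / 4)%:E <= \int[mu]_x (\1_I2 x * normal_pdf m s x)%:E)%E -> `|m| <= 14.
Proof.
move=> s0 s8 ge; have mpdf := measurable_normal_pdf m s.
have mpdf2 := measurable_normal_pdf m (2 * s).
have s2 : 0 <= 2 * (8 * s ^+ 2) by do 2 apply: mulr_ge0 => //; exact: sqr_ge0.
have : ((m ^+ 2)%:E * (3 / 4)%:E <= (2 * (8 * s ^+ 2))%:E + 8%:E)%E.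
  rewrite -(integral_scaled_pdf m s (k := 8))//.
  rewrite -(integral_scaled_pdf m (2 * s) s2).
  rewrite (le_trans (lee_wpmul2l _ ge)) ?lee_fin ?sqr_ge0//.
  rewrite -ge0_integralZl_EFin ?sqr_ge0//; last 2 first.
  - by move=> x _; rewrite lee_fin mulr_ge0 ?normal_pdf_ge0.
  - by apply/measurable_EFinP; exact: measurable_funM.
  rewrite -ge0_integralD//.
  - apply: le_integral_any => x; first by rewrite lee_fin mulr_ge0 ?sqr_ge0// mulr_ge0 ?normal_pdf_ge0.
    rewrite -EFinM -EFinD lee_fin indicE.
    have p0 := normal_pdf_ge0 m s x; have := normal_sqr_dominate m x s0.
    case: (boolP (x \in _)) => [|_]; last first.
      by have := mulr_ge0 (sqr_ge0 (x - m)) p0; rewrite mul0r mulr0; lra.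
    rewrite inE/= in_itv/= mul1r => /andP[x1 x2].
    have hm : m ^+ 2 <= 2 * (x - m) ^+ 2 + 8 by have := sqr_ge0 (2 * x - m); nra.
    by have := ler_wpM2r p0 hm; lra.
  - by move=> x _; rewrite lee_fin mulr_ge0 ?normal_pdf_ge0.
  - by apply/measurable_EFinP; exact: measurable_funM.
  - by move=> x _; rewrite lee_fin mulr_ge0 ?normal_pdf_ge0.
  - by apply/measurable_EFinP; exact: measurable_funM.
rewrite -EFinM -EFinD lee_fin => mE.
by rewrite ler_norml; apply/andP; split; nra.
Qed.

Lemma measurable_norm_le X (v : R) : measurable_fun setT X ->
  measurable [set w | `|X w| <= v].
Proof.
move=> mX; rewrite -[X in measurable X]setTI.
by apply: measurable_fun_le => //; exact: measurableT_comp.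
Qed.

(** Concentration in [[-2, 2]] with probability [3/4] bounds mean and variance
    by absolute constants, hence the exponential moments; this covers degenerate
    laws and laws with nonzero mean at once. *)
Lemma normal_law_exp t X : 0 <= t -> measurable_fun setT X -> normal_law P X ->
  ((3 / 4)%:E <= P [set w | `|X w| <= 2]%R)%E ->
  (\int[P]_w (expR (t * `|X w|))%:E <= (2 * expR (t * 14 + t ^+ 2 * 8))%:E)%E.
Proof.
move=> t0 mX nX X1.
have mE : measurable_fun setT (fun x : R => (expR (t * `|x|))%:E).
  apply/measurable_EFinP; apply: (measurableT_comp (@measurable_expR R)).
  by apply: measurable_funM => //; exact: measurable_normr.
have mS : measurable_fun setT (fun x : R => (\1_I2 x)%:E : \bar R).
  by apply/measurable_EFinP; exact: measurable_indic.
have X1' : ((3 / 4)%:E <= \int[P]_w (\1_I2 (X w))%:E)%E.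
  rewrite (_ : (\int[P]_w _)%E = P [set w | `|X w| <= 2]%R)//.
  rewrite -[X in P X]setIT -integral_indic//; last exact: measurable_norm_le.
  apply: eq_integral => w _; rewrite !indicE; congr (nat_of_bool _)%:R%:E.
  by apply/idP/idP; rewrite !inE/= in_itv/= -ler_norml.
move: X1' => {}X1.
have E0 (x : R) : (0 <= (expR (t * `|x|))%:E)%E by rewrite lee_fin expR_ge0.
have S0 (x : R) : (0 <= (\1_I2 x)%:E :> \bar R)%E by rewrite lee_fin.
case: nX => m [s [[s0 XE]|XE]].
  have mpdf2 := measurable_normal_pdf m (2 * s).
  move: X1; rewrite (@expectation_law X (normal_prob m s) _ mX XE mS S0).
  rewrite (@expectation_law X (normal_prob m s) _ mX XE mE E0).
  rewrite !integral_normal_prob//; under eq_integral do rewrite -EFinM.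
  move=> X1; under eq_integral do rewrite -EFinM.
  have s8 := normal_variance_le8 s0 X1; have m14 := normal_mean_le14 s0 s8 X1.
  have le1 : t * `|m| + t ^+ 2 * s ^+ 2 <= t * 14 + t ^+ 2 * 8.
    by rewrite lerD// ler_wpM2l// sqr_ge0.
  set k := 2 * expR _; have k0 : 0 <= k by rewrite mulr_ge0// expR_ge0.
  rewrite -(integral_scaled_pdf m (2 * s) k0).
  apply: ge0_le_integral => //.
  - by move=> x _; rewrite lee_fin mulr_ge0 ?normal_pdf_ge0 ?expR_ge0.
  - apply/measurable_EFinP; apply: measurable_funM; last exact: measurable_normal_pdf.
    exact/measurable_EFinP.
  - by apply/measurable_EFinP; exact: measurable_funM.
  move=> x _; rewrite lee_fin (le_trans (normal_exp_dominate m x s0 t0))//.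
  rewrite mulrA ler_wpM2r ?normal_pdf_ge0// mulrC ler_wpM2l//.
  by rewrite ler_expR.
have {}XE (B : set R) : measurable B -> P (X @^-1` B) = (@dirac _ (measurableTypeR R) m R) B.
  by move=> mB; rewrite XE.
move: X1; rewrite (expectation_law mX XE mS S0) (expectation_law mX XE mE E0).
rewrite !integral_dirac//= !diracT !mul1e !lee_fin indicE => m1.
rewrite (@le_trans _ _ (expR (t * 14 + t ^+ 2 * 8)))//.
  rewrite ler_expR -[leLHS]addr0 lerD ?mulr_ge0 ?sqr_ge0//.
  rewrite ler_wpM2l//; move: m1; case: (boolP (m \in _)) => [|_ /= h]; last by exfalso; lra.
  rewrite inE/= in_itv/= -ler_norml; lra.
by rewrite mulr_natl mulr2n lerDl expR_ge0.
Qed.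

(** Scaling by [v] reduces to unit scale. *)
Lemma normal_exp_moment t v X : 0 <= t -> 0 < v -> measurable_fun setT X ->
  (forall c, normal_law P (fun w => c * X w)) ->
  ((3 / 4)%:E <= P [set w | `|X w| <= 2 * v]%R)%E ->
  (\int[P]_w (expR (t * `|X w|))%:E <=
     (2 * expR (t * v * 14 + (t * v) ^+ 2 * 8))%:E)%E.
Proof.
move=> t0 v0 mX nX Xv.
have mY : measurable_fun setT (fun w => v^-1 * X w) by exact: measurable_funM.
have tv0 : 0 <= t * v by rewrite mulr_ge0// ltW.
have := normal_law_exp tv0 mY (nX v^-1).
have -> : (\int[P]_w (expR (t * v * `|v^-1 * X w|))%:E =
           \int[P]_w (expR (t * `|X w|))%:E)%E.
  apply: eq_integral => w _; congr (expR _)%:E.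
  by rewrite normrM gtr0_norm ?invr_gt0// mulrA mulfK ?gt_eqF.
apply; apply: (le_trans Xv); rewrite le_eqVlt; apply/orP; left; apply/eqP.
congr (P _); apply/funext => w /=; apply/propext.
by rewrite normrM gtr0_norm ?invr_gt0// ler_pdivrMl// mulrC.
Qed.

(** By [y^p <= exp (p y)] for [y = |X| / v]. *)
Lemma normal_power_moment p v X : 0 < p -> 0 < v -> measurable_fun setT X ->
  (forall c, normal_law P (fun w => c * X w)) ->
  ((3 / 4)%:E <= P [set w | `|X w| <= 2 * v]%R)%E ->
  (\int[P]_w (`|X w| `^ p)%:E <=
     (2 * expR (p * 14 + p ^+ 2 * 8) * v `^ p)%:E)%E.
Proof.
move=> p0 v0 mX nX Xv.
have pv0 : 0 <= p / v by rewrite divr_ge0 ?ltW.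
have := normal_exp_moment pv0 v0 mX nX Xv.
rewrite divfK ?gt_eqF// => le1.
rewrite mulrC EFinM; apply: (@le_trans _ _
  ((v `^ p)%:E * \int[P]_w (expR (p / v * `|X w|))%:E)%E); last first.
  by rewrite lee_wpmul2l// lee_fin powR_ge0.
rewrite -ge0_integralZl_EFin ?powR_ge0//; last first.
  apply/measurable_EFinP; apply: (measurableT_comp (@measurable_expR R)).
  by apply: measurable_funM => //; exact: measurableT_comp.
apply: le_integral_any => w; first by rewrite lee_fin powR_ge0.
rewrite -EFinM lee_fin.
have -> : `|X w| = v * (`|X w| / v) by rewrite mulrC divfK// gt_eqF.
set y := `|X w| / v; have y0 : 0 <= y by rewrite divr_ge0// ltW.
rewrite powRM ?(ltW v0)// ler_wpM2l ?powR_ge0//.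
rewrite mulrA divfK ?gt_eqF// mulrC expRM ge0_ler_powR ?nnegrE ?expR_ge0 ?(ltW p0)//.
by apply: (le_trans _ (expR_ge1Dx y)); rewrite lerDr.
Qed.

(** Turns a bound on the second moment into the concentration hypothesis of the
    moment bounds. *)
Lemma chebyshev_concentration v X : 0 < v -> measurable_fun setT X ->
  (\int[P]_w (X w ^+ 2)%:E <= (v ^+ 2)%:E)%E ->
  ((3 / 4)%:E <= P [set w | `|X w| <= 2 * v]%R)%E.
Proof.
move=> v0 mX Xv; have mA := measurable_norm_le (2 * v) mX.
set A := [set w | _] in mA *.
have v2 : 0 < v ^+ 2 by rewrite exprn_gt0.
have k0 : 0 <= (4 * v ^+ 2)^-1 by rewrite invr_ge0 mulr_ge0// ltW.
have mX2 : measurable_fun setT (fun w => (X w ^+ 2)%:E).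
  by apply/measurable_EFinP; exact: measurable_funX.
have : (1 <= P A + (4^-1)%:E)%E.
  apply: (@le_trans _ _ (P A + ((4 * v ^+ 2)^-1)%:E * \int[P]_w (X w ^+ 2)%:E)%E); last first.
    rewrite leeD2l//; apply: (le_trans (lee_wpmul2l _ Xv)); rewrite ?lee_fin//.
    by rewrite invfM mulfVK// gt_eqF.
  have PE B : measurable B -> P B = (\int[P]_w (\1_B w)%:E)%E.
    by move=> mB; rewrite integral_indic// setIT.
  rewrite -(@probability_setT _ _ _ P) !PE//.
  rewrite -ge0_integralZl_EFin//; last by move=> w _; rewrite lee_fin sqr_ge0.
  rewrite -ge0_integralD//; last 3 first.
  - by apply/measurable_EFinP; exact: measurable_indic.
  - by move=> w _; rewrite -EFinM lee_fin mulr_ge0 ?sqr_ge0.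
  - exact: measurable_funeM.
  apply: le_integral_any => w; first by rewrite lee_fin.
  rewrite -EFinM -EFinD lee_fin !indicE in_setT.
  case: (boolP (w \in A)) => [_|]; first by rewrite lerDl mulr_ge0// sqr_ge0.
  rewrite notin_setE /A/= => /negP; rewrite -ltNge => Xw.
  rewrite add0r ler_pdivlMl ?mulr_gt0// mulr1.
  rewrite -(real_normK (num_real (X w))) (_ : 4 * v ^+ 2 = (2 * v) ^+ 2); last by ring.
  have v2' : 0 <= 2 * v by rewrite mulr_ge0// ltW.
  by rewrite lerXn2r ?nnegrE// ltW.
have := probability_le1 P mA; have := measure_ge0 P A.
case: (P A) => [a|//|//] _ _; rewrite -EFinD !lee_fin; lra.
Qed.

End normal_moments.

(** * Uniform second moments of a continuous Gaussian field *)

Section fatou_cvg.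
Context {d : measure_display} {T : measurableType d} {R : realType}.

Lemma fatou_bound (mu : {measure set T -> \bar R}) (f : nat -> T -> R)
    (g : T -> R) (c : \bar R) :
  (forall n, measurable_fun setT (f n)) -> (forall n x, 0 <= f n x) ->
  (forall x, f n x @[n --> \oo] --> g x) ->
  (forall n, (\int[mu]_x (f n x)%:E <= c)%E) -> (\int[mu]_x (g x)%:E <= c)%E.
Proof.
move=> mf f0 fg fc.
have := @fatou _ _ _ mu setT measurableT (fun n x => (f n x)%:E).
have -> : (fun x => limn_einf (fun n => (f n x)%:E)) = (fun x => (g x)%:E).
  apply/funext => x.
  have h : (f n x)%:E @[n --> \oo] --> (g x)%:E.
    by apply: cvg_EFin; [exact: nearW|exact: fg].
  by rewrite (cvg_limn_einf_sup h).1.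
move=> fat; apply: (le_trans (fat _ _)).
- by move=> n; apply/measurable_EFinP.
- by move=> n x _; rewrite lee_fin.
rewrite limn_einf_lim; apply: lime_le; first exact: is_cvg_einfs.
apply: nearW => n; apply: (le_trans _ (fc n)).
by apply: ereal_inf_lbound; exists n => //=.
Qed.
End fatou_cvg.

Section interp_integral.
Context {R : realType} {d : measure_display} {T : measurableType d}.

Lemma integral_sum_ge0 (mu : {measure set T -> \bar R}) n (f : 'I_n -> T -> R) :
  (forall i, measurable_fun setT (f i)) -> (forall i w, 0 <= f i w) ->
  (\int[mu]_w (\sum_(i < n) f i w)%:E = \sum_(i < n) \int[mu]_w (f i w)%:E)%E.
Proof.
move=> mf f0; rewrite -ge0_integral_sum//.
- by apply: eq_integral => w _; rewrite -sumEFin.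
- by move=> i; apply/measurable_EFinP.
- by move=> i w _; rewrite lee_fin.
Qed.

Lemma measurable_interp_at (L : R) N (F : T -> R * R -> R) (x : R * R) : 0 < L ->
  (forall z, csq L z -> measurable_fun setT (F^~ z)) ->
  measurable_fun setT (fun w => interp L N (F w) x).
Proof.
move=> L0 mF; apply: measurable_sum => i; apply: measurable_sum => j.
do 2 apply: measurable_funM => //.
by apply: mF; exact: grid_csq.
Qed.

(** The integral of the interpolant is the average, with the same weights, of
    the integrals at the nodes of the cell. *)
Lemma integral_interp_le (mu : {measure set T -> \bar R}) (L : R) N
    (F : T -> R * R -> R) (x : R * R) (c : R) :
  0 < L -> (0 < N)%N -> csq L x ->
  (forall z, csq L z -> measurable_fun setT (F^~ z)) ->
  (forall w z, csq L z -> 0 <= F w z) ->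
  (forall i j : 'I_N.+1, let z := (i%:R * (L / N%:R), j%:R * (L / N%:R)) in
    `|x.1 - z.1| <= L / N%:R -> `|x.2 - z.2| <= L / N%:R ->
    (\int[mu]_w (F w z)%:E <= c%:E)%E) ->
  (\int[mu]_w (interp L N (F w) x)%:E <= c%:E)%E.
Proof.
move=> L0 N0 xL mF F0 Fc; rewrite /interp.
set h := L / N%:R.
pose k (i j : 'I_N.+1) := hat (x.1 / h - i%:R) * hat (x.2 / h - j%:R).
pose z (i j : 'I_N.+1) : R * R := (i%:R * h, j%:R * h).
have zL i j : csq L (z i j) by exact: grid_csq.
have k0 i j : 0 <= k i j by rewrite mulr_ge0// hat_ge0.
have mk i j : measurable_fun setT (fun w => F w (z i j) * k i j).
  by apply: measurable_funM => //; exact: mF.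
have Fk0 i j w : 0 <= F w (z i j) * k i j by rewrite mulr_ge0// F0.
have mS i : measurable_fun setT (fun w => \sum_(j < N.+1) F w (z i j) * k i j).
  exact: measurable_sum.
have -> : (\int[mu]_w (\sum_(i < N.+1) \sum_(j < N.+1) F w (i%:R * h, j%:R * h)
    * hat (x.1 / h - i%:R) * hat (x.2 / h - j%:R))%:E =
  \int[mu]_w (\sum_(i < N.+1) \sum_(j < N.+1) F w (z i j) * k i j)%:E)%E.
  apply: eq_integral => w _; congr (_%:E); apply: eq_bigr => i _.
  by apply: eq_bigr => j _; rewrite -mulrA.
rewrite integral_sum_ge0//; last by move=> i w; apply: sumr_ge0.
rewrite -[leRHS](congr1 EFin (interp_cst c L0 N0 xL)) /interp -/h -sumEFin.
apply: lee_sum => i _; rewrite integral_sum_ge0// -sumEFin; apply: lee_sum => j _.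
rewrite -mulrA -/(k i j).
have -> : (\int[mu]_w (F w (z i j) * k i j)%:E =
           \int[mu]_w (F w (z i j))%:E * (k i j)%:E)%E.
  rewrite -ge0_integralZr//.
  - by apply/measurable_EFinP; exact: mF.
  - by move=> w _; rewrite lee_fin F0.
  - by rewrite lee_fin.
rewrite (EFinM c (k i j)); have [hx|hx] := leP `|x.1 - i%:R * h| h; last first.
  rewrite /k; have [->|/hat_near] := eqVneq (hat (x.1 / h - i%:R)) 0.
    by rewrite mul0r !mule0.
  by move=> /(_ L0 N0) /le_lt_trans /(_ hx); rewrite ltxx.
have [hy|hy] := leP `|x.2 - j%:R * h| h; last first.
  rewrite /k; have [->|/hat_near] := eqVneq (hat (x.2 / h - j%:R)) 0.
    by rewrite mulr0 !mule0.
  by move=> /(_ L0 N0) /le_lt_trans /(_ hy); rewrite ltxx.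
by apply: lee_wpmul2r; [rewrite lee_fin|exact: Fc].
Qed.
End interp_integral.

Section field_variance.
Context {R : realType} {d : measure_display} {T : measurableType d}.
Variables (P : probability T R) (L : R) (W : T -> R * R -> R).
Hypotheses (L0 : 0 < L) (gW : gaussian_field P (csq L) W).

Lemma field_measurable z : csq L z -> measurable_fun setT (W^~ z).
Proof. by case: gW => mW _; exact: mW. Qed.

(** All multiples are normal, degenerate or not; this is the form in which
    [normal_exp_moment] rescales. *)
Lemma field_normal z : csq L z -> forall c, normal_law P (fun w => c * W w z).
Proof.
move=> zL c; have [_ /(_ 1%N (fun=> z) (fun=> c) (fun=> zL))] := gW.
by congr (normal_law P _); apply/funext => w; rewrite big_ord1.
Qed.

Lemma field_normalB z z' : csq L z -> csq L z' ->
  forall c, normal_law P (fun w => c * (W w z - W w z')).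
Proof.
move=> zL zL' c; have [_ /(_ 2%N (fun i => if i == 0 :> nat then z else z')
  (fun i => if i == 0 :> nat then c else - c)) h] := gW.
have {}h := h (fun i => if i == 0 :> nat as b return csq L (if b then z else z') then zL else zL').
move: h; congr (normal_law P _); apply/funext => w.
by rewrite big_ord_recl big_ord1 /= mulNr mulrBr.
Qed.

Hypothesis cW : forall w, {within csq L, continuous (W w)}.

Lemma field_bounded w : exists M : nat, forall z, csq L z -> `|W w z| <= M%:R.
Proof.
have kL : compact (csq L) by apply: compact_setX; exact: segment_compact.
have : bounded_set (W w @` csq L).
  by apply: compact_bounded; apply: continuous_compact.
move=> [M [_ /(_ (M + 1))]]; rewrite ltrDl ltr01 => /(_ isT) vM.
exists (Num.trunc (M + 1)).+1 => z zL; apply: ltW.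
by apply: le_lt_trans (truncnS_gt _); apply: vM; exists z.
Qed.

Let node (N i j : nat) : R * R :=
  ((minn i N)%:R * (L / N%:R), (minn j N)%:R * (L / N%:R)).

Let node_csq N i j : csq L (node N i j).
Proof.
by split; rewrite /= in_itv/=; apply: grid_in => //; rewrite ltnS geq_minr.
Qed.

(** Tightness: continuous paths are bounded, so one constant bounds the values
    at all nodes of all grids with probability at least [3/4], which for normal
    laws bounds the second moments at the nodes; Jensen's inequality and Fatou's
    lemma along the interpolants reach the other points. The bound is not
    explicit and only serves to justify exchanging integrals. *)
Lemma field_variance_bounded : exists2 M : R, 0 < M &
  forall z, csq L z -> (\int[P]_w (W w z ^+ 2)%:E <= M%:E)%E.
Proof.
(* Intersecting over the nodes of all grids keeps the event measurable. *)
pose A (M : nat) := \bigcap_N \bigcap_i \bigcap_j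
  [set w | `|W w (node N i j)| <= M%:R].
have mA M : measurable (A M).
  apply: bigcapT_measurable => N; apply: bigcapT_measurable => i.
  apply: bigcapT_measurable => j; apply: measurable_norm_le.
  exact: field_measurable.
have AT : \bigcup_M A M = setT.
  apply/seteqP; split=> // w _; have [M WM] := field_bounded w.
  by exists M => // N _ i _ j _; exact: WM.
have /= := @nondecreasing_cvg_mu _ _ _ P A mA.
rewrite AT => /(_ measurableT) /=; rewrite probability_setT => PA.
have [M PM] : exists M, ((3 / 4)%:E <= P (A M))%E.
  have {}PA : (P \o A) x @[x --> \oo] --> 1%E.
    apply: PA => m n mn; apply/subsetPset => w Am N _ i _ j _ /=.
    by apply: (le_trans (Am N I i I j I)); rewrite ler_nat.
  apply: contrapT => nP.
  have : (limn (P \o A) <= (3 / 4)%:E)%E.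
    apply: lime_le; first by apply/cvg_ex; exists 1%E.
    by apply: nearW => M; rewrite leNgt; apply/negP => /ltW PM; apply: nP; exists M.
  by rewrite (cvg_lim _ PA)// lee_fin; apply/negP; rewrite -ltNge; lra.
have M0 : 0 < M.+1%:R / 2 :> R by rewrite divr_gt0.
pose C : R := 2 * expR (2 * 14 + 2 ^+ 2 * 8) * (M.+1%:R / 2) `^ 2.
have grid N i j : (\int[P]_w (W w (node N i j) ^+ 2)%:E <= C%:E)%E.
  have zL := node_csq N i j.
  have -> : (\int[P]_w (W w (node N i j) ^+ 2)%:E =
             \int[P]_w (`|W w (node N i j)| `^ 2)%:E)%E.
    by apply: eq_integral => w _; rewrite powR_mulrn// real_normK ?num_real.
  apply: (normal_power_moment _ M0 (field_measurable zL) (field_normal zL)) => //.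
  apply: (le_trans PM); apply: le_measure; rewrite ?inE//.
    by apply: measurable_norm_le; exact: field_measurable.
  move=> w /(_ N I i I j I) /= WM; rewrite mulrC divfK//.
  by rewrite (le_trans WM)// ler_nat.
exists C; first by rewrite mulr_gt0 ?powR_gt0// mulr_gt0// expR_gt0.
move=> z zL.
apply: (@fatou_bound _ _ _ P (fun n w => interp L n.+1 (W w) z ^+ 2)).
- move=> n; apply: measurable_funX.
  exact: (measurable_interp_at _ _ L0 field_measurable).
- by move=> n w; exact: sqr_ge0.
- by move=> w; rewrite expr2; under eq_fun do rewrite expr2; apply: cvgM; exact: cvg_interp.
move=> n; apply: (@le_trans _ _ (\int[P]_w (interp L n.+1 (fun z => W w z ^+ 2) z)%:E)%E).
  apply: le_integral_any => w; first by rewrite lee_fin sqr_ge0.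
  rewrite lee_fin.
  apply: (@jensen_interp _ L n.+1 (W w) z (fun a => a ^+ 2) (fun a => 2 * a)) => //.
  by move=> a b; have := sqr_ge0 (a - b); nra.
apply: (@integral_interp_le _ _ _ P L n.+1 (fun w z => W w z ^+ 2)) => //.
- by move=> z' zL'; apply: measurable_funX; exact: field_measurable.
- by move=> w z' _; exact: sqr_ge0.
move=> i j z' _ _; have := grid n.+1 i j; rewrite /node.
have iN (k : 'I_n.+2) : minn k n.+1 = k by apply/minn_idPl; rewrite -ltnS.
by rewrite !iN.
Qed.

End field_variance.

(** * Fubini's theorem for random fields *)

Section leb2_sigma_finite.
Context {R : realType}.
Local Notation RR := (measurableTypeR R * measurableTypeR R)%type.

Lemma leb2_sigma_finite : sigma_finite setT (@leb2 R : set RR -> \bar R).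
Proof.
pose I n : set R := `](- n%:R)%R, n%:R[%classic.
exists (fun n => I n `*` I n).
  apply/esym/seteqP; split=> // z _.
  have zi (t : R) n : (Num.trunc `|t| < n)%N -> I n t.
    rewrite /I /= in_itv/= -ltr_norml => h; apply: lt_le_trans (truncnS_gt _) _.
    by rewrite ler_nat.
  exists (maxn (Num.trunc `|z.1|) (Num.trunc `|z.2|)).+1 => //.
  by split; apply: zi; rewrite ltnS ?leq_maxl ?leq_maxr.
move=> n; split; first by apply: measurableX; exact: measurable_itv.
have mI : lebesgue_measure (I n) = (n%:R + n%:R)%:E.
  rewrite /I lebesgue_measure_itv/= lte_fin; case: ifPn => [_|]; first by rewrite -EFinD opprK.
  rewrite -leNgt => h; have : (0 : R) <= n%:R by []; move=> h'.
  by have -> : n%:R = 0 :> R by [lra]; rewrite addr0.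
rewrite /leb2 product_measure1E; try exact: measurable_itv.
rewrite [X in (X * _)%E](_ : _ = (n%:R + n%:R)%:E); last exact: mI.
rewrite [X in (_ * X)%E](_ : _ = (n%:R + n%:R)%:E); last exact: mI.
by rewrite -EFinM ltry.
Qed.

HB.instance Definition _ := Measure.on (@leb2 R : set RR -> \bar R).
HB.instance Definition _ :=
  Measure_isSigmaFinite.Build _ RR R (@leb2 R) leb2_sigma_finite.
End leb2_sigma_finite.

Section fubini_random_field.
Context {R : realType} {d : measure_display} {T : measurableType d}.
Variable P : probability T R.
Implicit Types (L : R).
Local Notation RR := (measurableTypeR R * measurableTypeR R)%type.
Let nu : {sigma_finite_measure set RR -> \bar R} := @leb2 R.

(** Tonelli's theorem on the product of the sample space with the square, for
    functions that are measurable there and extended by zero. *)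
Lemma tonelli_field L (f : T * (R * R) -> \bar R) :
  measurable_fun ([set: T] `*` sq L) f -> (forall x, 0 <= f x)%E ->
  measurable_fun setT (fun w => \int[leb2]_(y in sq L) f (w, y))%E /\
  (\int[P]_w \int[leb2]_(y in sq L) f (w, y) =
   \int[leb2]_(y in sq L) \int[P]_w f (w, y))%E.
Proof.
move=> mf f0; pose g := f \_ ([set: T] `*` sq L).
have mS : measurable ([set: T] `*` sq L) by apply: measurableX => //; exact: measurable_sq.
have mg : measurable_fun setT g by apply/(measurable_restrictT _ mS).
have g0 z : (0 <= g z)%E by rewrite /g /patch; case: ifP.
have gE w y : g (w, y) = ((fun y => f (w, y)) \_ (sq L)) y.
  rewrite /g /patch; case: ifPn => [|]; first by rewrite inE => -[_ /= yL]; rewrite mem_set.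
  by rewrite notin_setE /= => h; case: ifPn => // /set_mem yL; exfalso; apply: h.
split.
  have := @measurable_fun_fubini_tonelli_F _ _ T RR R nu g mg g0.
  apply: eq_measurable_fun => w _; rewrite [RHS]integral_mkcond /fubini_F.
  by apply: eq_integral => y _; rewrite gE.
have := @fubini_tonelli _ _ T RR R P nu g mg g0.
move=> h; transitivity (\int[P]_x \int[nu]_y g (x, y))%E.
  apply: eq_integral => w _; rewrite [LHS]integral_mkcond.
  by apply: eq_integral => y _; rewrite gE.
rewrite h [RHS]integral_mkcond; apply: eq_integral => y _.
rewrite [RHS]/patch; case: ifPn => yL.
  by apply: eq_integral => w _; rewrite gE /patch yL.
by rewrite integral0_eq// => w _; rewrite gE /patch (negbTE yL).
Qed.

Lemma integrable_field L (f : T * (R * R) -> \bar R) :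
  measurable_fun ([set: T] `*` sq L) f ->
  (\int[leb2]_(y in sq L) \int[P]_w `|f (w, y)| < +oo)%E ->
  [/\ P.-integrable setT (fun w => \int[leb2]_(y in sq L) f (w, y))%E,
  @measurable_fun _ _ RR (\bar R) (sq L) (fun y => \int[P]_w f (w, y))%E &
  (\int[P]_w \int[leb2]_(y in sq L) f (w, y) =
   \int[leb2]_(y in sq L) \int[P]_w f (w, y))%E].
Proof.
move=> mf fi; pose g := f \_ ([set: T] `*` sq L).
have mS : measurable ([set: T] `*` sq L) by apply: measurableX => //; exact: measurable_sq.
have mg : measurable_fun setT g by apply/(measurable_restrictT _ mS).
have gE w y : g (w, y) = ((fun y => f (w, y)) \_ (sq L)) y.
  rewrite /g /patch; case: ifPn => [|]; first by rewrite inE => -[_ /= yL]; rewrite mem_set.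
  by rewrite notin_setE /= => h; case: ifPn => // /set_mem yL; exfalso; apply: h.
have gi : (P \x nu)%E.-integrable setT g.
  apply/(integrable21ltyP P nu mg); move: fi; congr (_ < _)%E.
  rewrite [LHS]integral_mkcond; apply: eq_integral => y _.
  rewrite [LHS]/patch; case: ifPn => yL.
    by apply: eq_integral => w _; rewrite gE /patch yL.
  by rewrite integral0_eq// => w _; rewrite gE /patch (negbTE yL) abse0.
have FE w : (fubini_F nu g w = \int[leb2]_(y in sq L) f (w, y))%E.
  rewrite [RHS]integral_mkcond /fubini_F; apply: eq_integral => y _.
  by rewrite gE.
have GE y : (fubini_G P g y = ((fun y => \int[P]_w f (w, y)) \_ (sq L)) y)%E.
  rewrite /fubini_G [RHS]/patch; case: ifPn => yL.
    by apply: eq_integral => w _; rewrite gE /patch yL.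
  by rewrite integral0_eq// => w _; rewrite gE /patch (negbTE yL).
split.
- have := @integrable_fubini_F _ _ _ _ _ P nu g gi.
  by apply: eq_integrable => // w _; rewrite FE.
- apply/(measurable_restrictT _ (msq L)).
  have := @measurable_fubini_G _ _ _ _ _ P nu g gi.
  by congr (measurable_fun _ _); apply/funext => y; exact: GE.
transitivity (\int[P]_x fubini_F nu g x)%E.
  by apply: eq_integral => w _; rewrite FE.
rewrite integral12_prod_meas1// -integral21_prod_meas1//.
by rewrite [RHS]integral_mkcond; apply: eq_integral => y _; exact: GE.
Qed.

End fubini_random_field.

(** * Weighted averages of a field and the expansion of its covariance *)

Section sq_jensen.
Context {R : realType}.

(** From the nonnegativity of the integral of the squared deviation from the
    mean. *)
Lemma sq_jensen L (g : R * R -> R) : 0 < L -> L2 L g ->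
  (((\int[leb2]_(x in sq L) g x)%R ^+ 2)%:E <=
   (L ^+ 2)%:E * \int[leb2]_(x in sq L) (g x ^+ 2)%:E)%E.
Proof.
move=> L0 Lg; have L20 : 0 < L ^+ 2 by rewrite exprn_gt0.
set G := (\int[leb2]_(x in sq L) g x)%R; pose c := G / L ^+ 2.
have ig := L2_integrable L0 Lg; have ig2 := L2_sqr_integrable Lg.
have ic := L2_integrable L0 (L2_cst (c ^+ 2) L0).
have Ec : (\int[leb2]_(x in sq L) (c ^+ 2))%R = c ^+ 2 * L ^+ 2.
  rewrite /Rintegral integral_cst; last exact: msq.
  transitivity (fine ((c ^+ 2)%:E * (L ^+ 2)%:E)%E) => //.
  by congr (fine (_ * _)%E); exact: leb2_sq.
have fin := integrable_fin_num (msq L) ig2.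
rewrite -(fineK fin) -EFinM lee_fin.
have : 0 <= (\int[leb2]_(x in sq L) (g x ^+ 2 - (2 * c) * g x + c ^+ 2))%R.
  apply: Rintegral_ge0 => x _.
  by have := sqr_ge0 (g x - c); nra.
have i1 := integrableZl (msq L) (2 * c) ig.
rewrite RintegralD//; last 2 first.
- exact: msq.
- exact: (integrableB (msq L) ig2 i1).
rewrite RintegralB//; last exact: msq.
rewrite RintegralZl//; last exact: msq.
rewrite Ec -/G; rewrite /Rintegral => h.
have cE : c * L ^+ 2 = G by rewrite /c divfK// gt_eqF.
have : c * G = c ^+ 2 * L ^+ 2 by rewrite -cE; ring.
move=> cG; rewrite -/(fine _) in h.
have {}h : c * G <= fine (\int[leb2]_(x in sq L) (g x ^+ 2)%:E)%E by lra.
have := ler_wpM2l (ltW L20) h; rewrite mulrCA mulrA mulrC cE; lra.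
Qed.

End sq_jensen.

Section field_integrals.
Context {R : realType} {d : measure_display} {T : measurableType d}.
Variables (P : probability T R) (L : R) (W : T -> R * R -> R) (M : R).
Hypotheses (L0 : 0 < L)
  (mW : forall z, csq L z -> measurable_fun setT (W^~ z))
  (cW : forall w, {within csq L, continuous (W w)})
  (M0 : 0 < M)
  (WM : forall z, csq L z -> (\int[P]_w (W w z ^+ 2)%:E <= M%:E)%E).

Local Notation RR := (measurableTypeR R * measurableTypeR R)%type.
Implicit Types (phi : R * R -> R) (X : T -> R).

Definition pairing (phi : R * R -> R) (w : T) : R :=
  (\int[leb2]_(y in sq L) (phi y * W w y))%R.

Lemma measurable_field_sq w : measurable_fun (sq L) (W w).
Proof.
apply: (measurable_funS (measurable_csq _) (@sq_csq _ L)).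
exact: continuous_measurable2.
Qed.

Lemma field_L2 w : L2 L (W w).
Proof.
have [B WB] : exists B : nat, forall z, csq L z -> `|W w z| <= B%:R.
  exact: field_bounded.
apply: (@bounded_L2 _ _ _ B%:R) => // [|x xL]; first exact: measurable_field_sq.
exact/WB/sq_csq.
Qed.

Lemma field_L2M phi (B : R) w : measurable_fun (sq L) phi ->
  (forall y, sq L y -> `|phi y| <= B) -> L2 L (fun y => phi y * W w y).
Proof. by move=> mphi phiB; apply: (L2_bdM mphi phiB); exact: field_L2. Qed.

Lemma measurable_field_joint phi : measurable_fun (sq L) phi ->
  measurable_fun ([set: T] `*` sq L) (fun z => phi z.2 * W z.1 z.2).
Proof.
move=> mphi; apply: measurable_funM.
  have ms : measurable_fun ([set: T] `*` sq L) (@snd T (R * R)).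
    by apply: measurable_funTS; exact: measurable_snd.
  apply: (measurable_comp _ _ mphi ms); first exact: measurable_sq.
  by move=> _ [z [_ zL] <-].
apply: (measurable_funS _ _ (caratheodory_measurable L0 mW cW)).
  by apply: measurableX => //; exact: measurable_csq.
by move=> [w z] [_ zL]; split => //; exact: sq_csq.
Qed.

(** Fubini's theorem for a square-integrable random variable times a weighted
    average of the field. *)
Lemma expectation_pairing X phi (B V : R) :
  measurable_fun setT X -> (\int[P]_w (X w ^+ 2)%:E <= V%:E)%E ->
  measurable_fun (sq L) phi -> (forall y, sq L y -> `|phi y| <= B) ->
  [/\ P.-integrable setT (fun w => (X w * pairing phi w)%:E),
  @measurable_fun _ _ RR (\bar R) (sq L)
    (fun y => (phi y * (\int[P]_w (X w * W w y))%R)%:E) &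
  (\int[P]_w (X w * pairing phi w)%:E =
   \int[leb2]_(y in sq L) (phi y * \int[P]_w (X w * W w y))%:E)%E].
Proof.
move=> mX XV mphi phiB.
pose f (z : T * (R * R)) := (X z.1 * (phi z.2 * W z.1 z.2))%:E.
have mf : measurable_fun ([set: T] `*` sq L) f.
  apply/measurable_EFinP; apply: measurable_funM; last exact: measurable_field_joint.
  by apply: measurable_funTS; apply: measurableT_comp.
have XW y : sq L y -> (\int[P]_w `|X w * W w y|%:E <= (V + M)%:E)%E.
  move=> yL; have yL' := sq_csq yL.
  have mX2 : measurable_fun setT (fun w => (X w ^+ 2)%:E).
    by apply/measurable_EFinP; exact: measurable_funX.
  have mW2 : measurable_fun setT (fun w => (W w y ^+ 2)%:E).
    by apply/measurable_EFinP; apply: measurable_funX; exact: mW.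
  rewrite EFinD; apply: (le_trans _ (leeD XV (WM yL'))).
  rewrite -ge0_integralD//; last 2 first.
  - by move=> w _; rewrite lee_fin sqr_ge0.
  - by move=> w _; rewrite lee_fin sqr_ge0.
  apply: le_integral_any => w; first by rewrite lee_fin.
  rewrite -EFinD lee_fin ler_norml; apply/andP; split.
    by have := sqr_ge0 (X w + W w y); have := sqr_ge0 (X w - W w y); nra.
  by have := sqr_ge0 (X w + W w y); have := sqr_ge0 (X w - W w y); nra.
have B0 y : sq L y -> 0 <= B by move=> yL; exact: le_trans (phiB y yL).
have iXW y : sq L y -> P.-integrable setT (fun w => (X w * W w y)%:E).
  move=> yL; apply/integrableP; split.
    by apply/measurable_EFinP; apply: measurable_funM => //; apply: mW; exact: sq_csq.
  by apply: (le_lt_trans (XW y yL)); rewrite ltry.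
have fi : (\int[leb2]_(y in sq L) \int[P]_w `|f (w, y)| < +oo)%E.
  apply: (@le_lt_trans _ _ (\int[leb2]_(y in sq L) (B * (V + M))%:E)%E); last first.
    rewrite integral_cst; last exact: msq.
    apply: (@eq_ind_r _ ((L ^+ 2)%:E) (fun x => ((B * (V + M))%:E * x < +oo)%E)).
      by rewrite -EFinM ltry.
    exact: leb2_sq.
  rewrite integral_mkcond [leRHS]integral_mkcond.
  apply: le_integral_any => y; rewrite /patch; case: ifPn => // /set_mem yL.
    by apply: integral_ge0.
  apply: (@le_trans _ _ (\int[P]_w (B%:E * `|X w * W w y|%:E))%E).
    apply: le_integral_any => w; first exact: abse_ge0.
    rewrite /f /= -EFinM lee_fin mulrCA normrM ler_wpM2r//.
    exact: phiB.
  rewrite ge0_integralZl_EFin ?(B0 y)//; last first.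
    apply/measurable_EFinP; apply: measurableT_comp => //.
    by apply: measurable_funM => //; apply: mW; exact: sq_csq.
  by rewrite EFinM lee_wpmul2l ?lee_fin ?(B0 y)//; exact: XW.
have [fint fint2 fE] := integrable_field mf fi.
have XE w : ((X w * pairing phi w)%:E = \int[leb2]_(y in sq L) f (w, y))%E.
  have i1 := L2_integrable L0 (field_L2M w mphi phiB).
  rewrite EFinM /pairing -(Rintegral_EFin i1) -integralZl//; first exact: msq.
have YE y : sq L y ->
    ((phi y * (\int[P]_w (X w * W w y))%R)%:E = \int[P]_w f (w, y))%E.
  move=> yL.
  rewrite EFinM [in LHS]/Rintegral fineK; last exact: (integrable_fin_num _ (iXW y yL)).
  rewrite -integralZl//; last exact: iXW.
  by apply: eq_integral => w _; rewrite /f/= -EFinM mulrCA.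
split.
- by move: fint; apply: eq_integrable => // w _; rewrite XE.
- by move: fint2; apply: eq_measurable_fun => y /set_mem yL; rewrite YE.
under eq_integral do rewrite XE.
by rewrite fE; apply: eq_integral => y /set_mem yL; rewrite YE.
Qed.

Lemma integral_patch_sq (f : R * R -> \bar R) (c : \bar R) : (0 <= c)%E ->
  (forall y, sq L y -> (0 <= f y)%E) -> (forall y, sq L y -> (f y <= c)%E) ->
  (\int[leb2]_(y in sq L) f y <= c * (L ^+ 2)%:E)%E.
Proof.
move=> c0 f0 fc.
apply: (@le_trans _ _ (\int[leb2]_(y in sq L) c)%E); last first.
  rewrite integral_cst; last exact: msq.
  by rewrite le_eqVlt; apply/orP; left; apply/eqP; congr (_ * _)%E; exact: leb2_sq.
rewrite integral_mkcond [leRHS]integral_mkcond.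
apply: le_integral_any => y; rewrite /patch; case: ifPn => // /set_mem yL.
- exact: f0.
- exact: fc.
Qed.

(** Jensen's inequality under the expectation; the constant is crude, and
    [pairing_variance] replaces it once the averages are known to be
    measurable. *)
Lemma pairing_square phi (B : R) :
  measurable_fun (sq L) phi -> (forall y, sq L y -> `|phi y| <= B) ->
  measurable_fun setT (pairing phi) /\
  (\int[P]_w (pairing phi w ^+ 2)%:E <= (L ^+ 2 * (B ^+ 2 * M * L ^+ 2))%:E)%E.
Proof.
move=> mphi phiB.
have one : (\int[P]_w ((1 : R) ^+ 2)%:E <= 1%:E)%E.
  by rewrite expr1n -[leRHS]mul1e -(@probability_setT _ _ _ P) integral_cst.
have [i1 _ _] := expectation_pairing (measurable_cst (1 : R)) one mphi phiB.
split.
  have := measurable_int _ i1 => /measurable_EFinP.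
  by apply: eq_measurable_fun => w _; rewrite mul1r.
have B0 : 0 <= B ^+ 2 by exact: sqr_ge0.
have mf : measurable_fun ([set: T] `*` sq L) (fun z : T * (R * R) => ((phi z.2 * W z.1 z.2) ^+ 2)%:E).
  by apply/measurable_EFinP; apply: measurable_funX; exact: measurable_field_joint.
apply: (@le_trans _ _ (\int[P]_w ((L ^+ 2)%:E * \int[leb2]_(y in sq L) ((phi y * W w y) ^+ 2)%:E)))%E.
  apply: le_integral_any => w; first by rewrite lee_fin sqr_ge0.
  by apply: (sq_jensen L0); exact: (field_L2M w mphi phiB).
have f0 (z : T * (R * R)) : (0 <= ((phi z.2 * W z.1 z.2) ^+ 2)%:E)%E by rewrite lee_fin sqr_ge0.
have [mI h] := tonelli_field P mf f0.
rewrite ge0_integralZl_EFin ?sqr_ge0//; last by move=> w _; apply: integral_ge0 => y _; rewrite lee_fin sqr_ge0.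
rewrite (EFinM (L ^+ 2)) lee_wpmul2l ?lee_fin ?sqr_ge0//.
rewrite [leLHS]h.
rewrite (EFinM (B ^+ 2 * M)); apply: integral_patch_sq.
- by rewrite lee_fin mulr_ge0// ltW.
- by move=> y _; apply: integral_ge0 => w _; rewrite lee_fin sqr_ge0.
move=> y yL; rewrite EFinM.
apply: (@le_trans _ _ ((B ^+ 2)%:E * \int[P]_w (W w y ^+ 2)%:E)%E); last first.
  by rewrite lee_wpmul2l ?lee_fin//; apply: WM; exact: sq_csq.
rewrite -ge0_integralZl_EFin//; last 2 first.
- by move=> w _; rewrite lee_fin sqr_ge0.
- by apply/measurable_EFinP; apply: measurable_funX; apply: mW; exact: sq_csq.
apply: le_integral_any => w; first by rewrite lee_fin sqr_ge0.
rewrite -EFinM lee_fin exprMn ler_wpM2r ?sqr_ge0//.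
by rewrite -(real_normK (num_real (phi y))) lerXn2r ?nnegrE ?phiB// (le_trans _ (phiB y yL)).
Qed.

Variables (e : nat -> R * R -> R) (lam : nat -> R) (Ce : R).
Hypotheses (oe : orthonormal_basis L e)
  (be : forall i y, sq L y -> `|e i y| <= Ce)
  (eig : forall i, {ae leb2, forall z : R * R, sq L z ->
    (\int[leb2]_(y in sq L) ((\int[P]_w (W w z * W w y)) * e i y))%R
      = lam i * e i z}).

Let me i : measurable_fun (sq L) (e i).
Proof. by have [/(_ i) []] := oe. Qed.

Let eL2 i : L2 L (e i).
Proof. by have [/(_ i)] := oe. Qed.

(** The averages against the eigenfunctions are uncorrelated with variances [lam
    i]: two applications of Fubini's theorem turn the covariance function into
    its integral operator. *)
Lemma pairing_eigen i j :
  P.-integrable setT (fun w => (pairing (e i) w * pairing (e j) w)%:E) /\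
  (\int[P]_w (pairing (e i) w * pairing (e j) w)%:E = (lam i * (i == j)%:R)%:E)%E.
Proof.
have [mi Ei] := pairing_square (me i) (be i).
have [ij ij2 ->] := expectation_pairing mi Ei (me j) (be j).
split=> //.
have [_ /(_ i j) orth _] := oe.
have ie := L2_integrableM (eL2 i) (eL2 j).
rewrite -orth EFinM -(Rintegral_EFin ie) -integralZl//; last exact: msq.
apply: ae_eq_integral.
- exact: msq.
- exact: ij2.
- by apply: measurable_funeM; exact: measurable_int ie.
have := eig i; apply: filterS => y; move=> /[swap] yL /(_ yL) eigy /=.
rewrite -EFinM; congr (_%:E).
have [_ _ h] := expectation_pairing (mW (sq_csq yL)) (WM (sq_csq yL)) (me i) (be i).
have -> : (\int[P]_w (pairing (e i) w * W w y))%R = lam i * e i y.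
  rewrite -eigy /Rintegral; congr fine.
  transitivity (\int[P]_w (W w y * pairing (e i) w)%:E)%E.
    by apply: eq_integral => w _; rewrite mulrC.
  by rewrite h; apply: eq_integral => z _; rewrite mulrC.
by ring.
Qed.

Lemma pairing_sum (c : nat -> R) n w :
  pairing (fun y => \sum_(i < n) c i * e i y) w =
  \sum_(i < n) c i * pairing (e i) w.
Proof.
have iI i := L2_integrable L0 (field_L2M w (me i) (be i)).
elim: n => [|n IH].
  rewrite big_ord0 /pairing /Rintegral integral0_eq// => y _.
  by rewrite big_ord0 mul0r.
rewrite big_ord_recr /= -IH /pairing.
rewrite -RintegralZl//; last exact: msq.
rewrite -RintegralD//.
- by apply: eq_Rintegral => y _; rewrite big_ord_recr /= mulrDl mulrA.
- exact: msq.
- have mS : measurable_fun (sq L) (fun y => \sum_(i < n) c i * e i y).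
    by apply: measurable_sum => i; apply: measurable_funM.
  apply: (L2_integrable L0); apply: (@field_L2M _ (\sum_(i < n) `|c i| * Ce) _ mS).
  move=> y yL; apply: (le_trans (ler_norm_sum _ _ _)); apply: ler_sum => i _.
  by rewrite normrM ler_wpM2l// be.
- have := integrableZl (msq L) (c n) (iI n).
  by apply: eq_integrable => //; exact: msq.
Qed.

Lemma integral_pairing_sum (c : nat -> R) n :
  (\int[P]_w ((\sum_(i < n) c i * pairing (e i) w) ^+ 2)%:E =
   (\sum_(i < n) lam i * c i ^+ 2)%:E)%E.
Proof.
have iI (i j : nat) : P.-integrable setT
    (fun w => (c i * c j)%:E * (pairing (e i) w * pairing (e j) w)%:E)%E.
  by apply: integrableZl => //; have [] := pairing_eigen i j.
transitivity (\int[P]_w \sum_(i < n) \sum_(j < n)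
    ((c i * c j)%:E * (pairing (e i) w * pairing (e j) w)%:E))%E.
  apply: eq_integral => w _; rewrite expr2 mulr_suml -sumEFin; apply: eq_bigr => i _.
  rewrite mulr_sumr -sumEFin; apply: eq_bigr => j _.
  by rewrite -EFinM; congr (_%:E); ring.
rewrite integral_sum//; last by move=> i; apply: integrable_sum => // j _; exact: iI.
rewrite -sumEFin; apply: eq_bigr => i _.
rewrite integral_sum//.
rewrite (bigD1 i)//= big1 ?adde0 => [|j ji].
  rewrite integralZl//; last by have [] := pairing_eigen i i.
  have [_ ->] := pairing_eigen i i.
  by rewrite eqxx mulr1 -EFinM; congr (_%:E); ring.
rewrite integralZl//; last by have [] := pairing_eigen i j.
have [_ ->] := pairing_eigen i j.
rewrite (_ : (_ == _) = false) ?mulr0 ?mule0//.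
by apply/negbTE; apply: contraNneq ji => h; apply/eqP/val_inj.
Qed.

(** As a second moment. *)
Lemma eigenvalue_ge0 i : 0 <= lam i.
Proof.
have [_] := pairing_eigen i i; rewrite eqxx mulr1 => h.
rewrite -lee_fin -h; apply: integral_ge0 => w _.
by rewrite lee_fin -expr2 sqr_ge0.
Qed.

(** The eigenfunctions form an orthonormal basis and the path [W w] is
    bounded. *)
Lemma cvg_pairing (psi : R * R -> R) (B : R) w : measurable_fun (sq L) psi ->
  (forall y, sq L y -> `|psi y| <= B) ->
  \sum_(i < n) (\int[leb2]_(y in sq L) (psi y * e i y))%R * pairing (e i) w
    @[n --> \oo] --> pairing psi w.
Proof.
move=> mpsi psiB; set c := fun i => (\int[leb2]_(y in sq L) (psi y * e i y))%R.
have psi2 : L2 L psi.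
  by apply: (@bounded_L2 _ _ _ B).
have [_ _ /(_ _ psi2)] := oe.
pose s n y := psi y - \sum_(i < n) c i * e i y.
have sL2 n : L2 L (s n).
  apply: (L2B psi2); elim: n => [|n IH].
    by apply: (@eq_ind _ (fun=> 0) _ (L2_cst 0 L0)); apply/funext => y; rewrite big_ord0.
  rewrite (_ : (fun y => _) = (fun y => \sum_(i < n) c i * e i y + c n * e n y)).
    exact: (L2D IH (L2Z _ (eL2 n))).
  by apply/funext => y; rewrite big_ord_recr.
have [Bw WB] : exists Bw : nat, forall z, csq L z -> `|W w z| <= Bw%:R.
  exact: field_bounded.
move=> h.
have {}h : (\int[leb2]_(y in sq L) ((s n y) ^+ 2)%:E)%E @[n --> \oo] --> 0%E.
  apply: cvg_sqrte; first by move=> n; apply: integral_ge0 => y _; rewrite lee_fin sqr_ge0.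
  have E n : ((\int[leb2]_(y in sq L) ((s n y) ^+ 2)%:E) `^ 2^-1 = LpD L 2%:E (s n))%E.
    rewrite LpDE ?pnatr_eq0//; congr (poweR _ _); apply: eq_integral => y _.
    by rewrite powR_mulrn// real_normK ?num_real.
  by under eq_fun do rewrite E; exact: h.
have Bw0 : 0 <= Bw%:R :> R by [].
have diff n : pairing psi w - \sum_(i < n) c i * pairing (e i) w = pairing (s n) w.
  rewrite -pairing_sum /pairing -RintegralB//.
  - by apply: eq_Rintegral => y _; rewrite /s mulrBl.
  - exact: msq.
  - exact: (L2_integrableM psi2 (field_L2 w)).
  have sl : L2 L (fun y => psi y - s n y) := L2B psi2 (sL2 n).
  have := L2_integrableM sl (field_L2 w).
  by apply: eq_integrable => [|y _]; [exact: msq|rewrite /s subKr].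
have sq_le n : ((pairing (s n) w ^+ 2)%:E <=
    (L ^+ 2 * Bw%:R ^+ 2)%:E * \int[leb2]_(y in sq L) ((s n y) ^+ 2)%:E)%E.
  have sWL : L2 L (fun y => W w y * s n y).
    by apply: (L2_bdM (measurable_field_sq w) _ (sL2 n)) => y yL; apply: WB; exact: sq_csq.
  have := sq_jensen L0 sWL.
  rewrite (_ : (\int[leb2]_(x in sq L) (W w x * s n x))%R = pairing (s n) w); last first.
    by apply: eq_Rintegral => y _; rewrite mulrC.
  move=> /le_trans; apply; rewrite (EFinM (L ^+ 2) (Bw%:R ^+ 2)) -muleA lee_wpmul2l ?lee_fin ?sqr_ge0//.
  have is2 := L2_sqr_integrable (sL2 n).
  rewrite -integralZl//; last exact: msq.
  rewrite [leLHS]integral_mkcond [leRHS]integral_mkcond.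
  apply: le_integral_any => y; rewrite /patch; case: ifPn => // /set_mem yL.
    by rewrite lee_fin sqr_ge0.
  rewrite -EFinM lee_fin exprMn ler_wpM2r ?sqr_ge0//.
  rewrite -(real_normK (num_real (W w y))) lerXn2r ?nnegrE//.
  by apply: WB; exact: sq_csq.
set K := L ^+ 2 * Bw%:R ^+ 2 in sq_le.
have K0 : 0 <= K by rewrite mulr_ge0// sqr_ge0.
apply/cvgrPdist_lt => eps eps0.
have q0 : 0 < eps ^+ 2 / (K + 1) by rewrite divr_gt0 ?exprn_gt0// ltr_wpDl.
have /fine_cvgP[hfin /cvgr0Pnorm_lt /(_ _ q0) nfin] := h.
near=> n.
have fn : (\int[leb2]_(y in sq L) ((s n y) ^+ 2)%:E)%E \is a fin_num by near: n.
have In : `|fine (\int[leb2]_(y in sq L) ((s n y) ^+ 2)%:E)%E| < eps ^+ 2 / (K + 1) by near: n.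
rewrite -/c diff; move: (sq_le n); rewrite -(fineK fn) -EFinM lee_fin => le2.
have : pairing (s n) w ^+ 2 < eps ^+ 2.
  move: In; rewrite ger0_norm; last first.
    by apply: fine_ge0; apply: integral_ge0 => y _; rewrite lee_fin sqr_ge0.
  rewrite ltr_pdivlMr; last by rewrite ltr_wpDl.
  move=> In; apply: le_lt_trans le2 _; apply: le_lt_trans In.
  rewrite mulrC ler_wpM2l ?lerDl//.
  by apply: fine_ge0; apply: integral_ge0 => y _; rewrite lee_fin sqr_ge0.
move=> lt2; rewrite -(@ltr_pXn2r _ 2)// ?nnegrE ?(ltW eps0)//.
by rewrite real_normK ?num_real.
Unshelve. all: end_near. Qed.

(** The partial sums of the expansion of [psi] have second moment [sum_i lam_i
    <psi, e_i>^2] by [pairing_eigen]; Fatou's lemma passes to the limit. *)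
Lemma pairing_variance (psi : R * R -> R) (B c : R) : measurable_fun (sq L) psi ->
  (forall y, sq L y -> `|psi y| <= B) ->
  (forall n, \sum_(i < n) lam i *
    (\int[leb2]_(y in sq L) (psi y * e i y))%R ^+ 2 <= c) ->
  (\int[P]_w (pairing psi w ^+ 2)%:E <= c%:E)%E.
Proof.
move=> mpsi psiB sumc; apply: (@fatou_bound _ _ _ P (fun n w =>
  (\sum_(i < n) (\int[leb2]_(y in sq L) (psi y * e i y))%R * pairing (e i) w) ^+ 2)).
- move=> n; apply: measurable_funX; apply: measurable_sum => i.
  apply: measurable_funM => //.
  by have [] := pairing_square (me i) (be i).
- by move=> n w; exact: sqr_ge0.
- move=> w; rewrite expr2; under eq_fun do rewrite expr2.
  by apply: cvgM; exact: cvg_pairing mpsi psiB.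
move=> n; rewrite (integral_pairing_sum
  (fun i => (\int[leb2]_(y in sq L) (psi y * e i y))%R)).
by rewrite lee_fin.
Qed.

End field_integrals.

(** * Averages over shrinking boxes *)

Section boxes.
Context {R : realType}.
Implicit Types (L c : R) (h : R * R -> R) (x z : R * R).
Local Notation RR := (measurableTypeR R * measurableTypeR R)%type.

Definition box x (dl : R) : set (R * R) :=
  `]x.1 - dl, x.1 + dl[ `*` `]x.2 - dl, x.2 + dl[.

Lemma measurable_box x dl : measurable (box x dl).
Proof. by apply: measurableX; exact: measurable_itv. Qed.

Lemma leb2_box x dl : 0 < dl -> leb2 (box x dl) = (4 * dl ^+ 2)%:E.
Proof.
move=> d0; rewrite /leb2 /box product_measure1E; try exact: measurable_itv.
have E (a : R) : lebesgue_measure (`]a - dl, a + dl[%classic : set R) = (2 * dl)%:E.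
  rewrite lebesgue_measure_itv/= lte_fin ltrBlDr -addrA ltrDl addr_gt0//.
  by rewrite -EFinD; congr (_%:E); ring.
transitivity ((2 * dl)%:E * (2 * dl)%:E)%E; first by congr (_ * _)%E; exact: E.
by rewrite -EFinM; congr (_%:E); ring.
Qed.

Lemma in_box x dl z :
  box x dl z <-> `|x.1 - z.1| < dl /\ `|x.2 - z.2| < dl.
Proof.
rewrite /box /= !in_itv/= !ltr_distl; split=> -[/andP[a1 a2] /andP[b1 b2]];
  split; apply/andP; split; lra.
Qed.

Lemma box_sub L x : sq L x -> exists2 dl, 0 < dl & box x dl `<=` sq L.
Proof.
move=> [/=]; rewrite !in_itv /= => /andP[a1 a2] /andP[b1 b2].
exists (Num.min (Num.min x.1 (L - x.1)) (Num.min x.2 (L - x.2))).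
  by rewrite !lt_min a1 b1 !subr_gt0 a2 b2.
move=> z /in_box; rewrite !lt_min => -[/andP[/andP[z1 z2] _] /andP[_ /andP[z3 z4]]].
move: z1 z2 z3 z4; rewrite !ltr_norml => /andP[? ?] /andP[? ?] /andP[? ?] /andP[? ?].
by split; rewrite /= in_itv/=; apply/andP; split; lra.
Qed.

Lemma continuous_csq L h x e : csq L x -> {within csq L, continuous h} -> 0 < e ->
  exists2 dl, 0 < dl & forall z, csq L z -> box x dl z -> `|h x - h z| <= e.
Proof.
move=> xL ch e0.
have : \forall z \near within (csq L) (nbhs x), `|h x - h z| <= e.
  have := ch x; rewrite /prop_for /continuous_at nbhs_subspace_in//.
  by move=> /cvgrPdist_le /(_ _ e0).
case=> -[A B] /= [/nbhs_ballP[d1 /= d10 Ad] /nbhs_ballP[d2 /= d20 Bd]] AB.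
exists (Num.min d1 d2); first by rewrite !lt_min d10 d20.
move=> z zL /in_box; rewrite !lt_min => -[/andP[z1 z2] /andP[z3 z4]].
by apply: (AB z) => //; split; [apply: Ad|apply: Bd].
Qed.

Lemma continuous_box L h x e : sq L x -> {within csq L, continuous h} -> 0 < e ->
  exists dl, [/\ 0 < dl, box x dl `<=` sq L &
    forall z, box x dl z -> `|h x - h z| <= e].
Proof.
move=> xL ch e0; have [d0 d00 d0L] := box_sub xL.
have [d1 d10 d1h] := continuous_csq (sq_csq xL) ch e0.
have mB z : box x (Num.min d0 d1) z -> box x d0 z /\ box x d1 z.
  by move=> /in_box; rewrite !lt_min => -[/andP[? ?] /andP[? ?]]; split; apply/in_box.
exists (Num.min d0 d1); split; first by rewrite !lt_min d00 d10.
  by move=> z /mB[/d0L].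
by move=> z /mB[/d0L zL]; apply: d1h; exact: sq_csq.
Qed.

(** Boxes have positive measure, so an exceptional null set contains no
    neighbourhood of a point where the bound fails. *)
Lemma continuous_ae_le L h c : {within csq L, continuous h} ->
  {ae leb2, forall z : R * R, sq L z -> h z <= c} ->
  forall x, sq L x -> h x <= c.
Proof.
move=> ch aec x xL; rewrite leNgt; apply/negP => hx.
have e0 : 0 < (h x - c) / 2 by rewrite divr_gt0// subr_gt0.
have [dl [dl0 dlL dlh]] := continuous_box xL ch e0.
have : leb2.-negligible (box x dl).
  apply: negligibleS aec => z zb /= nz.
  have zL := dlL _ zb; have := nz zL; have := dlh _ zb.
  by rewrite ler_norml => /andP[? ?] ?; lra.
have mb : @measurable _ RR (box x dl) := measurable_box x dl.
move=> /(@negligibleP _ _ R leb2 _ mb) b0.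
have := leb2_box x dl0; move: b0; rewrite /= => -> /eqP.
by rewrite eqe eq_sym gt_eqF// mulr_gt0// exprn_gt0.
Qed.

Lemma LpD_sup_ae L v c : 0 < L -> (LpD L +oo v <= c%:E)%E ->
  {ae leb2, forall z : R * R, sq L z -> `|v z| <= c}.
Proof.
move=> L0; rewrite /LpD unlock; case: ifPn => [_|]; last first.
  rewrite -leNgt => h; exfalso.
  have : (leb2 (sq L) <= leb2 (setT : set (R * R)))%E.
    by apply: le_measure; rewrite ?inE//; exact: msq.
  rewrite leb2_sq// => /le_trans /(_ h); rewrite lee_fin.
  by rewrite leNgt exprn_gt0.
move=> /ess_supP; apply: filterS => z + zL /=.
by rewrite /= /patch mem_set// lee_fin.
Qed.

Lemma C1_closed_bound L v c : 0 < L -> C1_closed L v -> (LpD L +oo v <= c%:E)%E ->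
  forall x, sq L x -> `|v x| <= c.
Proof.
move=> L0 [cv _] /(LpD_sup_ae L0); apply: (@continuous_ae_le L (fun x => `|v x|)).
by move=> x; apply: cvg_norm; exact: cv.
Qed.

(** The essential bound on the gradient bounds its continuous extension
    everywhere; the mean value theorem is then applied along two sides of a
    rectangle. *)
Lemma C1_closed_lipschitz L v c : 0 < L -> C1_closed L v ->
  (LpD L +oo (fun z => eucl (dx v z, dy v z)) <= c%:E)%E ->
  forall x y, sq L x -> sq L y ->
  `|v x - v y| <= c * (`|x.1 - y.1| + `|x.2 - y.2|).
Proof.
move=> L0 [cv [d1 [d2 [c1 c2 vd]]]] /(LpD_sup_ae L0) aec.
have b1 x : sq L x -> `|d1 x| <= c.
  apply: (@continuous_ae_le L (fun x => `|d1 x|)).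
    by move=> z; apply: cvg_norm; exact: c1.
  move: aec; apply: filterS => z /[swap] zL /(_ zL).
  have [_ -> ->] := vd _ zL; apply: le_trans.
  rewrite [leRHS]ger0_norm ?sqrtr_ge0// /eucl -[`|d1 z|]sqrtr_sqr ler_sqrt//=.
    by rewrite lerDl sqr_ge0.
  by rewrite addr_ge0 ?sqr_ge0.
have b2 x : sq L x -> `|d2 x| <= c.
  apply: (@continuous_ae_le L (fun x => `|d2 x|)).
    by move=> z; apply: cvg_norm; exact: c2.
  move: aec; apply: filterS => z /[swap] zL /(_ zL).
  have [_ -> ->] := vd _ zL; apply: le_trans.
  rewrite [leRHS]ger0_norm ?sqrtr_ge0// /eucl -[`|d2 z|]sqrtr_sqr ler_sqrt//=.
    by rewrite lerDr sqr_ge0.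
  by rewrite addr_ge0 ?sqr_ge0.
have mvt (f f' : R -> R) a b : (forall t, 0 < t < L -> derivable f t 1 /\ derive1 f t = f' t) ->
    (forall t, 0 < t < L -> `|f' t| <= c) ->
    0 < a < L -> 0 < b < L -> `|f a - f b| <= c * `|a - b|.
  move=> df bf; wlog ab : a b / a <= b.
    move=> H a0 b0; have [ab|/ltW ba] := leP a b; first exact: H.
    by rewrite distrC [`|a - b|]distrC; apply: H.
  move=> /andP[a0 aL] /andP[b0 bL].
  have inI t : t \in `[a, b] -> 0 < t < L.
    by rewrite in_itv/= => /andP[at_ tb]; rewrite (lt_le_trans a0)//= (le_lt_trans tb).
  have fd t : t \in `[a, b] -> is_derive t (1 : R) f (f' t).
    move=> /inI /df [ft <-]; rewrite derive1E; exact: DeriveDef.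
  have fd' t : t \in `]a, b[ -> is_derive t (1 : R) f (f' t).
    by move=> tI; apply: fd; apply: subset_itv_oo_cc tI.
  have cf : {within `[a, b], continuous f}.
    by apply: derivable_within_continuous => t tI; have [] := fd t tI.
  have [k kI E] := MVT_segment ab fd' cf.
  rewrite distrC E normrM [`|b - a|]distrC ler_wpM2r//; exact: bf (inI _ kI).
move=> x y xL yL.
have mid : sq L (x.1, y.2) by case: xL => ? _; case: yL.
have inL t : t \in `]0, L[ -> 0 < t < L by rewrite in_itv.
have [x1 x2] := xL; have [y1 y2] := yL.
rewrite (le_trans (ler_distD (v (x.1, y.2)) _ _))// mulrDr [leRHS]addrC.
apply: lerD.
- case: x x1 x2 {xL mid} => a b /= x1 x2.
  apply: (mvt (fun t => v (a, t)) (fun t => d2 (a, t))); rewrite ?inL//.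
    by move=> t tL; have [[_ dt] _ h] := vd (a, t) (conj x1 tL).
  by move=> t tL; apply: b2.
- case: y y1 y2 {yL mid} => a b /= y1 y2.
  apply: (mvt (fun t => v (t, b)) (fun t => d1 (t, b))); rewrite ?inL//.
    by move=> t tL; have [[dt _] h _] := vd (t, b) (conj tL y2).
  by move=> t tL; apply: b1.
Qed.

Lemma box_shrink x dl n : 0 < dl -> box x (dl / n.+1%:R) `<=` box x dl.
Proof.
move=> dl0 z /in_box[z1 z2].
have h : dl / n.+1%:R <= dl.
  by rewrite ler_pdivrMr// ler_peMr ?(ltW dl0)// ler1n.
by apply/in_box; split; exact: lt_le_trans h.
Qed.

(** The normalized indicator of a box, an approximate unit at its centre. *)
Definition avg x dl z : R := (4 * dl ^+ 2)^-1 * \1_(box x dl) z.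

Lemma measurable_avg L x dl : measurable_fun (sq L) (avg x dl).
Proof.
apply: measurable_funTS; apply: measurable_funM => //.
exact: measurable_indic (measurable_box x dl).
Qed.

Lemma avg_bound x dl z : 0 < dl -> `|avg x dl z| <= (4 * dl ^+ 2)^-1.
Proof.
move=> d0; have h : 0 <= (4 * dl ^+ 2)^-1 by rewrite invr_ge0 mulr_ge0// sqr_ge0.
rewrite /avg indicE normrM ger0_norm// ler_piMr//.
by case: (z \in _); rewrite ?normr1 ?normr0.
Qed.

Lemma avg_L2 L x dl : 0 < L -> 0 < dl -> L2 L (avg x dl).
Proof.
move=> L0 d0; apply: (@bounded_L2 _ _ _ (4 * dl ^+ 2)^-1) => //.
- exact: measurable_avg.
- by move=> z _; exact: avg_bound.
Qed.

Lemma Rintegral_avg L x dl k : 0 < L -> 0 < dl -> box x dl `<=` sq L ->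
  (\int[leb2]_(z in sq L) (avg x dl z * k))%R = k.
Proof.
move=> L0 d0 bL.
have mb : @measurable _ RR (box x dl) := measurable_box x dl.
have E : (\int[leb2]_(z in sq L) (\1_(box x dl) z)%:E = (4 * dl ^+ 2)%:E)%E.
  rewrite integral_indic//; last exact: msq.
  by rewrite setIidl//; exact: leb2_box.
have ib : leb2.-integrable (sq L) (EFin \o (\1_(box x dl) : R * R -> R)).
  have := @L2_integrable _ L _ L0 (L2Z (4 * dl ^+ 2) (avg_L2 x L0 d0)).
  apply: eq_integrable => [|z _]; first exact: msq.
  rewrite /= /avg mulrA divff ?mul1r//.
  by rewrite mulf_neq0// gt_eqF// exprn_gt0.
have -> : (\int[leb2]_(z in sq L) (avg x dl z * k))%R =
  (\int[leb2]_(z in sq L) ((4 * dl ^+ 2)^-1 * k * \1_(box x dl) z))%R.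
  by apply: eq_Rintegral => z _; rewrite /avg mulrAC.
rewrite RintegralZl//; last exact: msq.
rewrite {1}/Rintegral E /= mulrAC mulVf ?mul1r//.
by rewrite mulf_neq0// gt_eqF// exprn_gt0.
Qed.

Lemma avg_close L (f : R * R -> R) x dl k e : 0 < L -> 0 < dl -> box x dl `<=` sq L ->
  L2 L f -> (forall z, box x dl z -> `|f z - k| <= e) ->
  `|(\int[leb2]_(z in sq L) (avg x dl z * f z))%R - k| <= e.
Proof.
move=> L0 d0 bL f2 fk; have aL := avg_L2 x L0 d0.
have ic c : leb2.-integrable (sq L) (EFin \o (fun z => avg x dl z * c)).
  exact: (L2_integrableM aL (L2_cst c L0)).
have iff := L2_integrableM aL f2.
have bnd z : (k - e) * avg x dl z <= f z * avg x dl z <= (k + e) * avg x dl z.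
  rewrite /avg indicE; case: (boolP (z \in _)) => [/set_mem zb|]; last first.
    by rewrite !mulr0 lexx.
  have h : 0 <= (4 * dl ^+ 2)^-1 * true%:R by rewrite mulr1 invr_ge0 mulr_ge0// sqr_ge0.
  have := fk z zb; rewrite ler_norml => /andP[? ?].
  by rewrite !ler_wpM2r//; lra.
have lo : k - e <= (\int[leb2]_(z in sq L) (avg x dl z * f z))%R.
  rewrite -[leLHS](@Rintegral_avg L x dl) //; apply: le_Rintegral => //; first exact: msq.
  by move=> z _; have /andP[] := bnd z; rewrite mulrC [f z * _]mulrC.
have hi : (\int[leb2]_(z in sq L) (avg x dl z * f z))%R <= k + e.
  rewrite -[leRHS](@Rintegral_avg L x dl) //; apply: le_Rintegral => //; first exact: msq.
  by move=> z _; have /andP[] := bnd z; rewrite ![_ * avg _ _ _]mulrC.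
by rewrite ler_norml; apply/andP; split; lra.
Qed.

Lemma cvg_avg L (f : R * R -> R) x d0 : 0 < L -> sq L x -> {within csq L, continuous f} ->
  L2 L f -> 0 < d0 -> box x d0 `<=` sq L ->
  (\int[leb2]_(z in sq L) (avg x (d0 / n.+1%:R) z * f z))%R @[n --> \oo] --> f x.
Proof.
move=> L0 xL cf f2 d00 d0L; apply/cvgrPdist_le => e e0.
have [dl [dl0 dlL dlf]] := continuous_box xL cf e0.
near=> n.
have dn0 : 0 < d0 / n.+1%:R by rewrite divr_gt0.
have dn : d0 / n.+1%:R <= dl.
  rewrite ler_pdivrMr// -ler_pdivrMl// ltW//.
  apply: lt_le_trans (truncnS_gt _) _; rewrite ler_nat ltnS.
  by near: n; exact: nbhs_infty_ge.
have bn : box x (d0 / n.+1%:R) `<=` box x dl.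
  by move=> z /in_box[z1 z2]; apply/in_box; split; exact: lt_le_trans dn.
rewrite distrC; apply: avg_close => //.
- by move=> z /bn /dlL.
- by move=> z /bn /dlf; rewrite distrC.
Unshelve. all: end_near. Qed.

End boxes.

(** * Second moments of a field and of its increments *)

Section field_increments.
Context {R : realType} {d : measure_display} {T : measurableType d}.
Variables (P : probability T R) (L : R) (W : T -> R * R -> R) (M : R).
Hypotheses (L0 : 0 < L)
  (mW : forall z, csq L z -> measurable_fun setT (W^~ z))
  (cW : forall w, {within csq L, continuous (W w)})
  (M0 : 0 < M)
  (WM : forall z, csq L z -> (\int[P]_w (W w z ^+ 2)%:E <= M%:E)%E).
Variables (e : nat -> R * R -> R) (lam : nat -> R) (Ce Clam alpha beta gamma : R).
Hypotheses (oe : orthonormal_basis L e)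
  (be : forall i y, sq L y -> `|e i y| <= Ce)
  (eig : forall i, {ae leb2, forall z : R * R, sq L z ->
    (\int[leb2]_(y in sq L) ((\int[P]_w (W w z * W w y)) * e i y))%R
      = lam i * e i z})
  (Ce0 : 0 < Ce) (Clam0 : 0 < Clam) (beta0 : 0 < beta)
  (gamma0 : 0 < gamma) (gamma1 : gamma < 1) (abg : 2 * alpha * gamma <= beta)
  (lip : forall i x y, sq L x -> sq L y -> `|e i x - e i y| <=
     Ce * i.+1%:R `^ alpha * (`|x.1 - y.1| + `|x.2 - y.2|))
  (sumlam : forall n, \sum_(i < n) lam i * i.+1%:R `^ beta <= Clam).
Implicit Types (x y z : R * R).

Let lam0 i : 0 <= lam i.
Proof. exact: (eigenvalue_ge0 L0 mW cW M0 WM oe be eig). Qed.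

Let eL2 i : L2 L (e i).
Proof. by have [/(_ i)] := oe. Qed.

Let weighted (psi : R * R -> R) (B K : R) : measurable_fun (sq L) psi ->
  (forall y, sq L y -> `|psi y| <= B) -> 0 <= K ->
  (forall i, (\int[leb2]_(y in sq L) (psi y * e i y))%R ^+ 2 <= i.+1%:R `^ beta * K) ->
  (\int[P]_w (pairing L W psi w ^+ 2)%:E <= (Clam * K)%:E)%E.
Proof.
move=> mpsi psiB K0 cK.
apply: (pairing_variance L0 mW cW M0 WM oe be eig mpsi psiB) => n.
apply: (@le_trans _ _ (\sum_(i < n) lam i * i.+1%:R `^ beta * K)).
  by apply: ler_sum => i _; rewrite -mulrA ler_wpM2l.
by rewrite -mulr_suml ler_wpM2r.
Qed.

Let power_ge1 i : 1 <= i.+1%:R `^ beta :> R.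
Proof. by rewrite -[leLHS](powRr0 i.+1%:R) ler_powR ?ler1n// ltW. Qed.

(** Weights shrinking to [x] pair with every eigenfunction to at most [Ce]. *)
Lemma field_variance_sq x : sq L x ->
  (\int[P]_w (W w x ^+ 2)%:E <= (Clam * Ce ^+ 2)%:E)%E.
Proof.
move=> xL; have [d0 d00 d0L] := box_sub xL.
pose dl n := d0 / n.+1%:R.
have dl0 n : 0 < dl n by rewrite divr_gt0.
have dlL n : box x (dl n) `<=` sq L by move=> z /(box_shrink d00) /d0L.
have mavg n : measurable_fun (sq L) (avg x (dl n)) by exact: measurable_avg.
have bavg n z (_ : sq L z) := avg_bound x z (dl0 n).
apply: (@fatou_bound _ _ _ P (fun n w => pairing L W (avg x (dl n)) w ^+ 2)).
- move=> n; apply: measurable_funX.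
  by have [] := pairing_square L0 mW cW M0 WM (mavg n) (bavg n).
- by move=> n w; exact: sqr_ge0.
- move=> w; rewrite expr2; under eq_fun do rewrite expr2.
  by apply: cvgM; apply: cvg_avg => //; exact: field_L2.
move=> n; apply: (weighted (mavg n) (bavg n)) => [|i]; first exact: sqr_ge0.
apply: (@le_trans _ _ (Ce ^+ 2)); last by rewrite ler_peMl ?sqr_ge0.
rewrite -(real_normK (num_real (Rintegral _ _ _))) lerXn2r ?nnegrE ?(ltW Ce0)//.
rewrite -[Rintegral _ _ _]subr0; apply: avg_close => // z zb.
by rewrite subr0; apply: be; exact: dlL zb.
Qed.

Let dist x y := `|x.1 - y.1| + `|x.2 - y.2|.

Let min_power (t : R) : 0 <= t -> Num.min 1 t <= t `^ gamma.
Proof.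
move=> t0; have [t1|t1] := leP t 1.
  have [->|tn0] := eqVneq t 0; first by rewrite powR_ge0.
  rewrite -[leLHS]powRr1//; apply: ger_powR; last exact: ltW.
  by rewrite t1 lt0r tn0 t0.
by rewrite -[leLHS](powRr0 t) ler_powR// ltW.
Qed.

(** With [psi] the difference of two shrinking normalized indicators at [x] and
    [y], the coefficient [<psi, e_i>] is bounded by [2 Ce] through the bound of
    [e_i], and by [2 Ce i^alpha |x - y|] through its Lipschitz constant once the
    boxes are small against [|x - y|]; interpolating between the two with
    exponent [gamma] makes the weights [lam_i i^beta] sufficient. *)
Lemma field_increment_sq x y : sq L x -> sq L y ->
  (\int[P]_w ((W w x - W w y) ^+ 2)%:E <=
   (Clam * (2 * Ce * dist x y `^ gamma) ^+ 2)%:E)%E.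
Proof.
move=> xL yL; have dist0 : 0 <= dist x y by rewrite addr_ge0.
have [dist_eq|dist_n0] := eqVneq (dist x y) 0.
  have xy : x = y.
    move/eqP: dist_eq; rewrite paddr_eq0// !normr_eq0 !subr_eq0.
    by case: x y {xL yL dist0} => [? ?] [? ?] /= /andP[/eqP-> /eqP->].
  under eq_integral do rewrite xy subrr expr0n/=.
  by rewrite integral0 lee_fin mulr_ge0 ?(ltW Clam0)// sqr_ge0.
have distp : 0 < dist x y by rewrite lt0r dist_n0.
have [d1 d10 d1L] := box_sub xL; have [d2 d20 d2L] := box_sub yL.
(* Boxes so small that [e i] varies on each of them by at most its Lipschitz
   constant times [dist x y / 2]. *)
pose d0 := Num.min (Num.min d1 d2) (dist x y / 4).
have d00 : 0 < d0 by rewrite !lt_min d10 d20 divr_gt0.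
have bb x' dd : d0 <= dd -> box x' d0 `<=` box x' dd.
  by move=> h z /in_box[z1 z2]; apply/in_box; split; exact: lt_le_trans h.
have d01 : d0 <= d1 by rewrite !ge_min lexx.
have d02 : d0 <= d2 by rewrite !ge_min lexx orbT.
have d0d : 4 * d0 <= dist x y by rewrite mulrC -ler_pdivlMr// !ge_min lexx orbT.
pose dl n := d0 / n.+1%:R.
have dl0 n : 0 < dl n by rewrite divr_gt0.
have xdl n : box x (dl n) `<=` sq L by move=> z /(box_shrink d00) /(bb _ _ d01) /d1L.
have ydl n : box y (dl n) `<=` sq L by move=> z /(box_shrink d00) /(bb _ _ d02) /d2L.
pose psi n z := avg x (dl n) z - avg y (dl n) z.
have mpsi n : measurable_fun (sq L) (psi n).
  by apply: measurable_funB; exact: measurable_avg.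
have bpsi n z (_ : sq L z) : `|psi n z| <= (4 * dl n ^+ 2)^-1 + (4 * dl n ^+ 2)^-1.
  by rewrite (le_trans (ler_normB _ _))// lerD// avg_bound.
have psiE n (f : R * R -> R) : L2 L f ->
    (\int[leb2]_(z in sq L) (psi n z * f z))%R =
    (\int[leb2]_(z in sq L) (avg x (dl n) z * f z))%R -
    (\int[leb2]_(z in sq L) (avg y (dl n) z * f z))%R.
  move=> f2; rewrite -RintegralB//.
  - by apply: eq_Rintegral => z _; rewrite mulrBl.
  - exact: msq.
  - exact: (L2_integrableM (avg_L2 x L0 (dl0 n)) f2).
  - exact: (L2_integrableM (avg_L2 y L0 (dl0 n)) f2).
apply: (@fatou_bound _ _ _ P (fun n w => pairing L W (psi n) w ^+ 2)).
- move=> n; apply: measurable_funX.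
  by have [] := pairing_square L0 mW cW M0 WM (mpsi n) (bpsi n).
- by move=> n w; exact: sqr_ge0.
- move=> w; have c : pairing L W (psi n) w @[n --> \oo] --> W w x - W w y.
    rewrite /pairing; under eq_fun do rewrite (psiE _ _ (field_L2 L0 cW w)).
    apply: cvgB; apply: cvg_avg => //; try exact: field_L2.
    + by move=> z /(bb _ _ d01) /d1L.
    + by move=> z /(bb _ _ d02) /d2L.
  by rewrite expr2; under eq_fun do rewrite expr2; exact: cvgM.
move=> n; apply: (weighted (mpsi n) (bpsi n)) => [|i]; first exact: sqr_ge0.
rewrite psiE//.
set I1 := Rintegral _ _ _; set I2 := Rintegral _ _ _.
have bnd1 : `|I1 - I2| <= 2 * Ce.
  have b1 : `|I1 - 0| <= Ce.
    by apply: avg_close => // z zb; rewrite subr0; apply: be; exact: xdl zb.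
  have b2 : `|I2 - 0| <= Ce.
    by apply: avg_close => // z zb; rewrite subr0; apply: be; exact: ydl zb.
  by rewrite (le_trans (ler_normB _ _))// mulr_natl mulr2n; move: b1 b2; rewrite !subr0; exact: lerD.
set a := i.+1%:R `^ alpha.
have a0 : 0 <= a by exact: powR_ge0.
have dln : dl n <= d0 by rewrite ler_pdivrMr// ler_peMr ?(ltW d00)// ler1n.
have Ca : 0 <= Ce * a by rewrite mulr_ge0// ltW.
have near x' z : sq L x' -> box x' (dl n) z -> sq L z -> `|e i z - e i x'| <= Ce * a * (2 * d0).
  move=> xL' /in_box[z1 z2] zL; rewrite distrC (le_trans (lip _ xL' zL))// ler_wpM2l//.
  by rewrite mulr_natl mulr2n lerD// ltW// (lt_le_trans _ dln).
have bnd2 : `|I1 - I2| <= 2 * Ce * (a * dist x y).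
  have b1 : `|I1 - e i x| <= Ce * a * (2 * d0).
    by apply: avg_close => // z zb; apply: near => //; exact: xdl zb.
  have b2 : `|I2 - e i y| <= Ce * a * (2 * d0).
    by apply: avg_close => // z zb; apply: near => //; exact: ydl zb.
  have b3 := lip i xL yL; rewrite -/a -/(dist x y) in b3.
  have -> : I1 - I2 = (I1 - e i x) - (I2 - e i y) + (e i x - e i y) by ring.
  rewrite (le_trans (ler_normD _ _))// (le_trans (lerD (ler_normB _ _) b3))//.
  have := ler_wpM2l Ca d0d; lra.
have bnd : `|I1 - I2| <= 2 * Ce * (a * dist x y) `^ gamma.
  have : `|I1 - I2| <= 2 * Ce * Num.min 1 (a * dist x y).
    by rewrite minr_pMr ?mulr_ge0 ?(ltW Ce0)// mulr1 le_min bnd1 bnd2.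
  move=> /le_trans; apply; rewrite ler_wpM2l ?mulr_ge0 ?(ltW Ce0)//.
  by apply: min_power; rewrite mulr_ge0.
have C20 : 0 <= 2 * Ce by rewrite mulr_ge0// ltW.
rewrite -(real_normK (num_real (I1 - I2))).
apply: (@le_trans _ _ ((2 * Ce * (a * dist x y) `^ gamma) ^+ 2)).
  rewrite lerXn2r ?nnegrE//; apply: mulr_ge0 => //; exact: powR_ge0.
rewrite powRM// mulrCA exprMn ler_wpM2r ?sqr_ge0//.
rewrite -powR_mulrn ?powR_ge0// -!powRrM ler_powR ?ler1n//.
by move: abg; rewrite (_ : alpha * (gamma * 2) = 2 * alpha * gamma)//; ring.
Qed.

(** Points of the closed square are approached from the inside by homotheties
    about the centre, which do not increase distances. *)
Let inner n x : R * R :=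
  let t := n.+2%:R^-1 in
  ((1 - t) * x.1 + t * (L / 2), (1 - t) * x.2 + t * (L / 2)).

Let tn n : (0 : R) < (n.+2%:R^-1 : R) < (1 : R).
Proof. by rewrite invr_gt0 ltr0n invf_lt1 ?ltr0n// ltr1n. Qed.

Let inner_sq n x : csq L x -> sq L (inner n x).
Proof.
move=> [/=]; rewrite !in_itv/= => /andP[a1 a2] /andP[b1 b2].
have /andP[t0 t1] := tn n; have L2 : 0 < L / 2 by rewrite divr_gt0.
set t := n.+2%:R^-1 in t0 t1 *.
split; rewrite /= in_itv/= -/t; apply/andP; split; nra.
Qed.

Let inner_dist n x y : dist (inner n x) (inner n y) <= dist x y.
Proof.
have /andP[t0 t1] := tn n; set t := n.+2%:R^-1 in t0 t1.
have h (a b : R) : `|((1 - t) * a + t * (L / 2)) - ((1 - t) * b + t * (L / 2))| <= `|a - b|.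
  rewrite (_ : _ - _ = (1 - t) * (a - b)); last by ring.
  rewrite normrM ger0_norm ?subr_ge0 ?(ltW t1)// ler_piMl//; lra.
by rewrite /dist lerD// h.
Qed.

Let cvg_inner (f : R * R -> R) x : {within csq L, continuous f} -> csq L x ->
  f (inner n x) @[n --> \oo] --> f x.
Proof.
move=> cf xL; apply/cvgrPdist_le => eps eps0.
have [dl dl0 dlf] := continuous_csq xL cf eps0.
near=> n.
have /andP[t0 t1] := tn n.
have tL : n.+2%:R^-1 * L < dl.
  rewrite mulrC ltr_pdivrMr ?ltr0n// -ltr_pdivrMl//.
  have : (Num.trunc (dl^-1 * L)).+1%:R <= n.+2%:R :> R.
    by rewrite ler_nat ltnS leqW//; near: n; exact: nbhs_infty_ge.
  by apply: lt_le_trans; exact: truncnS_gt.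
apply: dlf; first exact/sq_csq/inner_sq.
case: xL => /=; rewrite !in_itv/= => /andP[a1 a2] /andP[b1 b2].
have L2 : 0 < L / 2 by rewrite divr_gt0.
apply/in_box; rewrite /inner/=.
set t := n.+2%:R^-1 in t0 t1 tL *.
have h (a : R) : 0 <= a -> a <= L -> `|a - ((1 - t) * a + t * (L / 2))| < dl.
  move=> a0 aL; apply: le_lt_trans tL.
  rewrite (_ : a - _ = t * (a - L / 2)); last by ring.
  rewrite normrM gtr0_norm// ler_wpM2l ?(ltW t0)// ler_norml.
  by apply/andP; split; lra.
by split; apply: h.
Unshelve. all: end_near. Qed.

Lemma field_variance x : csq L x ->
  (\int[P]_w (W w x ^+ 2)%:E <= (Clam * Ce ^+ 2)%:E)%E.
Proof.
move=> xL; apply: (@fatou_bound _ _ _ P (fun n w => W w (inner n x) ^+ 2)).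
- by move=> n; apply: measurable_funX; apply: mW; exact/sq_csq/inner_sq.
- by move=> n w; exact: sqr_ge0.
- move=> w; rewrite expr2; under eq_fun do rewrite expr2.
  by apply: cvgM; exact: cvg_inner.
- by move=> n; apply: field_variance_sq; exact: inner_sq.
Qed.

Lemma field_increment x y : csq L x -> csq L y ->
  (\int[P]_w ((W w x - W w y) ^+ 2)%:E <=
   (Clam * (2 * Ce * (`|x.1 - y.1| + `|x.2 - y.2|) `^ gamma) ^+ 2)%:E)%E.
Proof.
move=> xL yL; apply: (@fatou_bound _ _ _ P
  (fun n w => (W w (inner n x) - W w (inner n y)) ^+ 2)).
- move=> n; apply: measurable_funX; apply: measurable_funB;
    apply: mW; exact/sq_csq/inner_sq.
- by move=> n w; exact: sqr_ge0.
- move=> w; rewrite expr2; under eq_fun do rewrite expr2.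
  by apply: cvgM; apply: cvgB; exact: cvg_inner.
move=> n; apply: (le_trans (field_increment_sq (inner_sq n xL) (inner_sq n yL))).
rewrite lee_fin ler_wpM2l ?(ltW Clam0)//.
have C20 : 0 <= 2 * Ce by rewrite mulr_ge0// ltW.
have p0 (t : R) : 0 <= 2 * Ce * t `^ gamma by apply: mulr_ge0 => //; exact: powR_ge0.
rewrite lerXn2r ?nnegrE ?p0// ler_wpM2l//.
by rewrite ge0_ler_powR ?nnegrE ?(ltW gamma0) ?addr_ge0//; exact: inner_dist.
Qed.

End field_increments.

(** * Continuous versions and moments of the interpolation error *)

Section continuous_version.
Context {R : realType} {d : measure_display} {T : measurableType d}.
Variable P : probability T R.
Implicit Types (X Y : T -> R) (W : T -> R * R -> R) (L : R).

(** The law of a random variable is insensitive to null sets. *)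
Lemma normal_law_ae X Y : measurable_fun setT X -> measurable_fun setT Y ->
  {ae P, forall w, X w = Y w} -> normal_law P X -> normal_law P Y.
Proof.
move=> mX mY XY.
have E (B : set R) : measurable B -> P (Y @^-1` B) = P (X @^-1` B).
  move=> mB.
  have mXB : measurable (X @^-1` B) by rewrite -[_ @^-1` _]setTI; exact: mX.
  have mYB : measurable (Y @^-1` B) by rewrite -[_ @^-1` _]setTI; exact: mY.
  rewrite -[X in P X = _]setIT -[X in _ = P X]setIT -!integral_indic//.
  apply: ae_eq_integral => //.
  - by apply/measurable_EFinP; exact: measurable_indic.
  - by apply/measurable_EFinP; exact: measurable_indic.
  move: XY; apply: filterS => w h _; rewrite !indicE; congr (nat_of_bool _)%:R%:E.
  by apply/idP/idP; rewrite !inE /= h.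
by move=> [m [s [[s0 XE]|XE]]]; exists m, s; [left; split => //|right] => B mB;
  rewrite E// XE.
Qed.

(** What the error analysis uses of a random field; [v] is the scale of its
    standard deviation and [gamma] the Hoelder exponent of its increments in
    mean square. *)
Definition regular_field L (gamma v : R) W :=
  [/\ gaussian_field P (csq L) W,
      forall w, {within csq L, continuous (W w)},
      forall x, csq L x -> (\int[P]_w (W w x ^+ 2)%:E <= (v ^+ 2)%:E)%E &
      forall x y, csq L x -> csq L y ->
        (\int[P]_w ((W w x - W w y) ^+ 2)%:E <=
         ((v * (`|x.1 - y.1| + `|x.2 - y.2|) `^ gamma) ^+ 2)%:E)%E].

Section field_version.
Variables (L alpha Ce : R) (W : T -> R * R -> R) (lam : nat -> R)
  (e : nat -> R * R -> R).
Hypotheses (L0 : 0 < L) (fW : field_assumption P L alpha Ce W lam e).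

(** The field is set to zero on the null set of discontinuous paths. *)
Lemma continuous_version : exists W',
  [/\ gaussian_field P (csq L) W', forall w, {within csq L, continuous (W' w)} &
   {ae P, forall w, W' w = W w}].
Proof.
have [[mW nW] _ [N [mN PN WN]] _ _] := fW.
pose W' w z := \1_(~` N) w * W w z.
have W'E : {ae P, forall w, W' w = W w}.
  exists N; split => // w /= h; apply: contrapT => wN; apply: h.
  by apply/funext => z; rewrite /W' indicE mem_set// mul1r.
have mW' z : csq L z -> measurable_fun setT (W'^~ z).
  move=> zL; apply: measurable_funM; last exact: mW.
  by apply: measurable_indic; exact: measurableC.
exists W'; split => //.
  split=> // k z c zL; have := nW k z c zL; apply: normal_law_ae.
  - by apply: measurable_sum => i; apply: measurable_funM => //; exact: mW.
  - by apply: measurable_sum => i; apply: measurable_funM => //; exact: mW'.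
  - by move: W'E; apply: filterS => w ->.
move=> w; have [wN|wN] := pselect (N w).
  have -> : W' w = fun=> 0.
    by apply/funext => z; rewrite /W' indicE memNset ?mul0r//; apply.
  by move=> z; exact: cvg_cst.
have -> : W' w = W w by apply/funext => z; rewrite /W' indicE mem_set// mul1r.
by apply: contrapT => h; apply: wN; exact: WN.
Qed.

(** The field has mean zero, so its covariance is the expectation of the
    product. *)
Lemma cov_fun_version W' z y : csq L z -> csq L y ->
  (forall x, csq L x -> measurable_fun setT (W'^~ x)) ->
  {ae P, forall w, W' w = W w} ->
  cov_fun P W z y = (\int[P]_w (W' w z * W' w y))%R.
Proof.
move=> zL yL mW' W'E; have [[mW nW] EW _ _ _] := fW.
rewrite /cov_fun covariance.unlock (EW _ zL) (EW _ yL); congr fine.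
rewrite unlock; apply: ae_eq_integral => //.
- apply/measurable_EFinP; apply: measurable_funM; apply: measurable_funB => //; exact: mW.
- by apply/measurable_EFinP; apply: measurable_funM; exact: mW'.
by move: W'E; apply: filterS => w -> _ /=; rewrite !fctE /= !subr0.
Qed.

Lemma eigen_version W' : (forall x, csq L x -> measurable_fun setT (W'^~ x)) ->
  {ae P, forall w, W' w = W w} ->
  forall i, {ae leb2, forall z : R * R, sq L z ->
    (\int[leb2]_(y in sq L) ((\int[P]_w (W' w z * W' w y)) * e i y))%R
      = lam i * e i z}.
Proof.
move=> mW' W'E i; have [_ _ _ [_ eigW] _] := fW.
move: (eigW i); apply: filterS => z /[swap] zL /(_ zL) <-.
apply: eq_Rintegral => y /set_mem yL.
by rewrite (@cov_fun_version W' z y)//; exact: sq_csq.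
Qed.

Lemma eigen_bound : [/\ forall i y, sq L y -> `|e i y| <= Ce &
  forall i x y, sq L x -> sq L y -> `|e i x - e i y| <=
    Ce * i.+1%:R `^ alpha * (`|x.1 - y.1| + `|x.2 - y.2|)].
Proof.
have [_ _ _ _ he] := fW; split=> i.
  by have [h1 h2 _] := he i; exact: C1_closed_bound h1 h2.
by have [h1 _ h2] := he i; exact: C1_closed_lipschitz h1 h2.
Qed.

Lemma field_eigenvalue_ge0 i : 0 <= lam i.
Proof.
have [W' [gW' cW' W'E]] := continuous_version.
have mW' z := @field_measurable _ _ _ P L W' gW' z.
have [M M0 WM] := field_variance_bounded L0 gW' cW'.
have [_ _ _ [oe _] _] := fW; have [be _] := eigen_bound.
exact: (eigenvalue_ge0 L0 mW' cW' M0 WM oe be (eigen_version mW' W'E)).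
Qed.

(** The bounds [Clam Ce^2] and [Clam (2 Ce |x - y|^gamma)^2] fit in one scale [v
    = 2 Ce sqrt Clam]. *)
Lemma field_regular (Clam beta gamma : R) : 0 < Ce -> 0 < Clam ->
  0 < beta -> 0 < gamma -> gamma < 1 -> 2 * alpha * gamma <= beta ->
  (forall n, \sum_(i < n) lam i * i.+1%:R `^ beta <= Clam) ->
  exists W', {ae P, forall w, W' w = W w} /\
    regular_field L gamma (2 * Ce * Num.sqrt Clam) W'.
Proof.
move=> Ce0 Clam0 beta0 gamma0 gamma1 abg sumlam.
have [W' [gW' cW' W'E]] := continuous_version.
have mW' z := @field_measurable _ _ _ P L W' gW' z.
have [M M0 WM] := field_variance_bounded L0 gW' cW'.
have [_ _ _ [oe _] _] := fW; have [be lip] := eigen_bound.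
have eig := eigen_version mW' W'E.
have sq2 : Num.sqrt Clam ^+ 2 = Clam by rewrite sqr_sqrtr// ltW.
exists W'; split=> //; split=> //.
- move=> x xL; apply: le_trans (field_variance L0 mW' cW' M0 WM oe be eig Ce0
    beta0 sumlam xL) _.
  rewrite lee_fin exprMn sq2 mulrC ler_wpM2r ?(ltW Clam0)//.
  by have := sqr_ge0 Ce; nra.
- move=> x y xL yL; have h := @field_increment _ _ _ P L W' M L0 mW' cW' M0 WM e lam Ce Clam alpha beta gamma oe be eig
    Ce0 Clam0.
  have {}h := h gamma0 gamma1 abg lip sumlam x y xL yL.
  apply: (le_trans h).
  by rewrite lee_fin le_eqVlt; apply/orP; left; apply/eqP; rewrite !exprMn sq2; ring.
Qed.

End field_version.

(** A supporting line of the convex function [exp (t |a|)], with slope [t sg a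
    exp (t |a|)]. *)
Lemma exp_norm_slope (t a b : R) : 0 <= t ->
  expR (t * `|a|) + (t * Num.sg a * expR (t * `|a|)) * (b - a) <= expR (t * `|b|).
Proof.
move=> t0; have -> : expR (t * `|b|) = expR (t * `|a|) * expR (t * `|b| - t * `|a|).
  by rewrite -expRD addrC subrK.
have -> : expR (t * `|a|) + t * Num.sg a * expR (t * `|a|) * (b - a) =
  expR (t * `|a|) * (1 + t * (Num.sg a * (b - a))) by ring.
rewrite ler_wpM2l ?expR_ge0// (le_trans _ (expR_ge1Dx _))// lerD2l -mulrBr ler_wpM2l//.
rewrite mulrBr mulrC [Num.sg a * a]mulrC [a * _]mulrC -normrEsg lerB// mulrC.
by rewrite (le_trans (ler_norm _))// normrM ler_piMl// normr_sg; case: (_ != 0).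
Qed.

(** A supporting line of the convex function [|a|^p], by Young's inequality. *)
Lemma power_norm_slope (p a b : R) : 1 < p ->
  `|a| `^ p + (p * Num.sg a * `|a| `^ (p - 1)) * (b - a) <= `|b| `^ p.
Proof.
move=> p1; have p0 : 0 < p by exact: lt_trans p1.
have pm0 : 0 < p - 1 by rewrite subr_gt0.
set A := `|a|; set B := `|b|; have A0 : 0 <= A by exact: normr_ge0.
have B0 : 0 <= B by exact: normr_ge0.
have AA : A `^ (p - 1) * A = A `^ p.
  by rewrite -{2}(powRr1 A0) -powRD ?subrK// gt_eqF// implybT.
have sB : Num.sg a * b <= B.
  by rewrite (le_trans (ler_norm _))// normrM ler_piMl// normr_sg; case: (_ != 0).
have sA : Num.sg a * a = A by rewrite -normrEsg.
(* Young's inequality for the conjugate exponents [p] and [p / (p - 1)]. *)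
have young : p * A `^ (p - 1) * B <= B `^ p + (p - 1) * A `^ p.
  have q0 : 0 < p / (p - 1) by rewrite divr_gt0.
  have pq : p^-1 + (p / (p - 1))^-1 = 1 by rewrite invf_div; field; rewrite gt_eqF.
  have := conjugate_powR B0 (powR_ge0 A (p - 1)) p0 q0 pq.
  rewrite -powRrM mulrCA divff ?gt_eqF// mulr1 invf_div => h.
  have := ler_wpM2l (ltW p0) h; rewrite mulrDr.
  have -> : p * (B `^ p / p) = B `^ p by rewrite mulrC divfK// gt_eqF.
  have -> : p * (A `^ p * ((p - 1) / p)) = (p - 1) * A `^ p by field; rewrite gt_eqF.
  by rewrite [B * _]mulrC mulrA.
have : p * A `^ (p - 1) * (Num.sg a * b) <= p * A `^ (p - 1) * B.
  by rewrite ler_wpM2l// mulr_ge0 ?powR_ge0// ltW.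
have -> : p * Num.sg a * A `^ (p - 1) * (b - a) =
   p * A `^ (p - 1) * (Num.sg a * b) - p * (A `^ (p - 1) * A) by rewrite -sA; ring.
rewrite AA; lra.
Qed.

Section regular.
Variables (L gamma v : R) (W : T -> R * R -> R).
Hypotheses (L0 : 0 < L) (v0 : 0 < v) (gamma0 : 0 < gamma)
  (rW : regular_field L gamma v W).

(** The absolute constants 14 and 8 are the bounds on the mean and the variance
    at unit scale of [normal_mean_le14] and [normal_variance_le8]. *)
Definition Cmoment (p : R) : R := 2 * expR (p * 14 + p ^+ 2 * 8).

Lemma Cmoment_ge0 p : 0 <= Cmoment p.
Proof. by rewrite mulr_ge0// expR_ge0. Qed.

Lemma regular_exp t x : 0 <= t -> csq L x ->
  (\int[P]_w (expR (t * `|W w x|))%:E <= (Cmoment (t * v))%:E)%E.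
Proof.
move=> t0 xL; have [gW _ vW _] := rW.
have mx := field_measurable gW xL.
by apply: (normal_exp_moment t0 v0 mx (field_normal gW xL));
  apply: chebyshev_concentration => //; exact: vW.
Qed.

(** The scale of the increment is [v |x - y|^gamma]. *)
Lemma regular_increment p x y : 0 < p -> csq L x -> csq L y ->
  (\int[P]_w (`|W w x - W w y| `^ p)%:E <= (Cmoment p * v `^ p *
     (`|x.1 - y.1| + `|x.2 - y.2|) `^ (gamma * p))%:E)%E.
Proof.
move=> p0 xL yL; have [gW _ _ iW] := rW.
have dist0 : 0 <= `|x.1 - y.1| + `|x.2 - y.2| by rewrite addr_ge0.
have [dist_eq|dist_n0] := eqVneq (`|x.1 - y.1| + `|x.2 - y.2|) 0.
  have xy : x = y.
    move/eqP: dist_eq; rewrite paddr_eq0// !normr_eq0 !subr_eq0.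
    by case: x y {xL yL dist0} => [? ?] [? ?] /= /andP[/eqP-> /eqP->].
  under eq_integral do rewrite xy subrr normr0 powR0 ?gt_eqF//.
  by rewrite integral0 lee_fin !mulr_ge0 ?powR_ge0 ?Cmoment_ge0.
have dp : 0 < (`|x.1 - y.1| + `|x.2 - y.2|) `^ gamma by rewrite powR_gt0// lt0r dist_n0.
have vd : 0 < v * (`|x.1 - y.1| + `|x.2 - y.2|) `^ gamma by rewrite mulr_gt0.
have mB : measurable_fun setT (fun w => W w x - W w y).
  by apply: measurable_funB; apply: (field_measurable gW).
apply: (le_trans (normal_power_moment p0 vd mB (field_normalB gW xL yL) _)).
  by apply: chebyshev_concentration => //; exact: iW.
by rewrite lee_fin powRM ?(ltW v0) ?(ltW dp)// -powRrM mulrA.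
Qed.

(** By Jensen's inequality the interpolant inherits the exponential moments. *)
Lemma interp_exp N t x : (0 < N)%N -> 0 <= t -> csq L x ->
  (\int[P]_w (expR (t * `|interp L N (W w) x|))%:E <= (Cmoment (t * v))%:E)%E.
Proof.
move=> N0 t0 xL; have [gW _ _ _] := rW.
apply: (@le_trans _ _ (\int[P]_w (interp L N (fun z => expR (t * `|W w z|)) x)%:E)%E).
  apply: le_integral_any => w; first by rewrite lee_fin expR_ge0.
  rewrite lee_fin; apply: (@jensen_interp _ L N (W w) x (fun a => expR (t * `|a|))
    (fun a => t * Num.sg a * expR (t * `|a|))) => // a b.
  exact: exp_norm_slope.
apply: (@integral_interp_le _ _ _ P L N (fun w z => expR (t * `|W w z|))) => //.
- move=> z zL; apply: (measurableT_comp (@measurable_expR R)).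
  apply: measurable_funM => //; apply: measurableT_comp => //.
  exact: (field_measurable gW).
by move=> i j z _ _; apply: regular_exp => //; exact: grid_csq.
Qed.

(** The interpolation error is the interpolant of the increments [W z - W x]; by
    Jensen's inequality its moments are averages of those of increments over at
    most one cell. *)
Lemma interp_error N p x : (0 < N)%N -> 1 < p -> csq L x ->
  (\int[P]_w (`|W w x - interp L N (W w) x| `^ p)%:E <= (Cmoment p * v `^ p *
     (2 * (L / N%:R)) `^ (gamma * p))%:E)%E.
Proof.
move=> N0 p1 xL; have [gW _ _ _] := rW; have p0 : 0 < p by exact: lt_trans p1.
have h0 : 0 <= L / N%:R by rewrite divr_ge0// ltW.
apply: (@le_trans _ _ (\int[P]_w (interp L N (fun z => `|W w z - W w x| `^ p) x)%:E)%E).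
  apply: le_integral_any => w; first by rewrite lee_fin powR_ge0.
  rewrite lee_fin distrC.
  have -> : interp L N (W w) x - W w x = interp L N (fun z => W w z - W w x) x.
    by rewrite (interpD L N (W w) (fun=> - W w x)) interp_cst.
  apply: (@jensen_interp _ L N (fun z => W w z - W w x) x (fun a => `|a| `^ p)
    (fun a => p * Num.sg a * `|a| `^ (p - 1))) => // a b.
  exact: power_norm_slope.
apply: (@integral_interp_le _ _ _ P L N (fun w z => `|W w z - W w x| `^ p)) => //.
- move=> z zL; apply: measurable_fun_powR => //; apply: measurableT_comp => //.
  by apply: measurable_funB; exact: (field_measurable gW).
move=> i j z z1 z2; have zL : csq L z by exact: grid_csq.
apply: (le_trans (regular_increment p0 zL xL)).
rewrite lee_fin ler_wpM2l ?mulr_ge0 ?Cmoment_ge0 ?powR_ge0//.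
rewrite ge0_ler_powR ?nnegrE ?addr_ge0 ?mulr_ge0 ?(ltW gamma0) ?(ltW p0) ?(ltW L0)//.
by rewrite distrC [X in _ + X]distrC mulr_natl mulr2n lerD.
Qed.

End regular.
End continuous_version.

(** * Independence and random evaluation points *)

Section independence.
Context {R : realType} {d : measure_display} {T : measurableType d}.
Variable P : probability T R.
Implicit Types (F G : set (set T)).

Lemma indepS F F' G G' : F' `<=` F -> G' `<=` G -> indep P F G -> indep P F' G'.
Proof.
move=> FF GG h E E' EF EG; apply: h.
- exact: (@sub_sigma_algebra2 _ setT F F' FF _ EF).
- exact: (@sub_sigma_algebra2 _ setT G G' GG _ EG).
Qed.

Lemma gens_measurable (S : set (R * R)) (W : T -> R * R -> R) :
  (forall z, S z -> measurable_fun setT (W^~ z)) ->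
  <<s gens S W >> `<=` measurable.
Proof.
move=> mW; apply: smallest_sub; first exact: sigma_algebra_measurable.
by move=> _ [z Sz [B mB ->]]; rewrite -[_ @^-1` _]setTI; exact: mW.
Qed.

Lemma gens_fun (U : Type) (S : set U) (X : T -> U -> R) G z : S z ->
  gens S X `<=` G ->
  measurable_fun setT ((X^~ z) : g_sigma_algebraType G -> R).
Proof.
move=> Sz XG _ B mB; rewrite setTI; apply: sub_sigma_algebra; apply: XG.
by exists z => //; exists B.
Qed.

(** Every event of the modified field coincides, off the exceptional null set,
    with an event of the field. *)
Lemma indep_version F (S : set (R * R)) (W W' : T -> R * R -> R) (N : set T) :
  <<s F >> `<=` measurable ->
  (forall z, S z -> measurable_fun setT (W^~ z)) ->
  (forall z, S z -> measurable_fun setT (W'^~ z)) ->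
  measurable N -> P N = 0%E -> (forall w, ~ N w -> W' w = W w) ->
  indep P F (gens S W) -> indep P F (gens S W').
Proof.
move=> mF mW mW' mN PN WE ind E E' EF EG.
have [A AG AE] : exists2 A, <<s gens S W >> A & forall w, ~ N w -> E' w <-> A w.
  apply: (@smallest_sub _ _ (gens S W')
    [set E' | exists2 A, <<s gens S W >> A & forall w, ~ N w -> E' w <-> A w]) EG.
    split.
    - by exists set0 => //; exact: sigma_algebra0.
    - move=> B [A sA AB]; exists (setT `\` A); first exact: sigma_algebraCD.
      by move=> w Nw; have := AB w Nw; rewrite /setD /=; tauto.
    - move=> B /= hB; have [A hA] := choice (fun n => let: ex_intro2 A a b := hB n in ex_intro (fun A => <<s gens S W >> A /\ forall w, ~ N w -> B n w <-> A w) A (conj a b)).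
      exists (\bigcup_n A n); first by apply: sigma_algebra_bigcup => n; have [] := hA n.
      by move=> w Nw; split=> -[n _ h]; exists n => //; have [_ hn] := hA n; apply/(hn _ Nw).
  move=> _ [z Sz [B mB ->]]; exists ((W^~ z) @^-1` B).
    by apply: sub_sigma_algebra; exists z => //; exists B.
  by move=> w Nw /=; rewrite WE.
have mE := mF _ EF; have mA := gens_measurable mW AG; have mE' := gens_measurable mW' EG.
have PE (B B' : set T) : measurable B -> measurable B' ->
    (forall w, ~ N w -> B w <-> B' w) -> P B = P B'.
  move=> mB mB' h; have Z (C : set T) : measurable C -> P C = P (C `\` N).
    move=> mC; rewrite measureD//=; last by rewrite ltey_eq fin_num_measure.
    by rewrite (@subset_measure0 _ _ _ P (C `&` N) N)//= ?sube0//; exact: measurableI.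
  rewrite Z// [RHS]Z//; congr (P _); apply/seteqP.
  by split=> w [Bw Nw]; split => //; have := h w Nw; tauto.
rewrite (PE E' A)// (PE (E `&` E') (E `&` A))//; try exact: measurableI.
  exact: ind.
by move=> w Nw; have := AE w Nw; rewrite /setI /=; tauto.
Qed.

(** On two copies of the sample space, one with each of two independent
    sigma-algebras, the diagonal carries [P] to the product measure. *)
Lemma indep_tonelli F G (f : T * T -> \bar R) :
  <<s F >> `<=` measurable -> <<s G >> `<=` measurable -> indep P F G ->
  measurable_fun setT (f : g_sigma_algebraType F * g_sigma_algebraType G -> \bar R) ->
  (forall z, (0 <= f z)%E) ->
  (\int[P]_w f (w, w) = \int[P]_w \int[P]_w' f (w, w'))%E.
Proof.
move=> mF mG ind mf f0.
pose X : T -> g_sigma_algebraType F := id.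
pose Y : T -> g_sigma_algebraType G := id.
have mX : measurable_fun setT X by move=> _ B mB; rewrite setTI; exact: mF.
have mY : measurable_fun setT Y by move=> _ B mB; rewrite setTI; exact: mG.
pose Xm := isMeasurableFun.Build _ _ _ _ X mX.
pose Ym := isMeasurableFun.Build _ _ _ _ Y mY.
pose X' : {mfun T >-> g_sigma_algebraType F} := HB.pack X Xm.
pose Y' : {mfun T >-> g_sigma_algebraType G} := HB.pack Y Ym.
pose Z : T -> g_sigma_algebraType F * g_sigma_algebraType G := fun w => (X w, Y w).
have mZ : measurable_fun setT Z by exact: measurable_fun_pair.
pose Zm := isMeasurableFun.Build _ _ _ _ Z mZ.
pose Z' : {mfun T >-> (g_sigma_algebraType F * g_sigma_algebraType G)%type} := HB.pack Z Zm.
pose P1 := distribution P X'; pose P2 := distribution P Y'.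
transitivity (\int[distribution P Z']_z f z)%E.
  by rewrite ge0_integral_distribution.
transitivity (\int[(P1 \x P2)%E]_z f z)%E.
  apply: eq_measure_integral => A mA _; apply/esym.
  apply: (@product_measure_unique _ _ _ _ R P1 P2 (distribution P Z')) .
  - by move=> B C mB mC; exact: ind.
  - exact: mA.
have mF2 := @measurable_fun_fubini_tonelli_F _ _ (g_sigma_algebraType F) (g_sigma_algebraType G) R P2 f mf f0.
have F20 y : (0 <= fubini_F P2 f y)%E by apply: integral_ge0.
rewrite (@fubini_tonelli1 _ _ _ _ R P1 P2 f mf f0).
rewrite (@ge0_integral_distribution _ _ _ _ _ P X' _ mF2 F20).
apply: eq_integral => w _; rewrite /fubini_F.
have mfw : measurable_fun setT ((fun y => f (X' w, y)) : g_sigma_algebraType G -> \bar R).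
  exact: measurableT_comp mf (pair1_measurable _).
exact: (@ge0_integral_distribution _ _ _ _ _ P Y' _ mfw (fun y => f0 (X' w, y))).
Qed.

(** The field and the points are separated by [indep_tonelli], so that the bound
    at fixed points may be integrated over the points. *)
Lemma indep_field_increment F G (K p s C : R) (W : T -> R * R -> R)
    (X1 X2 Y1 Y2 : T -> R) :
  0 < K -> 0 <= C -> <<s F >> `<=` measurable -> <<s G >> `<=` measurable -> indep P F G ->
  (forall z, csq K z -> measurable_fun setT ((W^~ z) : g_sigma_algebraType G -> R)) ->
  (forall w, {within csq K, continuous (W w)}) ->
  measurable_fun setT (X1 : g_sigma_algebraType F -> R) ->
  measurable_fun setT (X2 : g_sigma_algebraType F -> R) ->
  measurable_fun setT (Y1 : g_sigma_algebraType F -> R) ->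
  measurable_fun setT (Y2 : g_sigma_algebraType F -> R) ->
  (forall w, csq K (X1 w, X2 w)) -> (forall w, csq K (Y1 w, Y2 w)) ->
  (forall x y, csq K x -> csq K y -> (\int[P]_w (`|W w x - W w y| `^ p)%:E <=
    (C * (`|x.1 - y.1| + `|x.2 - y.2|) `^ s)%:E)%E) ->
  (\int[P]_w (`|W w (X1 w, X2 w) - W w (Y1 w, Y2 w)| `^ p)%:E <=
   C%:E * \int[P]_w ((`|X1 w - Y1 w| + `|X2 w - Y2 w|) `^ s)%:E)%E.
Proof.
move=> K0 C0 mF mG ind mW cW mX1 mX2 mY1 mY2 XK YK WC.
pose T1 := g_sigma_algebraType F; pose T2 := g_sigma_algebraType G.
pose f (z : T * T) := (`|W z.2 (X1 z.1, X2 z.1) - W z.2 (Y1 z.1, Y2 z.1)| `^ p)%:E.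
have mJ := @caratheodory_measurable _ T2 R K W K0 mW cW.
have mWX (A B : T -> R) : measurable_fun setT (A : T1 -> R) -> measurable_fun setT (B : T1 -> R) ->
    (forall w, csq K (A w, B w)) ->
    measurable_fun setT ((fun z => W z.2 (A z.1, B z.1)) : T1 * T2 -> R).
  move=> mA mB AB.
  have mp : measurable_fun setT ((fun z => (z.2, (A z.1, B z.1))) : T1 * T2 -> T2 * (R * R)).
    apply: measurable_fun_pair; first exact: measurable_snd.
    by apply: measurable_fun_pair; apply: measurableT_comp => //; exact: measurable_fst.
  apply: (measurable_comp _ _ mJ mp).
  - by apply: measurableX => //; exact: measurable_csq.
  - by move=> _ [z _ <-]; split => //=; exact: AB.
have mf : measurable_fun setT (f : T1 * T2 -> \bar R).
  apply/measurable_EFinP; apply: measurable_fun_powR; apply: measurableT_comp => //.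
  by apply: measurable_funB; apply: mWX.
have f0 z : (0 <= f z)%E by rewrite lee_fin powR_ge0.
rewrite [leLHS](indep_tonelli mF mG ind mf f0).
rewrite -ge0_integralZl_EFin//; last first.
- have up (A : T -> R) : measurable_fun setT (A : T1 -> R) -> measurable_fun setT A.
    by move=> mA _ B mB; apply: mF; exact: mA.
  apply/measurable_EFinP; apply: measurable_fun_powR.
  by apply: measurable_funD; apply: measurableT_comp => //;
    apply: measurable_funB; exact: up.
apply: le_integral_any => w; first by apply: integral_ge0.
rewrite -EFinM; exact: (WC (X1 w, X2 w) (Y1 w, Y2 w) (XK w) (YK w)).
Qed.

End independence.

(** * The pointwise error of the coefficient *)

Section elementary.
Context {R : realType}.
Implicit Types (a b s t p phi psi : R).

Lemma powR_addl a b s : 0 <= a -> 0 <= b -> 0 <= s ->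
  (a + b) `^ s <= 2 `^ s * (a `^ s + b `^ s).
Proof.
move=> a0 b0 s0; wlog ab : a b a0 b0 / a <= b.
  move=> H; have [ab|/ltW ba] := leP a b; first exact: H.
  by rewrite addrC [_ + b `^ s]addrC; exact: H.
apply: (@le_trans _ _ ((2 * b) `^ s)).
  by rewrite ge0_ler_powR ?nnegrE ?addr_ge0 ?mulr_ge0// mulr_natl mulr2n lerD2r.
by rewrite powRM// ler_wpM2l ?powR_ge0// lerDr powR_ge0.
Qed.

Lemma chi_lipschitz A s t : `|chi A s - chi A t| <= `|s - t|.
Proof.
rewrite /chi; wlog st : s t / s <= t.
  move=> H; have [st|/ltW ts] := leP s t; first exact: H.
  by rewrite distrC [leRHS]distrC; exact: H.
rewrite distrC [leRHS]distrC !ger0_norm ?subr_ge0 ?le_min2r//.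
- by have [sA|As] := leP s A; have [tA|At] := leP t A; lra.
- by have [sA|As] := leP s A; have [tA|At] := leP t A; lra.
Qed.

(** The mean value theorem; between two points [|x|] is at most the larger of
    their absolute values. *)
Lemma exp_growth_increment phi psi (F : R -> R) s t : 0 <= phi -> 0 <= psi ->
  (forall x, derivable F x 1) -> (forall x, `|derive1 F x| <= phi * expR (psi * `|x|)) ->
  `|F s - F t| <= phi * ((expR (psi * `|s|) + expR (psi * `|t|)) * `|s - t|).
Proof.
move=> phi0 psi0 dF bF; wlog st : s t / s <= t.
  move=> H; have [st|/ltW ts] := leP s t; first exact: H.
  by rewrite distrC [`|s - t|]distrC [expR _ + _]addrC; exact: H.
have fd u : u \in `]s, t[ -> is_derive u (1 : R) F (derive1 F u).
  by move=> _; rewrite derive1E; exact: DeriveDef.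
have cF : {within `[s, t], continuous F}.
  by apply: derivable_within_continuous => u _; exact: dF.
have [u uI E] := MVT_segment st fd cF.
rewrite distrC E normrM mulrA [`|t - s|]distrC ler_wpM2r// (le_trans (bF u))// ler_wpM2l//.
move: uI; rewrite in_itv/= => /andP[su ut].
have [u0|u0] := leP 0 u.
  apply: (@le_trans _ _ (expR (psi * `|t|))); last by rewrite lerDr expR_ge0.
  by rewrite ler_expR ler_wpM2l// ger0_norm// (le_trans ut)// ler_norm.
apply: (@le_trans _ _ (expR (psi * `|s|))); last by rewrite lerDl expR_ge0.
by rewrite ler_expR ler_wpM2l// ltr0_norm// -normrN (le_trans _ (ler_norm _))// lerN2.
Qed.

End elementary.

Section coefficient_moments.
Context {R : realType} {d : measure_display} {T : measurableType d}.
Variable P : probability T R.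
Implicit Types (p gamma v L : R) (W : T -> R * R -> R) (F G : set (set T)).

Definition Cphi p v phi psi : R :=
  phi `^ p * ((2 `^ (p * 2) * (2 * Cmoment (psi * (p * 2) * v))) `^ 2^-1 *
    (Cmoment (p * 2) * v `^ (p * 2)) `^ 2^-1).

(** Cauchy-Schwarz separates the exponential growth of [Phi'] from the
    interpolation error. *)
Lemma interp_phi_error p gamma v L W phi psi (Phi : R -> R) N x :
  0 < L -> 0 < v -> 0 < gamma -> regular_field P L gamma v W -> 1 < p ->
  0 <= phi -> 0 <= psi -> continuous Phi ->
  (forall x, derivable Phi x 1) ->
  (forall x, `|derive1 Phi x| <= phi * expR (psi * `|x|)) ->
  (0 < N)%N -> csq L x ->
  (\int[P]_w (`|Phi (interp L N (W w) x) - Phi (W w x)| `^ p)%:E <=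
   (Cphi p v phi psi * (2 * (L / N%:R)) `^ (gamma * p))%:E)%E.
Proof.
move=> L0 v0 gamma0 rW p1 phi0 psi0 cPhi dPhi bPhi N0 xL.
have [gW _ _ _] := rW; have p0 : 0 < p by exact: lt_trans p1.
have p20 : 0 < p * 2 by exact: mulr_gt0.
have mW : measurable_fun setT (W^~ x) by exact: (field_measurable gW xL).
have mI : measurable_fun setT (fun w => interp L N (W w) x).
  by apply: measurable_interp_at => // z; exact: (field_measurable gW).
pose e (w : T) := expR (psi * `|interp L N (W w) x|) + expR (psi * `|W w x|).
have e0 w : 0 <= e w by rewrite addr_ge0 ?expR_ge0.
have me (X : T -> R) t : measurable_fun setT X -> measurable_fun setT (fun w => expR (t * `|X w|)).
  move=> mX; apply: (measurableT_comp (@measurable_expR R)).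
  by apply: measurable_funM => //; exact: measurableT_comp.
pose f w := e w `^ p.
pose g w := `|W w x - interp L N (W w) x| `^ p.
have mf : measurable_fun setT f.
  by apply: measurable_fun_powR; apply: measurable_funD; exact: me.
have mg : measurable_fun setT g.
  by apply: measurable_fun_powR; apply: measurableT_comp => //; exact: measurable_funB.
have h := hoelder_ge0 P mf mg (fun w => powR_ge0 _ _) (fun w => powR_ge0 _ _)
  (p := 2) (q := 2) (ltr0Sn _ _) (ltr0Sn _ _).
have {}h : (\int[P]_w (f w * g w)%:E <=
   (\int[P]_w (f w `^ 2)%:E) `^ 2^-1 * (\int[P]_w (g w `^ 2)%:E) `^ 2^-1)%E.
  by apply: h; field.
have hg : (\int[P]_w (g w `^ 2)%:E <=
    (Cmoment (p * 2) * v `^ (p * 2) * (2 * (L / N%:R)) `^ (gamma * (p * 2)))%:E)%E.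
  under eq_integral do rewrite -powRrM.
  apply: (interp_error L0 v0 gamma0 rW N0 _ xL).
  by rewrite mulr_natr mulr2n ltr_wpDl// ltW.
have hf : (\int[P]_w (f w `^ 2)%:E <=
    (2 `^ (p * 2) * (2 * Cmoment (psi * (p * 2) * v)))%:E)%E.
  apply: (@le_trans _ _ (\int[P]_w ((2 `^ (p * 2))%:E *
     ((expR (psi * (p * 2) * `|interp L N (W w) x|))%:E + (expR (psi * (p * 2) * `|W w x|))%:E)))%E).
    apply: le_integral_any => w; first by rewrite lee_fin powR_ge0.
    rewrite -EFinD -EFinM lee_fin /f -powRrM.
    apply: (le_trans (powR_addl (expR_ge0 _) (expR_ge0 _) (ltW p20))).
    by rewrite -!expRM mulrAC [psi * `|W w x| * _]mulrAC.
  rewrite ge0_integralZl_EFin ?powR_ge0//; last 2 first.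
  - by move=> w _; rewrite -EFinD lee_fin addr_ge0 ?expR_ge0.
  - by apply/measurable_EFinP; apply: measurable_funD; exact: me.
  rewrite (EFinM (2 `^ (p * 2))) lee_wpmul2l ?lee_fin ?powR_ge0//.
  rewrite ge0_integralD//; last 2 first.
  - by apply/measurable_EFinP; exact: me.
  - by apply/measurable_EFinP; exact: me.
  rewrite mulr_natl mulr2n EFinD leeD//.
  - by apply: (interp_exp L0 v0 rW N0 _ xL); rewrite mulr_ge0// ltW.
  - by apply: (regular_exp v0 rW _ xL); rewrite mulr_ge0// ltW.
apply: (@le_trans _ _ ((phi `^ p)%:E * \int[P]_w (f w * g w)%:E)%E).
  rewrite -ge0_integralZl_EFin ?powR_ge0//; last 2 first.
  - by move=> w _; rewrite lee_fin mulr_ge0 ?powR_ge0.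
  - by apply/measurable_EFinP; exact: measurable_funM.
  apply: le_integral_any => w; first by rewrite lee_fin powR_ge0.
  rewrite -EFinM lee_fin /f /g -!powRM ?mulr_ge0//.
  rewrite ge0_ler_powR ?nnegrE ?(ltW p0) ?mulr_ge0//.
  rewrite (le_trans (exp_growth_increment _ _ phi0 psi0 dPhi bPhi))//.
  by rewrite [`|_ - W w x|]distrC.
rewrite /Cphi -(mulrA (phi `^ p)) (EFinM (phi `^ p)) lee_wpmul2l ?lee_fin ?powR_ge0//.
apply: (le_trans h); rewrite -mulrA EFinM.
set u := 2 `^ (p * 2) * _ in hf *; set k := Cmoment (p * 2) * _ in hg *.
have u0 : 0 <= u by rewrite mulr_ge0 ?powR_ge0// mulr_ge0 ?Cmoment_ge0.
have k0 : 0 <= k by rewrite mulr_ge0 ?powR_ge0 ?Cmoment_ge0.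
have i0 (q : T -> R) : (0 <= \int[P]_w (q w `^ 2)%:E)%E.
  by apply: integral_ge0 => w _; rewrite lee_fin powR_ge0.
apply: lee_pmul; rewrite ?poweR_ge0//.
  by rewrite -poweR_EFin; apply: le_poweR2r.
have -> : k `^ 2^-1 * (2 * (L / N%:R)) `^ (gamma * p) =
    (k * (2 * (L / N%:R)) `^ (gamma * (p * 2))) `^ 2^-1.
  rewrite (powRM _ k0 (powR_ge0 _ _)) -powRrM; congr (_ * _ `^ _).
  by rewrite mulrA mulfK.
by rewrite -poweR_EFin; apply: le_poweR2r.
Qed.

(** As in [indep_field_increment], the points are frozen. *)
Lemma indep_interp_error F G K p gamma v W N (Y1 Y2 : T -> R) :
  0 < K -> 0 < v -> 0 < gamma -> regular_field P K gamma v W -> (0 < N)%N -> 1 < p ->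
  <<s F >> `<=` measurable -> <<s G >> `<=` measurable -> indep P F G ->
  (forall z, csq K z -> measurable_fun setT ((W^~ z) : g_sigma_algebraType G -> R)) ->
  measurable_fun setT (Y1 : g_sigma_algebraType F -> R) ->
  measurable_fun setT (Y2 : g_sigma_algebraType F -> R) ->
  (forall w, csq K (Y1 w, Y2 w)) ->
  (\int[P]_w (`|W w (Y1 w, Y2 w) - interp K N (W w) (Y1 w, Y2 w)| `^ p)%:E <=
   (Cmoment p * v `^ p * (2 * (K / N%:R)) `^ (gamma * p))%:E)%E.
Proof.
move=> K0 v0 gamma0 rW N0 p1 mF mG ind mW mY1 mY2 YK.
have [gW cW _ _] := rW; have p0 : 0 < p by exact: lt_trans p1.
pose T1 := g_sigma_algebraType F; pose T2 := g_sigma_algebraType G.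
pose f (z : T * T) := (`|W z.2 (Y1 z.1, Y2 z.1) -
  interp K N (W z.2) (Y1 z.1, Y2 z.1)| `^ p)%:E.
have mJ := @caratheodory_measurable _ T2 R K W K0 mW cW.
have mI := @measurable_interp _ T2 R K N W K0 mW.
have mp : measurable_fun setT ((fun z => (z.2, (Y1 z.1, Y2 z.1))) : T1 * T2 -> T2 * (R * R)).
  apply: measurable_fun_pair; first exact: measurable_snd.
  by apply: measurable_fun_pair; apply: measurableT_comp => //; exact: measurable_fst.
have mf : measurable_fun setT (f : T1 * T2 -> \bar R).
  apply/measurable_EFinP; apply: measurable_fun_powR; apply: measurableT_comp => //.
  apply: measurable_funB; last exact: (measurableT_comp mI mp).
  apply: (measurable_comp _ _ mJ mp).
  - by apply: measurableX => //; exact: measurable_csq.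
  - by move=> _ [z _ <-]; split => //=; exact: YK.
have f0 z : (0 <= f z)%E by rewrite lee_fin powR_ge0.
rewrite [leLHS](indep_tonelli mF mG ind mf f0).
set c := (_ * _ `^ (gamma * p))%R.
have -> : (c%:E = \int[P]_w c%:E)%E.
  by rewrite integral_cst//= probability_setT mule1.
apply: le_integral_any => w; first by apply: integral_ge0.
exact: (interp_error K0 v0 gamma0 rW N0 p1 (YK w)).
Qed.

(** Agrees with [chi] on nonnegative values and always lies in [[0, K]]; the
    values of the subordinators and of their approximations are nonnegative only
    almost surely. *)
Definition clamp (K t : R) : R := Num.max 0 (chi K t).

Lemma clamp_in K t : 0 < K -> clamp K t \in `[0, K].
Proof.
move=> K0; rewrite in_itv/= /clamp /chi le_max lexx/= ge_max (ltW K0)/=.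
by rewrite ge_min lexx orbT.
Qed.

Lemma clamp_csq K s t : 0 < K -> csq K (clamp K s, clamp K t).
Proof. by move=> K0; split; exact: clamp_in. Qed.

Lemma clampE K t : 0 < K -> 0 <= t -> clamp K t = chi K t.
Proof. by move=> K0 t0; apply/max_idPr; rewrite /chi le_min t0 ltW. Qed.

Lemma clamp_lipschitz K s t : `|clamp K s - clamp K t| <= `|s - t|.
Proof.
apply: le_trans (chi_lipschitz K s t); rewrite /clamp.
set a := chi K s; set b := chi K t.
have [a0|a0] := leP 0 a; have [b0|b0] := leP 0 b => //.
- by rewrite subr0 !ger0_norm ?subr_ge0; lra.
- by rewrite sub0r normrN ger0_norm// distrC ger0_norm; lra.
- by rewrite subr0 normr0.
Qed.

Lemma measurable_clamp K : measurable_fun setT (clamp K).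
Proof.
apply: measurable_maxr; first exact: measurable_cst.
by apply: measurable_minr => //; exact: measurable_id.
Qed.
End coefficient_moments.

Section pair_on.
Context {d d1 d2 : measure_display} {U : measurableType d} {T1 : measurableType d1}
  {T2 : measurableType d2}.

Lemma measurable_fun_pair_on (S : set U) (f : U -> T1) (g : U -> T2) :
  measurable_fun S f -> measurable_fun S g -> measurable_fun S (fun u => (f u, g u)).
Proof.
move=> mf mg mS; have := mS.
have mh : measurable_fun setT (fun u => ((f \_ S) u, (g \_ S) u)).
  by apply: measurable_fun_pair; apply/(measurable_restrictT _ mS).
apply: (eq_measurable_fun (fun u => ((f \_ S) u, (g \_ S) u))).
  by move=> u uS; rewrite /patch uS.
exact: measurable_funTS.
Qed.

End pair_on.

Section field_composition.
Context {R : realType} {d d' : measure_display} {T : measurableType d} {U : measurableType d'}.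

Lemma measurable_field_comp (K : R) (W : T -> R * R -> R) (S : set U)
    (om : U -> T) (X Y : U -> R) : 0 < K -> measurable S ->
  (forall z, csq K z -> measurable_fun setT (W^~ z)) ->
  (forall w, {within csq K, continuous (W w)}) ->
  measurable_fun S om -> measurable_fun S X -> measurable_fun S Y ->
  (forall u, S u -> csq K (X u, Y u)) ->
  measurable_fun S (fun u => W (om u) (X u, Y u)).
Proof.
move=> K0 mS mW cW mom mX mY XY.
have mJ := caratheodory_measurable K0 mW cW.
have mp : measurable_fun S (fun u => (om u, (X u, Y u))).
  by apply: measurable_fun_pair_on => //; exact: measurable_fun_pair_on.
apply: (measurable_comp _ _ mJ mp).
- by apply: measurableX => //; exact: measurable_csq.
- by move=> _ [u Su <-]; split => //=; exact: XY.
Qed.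

Lemma measurable_interp_comp (K : R) N (W : T -> R * R -> R) (S : set U)
    (om : U -> T) (X Y : U -> R) : 0 < K ->
  (forall z, csq K z -> measurable_fun setT (W^~ z)) ->
  measurable_fun S om -> measurable_fun S X -> measurable_fun S Y ->
  measurable_fun S (fun u => interp K N (W (om u)) (X u, Y u)).
Proof.
move=> K0 mW mom mX mY.
have mJ := @measurable_interp _ _ _ K N W K0 mW.
have mp : measurable_fun S (fun u => (om u, (X u, Y u))).
  by apply: measurable_fun_pair_on => //; exact: measurable_fun_pair_on.
exact: (measurableT_comp mJ mp).
Qed.

End field_composition.

Section coefficient_error.
Context {R : realType} {d : measure_display} {T : measurableType d}.
Variables (P : probability T R) (D K A p gamma v phi psi Clip Cl : R).
Variables (Phi1 Phi2 : R -> R) (abar : R * R -> R).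
Hypotheses (D0 : 0 < D) (K0 : 0 < K) (v0 : 0 < v) (gamma0 : 0 < gamma) (p1 : 1 < p)
  (phi0 : 0 <= phi) (psi0 : 0 <= psi) (Clip0 : 0 <= Clip) (Cl0 : 0 <= Cl)
  (cPhi1 : continuous Phi1)
  (dPhi1 : forall x, derivable Phi1 x 1)
  (bPhi1 : forall x, `|derive1 Phi1 x| <= phi * expR (psi * `|x|))
  (lPhi2 : forall x y, `|Phi2 x - Phi2 y| <= Clip * `|x - y|).

(** The coefficient with [clamp] in place of [chi], which is meaningful for
    every sample. *)
Definition regular_coefficient (V1 V2 : R * R -> R) (k1 k2 : R -> R) (x : R * R) : R :=
  chi A (abar x + Phi1 (V1 x) + Phi2 (V2 (clamp K (k1 x.1), clamp K (k2 x.2)))).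

Definition Ccoef : R := 2 `^ p * 2 `^ (gamma * p) *
  (Cphi p v phi psi + Clip `^ p * 2 `^ p * (Cmoment p * v `^ p) * (1 + 2 * Cl)).

Variables (W1 W2 : T -> R * R -> R) (l1 l2 m1 m2 : T -> R -> R) (F G : set (set T)).
Hypotheses (rW1 : regular_field P D gamma v W1) (rW2 : regular_field P K gamma v W2)
  (mF : <<s F >> `<=` measurable) (mG : <<s G >> `<=` measurable) (ind : indep P F G)
  (mW2 : forall z, csq K z -> measurable_fun setT ((W2^~ z) : g_sigma_algebraType G -> R))
  (ml1 : forall t, t \in `[0, D] -> measurable_fun setT ((l1^~ t) : g_sigma_algebraType F -> R))
  (ml2 : forall t, t \in `[0, D] -> measurable_fun setT ((l2^~ t) : g_sigma_algebraType F -> R))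
  (mm1 : forall t, t \in `[0, D] -> measurable_fun setT ((m1^~ t) : g_sigma_algebraType F -> R))
  (mm2 : forall t, t \in `[0, D] -> measurable_fun setT ((m2^~ t) : g_sigma_algebraType F -> R)).

Let p0 : 0 < p. Proof. exact: lt_trans p1. Qed.

Let up (X : T -> R) : measurable_fun setT (X : g_sigma_algebraType F -> R) ->
  measurable_fun setT X.
Proof. by move=> mX _ B mB; apply: mF; exact: mX. Qed.

Let clampF (X : T -> R) : measurable_fun setT (X : g_sigma_algebraType F -> R) ->
  measurable_fun setT ((fun w => clamp K (X w)) : g_sigma_algebraType F -> R).
Proof. by move=> mX; exact: (measurableT_comp (measurable_clamp K) mX). Qed.

(** The error splits into that of [Phi1] at the interpolated field, the
    interpolation error of the second field at the approximate points, and its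
    increment between exact and approximate points; cutting off by [chi A] is
    nonexpansive. *)
Lemma coefficient_error (eW el : R) (N1 N2 : nat) x : 0 < eW -> 0 < el -> csq D x ->
  (0 < N1)%N -> D / N1%:R <= eW -> (0 < N2)%N -> K / N2%:R <= eW ->
  (forall t, t \in `[0, D] ->
    (\int[P]_w (`|l1 w t - m1 w t| `^ (gamma * p))%:E <= (Cl * el)%:E)%E) ->
  (forall t, t \in `[0, D] ->
    (\int[P]_w (`|l2 w t - m2 w t| `^ (gamma * p))%:E <= (Cl * el)%:E)%E) ->
  (\int[P]_w (`|regular_coefficient (interp D N1 (W1 w)) (interp K N2 (W2 w)) (m1 w) (m2 w) x
     - regular_coefficient (W1 w) (W2 w) (l1 w) (l2 w) x| `^ p)%:E <=
   (Ccoef * (eW `^ (gamma * p) + el))%:E)%E.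
Proof.
move=> eW0 el0 xD N10 N1e N20 N2e El1 El2.
have [x1 x2] := xD.
have [gW1 cW1 _ _] := rW1; have [gW2 cW2 _ iW2] := rW2.
have mW1' z := @field_measurable _ _ _ P D W1 gW1 z.
have mW2' z := @field_measurable _ _ _ P K W2 gW2 z.
have mZ1 := clampF (ml1 x1); have mZ2 := clampF (ml2 x2).
have mY1 := clampF (mm1 x1); have mY2 := clampF (mm2 x2).
set Z1 := (fun w => clamp K (l1 w x.1)) in mZ1.
set Z2 := (fun w => clamp K (l2 w x.2)) in mZ2.
set Y1 := (fun w => clamp K (m1 w x.1)) in mY1.
set Y2 := (fun w => clamp K (m2 w x.2)) in mY2.
have ZK w : csq K (Z1 w, Z2 w) by exact: clamp_csq.
have YK w : csq K (Y1 w, Y2 w) by exact: clamp_csq.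
pose s := gamma * p; have s0 : 0 < s by exact: mulr_gt0.
have gs (t : R) : 0 <= t -> t <= eW -> (2 * t) `^ s <= 2 `^ s * eW `^ s.
  move=> t0 te; rewrite powRM// ler_wpM2l ?powR_ge0//.
  by rewrite ge0_ler_powR ?nnegrE ?(ltW s0) ?(ltW eW0).
pose f1 w := Phi1 (interp D N1 (W1 w) x) - Phi1 (W1 w x).
pose f2 w := W2 w (Y1 w, Y2 w) - interp K N2 (W2 w) (Y1 w, Y2 w).
pose f3 w := W2 w (Z1 w, Z2 w) - W2 w (Y1 w, Y2 w).
have mWZ (A1 A2 : T -> R) : measurable_fun setT A1 -> measurable_fun setT A2 ->
    (forall w, csq K (A1 w, A2 w)) -> measurable_fun setT (fun w => W2 w (A1 w, A2 w)).
  by move=> mA1 mA2 A12; apply: (measurable_field_comp K0 _ mW2' cW2).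
have mf1 : measurable_fun setT f1.
  apply: measurable_funB.
    apply: measurableT_comp; first exact: continuous_measurable_fun.
    exact: measurable_interp_at.
  by apply: measurableT_comp; [exact: continuous_measurable_fun|exact: mW1'].
have mf2 : measurable_fun setT f2.
  apply: measurable_funB; first by apply: mWZ => //; exact: up.
  by apply: (measurable_interp_comp N2 K0 mW2'); [exact: measurable_id|exact: up|exact: up].
have mf3 : measurable_fun setT f3 by apply: measurable_funB; apply: mWZ => //; exact: up.
have mP (f : T -> R) : measurable_fun setT f -> measurable_fun setT (fun w => (`|f w| `^ p)%:E).
  by move=> mf; apply/measurable_EFinP; apply: measurable_fun_powR; exact: measurableT_comp.
have E1 : (\int[P]_w (`|f1 w| `^ p)%:E <= (Cphi p v phi psi * (2 `^ s * eW `^ s))%:E)%E.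
  have Cp0 : 0 <= Cphi p v phi psi by rewrite !mulr_ge0 ?powR_ge0.
  apply: (le_trans (interp_phi_error D0 v0 gamma0 rW1 p1 phi0 psi0 cPhi1 dPhi1 bPhi1 N10 xD)).
  by rewrite lee_fin ler_wpM2l// gs// divr_ge0// ltW.
set Cv := Cmoment p * v `^ p.
have Cv0 : 0 <= Cv by rewrite mulr_ge0 ?powR_ge0 ?Cmoment_ge0.
have E2 : (\int[P]_w (`|f2 w| `^ p)%:E <= (Cv * (2 `^ s * eW `^ s))%:E)%E.
  apply: (le_trans (indep_interp_error K0 v0 gamma0 rW2 N20 p1 mF mG ind mW2 mY1 mY2 YK)).
  by rewrite lee_fin ler_wpM2l// gs// divr_ge0// ltW.
have E3 : (\int[P]_w (`|f3 w| `^ p)%:E <= (Cv * (2 `^ s * (2 * Cl * el)))%:E)%E.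
  have inc x' y' : csq K x' -> csq K y' -> (\int[P]_w (`|W2 w x' - W2 w y'| `^ p)%:E <=
    (Cv * (`|x'.1 - y'.1| + `|x'.2 - y'.2|) `^ s)%:E)%E by exact: regular_increment.
  apply: (le_trans (indep_field_increment K0 Cv0 mF mG ind mW2 cW2 mZ1 mZ2 mY1 mY2 ZK YK inc)).
  rewrite (EFinM Cv) lee_wpmul2l ?lee_fin//.
  have mls (l m : T -> R -> R) t : measurable_fun setT ((l^~ t) : g_sigma_algebraType F -> R) ->
      measurable_fun setT ((m^~ t) : g_sigma_algebraType F -> R) ->
      measurable_fun setT (fun w => (`|l w t - m w t| `^ s)%:E).
    move=> ml mm; apply/measurable_EFinP; apply: measurable_fun_powR.
    by apply: measurableT_comp => //; apply: measurable_funB; exact: up.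
  have ms1 := mls _ _ _ (ml1 x1) (mm1 x1); have ms2 := mls _ _ _ (ml2 x2) (mm2 x2).
  apply: (@le_trans _ _ (\int[P]_w ((2 `^ s)%:E *
     ((`|l1 w x.1 - m1 w x.1| `^ s)%:E + (`|l2 w x.2 - m2 w x.2| `^ s)%:E)))%E).
    apply: le_integral_any => w; first by rewrite lee_fin powR_ge0.
    rewrite -EFinD -EFinM lee_fin; apply: (@le_trans _ _
      ((`|l1 w x.1 - m1 w x.1| + `|l2 w x.2 - m2 w x.2|) `^ s)).
      by rewrite ge0_ler_powR ?nnegrE ?addr_ge0 ?(ltW s0)// lerD// clamp_lipschitz.
    by apply: powR_addl => //; exact: ltW.
  rewrite ge0_integralZl_EFin ?powR_ge0//; last 2 first.
  - by move=> w _; rewrite -EFinD lee_fin addr_ge0 ?powR_ge0.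
  - exact: emeasurable_funD.
  rewrite (EFinM (2 `^ s)) lee_wpmul2l ?lee_fin ?powR_ge0//.
  rewrite ge0_integralD//.
  by rewrite -mulrA mulr_natl mulr2n EFinD leeD// ?El1 ?El2.
have bnd w : `|regular_coefficient (interp D N1 (W1 w)) (interp K N2 (W2 w)) (m1 w) (m2 w) x
     - regular_coefficient (W1 w) (W2 w) (l1 w) (l2 w) x| `^ p <=
   2 `^ p * (`|f1 w| `^ p + Clip `^ p * 2 `^ p * (`|f2 w| `^ p + `|f3 w| `^ p)).
  apply: (@le_trans _ _ ((`|f1 w| + Clip * (`|f2 w| + `|f3 w|)) `^ p)).
    rewrite ge0_ler_powR ?nnegrE ?(ltW p0)// ?addr_ge0 ?mulr_ge0 ?addr_ge0//.
    rewrite /regular_coefficient (le_trans (chi_lipschitz _ _ _))//.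
    set b1 := Phi2 _; set b2 := Phi2 _.
    have -> : abar x + Phi1 (interp D N1 (W1 w) x) + b1 - (abar x + Phi1 (W1 w x) + b2)
      = f1 w + (b1 - b2) by rewrite /f1; ring.
    rewrite (le_trans (ler_normD _ _))// lerD2l (le_trans (lPhi2 _ _))// ler_wpM2l//.
    rewrite -[`|f2 w|]normrN -[`|f3 w|]normrN (le_trans _ (ler_normD _ _))//.
    by rewrite le_eqVlt; apply/orP; left; apply/eqP; congr `|_|; rewrite /f2 /f3; ring.
  apply: (le_trans (powR_addl _ _ (ltW p0))) => //; first by rewrite mulr_ge0// addr_ge0.
  rewrite ler_wpM2l ?powR_ge0// lerD2l powRM ?addr_ge0// -mulrA ler_wpM2l ?powR_ge0//.
  by apply: powR_addl => //; exact: ltW.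
apply: (@le_trans _ _ ((2 `^ p)%:E * (\int[P]_w (`|f1 w| `^ p)%:E +
  (Clip `^ p * 2 `^ p)%:E * (\int[P]_w (`|f2 w| `^ p)%:E + \int[P]_w (`|f3 w| `^ p)%:E)))%E).
  have k0 : 0 <= Clip `^ p * 2 `^ p by rewrite mulr_ge0 ?powR_ge0.
  have m23 := emeasurable_funD (mP _ mf2) (mP _ mf3).
  have n0 (f : T -> R) w : [set: T] w -> (0 <= (`|f w| `^ p)%:E)%E.
    by move=> _; rewrite lee_fin powR_ge0.
  have n23 w : [set: T] w -> (0 <= (`|f2 w| `^ p)%:E + (`|f3 w| `^ p)%:E)%E.
    by move=> _; rewrite adde_ge0// lee_fin powR_ge0.
  have nk w : [set: T] w -> (0 <= (Clip `^ p * 2 `^ p)%:E *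
      ((`|f2 w| `^ p)%:E + (`|f3 w| `^ p)%:E))%E.
    by move=> Tw; rewrite mule_ge0// ?lee_fin// n23.
  have mk : measurable_fun setT (fun w => (Clip `^ p * 2 `^ p)%:E *
      ((`|f2 w| `^ p)%:E + (`|f3 w| `^ p)%:E))%E by exact: measurable_funeM.
  rewrite -(ge0_integralD _ measurableT (n0 f2) (mP _ mf2) (n0 f3) (mP _ mf3)).
  rewrite -(ge0_integralZl_EFin _ measurableT n23 m23 k0).
  rewrite -(ge0_integralD _ measurableT (n0 f1) (mP _ mf1) nk mk).
  rewrite -ge0_integralZl_EFin ?powR_ge0//; last 2 first.
  - by move=> w Tw; rewrite adde_ge0 ?nk ?n0.
  - by apply: emeasurable_funD => //; exact: mP.
  by apply: le_integral_any => w; rewrite ?lee_fin ?powR_ge0// -!EFinD -!EFinM lee_fin bnd.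
have k0 : 0 <= Clip `^ p * 2 `^ p by rewrite mulr_ge0 ?powR_ge0.
apply: (@le_trans _ _ ((2 `^ p)%:E * ((Cphi p v phi psi * (2 `^ s * eW `^ s))%:E +
  (Clip `^ p * 2 `^ p)%:E * ((Cv * (2 `^ s * eW `^ s))%:E +
     (Cv * (2 `^ s * (2 * Cl * el)))%:E)))%E).
  rewrite lee_wpmul2l ?lee_fin ?powR_ge0// leeD// lee_wpmul2l ?lee_fin//.
  exact: leeD.
rewrite [leLHS](_ : _ = (2 `^ p * (Cphi p v phi psi * (2 `^ s * eW `^ s) +
  Clip `^ p * 2 `^ p * (Cv * (2 `^ s * eW `^ s) + Cv * (2 `^ s * (2 * Cl * el)))))%:E)//.
rewrite lee_fin /Ccoef -/s -/Cv.
have Cp0 : 0 <= Cphi p v phi psi by rewrite !mulr_ge0 ?powR_ge0.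
set k := Clip `^ p * 2 `^ p in k0 *; set e := eW `^ s; set C := Cphi _ _ _ _ in Cp0 *.
set a := 2 `^ p; set b := 2 `^ s.
have [a0 b0 e0] : [/\ 0 <= a, 0 <= b & 0 <= e] by rewrite !powR_ge0.
rewrite -subr_ge0.
have -> : a * b * (C + k * Cv * (1 + 2 * Cl)) * (e + el) -
   a * (C * (b * e) + k * (Cv * (b * e) + Cv * (b * (2 * Cl * el)))) =
   a * b * (C * el + k * Cv * (2 * Cl * e + el)) by ring.
have el0' := ltW el0.
apply: mulr_ge0; first exact: mulr_ge0.
apply: addr_ge0; first exact: mulr_ge0.
apply: mulr_ge0; first exact: mulr_ge0.
by apply: addr_ge0 => //; apply: mulr_ge0 => //; exact: mulr_ge0.
Qed.

End coefficient_error.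

(** * Joint measurability of the coefficients *)

Section measurability.
Context {R : realType} {d : measure_display} {T : measurableType d}.
Variable P : probability T R.
Implicit Types (D K A : R).

(** A function that is continuous on the open square is there the limit of its
    compositions with homotheties carrying the closed square into the open
    one. *)
Lemma continuous_sq_measurable D (f : R * R -> R) : 0 < D ->
  {within sq D, continuous f} -> measurable_fun (sq D) f.
Proof.
move=> D0 cf.
pose t n : R := n.+2%:R^-1.
have tn n : 0 < t n < 1 by rewrite /t invr_gt0 ltr0n invf_lt1 ?ltr0n// ltr1n.
pose g n (x : R * R) := ((1 - t n) * x.1 + t n * (D / 2), (1 - t n) * x.2 + t n * (D / 2)).
have D2 : 0 < D / 2 by rewrite divr_gt0.
have gsq n x : csq D x -> sq D (g n x).
  move=> [/=]; rewrite !in_itv/= => /andP[a1 a2] /andP[b1 b2].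
  have /andP[t0 t1] := tn n.
  by split; rewrite /= in_itv/=; apply/andP; split; nra.
have cg n : continuous (g n).
  move=> x; apply: cvg_pair2.
  - by apply: cvgD; [apply: cvgM; [exact: cvg_cst|exact: cvg_fst]|exact: cvg_cst].
  - by apply: cvgD; [apply: cvgM; [exact: cvg_cst|exact: cvg_snd]|exact: cvg_cst].
have oS : open (sq D).
  rewrite /sq openE => x xD; have [dl dl0 dlD] := box_sub xD.
  exists (`]x.1 - dl, x.1 + dl[%classic, `]x.2 - dl, x.2 + dl[%classic) => //=.
  by split; apply: open_nbhs_nbhs; split; try exact: interval_open;
    rewrite /= in_itv/= ltrBlDr ltrDl dl0.
have cf' : {in sq D, continuous f} by rewrite -continuous_open_subspace.
have mg n : measurable_fun (csq D) (f \o g n).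
  apply: continuous_measurable2 => //; apply: within_continuous_comp.
  - move=> y /set_mem [x xD <-]; apply: cf'; rewrite inE; exact: gsq.
  - exact: continuous_subspaceT.
have t0 : t n @[n --> \oo] --> (0 : R).
  have := @cvg_harmonic R; rewrite -cvg_shiftS; exact.
apply: (@measurable_fun_cvg _ _ R _ (fun n => f \o g n)).
- by move=> n; apply: (measurable_funS _ _ (mg n)); [exact: measurable_csq|exact: sq_csq].
move=> x xD /=.
apply: (@cvg_comp _ _ _ (fun n => g n x) f); last by apply: cf'; rewrite inE.
have lim0 (a : R) : (1 - t n) * a + t n * (D / 2) @[n --> \oo] --> a.
  rewrite [X in _ --> X](_ : a = (1 - 0) * a + 0 * (D / 2)); last by ring.
  apply: cvgD; last by apply: cvgMl.
  by apply: cvgMl; apply: cvgB => //; exact: cvg_cst.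
by apply: cvg_pair2; exact: lim0.
Qed.

(** Right-continuous paths are limits of their values at the next node of a
    grid. *)
Lemma right_continuous_measurable D (l : T -> R -> R) : 0 < D ->
  (forall t, t \in `[0, D] -> measurable_fun setT (l^~ t)) ->
  (forall w t, 0 <= t < D -> l w s @[s --> t^'+] --> l w t) ->
  measurable_fun ([set: T] `*` `]0, D[) (fun z => l z.1 z.2).
Proof.
move=> D0 ml cl.
pose h n : R := D / n.+1%:R; have h0 n : 0 < h n by rewrite divr_gt0.
pose I n k : set R := `[k%:R * h n, k.+1%:R * h n[%classic.
pose s n (z : T * R) : R := \sum_(k < n.+1) l z.1 (k.+1%:R * h n) * \1_(I n k) z.2.
have mS : measurable ([set: T] `*` `]0, D[) by apply: measurableX.
apply: (@measurable_fun_cvg _ _ R _ s).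
- move=> n; apply: measurable_funTS; apply: measurable_sum => k.
  apply: measurable_funM.
    apply: (measurableT_comp (f := l^~ _)); last exact: measurable_fst.
    apply: ml; rewrite in_itv/= mulr_ge0 ?(ltW (h0 n))//=.
    by rewrite /h mulrCA ger_pMr// ler_pdivrMr// mul1r ler_nat.
  apply: measurableT_comp; last exact: measurable_snd.
  by apply: measurable_indic; exact: measurable_itv.
move=> [w t] [_ /=]; rewrite in_itv/= => /andP[t0 tD].
pose k n := Num.trunc (t / h n).
have kP n : (k n)%:R * h n <= t < (k n).+1%:R * h n.
  rewrite -ler_pdivlMr// -ltr_pdivrMr// truncnS_gt andbT.
  by rewrite /k truncn_le divr_ge0 ?(ltW t0) ?(ltW (h0 n)).
have kn n : (k n < n.+1)%N.
  have : (k n)%:R * h n < n.+1%:R * h n.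
    have /andP[k1 _] := kP n; apply: (le_lt_trans k1).
    by rewrite /h mulrC divfK.
  by rewrite ltr_pM2r// ltr_nat.
have sE n : s n (w, t) = l w ((k n).+1%:R * h n).
  rewrite /s /= (bigD1 (Ordinal (kn n)))//= big1 ?addr0 => [|j jk].
    by rewrite indicE mem_set ?mulr1// /I /= in_itv/=.
  rewrite indicE memNset ?mulr0// /I /= in_itv/= => /andP[j1 j2].
  have /andP[k1 k2] := kP n.
  have jl : (j < (k n).+1)%N by rewrite -(ltr_nat R) -(ltr_pM2r (h0 n)) (le_lt_trans j1).
  have kl : (k n < j.+1)%N by rewrite -(ltr_nat R) -(ltr_pM2r (h0 n)) (le_lt_trans k1).
  have jkE : j = k n :> nat by apply/eqP; rewrite eqn_leq; apply/andP; split; rewrite -ltnS.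
  by move/eqP: jk; apply; exact: val_inj.
apply/cvgrPdist_le => e e0.
have t0D : 0 <= t < D by rewrite ltW.
have := cl w t t0D => /cvgrPdist_le /(_ _ e0).
case=> dl /= dl0 dlP; near=> n.
rewrite sE; have /andP[k1 k2] := kP n.
apply: dlP => //=; rewrite distrC ger0_norm ?subr_ge0 ?ltW//.
have : (k n).+1%:R * h n <= t + h n by rewrite -natr1 mulrDl mul1r lerD2r.
rewrite ltrBlDl => /le_lt_trans; apply; rewrite ltrD2l.
rewrite /h ltr_pdivrMr// -ltr_pdivrMl//.
apply: lt_le_trans (truncnS_gt _) _; rewrite ler_nat ltnS.
by near: n; exact: nbhs_infty_ge.
Unshelve. all: end_near. Qed.

Section joint.
Variables (D K A gamma v : R) (Phi1 Phi2 : R -> R) (abar : R * R -> R).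
Hypotheses (D0 : 0 < D) (K0 : 0 < K) (cabar : {within sq D, continuous abar})
  (cPhi1 : continuous Phi1) (cPhi2 : continuous Phi2).
Variables (W1 W2 : T -> R * R -> R) (k1 k2 : T -> R -> R).
Hypotheses (rW1 : regular_field P D gamma v W1) (rW2 : regular_field P K gamma v W2)
  (mk1 : measurable_fun ([set: T] `*` `]0, D[) (fun z => k1 z.1 z.2))
  (mk2 : measurable_fun ([set: T] `*` `]0, D[) (fun z => k2 z.1 z.2)).

Let S : set (T * (R * R)) := [set: T] `*` sq D.

Let mS : measurable S. Proof. by apply: measurableX => //; exact: measurable_sq. Qed.

Let mom : measurable_fun S fst.
Proof. by apply: measurable_funTS; exact: measurable_fst. Qed.

Let msnd : measurable_fun S snd.
Proof. by apply: measurable_funTS; exact: measurable_snd. Qed.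

Let mx1 : measurable_fun S (fun z => z.2.1).
Proof. exact: (measurableT_comp measurable_fst msnd). Qed.

Let mx2 : measurable_fun S (fun z => z.2.2).
Proof. exact: (measurableT_comp measurable_snd msnd). Qed.

Let mI : measurable ([set: T] `*` `]0, D[).
Proof. by apply: measurableX. Qed.

Let mZ1 : measurable_fun S (fun z => clamp K (k1 z.1 z.2.1)).
Proof.
apply: (measurableT_comp (measurable_clamp K)).
apply: (measurable_comp mI _ mk1 (measurable_fun_pair_on mom mx1)).
by move=> _ [[w x] [_ [/= xD _]] <-].
Qed.

Let mZ2 : measurable_fun S (fun z => clamp K (k2 z.1 z.2.2)).
Proof.
apply: (measurableT_comp (measurable_clamp K)).
apply: (measurable_comp mI _ mk2 (measurable_fun_pair_on mom mx2)).
by move=> _ [[w x] [_ [/= _ xD]] <-].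
Qed.

Let mchi : measurable_fun setT (chi A).
Proof. by apply: measurable_minr => //; exact: measurable_id. Qed.

Let m_abar : measurable_fun S (fun z => abar z.2).
Proof.
have h := continuous_sq_measurable D0 cabar.
by apply: (measurable_comp (measurable_sq D) _ h msnd) => _ [z [_ zD] <-].
Qed.

Lemma measurable_regular_coefficient :
  measurable_fun S (fun z =>
    regular_coefficient K A Phi1 Phi2 abar (W1 z.1) (W2 z.1) (k1 z.1) (k2 z.1) z.2).
Proof.
have [gW1 cW1 _ _] := rW1; have [gW2 cW2 _ _] := rW2.
apply: (measurableT_comp mchi); apply: measurable_funD; first apply: measurable_funD => //.
- apply: measurableT_comp; first exact: continuous_measurable_fun.
  have h : measurable_fun S (fun z => W1 z.1 (z.2.1, z.2.2)).
    apply: (measurable_field_comp D0 mS _ cW1 mom mx1 mx2) => [z|[w [a b]] [_ zD]].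
      exact: (field_measurable gW1).
    exact: sq_csq.
  by apply: eq_measurable_fun h => -[w [a b]].
- apply: measurableT_comp; first exact: continuous_measurable_fun.
  apply: (measurable_field_comp K0 mS _ cW2 mom mZ1 mZ2) => [z|z _].
    exact: (field_measurable gW2).
  exact: clamp_csq.
Qed.

Lemma measurable_interp_coefficient N1 N2 :
  measurable_fun S (fun z =>
    regular_coefficient K A Phi1 Phi2 abar (interp D N1 (W1 z.1))
      (interp K N2 (W2 z.1)) (k1 z.1) (k2 z.1) z.2).
Proof.
have [gW1 cW1 _ _] := rW1; have [gW2 cW2 _ _] := rW2.
apply: (measurableT_comp mchi); apply: measurable_funD; first apply: measurable_funD => //.
- apply: measurableT_comp; first exact: continuous_measurable_fun.
  have h : measurable_fun S (fun z => interp D N1 (W1 z.1) (z.2.1, z.2.2)).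
    apply: (measurable_interp_comp N1 D0 _ mom mx1 mx2) => z.
    exact: (field_measurable gW1).
  by apply: eq_measurable_fun h => -[w [a b]].
- apply: measurableT_comp; first exact: continuous_measurable_fun.
  apply: (measurable_interp_comp N2 K0 _ mom mZ1 mZ2) => z.
  exact: (field_measurable gW2).
Qed.

End joint.
End measurability.

(** * From moments at each point to mixed norms *)

Section mixed_norms.
Context {R : realType} {d : measure_display} {T : measurableType d}.
Variable P : probability T R.
Implicit Types (L s t p c : R).

Lemma LpD_ge0 L s (v : R * R -> R) : (0 <= LpD L s%:E v)%E.
Proof. exact: Lnorm_ge0. Qed.

(** The square has finite measure [L^2]. *)
Lemma LpD_le_exponent L s t (v : R * R -> R) : 0 < L -> 0 < s -> s <= t ->
  (LpD L s%:E v <= ((L ^+ 2) `^ (s^-1 - t^-1))%:E * LpD L t%:E v)%E.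
Proof.
move=> L0 s0 st; have t0 : 0 < t by exact: lt_le_trans st.
pose X : R * R -> \bar R := (fun x => (`|v x|)%:E) \_ (sq L).
have X0 x : (0 <= X x)%E by rewrite /X /patch; case: ifP => // _; rewrite lee_fin.
have XE q : 0 < q -> LpD L q%:E v = 'N[leb2]_q%:E[X]%E.
  move=> q0; rewrite LpDE ?gt_eqF// Lnorm_gee0E//; congr (poweR _ _).
  rewrite [LHS]integral_mkcond; apply: eq_integral => x _; rewrite /X /patch.
  by case: ifP => // _; rewrite poweR0r// gt_eqF.
rewrite !XE//.
have h := @Lnorm_le_exponent _ _ _ (@leb2 R) X (sq L) s t (msq L) X0 _ s0 st.
apply: (le_trans (h _)); first by move=> x xL; rewrite /X /patch memNset.
rewrite le_eqVlt; apply/orP; left; apply/eqP; congr (_ * _)%E.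
rewrite [X in (X `^ _)%E](_ : _ = (L ^+ 2)%:E); last exact: leb2_sq.
by rewrite poweR_EFin.
Qed.

(** By Jensen's inequality the norm in [L^s] is bounded by that in [L^p];
    Tonelli's theorem then exchanges the two integrals of the same exponent. *)
Lemma mixed_norm_bound L s p c (h : T -> R * R -> R) : 0 < L -> 0 < s -> s <= p -> 0 <= c ->
  measurable_fun ([set: T] `*` sq L) (fun z => h z.1 z.2) ->
  (forall x, sq L x -> (\int[P]_w (`|h w x| `^ p)%:E <= c%:E)%E) ->
  ('N[P]_p%:E[(fun w => LpD L s%:E (h w))] <=
    ((L ^+ 2) `^ (s^-1 - p^-1) * (c * L ^+ 2) `^ p^-1)%:E)%E.
Proof.
move=> L0 s0 sp c0 mh hc; have p0 : 0 < p by exact: lt_le_trans sp.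
set k := (L ^+ 2) `^ (s^-1 - p^-1); have k0 : 0 <= k by exact: powR_ge0.
have mf : measurable_fun ([set: T] `*` sq L) (fun z : T * (R * R) => (`|h z.1 z.2| `^ p)%:E).
  apply/measurable_EFinP; apply: measurable_fun_powR.
  exact: (measurableT_comp (@normr_measurable R setT) mh).
have f0 (z : T * (R * R)) : (0 <= (`|h z.1 z.2| `^ p)%:E)%E by rewrite lee_fin powR_ge0.
have [mI EI] := tonelli_field P mf f0.
rewrite Lnorm_gee0E; last by move=> w; exact: LpD_ge0.
have ck : 0 <= k `^ p * (c * L ^+ 2) by rewrite !mulr_ge0 ?powR_ge0// ltW// exprn_gt0.
rewrite [leRHS](_ : _ = ((k `^ p * (c * L ^+ 2))%:E `^ p^-1)%E); last first.
  have cD0 : 0 <= c * L ^+ 2 by rewrite mulr_ge0// ltW// exprn_gt0.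
  rewrite poweR_EFin (powRM _ (powR_ge0 k p) cD0).
  by rewrite -powRrM divff ?gt_eqF// powRr1.
apply: le_poweR2r; first by rewrite invr_ge0 ltW.
  by apply: integral_ge0 => w _; exact: poweR_ge0.
apply: (@le_trans _ _ (\int[P]_w ((k `^ p)%:E *
    \int[leb2]_(x in sq L) (`|h w x| `^ p)%:E))%E).
  apply: le_integral_any => w; first exact: poweR_ge0.
  have := LpD_le_exponent (h w) L0 s0 sp; rewrite -/k => le1.
  apply: (le_trans (le_poweR2r (ltW p0) (LpD_ge0 _ _ _) le1)).
  rewrite poweRM ?lee_fin ?LpD_ge0// LpDE ?gt_eqF// -poweRrM mulVf ?gt_eqF//.
  rewrite poweRe1; last by apply: integral_ge0 => x _; rewrite lee_fin powR_ge0.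
  by rewrite poweR_EFin.
rewrite ge0_integralZl_EFin ?powR_ge0//; last first.
  by move=> w _; apply: integral_ge0 => x _; rewrite lee_fin powR_ge0.
rewrite (EFinM (k `^ p)) lee_wpmul2l ?lee_fin ?powR_ge0// [leLHS]EI EFinM.
apply: (integral_patch_sq L0) => //.
by move=> x _; apply: integral_ge0 => w _; rewrite lee_fin powR_ge0.
Qed.

Lemma measurable_LpD L s (h : T -> R * R -> R) : s != 0 ->
  measurable_fun ([set: T] `*` sq L) (fun z => h z.1 z.2) ->
  measurable_fun setT (fun w => LpD L s%:E (h w)).
Proof.
move=> s0 mh.
have mf : measurable_fun ([set: T] `*` sq L) (fun z : T * (R * R) => (`|h z.1 z.2| `^ s)%:E).
  apply/measurable_EFinP; apply: measurable_fun_powR.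
  exact: (measurableT_comp (@normr_measurable R setT) mh).
have f0 (z : T * (R * R)) : (0 <= (`|h z.1 z.2| `^ s)%:E)%E by rewrite lee_fin powR_ge0.
have [mI _] := tonelli_field P mf f0.
rewrite (_ : (fun w => _) = (fun w => (\int[leb2]_(x in sq L) (`|h w x| `^ s)%:E) `^ s^-1)%E).
  exact: (measurableT_comp (measurable_poweR _) mI).
by apply/funext => w; rewrite LpDE.
Qed.

Lemma LpD_bounded L s A (v : R * R -> R) : 0 < L -> 0 < s -> 0 <= A ->
  (forall x, sq L x -> `|v x| <= A) -> LpD L s%:E v \is a fin_num.
Proof.
move=> L0 s0 A0 vA; rewrite ge0_fin_numE ?LpD_ge0// LpDE ?gt_eqF//; apply: poweR_lty.
apply: (@le_lt_trans _ _ ((A `^ s)%:E * (L ^+ 2)%:E)%E); last by rewrite -EFinM ltry.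
apply: (integral_patch_sq L0) => [|x _|x xL]; rewrite lee_fin ?powR_ge0//.
by rewrite ge0_ler_powR ?nnegrE ?(ltW s0)// vA.
Qed.

Lemma eq_LpD L s (v v' : R * R -> R) : (forall x, sq L x -> v x = v' x) ->
  LpD L s%:E v = LpD L s%:E v'.
Proof.
move=> vE; rewrite /LpD; congr (Lnorm _ _ _); apply/funext => x.
by rewrite /patch; case: ifPn => // /set_mem xL /=; rewrite vE.
Qed.

Lemma ae_le_Lnorm s (X Y : T -> \bar R) : 0 <= s ->
  (forall w, (0 <= X w)%E) -> (forall w, (0 <= Y w)%E) ->
  {ae P, forall w, (X w <= Y w)%E} -> ('N[P]_s%:E[X] <= 'N[P]_s%:E[Y])%E.
Proof.
move=> s0 X0 Y0 XY; rewrite !Lnorm_gee0E//; apply: le_poweR2r; first by rewrite invr_ge0.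
  by apply: integral_ge0 => w _; exact: poweR_ge0.
apply: ae_le_integral_any => [w|w|]; try exact: poweR_ge0.
by move: XY; apply: filterS => w h; exact: le_poweR2r.
Qed.

End mixed_norms.

(** * Versions of the random coefficients *)

Section assembly.
Context {R : realType} {d : measure_display} {T : measurableType d}.
Variable P : probability T R.

(** The paths are set to zero on a null set off which they are
    right-continuous. *)
Lemma subordinator_version (D : R) (l : T -> R -> R) : 0 < D -> subordinator P D l ->
  exists l', [/\ measurable_fun ([set: T] `*` `]0, D[) (fun z => l' z.1 z.2),
    {ae P, forall w, l' w = l w} &
    {ae P, forall w t, t \in `[0, D] -> 0 <= l w t}].
Proof.
move=> D0 [[ml l0 _ _ [_ cad]] mono].
have [N [mN PN lN]] := cad.
pose l' w t := \1_(~` N) w * l w t.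
have l'E w : ~ N w -> l' w = l w.
  by move=> wN; apply/funext => t; rewrite /l' indicE mem_set// mul1r.
exists l'; split.
- apply: right_continuous_measurable => // [t tD|w t tD].
    by apply: measurable_funM; [apply: measurable_indic; exact: measurableC|exact: ml].
  have [wN|wN] := pselect (N w).
    have -> : l' w = fun=> 0.
      by apply/funext => u; rewrite /l' indicE memNset ?mul0r//; apply.
    exact: cvg_cst.
  rewrite l'E//; apply: contrapT => h; apply: wN; apply: lN => /= -[c1 _].
  by apply: h; exact: c1.
- exists N; split => // w /= h; apply: contrapT => wN; apply: h; exact: l'E.
move: l0 mono; apply: filterS2 => w lw0 mw t; rewrite in_itv/= => /andP[t0 tD].
by rewrite -lw0 mw.
Qed.

Lemma partial_sum_le (a b : nat -> R) (beta Clam : R) :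
  (forall i, 0 <= a i) -> (forall i, 0 <= b i) ->
  (\sum_(0 <= i <oo) ((a i + b i) * i.+1%:R `^ beta)%:E <= Clam%:E)%E ->
  forall n, \sum_(i < n) a i * i.+1%:R `^ beta <= Clam.
Proof.
move=> a0 b0 S n; rewrite -lee_fin; apply: le_trans S.
have F0 i : (0 <= ((a i + b i) * i.+1%:R `^ beta)%:E :> \bar R)%E.
  by rewrite lee_fin mulr_ge0 ?powR_ge0// addr_ge0.
apply: (@le_trans _ _ (\sum_(0 <= i < n) ((a i + b i) * i.+1%:R `^ beta)%:E)%E).
  rewrite big_mkord sumEFin lee_fin; apply: ler_sum => i _.
  by rewrite ler_wpM2r ?powR_ge0// lerDl.
by apply: nneseries_lim_ge => i _.
Qed.

Section error.
Variables (D K A alpha beta Ce Clam phi psi Clip eta Cl gamma p : R).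
Hypotheses (D0 : 0 < D) (K0 : 0 < K)
  (beta0 : 0 < beta) (Ce0 : 0 < Ce) (Clam0 : 0 < Clam)
  (phi0 : 0 < phi) (psi0 : 0 < psi) (Clip0 : 0 < Clip) (Cl0 : 0 < Cl)
  (gamma0 : 0 < gamma) (gamma1 : gamma < 1) (abg : 2 * alpha * gamma <= beta)
  (p1 : 1 < p) (gp1 : 1 <= gamma * p < eta - 1).
Variables (W1 W2 : T -> R * R -> R) (lam1 lam2 : nat -> R) (e1 e2 : nat -> R * R -> R)
  (Phi1 Phi2 : R -> R) (abar : R * R -> R) (l1 l2 : T -> R -> R) (l1a l2a : R -> T -> R -> R).
Hypotheses (fW1 : field_assumption P D alpha Ce W1 lam1 e1)
  (fW2 : field_assumption P K alpha Ce W2 lam2 e2)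
  (sumlam : (\sum_(0 <= i <oo) ((lam1 i + lam2 i) * i.+1%:R `^ beta)%:E <= Clam%:E)%E)
  (Phi10 : forall x, 0 <= Phi1 x) (Phi20 : forall x, 0 <= Phi2 x)
  (cPhi1 : continuous Phi1) (cPhi2 : continuous Phi2)
  (dPhi1 : forall x, derivable Phi1 x 1)
  (bPhi1 : forall x, `|derive1 Phi1 x| <= phi * expR (psi * `|x|))
  (lPhi2 : forall x y, `|Phi2 x - Phi2 y| <= Clip * `|x - y|)
  (cabar : {within sq D, continuous abar})
  (sl1 : subordinator P D l1) (sl2 : subordinator P D l2)
  (al1 : subordinator_approximation P D eta Cl l1 l1a)
  (al2 : subordinator_approximation P D eta Cl l2 l2a)
  (ind : forall el, 0 < el ->
     indep P (gens `[0, D] l1 `|` gens `[0, D] l2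
                `|` gens `[0, D] (l1a el) `|` gens `[0, D] (l2a el))
             (gens (csq D) W1 `|` gens (csq K) W2)).

(** The fields and the subordinators are replaced by versions that are regular
    for every sample, the error estimate being insensitive to this; the
    approximations of the subordinators are kept, and the equalities hold at all
    points of the square simultaneously. *)
Lemma coefficient_versions (eW el : R) (N1 N2 : nat) : 0 < eW -> 0 < el ->
  (0 < N1)%N -> D / N1%:R <= eW -> (0 < N2)%N -> K / N2%:R <= eW ->
  exists a a' : T -> R * R -> R,
  [/\ measurable_fun ([set: T] `*` sq D) (fun z => a z.1 z.2),
      measurable_fun ([set: T] `*` sq D) (fun z => a' z.1 z.2),
      {ae P, forall w x, sq D x ->
        coefficient A K abar Phi1 Phi2 (W1 w) (W2 w) (l1 w) (l2 w) x = a w x},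
      {ae P, forall w x, sq D x ->
        coefficient A K abar Phi1 Phi2 (interp D N1 (W1 w)) (interp K N2 (W2 w))
          (l1a el w) (l2a el w) x = a' w x} &
      forall x, sq D x -> (\int[P]_w (`|a' w x - a w x| `^ p)%:E <=
        (Ccoef p gamma (2 * Ce * Num.sqrt Clam) phi psi Clip Cl *
           (eW `^ (gamma * p) + el))%:E)%E].
Proof.
move=> eW0 el0 N10 N1e N20 N2e.
have lam10 := field_eigenvalue_ge0 D0 fW1; have lam20 := field_eigenvalue_ge0 K0 fW2.
have s1 := partial_sum_le lam10 lam20 sumlam.
have s2 : forall n, \sum_(i < n) lam2 i * i.+1%:R `^ beta <= Clam.
  apply: (partial_sum_le lam20 lam10); move: sumlam.
  by under eq_eseriesr do rewrite addrC.
have v0 : 0 < 2 * Ce * Num.sqrt Clam by rewrite !mulr_gt0// sqrtr_gt0.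
have [V1 [V1E rV1]] := field_regular D0 fW1 Ce0 Clam0 beta0 gamma0 gamma1 abg s1.
have [V2 [V2E rV2]] := field_regular K0 fW2 Ce0 Clam0 beta0 gamma0 gamma1 abg s2.
have [k1 [mk1 k1E l10]] := subordinator_version D0 sl1.
have [k2 [mk2 k2E l20]] := subordinator_version D0 sl2.
have [ma1 l1a0 e1p] := al1 el0; have [ma2 l2a0 e2p] := al2 el0.
have mIs : [set: T] `*` `]0, D[ `<=` [set: T] `*` `[0, D].
  by move=> [w t] [_ /= h]; split => //; exact: subset_itv_oo_cc h.
have mI : measurable ([set: T] `*` (`[0, D]%classic : set R)) by exact: measurableX.
have ma1' := measurable_funS mI mIs ma1; have ma2' := measurable_funS mI mIs ma2.
pose a w := regular_coefficient K A Phi1 Phi2 abar (V1 w) (V2 w) (k1 w) (k2 w).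
pose a' w := regular_coefficient K A Phi1 Phi2 abar (interp D N1 (V1 w))
  (interp K N2 (V2 w)) (l1a el w) (l2a el w).
have sqI x : sq D x -> x.1 \in `[0, D] /\ x.2 \in `[0, D].
  by move=> /sq_csq[].
exists a, a'; split.
- exact: (measurable_regular_coefficient A D0 K0 cabar cPhi1 cPhi2 rV1 rV2 mk1 mk2).
- exact: (measurable_interp_coefficient A D0 K0 cabar cPhi1 cPhi2 rV1 rV2 ma1' ma2').
- have kE : {ae P, forall w, k1 w = l1 w /\ k2 w = l2 w}.
    by move: k1E k2E; apply: filterS2.
  have l0 : {ae P, forall w, (forall t, t \in `[0, D] -> 0 <= l1 w t) /\
      (forall t, t \in `[0, D] -> 0 <= l2 w t)}.
    by move: l10 l20; apply: filterS2.
  have VE : {ae P, forall w, V1 w = W1 w /\ V2 w = W2 w}.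
    by move: V1E V2E; apply: filterS2.
  move: VE kE l0; apply: filterS3 => w [E1 E2] [E3 E4] [p1w p2w] x /sqI[x1 x2].
  rewrite /a /regular_coefficient E1 E2 E3 E4 !clampE//.
  + exact: p2w.
  + exact: p1w.
- have VE : {ae P, forall w, V1 w = W1 w /\ V2 w = W2 w}.
    by move: V1E V2E; apply: filterS2.
  move: VE l1a0 l2a0; apply: filterS3 => w [E1 E2] p1w p2w x /sqI[x1 x2].
  rewrite /a' /regular_coefficient E1 E2 !clampE//.
  + exact: p2w.
  + exact: p1w.
move=> x xD.
set F := gens `[0, D] l1 `|` gens `[0, D] l2 `|` gens `[0, D] (l1a el) `|` gens `[0, D] (l2a el).
have [[ml1 _ _ _ _] _] := sl1; have [[ml2 _ _ _ _] _] := sl2.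
have mla (la : T -> R -> R) t : measurable_fun ([set: T] `*` `[0, D]) (fun z => la z.1 z.2) ->
    t \in `[0, D] -> measurable_fun setT (la^~ t).
  move=> ml tD; apply: (measurable_comp mI _ ml (pair2_measurable t)).
  by move=> _ [w _ <-].
have gm (l : T -> R -> R) : (forall t, t \in `[0, D] -> measurable_fun setT (l^~ t)) ->
    gens `[0, D] l `<=` measurable.
  move=> ml _ [t tD [B mB ->]]; rewrite -[_ @^-1` _]setTI; exact: ml.
have mF : <<s F >> `<=` measurable.
  apply: smallest_sub; first exact: sigma_algebra_measurable.
  move=> E [[[]|]|]; apply: gm => // t tD; exact: mla.
have [gV2 cV2 _ _] := rV2; have [mV2 _] := gV2; have [[mW2 _] _ _ _ _] := fW2.
have [N [mN PN V2N]] := V2E.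
have ind' : indep P F (gens (csq K) V2).
  apply: (@indep_version _ _ _ P F (csq K) W2 V2 N) => // [w wN|].
    by apply: contrapT => h; apply: wN; exact: V2N.
  by apply: indepS (ind el0) => // E h; right.
have h := @coefficient_error _ _ _ P D K A p gamma _ phi psi Clip Cl Phi1 Phi2 abar
  D0 K0 v0 gamma0 p1 (ltW phi0) (ltW psi0) (ltW Clip0) (ltW Cl0) cPhi1 dPhi1 bPhi1 lPhi2
  V1 V2 l1 l2 (l1a el) (l2a el) F (gens (csq K) V2) rV1 rV2 mF (gens_measurable mV2) ind'.
have {}h := h (fun z zK => gens_fun zK (@subset_refl _ _)).
have gF (l : T -> R -> R) : gens `[0, D] l `<=` F ->
  forall t, t \in `[0, D] -> measurable_fun setT ((l^~ t) : g_sigma_algebraType F -> R).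
  by move=> lF t tD; exact: gens_fun lF.
have {}h := h (gF l1 _) (gF l2 _) (gF (l1a el) _) (gF (l2a el) _).
apply: (@le_trans _ _ (\int[P]_w (`|a' w x - regular_coefficient K A Phi1 Phi2 abar
   (V1 w) (V2 w) (l1 w) (l2 w) x| `^ p)%:E)%E).
  apply: ae_le_integral_any => [w|w|]; rewrite ?lee_fin ?powR_ge0//.
  by move: k1E k2E; apply: filterS2 => w E1 E2; rewrite /a E1 E2.
apply: (h _ _ _ _ eW el N1 N2 x eW0 el0 (sq_csq xD) N10 N1e N20 N2e).
- by move=> E hE; left; left; left.
- by move=> E hE; left; left; right.
- by move=> E hE; left; right.
- by move=> E hE; right.
- by move=> t tD; have := e1p _ _ gp1 tD; rewrite unlock.
- by move=> t tD; have := e2p _ _ gp1 tD; rewrite unlock.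
Qed.

End error.
End assembly.

Section coefficient_bounds.
Context {R : realType}.

(** As [Phi1] and [Phi2] are nonnegative, the coefficient before cut-off is at
    least the bound [m] of [abar]. *)
Lemma coefficient_gt_lt (A K m : R) (abar : R * R -> R) (Phi1 Phi2 : R -> R)
    (W1 W2 : R * R -> R) (l1 l2 : R -> R) x :
  (forall z, 0 <= Phi1 z) -> (forall z, 0 <= Phi2 z) -> m <= abar x ->
  Num.min m A <= coefficient A K abar Phi1 Phi2 W1 W2 l1 l2 x <= A.
Proof.
move=> P1 P2 mx; rewrite /coefficient /chi; apply/andP; split; last by rewrite ge_min lexx orbT.
rewrite le_min; apply/andP; split; last by rewrite ge_min lexx orbT.
by rewrite ge_min -addrA -[leLHS]addr0 lerD// addr_ge0.
Qed.

Lemma cvg_powR_pair (a b k : R) : 0 < a -> 0 < b ->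
  ((k * (eps.1 `^ a + eps.2 `^ b))%:E @[eps --> (0^'+, 0^'+)] --> (0%:E : \bar R))%classic.
Proof.
move=> a0 b0; apply: cvg_EFin; first by apply: nearW.
rewrite [X in _ --> X](_ : _ = k * (0 + 0)); last by rewrite addr0 mulr0.
apply: cvgMr; apply: cvgD.
- exact: (@cvg_comp _ _ _ fst (fun e => e `^ a) (filter_prod 0^'+ 0^'+) _ _ cvg_fst (powR_cvg0 a0)).
- exact: (@cvg_comp _ _ _ snd (fun e => e `^ b) (filter_prod 0^'+ 0^'+) _ _ cvg_snd (powR_cvg0 b0)).
Qed.

End coefficient_bounds.

(** * The two error estimates *)

Section solution_error.
Context {R : realType} {d : measure_display} {T : measurableType d}.
Variable P : probability T R.
Variables (D : R) (G1 G2 : set (R * R)) (D0 : 0 < D).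

Lemma section_measurable (h : T -> R * R -> R) w :
  measurable_fun ([set: T] `*` sq D) (fun z => h z.1 z.2) -> measurable_fun (sq D) (h w).
Proof.
move=> mh; have mS : measurable ([set: T] `*` sq D) by apply: measurableX => //; exact: measurable_sq.
apply: (measurable_comp mS _ mh (measurable_funTS (pair1_measurable w))).
by move=> _ [x xD <-].
Qed.

(** The pathwise estimate [stab] holds almost surely; in the product on its
    right the coefficient error is almost surely equal to a measurable function,
    that of the versions [v] and [v']. *)
Lemma error_le_coefficient_error (A C b n r c m : R) (h h' f g u u' v v' : T -> R * R -> R) :
  0 < A -> 0 < C -> 0 < b -> 0 < n -> 0 < r -> 0 < c -> 0 < m ->
  c^-1 + m^-1 = 1 ->
  (forall w, measurable_fun (sq D) (h w) -> measurable_fun (sq D) (h' w) ->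
    (forall x, sq D x -> 0 <= h w x <= A) -> (forall x, sq D x -> 0 <= h' w x <= A) ->
    weak_solution D G1 G2 (h w) (f w) (g w) (u w) ->
    weak_solution D G1 G2 (h' w) (f w) (g w) (u' w) ->
    (H1norm D (u w \- u' w)%R <= C%:E * LpD D (2 * b)%:E (h' w \- h w)%R *
       grad_Lp D (2 * n)%:E (u w))%E) ->
  measurable_fun ([set: T] `*` sq D) (fun z => v z.1 z.2) ->
  measurable_fun ([set: T] `*` sq D) (fun z => v' z.1 z.2) ->
  {ae P, forall w x, sq D x -> h w x = v w x} ->
  {ae P, forall w x, sq D x -> h' w x = v' w x} ->
  (forall w x, sq D x -> 0 <= h w x <= A) -> (forall w x, sq D x -> 0 <= h' w x <= A) ->
  {ae P, forall w, weak_solution D G1 G2 (h w) (f w) (g w) (u w)} ->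
  {ae P, forall w, weak_solution D G1 G2 (h' w) (f w) (g w) (u' w)} ->
  ('N[P]_r%:E[(fun w => H1norm D (u w \- u' w)%R)] <=
    C%:E * 'N[P]_(r * c)%:E[(fun w => LpD D (2 * b)%:E (h' w \- h w)%R)] *
      'N[P]_(r * m)%:E[(fun w => grad_Lp D (2 * n)%:E (u w))])%E.
Proof.
move=> A0 C0 b0 n0 r0 c0 m0 cm stab mv mv' hv hv' hA hA' su su'.
have b20 : 0 < 2 * b by rewrite mulr_gt0.
have n20 : 0 < 2 * n by rewrite mulr_gt0.
pose L w := LpD D (2 * b)%:E (h' w \- h w)%R.
pose a w := fine (LpD D (2 * b)%:E (v' w \- v w)%R).
have a0 w : 0 <= a w by rewrite fine_ge0// LpD_ge0.
have ma : measurable_fun setT a.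
  have mI : measurable_fun setT (fun w => LpD D (2 * b)%:E (v' w \- v w)%R).
    apply: (@measurable_LpD _ _ _ P D (2 * b) (fun w => (v' w \- v w)%R)).
      by rewrite gt_eqF.
    exact: measurable_funB.
  exact: (measurableT_comp (@fine_measurable R setT measurableT) mI).
have vE : {ae P, forall w, (forall x, sq D x -> h w x = v w x) /\
    (forall x, sq D x -> h' w x = v' w x)}.
  by move: hv hv'; apply: filterS2.
have LE w : (forall x, sq D x -> h w x = v w x) /\
    (forall x, sq D x -> h' w x = v' w x) -> ((a w)%:E = L w)%E.
  move=> [E1 E2]; rewrite /a (@eq_LpD _ D (2 * b) (v' w \- v w)%R (h' w \- h w)%R); last first.
    by move=> x xD /=; rewrite E1// E2.
  rewrite fineK//; apply: (@LpD_bounded _ _ _ A) => //; first exact: ltW.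
  move=> x xD /=; have /andP[h0 h1] := hA w x xD; have /andP[h'0 h'1] := hA' w x xD.
  by rewrite ler_norml; apply/andP; split; lra.
apply: (@le_trans _ _ (C%:E * 'N[P]_(r * c)%:E[EFin \o a] *
    'N[P]_(r * m)%:E[(fun w => grad_Lp D (2 * n)%:E (u w))])%E).
  apply: Lnorm_le_mul => // [w|w|].
  - exact: poweR_ge0.
  - exact: LpD_ge0.
  move: vE su su'; apply: filterS3 => w E s1 s2; rewrite (LE _ E).
  have [E1 E2] := E; apply: stab => //; try exact: hA; try exact: hA'.
  - apply: eq_measurable_fun (section_measurable w mv) => x /set_mem xD /=.
    by rewrite E1.
  - apply: eq_measurable_fun (section_measurable w mv') => x /set_mem xD /=.
    by rewrite E2.
apply: lee_wpmul2r; first exact: Lnorm_ge0.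
apply: lee_wpmul2l; first by rewrite lee_fin ltW.
apply: ae_le_Lnorm => [|w|w|]; first by rewrite ltW// mulr_gt0.
- by rewrite lee_fin.
- exact: LpD_ge0.
by move: vE; apply: filterS => w /LE /= ->.
Qed.

(** The mixed norm is computed on the versions; [(x + y)^(1/p) <= 2^(1/p)
    (x^(1/p) + y^(1/p))] splits the rate. *)
Lemma coefficient_error_rate (b p kappa gamma eW el : R) (h h' v v' : T -> R * R -> R) :
  0 < b -> 2 * b <= p -> 0 < eW -> 0 < el ->
  measurable_fun ([set: T] `*` sq D) (fun z => v z.1 z.2) ->
  measurable_fun ([set: T] `*` sq D) (fun z => v' z.1 z.2) ->
  {ae P, forall w x, sq D x -> h w x = v w x} ->
  {ae P, forall w x, sq D x -> h' w x = v' w x} ->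
  (forall x, sq D x -> (\int[P]_w (`|v' w x - v w x| `^ p)%:E <=
    (kappa * (eW `^ (gamma * p) + el))%:E)%E) ->
  ('N[P]_p%:E[(fun w => LpD D (2 * b)%:E (h' w \- h w)%R)] <=
    ((D ^+ 2) `^ ((2 * b)^-1 - p^-1) * (kappa * D ^+ 2 * 2) `^ p^-1 *
      (eW `^ gamma + el `^ p^-1))%:E)%E.
Proof.
move=> b0 bp eW0 el0 mv mv' hv hv' ev.
have b20 : 0 < 2 * b by rewrite mulr_gt0.
have p0 : 0 < p by exact: lt_le_trans bp.
have e0 : 0 < eW `^ (gamma * p) + el by rewrite addr_gt0// powR_gt0.
have D20 : 0 <= D ^+ 2 by exact: sqr_ge0.
have k0 : 0 <= kappa.
  rewrite -(pmulr_lge0 _ e0) -lee_fin.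
  apply: le_trans (ev (D / 2, D / 2) _).
    by apply: integral_ge0 => w _; rewrite lee_fin powR_ge0.
  have d0 : 0 < D / 2 by rewrite divr_gt0.
  have dD : D / 2 < D by rewrite ltr_pdivrMr// ltr_pMr// ltr1n.
  by split; rewrite /= in_itv/= d0.
apply: (@le_trans _ _ 'N[P]_p%:E[(fun w => LpD D (2 * b)%:E (v' w \- v w)%R)]%E).
  apply: ae_le_Lnorm => [|w|w|]; first exact: ltW.
  - exact: LpD_ge0.
  - exact: LpD_ge0.
  move: hv hv'; apply: filterS2 => w E1 E2; rewrite (@eq_LpD _ _ _ _ (v' w \- v w)%R)//.
  by move=> x xD /=; rewrite E1// E2.
apply: le_trans (mixed_norm_bound D0 b20 bp _ _ ev) _.
- by rewrite mulr_ge0// ltW.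
- exact: measurable_funB.
rewrite lee_fin -[leRHS]mulrA ler_wpM2l ?powR_ge0//.
have pV : 0 <= p^-1 by rewrite invr_ge0 ltW.
have -> : kappa * (eW `^ (gamma * p) + el) * D ^+ 2 =
    (kappa * D ^+ 2) * (eW `^ (gamma * p) + el) by ring.
rewrite (@powRM _ _ (eW `^ (gamma * p) + el)) ?(ltW e0) ?(mulr_ge0 k0 D20)//.
rewrite (@powRM _ (kappa * D ^+ 2) 2) ?(mulr_ge0 k0 D20)// -[leRHS]mulrA ler_wpM2l ?powR_ge0//.
apply: le_trans (powR_addl _ _ pV) _; rewrite ?powR_ge0 ?(ltW el0)//.
by rewrite -powRrM -mulrA mulfV ?gt_eqF// mulr1.
Qed.

(** Both the square and the sample space have finite measure, so the exponents
    may be raised to those of the regularity assumption. *)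
Lemma gradient_norm_bound (n m r jreg kreg Creg : R) (u : T -> R * R -> R) :
  0 < n -> 0 < r -> 0 < m -> 2 * n <= 2 + jreg -> r * m < kreg ->
  (\int[P]_w (grad_Lp D (2 + jreg)%:E (u w)) `^ kreg = Creg%:E)%E ->
  ('N[P]_(r * m)%:E[(fun w => grad_Lp D (2 * n)%:E (u w))] <=
    ((D ^+ 2) `^ ((2 * n)^-1 - (2 + jreg)^-1) * Creg `^ kreg^-1)%:E)%E.
Proof.
move=> n0 r0 m0 nj mk Cr.
have n20 : 0 < 2 * n by rewrite mulr_gt0.
have rm0 : 0 < r * m by rewrite mulr_gt0.
have k0 : 0 < kreg by exact: lt_trans mk.
set X := fun w => grad_Lp D (2 + jreg)%:E (u w).
have X0 w : (0 <= X w)%E by exact: LpD_ge0.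
set q := (D ^+ 2) `^ _; have q0 : 0 < q by rewrite powR_gt0// exprn_gt0.
have kr0 : 0 < kreg - r * m by rewrite subr_gt0.
have := @Lnorm_le_mul _ _ _ P (fun w => grad_Lp D (2 * n)%:E (u w)) X (fun=> 1) q (r * m)
  (kreg / (kreg - r * m)) (kreg / (r * m)).
have -> : r * m * (kreg / (r * m)) = kreg by rewrite mulrCA mulfV ?mulr1// gt_eqF.
move=> h; apply: le_trans (h _ _ _ _ _ _ _ _ _ _) _ => //.
- by move=> w; exact: LpD_ge0.
- by rewrite divr_gt0.
- by rewrite divr_gt0.
- by rewrite !invf_div -mulrDl subrK mulfV// gt_eqF.
- by apply: nearW => w; rewrite mule1; exact: LpD_le_exponent.
rewrite !Lnorm_gee0E//.
under eq_integral do rewrite /= powR1.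
by rewrite integral_cst//= (@probability_setT _ _ _ P) mul1e poweR1r mule1 Cr poweR_EFin EFinM.
Qed.

End solution_error.

Lemma finite_exponent (R : realType) (x : \bar R) (a b : R) : 0 < a -> (1 <= x)%E ->
  (a%:E * x < b%:E)%E -> exists2 y : R, x = y%:E & 1 <= y.
Proof.
move=> a0; case: x => [y||] //; first by move=> y1 _; exists y.
by rewrite gt0_muley.
Qed.

Lemma conjugate_exponents (R : realType) (x y : R) : 1 <= x -> 1 <= y ->
  ((x%:E)^-1 + (y%:E)^-1 = 1)%E -> x^-1 + y^-1 = 1.
Proof.
move=> x1 y1; rewrite !inver !gt_eqF ?(lt_le_trans ltr01)// => /eqP.
by rewrite -EFinD eqe => /eqP.
Qed.

(* C1 is the constant C(abar_-, D, r) of the first inequality, chosen before all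
   other data (the domain includes the boundary decomposition).  The generic
   constant C2 of the second inequality must depend on the remaining constants
   as well, but on no further datum, and not on eW, el. *)
Theorem theorem5p9 (R : realType) (D : R) (G1 G2 : set (R * R))
    (abar_m r : R) (hD : 0 < D) (hG : boundary_decomposition D G1 G2)
    (habar_m : 0 < abar_m) (hr : 2 <= r) :
  exists2 C1 : R, 0 < C1 &
  forall (K A alpha beta Ce Clam phi psi Clip eta Cl gamma kreg jreg Creg : R)
    (b c m n : \bar R),
  0 < K -> 0 < A ->
  0 < alpha -> 0 < beta -> 0 < Ce -> 0 < Clam ->
  0 < phi -> 0 < psi -> 0 < Clip -> 0 < eta -> 0 < Cl ->
  0 < gamma < Num.min 1 (beta / (2 * alpha)) ->
  (1 <= b)%E -> (1 <= c)%E -> (1 <= m)%E -> (1 <= n)%E ->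
  (2%:E <= r%:E * c * gamma%:E)%E ->
  (2%:E * b <= r%:E * c)%E -> (r%:E * c < (eta - 1)%:E)%E ->
  (m^-1 + c^-1 = 1)%E -> (n^-1 + b^-1 = 1)%E ->
  2 <= kreg -> 0 < jreg ->
  (n < (1 + jreg / 2)%:E)%E -> (r%:E * m < kreg%:E)%E ->
  exists2 C2 : R, 0 < C2 &
  forall (d : measure_display) (Omega : measurableType d)
    (P : probability Omega R)
    (W1 W2 : Omega -> R * R -> R)
    (lam1 lam2 : nat -> R) (e1 e2 : nat -> R * R -> R)
    (Phi1 Phi2 : R -> R)
    (q : R) (f g : Omega -> R * R -> R)
    (abar : R * R -> R) (abar_p : R)
    (l1 l2 : Omega -> R -> R) (gam1 gam2 : R)
    (nu1 nu2 : {measure set R -> \bar R})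
    (l1a l2a : R -> Omega -> R -> R)
    (N1 N2 : R -> nat)
    (u : Omega -> R * R -> R) (ua : R -> R -> Omega -> R * R -> R),
  measure_is_complete P ->
  (* (i) *)
  field_assumption P D alpha Ce W1 lam1 e1 ->
  field_assumption P K alpha Ce W2 lam2 e2 ->
  indep P (gens (csq D) W1) (gens (csq K) W2) ->
  (\sum_(0 <= i <oo) ((lam1 i + lam2 i) * i.+1%:R `^ beta)%:E <= Clam%:E)%E ->
  (* (ii) *)
  (forall x, 0 <= Phi1 x) -> (forall x, 0 <= Phi2 x) ->
  continuous Phi1 -> continuous Phi2 ->
  (forall x, derivable Phi1 x 1) -> continuous (derive1 Phi1) ->
  (forall x, `|derive1 Phi1 x| <= phi * expR (psi * `|x|)) ->
  (forall x y, `|Phi2 x - Phi2 y| <= Clip * `|x - y|) ->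
  (* (iii) *)
  1 < q ->
  measurable_fun ([set: Omega] `*` sq D) (fun z => f z.1 z.2) ->
  ('N[P]_(q%:E)[(fun w => LpD D 2%:E (f w))] < +oo)%E ->
  measurable_fun ([set: Omega] `*` G2) (fun z => g z.1 z.2) ->
  ('N[P]_(q%:E)[(fun w => bd_L2 D G2 (g w))] < +oo)%E ->
  (* (iv) *)
  {within sq D, continuous abar} ->
  (forall x, sq D x -> abar_m <= abar x <= abar_p) ->
  (* (v) *)
  subordinator P D l1 -> levy_triplet P D l1 gam1 0 nu1 ->
  subordinator P D l2 -> levy_triplet P D l2 gam2 0 nu2 ->
  subordinator_approximation P D eta Cl l1 l1a ->
  subordinator_approximation P D eta Cl l2 l2a ->
  (forall el, 0 < el ->
     indep P (gens `[0, D] l1 `|` gens `[0, D] l2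
                `|` gens `[0, D] (l1a el) `|` gens `[0, D] (l2a el))
             (gens (csq D) W1 `|` gens (csq K) W2)) ->
  (* (vi) *)
  (forall eW, 0 < eW ->
     [/\ (0 < N1 eW)%N, D / (N1 eW)%:R <= eW,
         (0 < N2 eW)%N & K / (N2 eW)%:R <= eW]) ->
  let a w := coefficient A K abar Phi1 Phi2 (W1 w) (W2 w) (l1 w) (l2 w) in
  let aa eW el w := coefficient A K abar Phi1 Phi2
       (interp D (N1 eW) (W1 w)) (interp K (N2 eW) (W2 w))
       (l1a el w) (l2a el w) in
  {ae P, forall w, weak_solution D G1 G2 (a w) (f w) (g w) (u w)} ->
  (forall eW el, 0 < eW -> 0 < el ->
     {ae P, forall w,
        weak_solution D G1 G2 (aa eW el w) (f w) (g w) (ua eW el w)}) ->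
  (\int[P]_w (grad_Lp D (2 + jreg)%:E (u w)) `^ kreg = Creg%:E)%E ->
  let err eW el :=
    'N[P]_(r%:E)[(fun w => H1norm D (u w \- ua eW el w)%R)]%E in
  let bound eW el :=
    (C1%:E *
     'N[P]_(r%:E * c)[(fun w => LpD D (2%:E * b) (aa eW el w \- a w)%R)] *
     'N[P]_(r%:E * m)[(fun w => grad_Lp D (2%:E * n) (u w))])%E in
  err eps.1 eps.2 @[eps --> (0^'+, 0^'+)] --> 0%E /\
  forall eW el, 0 < eW -> 0 < el ->
    (err eW el <= bound eW el)%E /\
    (bound eW el <= (Creg * C2 *
       (eW `^ gamma + el `^ (fine ((r%:E * c)^-1)%E)))%:E)%E.
Proof.
have [C C0 stab] := pathwise_stability hD hG.
(* [C] depends on the domain and the boundary decomposition only; the pathwise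
   constant is [C / k] for a lower bound [k] of the coefficient. *)
exists (C / abar_m); first by rewrite divr_gt0.
move=> K A alpha beta Ce Clam phi psi Clip eta Cl gamma kreg jreg Creg b c m n.
move=> K0 A0 alpha0 beta0 Ce0 Clam0 phi0 psi0 Clip0 eta0 Cl0 /andP[gamma0 gmin].
move=> b1 c1 m1 n1 hrcg hbrc hrce hmc hnb hkreg hjreg hn hm.
have r0 : 0 < r by exact: lt_le_trans hr.
move: gmin; rewrite lt_min => /andP[gamma1 gab].
have [c' cE c'1] := finite_exponent r0 c1 hrce.
have [b' bE b'1] := finite_exponent (ltr0n _ 2) b1 (le_lt_trans hbrc hrce).
have [m' mE m'1] := finite_exponent r0 m1 hm.
have [n' nE n'1] : exists2 y : R, n = y%:E & 1 <= y.
  by apply: (@finite_exponent _ n 1 (1 + jreg / 2)) => //; rewrite mul1e.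
subst c b m n.
have c0 : 0 < c' by exact: lt_le_trans c'1.
have b0 : 0 < b' by exact: lt_le_trans b'1.
have m0 : 0 < m' by exact: lt_le_trans m'1.
have n0 : 0 < n' by exact: lt_le_trans n'1.
have {}hmc := conjugate_exponents m'1 c'1 hmc.
have {}hnb := conjugate_exponents n'1 b'1 hnb.
move: hrcg hbrc hrce hn hm; rewrite -!EFinM !lee_fin !lte_fin => hrcg hbrc hrce hn hm.
pose p := r * c'.
have p1 : 1 < p by rewrite /p; nra.
have p0 : 0 < p by exact: lt_trans p1.
have gp1 : 1 <= gamma * p < eta - 1.
  have -> : gamma * p = p * gamma by rewrite mulrC.
  apply/andP; split; first by rewrite /p; lra.
  apply: lt_trans hrce; rewrite -[ltRHS]mulr1 ltr_pM2l//.
have abg : 2 * alpha * gamma <= beta.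
  by move: gab; rewrite ltr_pdivlMr ?mulr_gt0// mulrC => /ltW.
have n2j : 2 * n' <= 2 + jreg by lra.
pose kappa := Ccoef p gamma (2 * Ce * Num.sqrt Clam) phi psi Clip Cl.
pose K1 := (D ^+ 2) `^ ((2 * b')^-1 - p^-1) * (kappa * D ^+ 2 * 2) `^ p^-1.
pose K2 := (D ^+ 2) `^ ((2 * n')^-1 - (2 + jreg)^-1) * Creg `^ kreg^-1.
have C1p : 0 < C / abar_m by rewrite divr_gt0.
have K10 : 0 <= K1 by rewrite mulr_ge0 ?powR_ge0.
have K20 : 0 <= K2 by rewrite mulr_ge0 ?powR_ge0.
(* The factor [Creg] of the claim is compensated by dividing by its absolute
   value; if it is zero, so is [K2]. *)
exists (1 + C / abar_m * K1 * K2 / `|Creg|).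
  by rewrite ltr_wpDr// divr_ge0// mulr_ge0// mulr_ge0// ltW.
move=> d Omega P W1 W2 lam1 lam2 e1 e2 Phi1 Phi2 q f g abar abar_p l1 l2 gam1 gam2 nu1 nu2.
move=> l1a l2a N1 N2 u ua _ fW1 fW2 _ sumlam Phi10 Phi20 cPhi1 cPhi2 dPhi1 _ bPhi1 lPhi2.
move=> _ _ _ _ _ cabar abarE sl1 _ sl2 _ al1 al2 ind hN a aa su sua Cr err bound.
have kreg0 : 0 < kreg by exact: lt_le_trans hkreg.
have aA w x : sq D x -> Num.min abar_m A <= a w x <= A.
  by move=> xD; apply: coefficient_gt_lt => //; case/andP: (abarE x xD).
have aaA eW el w x : sq D x -> Num.min abar_m A <= aa eW el w x <= A.
  by move=> xD; apply: coefficient_gt_lt => //; case/andP: (abarE x xD).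
have ge0 (y : R) : Num.min abar_m A <= y <= A -> 0 <= y <= A.
  move=> /andP[y0 ->]; rewrite andbT; apply: le_trans y0.
  by rewrite le_min !ltW.
have versions eW el : 0 < eW -> 0 < el -> exists v v' : Omega -> R * R -> R,
  [/\ measurable_fun ([set: Omega] `*` sq D) (fun z => v z.1 z.2),
      measurable_fun ([set: Omega] `*` sq D) (fun z => v' z.1 z.2),
      {ae P, forall w x, sq D x -> a w x = v w x},
      {ae P, forall w x, sq D x -> aa eW el w x = v' w x} &
      forall x, sq D x -> (\int[P]_w (`|v' w x - v w x| `^ p)%:E <=
        (kappa * (eW `^ (gamma * p) + el))%:E)%E].
  move=> eW0 el0; have [N10 N1e N20 N2e] := hN _ eW0.
  exact: (coefficient_versions A hD K0 beta0 Ce0 Clam0 phi0 psi0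
    Clip0 Cl0 gamma0 gamma1 abg p1 gp1 fW1 fW2 sumlam cPhi1 cPhi2 dPhi1 bPhi1 lPhi2 cabar
    sl1 sl2 al1 al2 ind eW0 el0 N10 N1e N20 N2e).
clearbody a aa.
have main eW el : 0 < eW -> 0 < el -> (err eW el <= bound eW el)%E /\
    (bound eW el <= ((C / abar_m) * K1 * K2 * (eW `^ gamma + el `^ p^-1))%:E)%E.
  move=> eW0 el0; have [v [v' [mv mv' va va' ev]]] := versions _ _ eW0 el0.
  split.
    rewrite /err /bound.
    have cm : c'^-1 + m'^-1 = 1 by rewrite addrC.
    have sua' := sua _ _ eW0 el0.
    apply: (@error_le_coefficient_error _ _ _ P D G1 G2 hD A (C / abar_m) b' n' r c' m' a (aa eW el)
      f g u (ua eW el) v v' A0 C1p b0 n0 r0 c0 m0 cm _ mv mv' va va' _ _ su sua').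
    - move=> w ma ma' _ _ s1 s2; have [Am|mA] := leP abar_m A.
        apply: (stab abar_m A _ _ _ _ _ _ _ _ habar_m b0 n0 _ ma ma' _ _ _ s1 s2).
        + by rewrite addrC.
        + by move=> x /(aA w) /ge0 /andP[y0 yA]; rewrite ger0_norm.
        + by move=> x /(aaA eW el w) /ge0 /andP[y0 yA]; rewrite ger0_norm.
        + by move=> x /(aaA eW el w) /andP[+ _]; rewrite min_l.
      (* The cut-off is below [abar_m], so both coefficients are constant and
         the right-hand side is zero. *)
      have aE x : sq D x -> a w x = A.
        move=> /(aA w); rewrite min_r ?(ltW mA)// => /andP[h1 h2].
        by apply/eqP; rewrite eq_le h1 h2.
      have aaE x : sq D x -> aa eW el w x = A.
        move=> /(aaA eW el w); rewrite min_r ?(ltW mA)// => /andP[h1 h2].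
        by apply/eqP; rewrite eq_le h1 h2.
      have L0 : LpD D (2 * b')%:E (aa eW el w \- a w)%R = 0%E.
        rewrite (@eq_LpD _ D _ _ (cst 0)); last by move=> x xD /=; rewrite aE// aaE// subrr.
        rewrite LpDE ?mulf_neq0 ?gt_eqF// integral0_eq ?poweR0r ?invr_eq0 ?mulf_neq0 ?gt_eqF//.
        by move=> x _; rewrite normr0 powR0// mulf_neq0// gt_eqF.
      have := stab A A _ _ _ _ _ _ b' n' A0 b0 n0 _ ma ma' _ _ _ s1 s2.
      rewrite L0 !mule0 !mul0e; apply.
      + by rewrite addrC.
      + by move=> x /aE ->; rewrite ger0_norm// ltW.
      + by move=> x /aaE ->; rewrite ger0_norm// ltW.
      + by move=> x /aaE ->.
    - by move=> w x xD; apply: ge0; exact: aA.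
    - by move=> w x xD; apply: ge0; exact: aaA.
  rewrite /bound.
  have E1 := coefficient_error_rate hD b0 hbrc eW0 el0 mv mv' va va' ev.
  have E2 := @gradient_norm_bound _ _ _ P D hD _ _ _ _ _ _ _ n0 r0 m0 n2j hm Cr.
  rewrite -/K2 in E2; rewrite -/p -/kappa -/K1 in E1.
  have -> : C / abar_m * K1 * K2 * (eW `^ gamma + el `^ p^-1) =
    C / abar_m * (K1 * (eW `^ gamma + el `^ p^-1)) * K2 by ring.
  rewrite (EFinM _ K2).
  have C1e : (0 <= (C / abar_m)%:E)%E by rewrite lee_fin ltW.
  apply: lee_pmul E2.
  - by apply: mule_ge0 => //; exact: Lnorm_ge0.
  - exact: Lnorm_ge0.
  - by rewrite (EFinM (C / abar_m)); exact: lee_wpmul2l.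
have Creg0 : 0 <= Creg.
  by rewrite -lee_fin -Cr; apply: integral_ge0 => w _; exact: poweR_ge0.
have absorb : C / abar_m * K1 * K2 <= Creg * (1 + C / abar_m * K1 * K2 / `|Creg|).
  have [Cz|Cnz] := eqVneq Creg 0.
    by rewrite /K2 Cz powR0 ?mulr0 ?mul0r// invr_eq0 gt_eqF.
  have -> : Creg * (1 + C / abar_m * K1 * K2 / `|Creg|) = Creg + C / abar_m * K1 * K2.
    by rewrite (ger0_norm Creg0) mulrDr mulr1 (mulrC _ Creg^-1) mulrA (mulfV Cnz) mul1r.
  by rewrite lerDr.
split.
  apply: (@squeeze_cvge _ _ _ _ (fun=> 0%E) _
    (fun eps => (C / abar_m * K1 * K2 * (eps.1 `^ gamma + eps.2 `^ p^-1))%:E)).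
  - exists ([set x | 0 < x], [set x | 0 < x]); first by split; exact: nbhs_right_gt.
    move=> [eW el] /= [eW0 el0]; rewrite Lnorm_ge0/=.
    have [h1 h2] := main _ _ eW0 el0; exact: le_trans h1 h2.
  - exact: cvg_cst.
  - by apply: cvg_powR_pair => //; rewrite invr_gt0.
move=> eW el eW0 el0; have [h1 h2] := main _ _ eW0 el0; split => //.
rewrite inver gt_eqF//=; apply: le_trans h2 _; rewrite lee_fin ler_wpM2r//.
by rewrite addr_ge0// powR_ge0.
Qed.
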